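(* For every integer $k\ge 0$, the entire function $\xi_k$ has order exactly $1$.
   Context: Let $\zeta$ be the Riemann zeta function, $\chi(s)=2^s\pi^{s-1}\sin(\pi s/2)\Gamma(1-s)$ (so $\zeta(s)=\chi(s)\zeta(1-s)$), and $$\omega(s)=\frac{\chi'}{\chi}(s)=\log 2\pi-\frac{\Gamma'}{\Gamma}(s)+\frac{\pi}{2}\tan\frac{\pi s}{2}.$$ The meromorphic functions $Z_k$ are defined recursively by $Z_0(s)=\zeta(s)$ and $Z_{k+1}(s)=Z_k'(s)-\frac12\omega(s)Z_k(s)$ for $k\ge 0$. For $k\ge 0$ define $$\xi_k(s)=\pi^{-\frac{s}{2}}\,s(s-1)\,\frac{Z_k(s)}{\Gamma\left(\frac{s}{2}\right)^{k-1}\Gamma\left(\frac{1-s}{2}\right)^k},$$ which is an entire function (after filling in removable singularities). The order of an entire function $f$ is the infimum of all $\alpha>0$ such that $f(s)=O(\exp(|s|^{\alpha}))$ as $|s|\to\infty$. *)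

(* Defs.v *)
From Stdlib Require Export Reals Factorial.
From Coquelicot Require Export Coquelicot.
Open Scope R_scope.
Open Scope C_scope.

Definition Cexp (z : C) : C := (exp (Re z) * cos (Im z), exp (Re z) * sin (Im z))%R.

Definition Csin (z : C) : C := (Cexp (Ci * z) - Cexp (- (Ci * z))) / (2 * Ci).

(* The power [a ^ s] of a positive real [a], with the real logarithm of [a]. *)
Definition Rcpow (a : R) (s : C) : C := Cexp (s * RtoC (ln a)).

Definition CpowZ (z : C) (n : Z) : C :=
  match n with
  | Z0 => 1
  | Zpos p => Cpow z (Pos.to_nat p)
  | Zneg p => / Cpow z (Pos.to_nat p)
  end.

(* Taken componentwise: this is the limit of [u] whenever [u] converges. *)
Definition Clim_seq (u : nat -> C) : C :=
  (real (Lim_seq (fun n => Re (u n))), real (Lim_seq (fun n => Im (u n)))).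

(* [s * (s + 1) * ... * (s + n)], with [n + 1] factors. *)
Fixpoint Crising (s : C) (n : nat) : C :=
  match n with
  | O => s
  | S m => Crising s m * (s + RtoC (INR n))
  end.

(* Gauss's product formula, valid at every [s] outside {0, -1, -2, ...}.
   The values at the poles are irrelevant. *)
Definition CGamma (s : C) : C :=
  Clim_seq (fun n => RtoC (INR (fact n)) * Rcpow (INR n) s / Crising s n).

(* The analytic continuation to the plane minus {1} of the Dirichlet series.
   By the identity theorem this determines [zeta] except for its value at the
   pole 1, which is irrelevant. *)
Definition is_riemann_zeta (zeta : C -> C) : Prop :=
  (forall s : C, s <> RtoC 1 -> ex_derive (K := C_AbsRing) zeta s) /\
  (forall s : C, (1 < Re s)%R ->
     is_series (K := C_AbsRing)
       (fun n : nat => Rcpow (INR (S n)) (- s)) (zeta s)).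

Definition chi (s : C) : C :=
  Rcpow 2 s * Rcpow PI (s - 1) * Csin (RtoC PI * s / 2) * CGamma (1 - s).

Definition omega (s : C) : C := C_derive chi s / chi s.

(* [C_derive] is a total operator that looks only at horizontal difference
   quotients; it is the complex derivative wherever that exists. Away from the
   integers [chi], [omega], [Zfun zeta k] and [xi_formula zeta k] are holomorphic
   and no division is by 0. Derivatives being local,
   arbitrary values taken at integers do not affect the values elsewhere. *)
Fixpoint Zfun (zeta : C -> C) (k : nat) (s : C) : C :=
  match k with
  | O => zeta s
  | S j => C_derive (Zfun zeta j) s - / 2 * omega s * Zfun zeta j s
  end.

(* The formula for the [k]-th xi function, before removable singularities are
   filled in; its values at integers are not meaningful. *)
Definition xi_formula (zeta : C -> C) (k : nat) (s : C) : C :=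
  Rcpow PI (- (s / 2)) * (s * (s - 1)) *
  (Zfun zeta k s /
   (CpowZ (CGamma (s / 2)) (Z.of_nat k - 1) * Cpow (CGamma ((1 - s) / 2)) k)).

(* [g] is [f] with all its removable singularities filled in, at every point
   of the plane. The limits are over punctured neighbourhoods, so the values of
   [f] at its isolated singularities play no role. *)
Definition fills_singularities (f g : C -> C) : Prop :=
  forall s : C, filterlim f (locally' s) (locally (g s)).

Definition is_entire (f : C -> C) : Prop :=
  forall s : C, ex_derive (K := C_AbsRing) f s.

Definition bigO_exp_pow (f : C -> C) (alpha : R) : Prop :=
  (exists M r : R, forall s : C,
     r < Cmod s -> Cmod (f s) <= M * exp (Rpower (Cmod s) alpha))%R.

(* [p_infty] when no exponent is admissible. *)
Definition growth_order (f : C -> C) : Rbar :=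
  Glb_Rbar (fun alpha : R => (0 < alpha)%R /\ bigO_exp_pow f alpha).

(* Main.v *)
Require Import Defs.
From Stdlib Require Import Lra Lia ZArith Classical.

(* Put A(s) = 1/Gamma(s/2), B(s) = 1/Gamma((1-s)/2), P = A B and Q = P (1/s + 1/(s-1)),
   all entire. Reflection and duplication give chi = c pi^s A/B, hence
   omega = log pi + A'/A - B'/B, and the recursion for Z_k becomes
     xi_(k+1) = P xi_k' - Q xi_k - (k - 1/2) P' xi_k,
   so that xi_k is entire as soon as xi_0 is.

   Upper bound. The functional equation of theta makes xi_0 entire: it is
   s (s-1) F(s - 1/2) + 1 for an even power series F with nonnegative coefficients, and
   |F(z)| <= F(|z|) is read off the Dirichlet series. Functions of size
   exp(O(|s| log |s|)) are stable under sums, products and, by Cauchy's estimate,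
   derivatives. 1/Gamma and xi_0 are among them, hence so are all the xi_k.

   Lower bound. At s = 2n+1 >= 3 both P and Q vanish while |P'(s)| = n! A(s) / 2 stays
   above a positive constant. Hence |xi_k(2n+1)| >= c_k |xi_0(2n+1)|, which is of size
   at least n! / pi^n up to a constant, and exceeds M exp(2n+1) for large n. *)

Open Scope R_scope.

(** * Complex derivatives and the exponential *)

(** [zeta] is given only by its Dirichlet series and its holomorphy off 1. Every fact about it is
    therefore proved on the real ray [s > 1], where all terms are positive and exchanging sums with
    integrals costs only inequalities, and is then carried over by the identity theorem. The chain
    Goursat, Cauchy, Morera serves this transport, and it also shows that limits of Gauss products
    and of power series are entire. Gamma enters through its entire reciprocal, so that zeros
    replace poles. The powers of [P] in the denominator of [Z_k] are exactly what the Gamma factors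
    of [xi_k] remove, and [Q] is regular because [P] vanishes at 0 and 1. Constants of the classical
    formulas are never evaluated in advance: that of theta is fixed by [x = 1], those of duplication
    and of chi drop out of the logarithmic derivative omega. The class exp(O(r log r)) fits order 1
    since [r log r] is below [r^alpha] for every [alpha > 1], while the factorial at the odd
    integers excludes even [alpha = 1]. The coefficient [k - 1/2] is never 0, so the factorial
    survives the recursion. *)

Definition cder (f : C -> C) (z l : C) : Prop :=
  @is_derive C_AbsRing C_NormedModule f z l.

Definition ccont (f : C -> C) (z : C) : Prop :=
  @continuous C_UniformSpace C_UniformSpace f z.

(** This division-free form, in which [h = 0] is allowed, is what all later derivative estimates are
    checked against. *)
Lemma cderP (f : C -> C) (z l : C) :
  cder f z l <->
  forall eps : R, 0 < eps -> exists d : R, 0 < d /\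
    forall h : C, Cmod h < d -> Cmod (f (z + h)%C - f z - h * l) <= eps * Cmod h.
Proof.
  split.
  - intros [_ H] eps He.
    specialize (H z (fun P HP => HP) (mkposreal eps He)).
    destruct H as [d Hd]. exists d. split; [apply cond_pos|].
    intros h Hh.
    specialize (Hd (z + h)%C).
    assert (E : (z + h - z = h)%C) by ring.
    replace (f (z + h)%C - f z - h * l)%C
      with (minus (minus (f (z + h)%C) (f z)) (scal (minus (z + h)%C z) l)).
    + replace (Cmod h) with (Cmod (minus (z + h) z)%C).
      * apply Hd. unfold ball; simpl. unfold AbsRing_ball. 
        change (Cmod (z + h - z) < d). now rewrite E.
      * change (Cmod (z + h - z) = Cmod h). now rewrite E.
    + change (f (z + h)%C - f z - (z + h - z) * l = f (z + h)%C - f z - h * l)%C.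
      now rewrite E.
  - intros H. split.
    + apply is_linear_scal_l.
    + intros x Hx eps.
      apply (@is_filter_lim_locally_unique C_AbsRing (AbsRing_NormedModule C_AbsRing) z x) in Hx. subst x.
      destruct (H eps (cond_pos eps)) as [d [Hd Hd']].
      exists (mkposreal d Hd). intros y Hy.
      change (Cmod (f y - f z - (y - z) * l) <= eps * Cmod (y - z)).
      replace (f y) with (f (z + (y - z))%C).
      * apply Hd'. apply Hy.
      * f_equal. ring.
Qed.

Lemma ccontP (f : C -> C) (z : C) :
  ccont f z <->
  forall eps : R, 0 < eps -> exists d : R, 0 < d /\
    forall h : C, Cmod h < d -> Cmod (f (z + h)%C - f z) < eps.
Proof.
  split.
  - intros H eps He.
    destruct (proj1 (filterlim_locally_ball_norm (F := locally z)
       (U := C_NormedModule) f (f z)) H (mkposreal eps He)) as [d Hd].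
    exists d. split; [apply cond_pos|].
    intros h Hh. apply (Hd (z + h)%C).
    apply C_NormedModule_mixin_compat1.
    change (Cmod (z + h - z) < d). replace (z + h - z)%C with h by ring. exact Hh.
  - intros H.
    apply (filterlim_locally_ball_norm (F := locally z) (U := C_NormedModule) f (f z)).
    intros eps.
    destruct (H eps (cond_pos eps)) as [d [Hd Hd']].
    (* Balls of the uniform structure of C are squares, while derivatives use discs. A square of
       half-side [d / 2] lies in the disc of radius [sqrt 2 * (d / 2) <= d]. *)
    assert (Hd2 : 0 < d / 2) by lra.
    exists (mkposreal _ Hd2). intros y Hy.
    change (Cmod (f y - f z) < eps).
    replace (f y) with (f (z + (y - z))%C) by (f_equal; ring).
    apply Hd'.
    apply (C_NormedModule_mixin_compat2 z y) in Hy.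
    change (Cmod (y - z) < sqrt 2 * (d / 2)) in Hy.
    assert (sqrt 2 <= 2).
    { rewrite <- (sqrt_square 2) at 2 by lra. apply sqrt_le_1_alt. lra. }
    nra.
Qed.

Lemma cder_unique f z l1 l2 : cder f z l1 -> cder f z l2 -> l1 = l2.
Proof.
  intros H1 H2. rewrite <- (is_C_derive_unique _ _ _ H1).
  now apply is_C_derive_unique.
Qed.

Lemma cder_ext_loc (f g : C -> C) (z l : C) (r : R) : 0 < r ->
  (forall w, Cmod (w - z) < r -> f w = g w) -> cder f z l -> cder g z l.
Proof.
  intros Hr E H. apply cderP. intros eps He.
  destruct (proj1 (cderP _ _ _) H eps He) as [d [Hd Hd']].
  exists (Rmin d r). split; [now apply Rmin_glb_lt|].
  intros h Hh.
  rewrite <- !E.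
  - apply Hd'. eapply Rlt_le_trans; [exact Hh|apply Rmin_l].
  - replace (z - z)%C with (RtoC 0) by ring. now rewrite Cmod_0.
  - replace (z + h - z)%C with h by ring.
    eapply Rlt_le_trans; [exact Hh|apply Rmin_r].
Qed.

Lemma cder_ext (f g : C -> C) (z l : C) :
  (forall w, f w = g w) -> cder f z l -> cder g z l.
Proof. intros E. apply (cder_ext_loc f g z l 1); [lra|auto]. Qed.

Lemma cder_eq (f : C -> C) (z l l' : C) : cder f z l -> l = l' -> cder f z l'.
Proof. now intros H <-. Qed.

Lemma cder_cont f z l : cder f z l -> ccont f z.
Proof.
  intros H. apply ccontP. intros eps He.
  destruct (proj1 (cderP _ _ _) H 1 Rlt_0_1) as [d [Hd Hd']].
  set (K := 1 + Cmod l). assert (HK : 0 < K) by (unfold K; generalize (Cmod_ge_0 l); lra).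
  exists (Rmin d (eps / K)). split.
  { apply Rmin_glb_lt; auto. now apply Rdiv_lt_0_compat. }
  intros h Hh.
  assert (H1 : Cmod h < d) by (eapply Rlt_le_trans; [exact Hh|apply Rmin_l]).
  assert (H2 : Cmod h < eps / K) by (eapply Rlt_le_trans; [exact Hh|apply Rmin_r]).
  specialize (Hd' h H1).
  replace (f (z + h)%C - f z)%C with ((f (z + h)%C - f z - h * l) + h * l)%C by ring.
  eapply Rle_lt_trans; [apply Cmod_triangle|].
  rewrite Cmod_mult.
  apply Rle_lt_trans with (Cmod h * K); [unfold K; lra|].
  apply (Rmult_lt_compat_r K) in H2; auto.
  unfold Rdiv in H2. rewrite Rmult_assoc, Rinv_l in H2; lra.
Qed.

Lemma cder_const (c z : C) : cder (fun _ => c) z 0.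
Proof. apply (@is_derive_const C_AbsRing C_NormedModule). Qed.

Lemma cder_id (z : C) : cder (fun w => w) z 1.
Proof.
  apply cderP. intros eps He. exists 1. split; [lra|]. intros h _.
  replace (z + h - z - h * 1)%C with (RtoC 0) by ring.
  rewrite Cmod_0. apply Rmult_le_pos; [lra|apply Cmod_ge_0].
Qed.

Lemma cder_plus (f g : C -> C) (z a b : C) :
  cder f z a -> cder g z b -> cder (fun w => f w + g w)%C z (a + b)%C.
Proof. apply (@is_derive_plus C_AbsRing C_NormedModule). Qed.

Lemma cder_opp (f : C -> C) (z a : C) :
  cder f z a -> cder (fun w => - f w)%C z (- a)%C.
Proof. apply (@is_derive_opp C_AbsRing C_NormedModule). Qed.

Lemma cder_minus (f g : C -> C) (z a b : C) :
  cder f z a -> cder g z b -> cder (fun w => f w - g w)%C z (a - b)%C.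
Proof. apply (@is_derive_minus C_AbsRing C_NormedModule). Qed.

Lemma cder_comp (f g : C -> C) (z a b : C) :
  cder f (g z) a -> cder g z b -> cder (fun w => f (g w)) z (b * a)%C.
Proof.
  intros Hf Hg. pose proof (cder_cont _ _ _ Hg) as Hc.
  apply cderP. intros eps He.
  (* The outer error is at most [e * |k|] with [|k| <= (1 + |b|) |h|], and the inner one contributes
     [e * |h| * |a|]; together they stay below [e * K * |h|]. *)
  set (K := Cmod a + Cmod b + 2).
  assert (HK : 2 <= K) by (unfold K; generalize (Cmod_ge_0 a) (Cmod_ge_0 b); lra).
  set (e := Rmin 1 (eps / K)).
  assert (He1 : 0 < e).
  { apply Rmin_glb_lt; [lra|]. apply Rdiv_lt_0_compat; lra. }
  assert (He2 : e <= 1) by apply Rmin_l.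
  assert (He3 : e * K <= eps).
  { apply Rle_trans with (eps / K * K); [apply Rmult_le_compat_r; [lra|apply Rmin_r]|].
    unfold Rdiv. rewrite Rmult_assoc, Rinv_l; lra. }
  destruct (proj1 (cderP _ _ _) Hf e He1) as [d1 [Hd1 Hd1']].
  destruct (proj1 (cderP _ _ _) Hg e He1) as [d2 [Hd2 Hd2']].
  destruct (proj1 (ccontP _ _) Hc d1 Hd1) as [d3 [Hd3 Hd3']].
  exists (Rmin d2 d3). split; [now apply Rmin_glb_lt|].
  intros h Hh.
  assert (H2 : Cmod h < d2) by (eapply Rlt_le_trans; [exact Hh|apply Rmin_l]).
  assert (H3 : Cmod h < d3) by (eapply Rlt_le_trans; [exact Hh|apply Rmin_r]).
  specialize (Hd2' h H2). specialize (Hd3' h H3). specialize (Hd1' _ Hd3').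
  set (k := (g (z + h)%C - g z)%C) in *.
  replace (g z + k)%C with (g (z + h)%C) in Hd1' by (unfold k; ring).
  replace (f (g (z + h)%C) - f (g z) - h * (b * a))%C
    with ((f (g (z + h)%C) - f (g z) - k * a) + (k - h * b) * a)%C by ring.
  eapply Rle_trans; [apply Cmod_triangle|]. rewrite Cmod_mult.
  assert (Hk : Cmod k <= (1 + Cmod b) * Cmod h).
  { replace k with ((k - h * b) + h * b)%C by ring.
    eapply Rle_trans; [apply Cmod_triangle|]. rewrite Cmod_mult.
    generalize (Cmod_ge_0 h). nra. }
  apply Rle_trans with (e * ((1 + Cmod b) * Cmod h) + e * Cmod h * Cmod a).
  - apply Rplus_le_compat.
    + eapply Rle_trans; [exact Hd1'|]. apply Rmult_le_compat_l; lra.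
    + apply Rmult_le_compat_r; [apply Cmod_ge_0|exact Hd2'].
  - apply Rle_trans with (e * K * Cmod h).
    + unfold K. generalize (Cmod_ge_0 h). nra.
    + apply Rmult_le_compat_r; [apply Cmod_ge_0|exact He3].
Qed.

Lemma cder_sqr (z : C) : cder (fun w => w * w)%C z (2 * z)%C.
Proof.
  apply cderP. intros eps He. exists eps. split; [lra|]. intros h Hh.
  replace ((z + h) * (z + h) - z * z - h * (2 * z))%C with (h * h)%C by ring.
  rewrite Cmod_mult. apply Rmult_le_compat_r; [apply Cmod_ge_0|lra].
Qed.

Lemma cder_scal (f : C -> C) (z a c : C) :
  cder f z a -> cder (fun w => c * f w)%C z (c * a)%C.
Proof.
  intros H.
  assert (Hc : cder (fun w => c * w)%C (f z) c).
  { apply cderP. intros eps He. exists 1. split; [lra|]. intros h _.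
    replace (c * (f z + h) - c * f z - h * c)%C with (RtoC 0) by ring.
    rewrite Cmod_0. apply Rmult_le_pos; [lra|apply Cmod_ge_0]. }
  eapply cder_eq; [exact (cder_comp _ _ _ _ _ Hc H)|ring].
Qed.

(* Polarization reduces the product rule to the derivative of the square. *)
Lemma cder_mult (f g : C -> C) (z a b : C) :
  cder f z a -> cder g z b -> cder (fun w => f w * g w)%C z (a * g z + f z * b)%C.
Proof.
  intros Hf Hg.
  pose proof (cder_comp _ _ _ _ _ (cder_sqr _) (cder_plus _ _ _ _ _ Hf Hg)) as H1.
  pose proof (cder_comp _ _ _ _ _ (cder_sqr _) (cder_minus _ _ _ _ _ Hf Hg)) as H2.
  pose proof (cder_scal _ _ _ (/ 4) (cder_minus _ _ _ _ _ H1 H2)) as H3.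
  assert (n4 : RtoC 4 <> RtoC 0) by (intros E; apply RtoC_inj in E; lra).
  eapply cder_eq; [eapply cder_ext; [|exact H3]|]; simpl; intros; field; assumption.
Qed.

Lemma cder_pow (f : C -> C) (n : nat) (z a : C) :
  cder f z a -> cder (fun w => f w ^ n)%C z (RtoC (INR n) * a * f z ^ (pred n))%C.
Proof.
  intros H. induction n as [|n IH].
  - eapply cder_eq; [eapply cder_ext; [|apply (cder_const 1)]|]; simpl; intros; ring.
  - eapply cder_eq; [eapply cder_ext; [|exact (cder_mult _ _ _ _ _ H IH)]|].
    + intros; simpl; ring.
    + rewrite S_INR, RtoC_plus. destruct n; simpl; ring.
Qed.

Lemma ccont_neq0_loc (f : C -> C) (z : C) : ccont f z -> f z <> 0%C ->
  exists r, 0 < r /\ forall w, Cmod (w - z) < r -> f w <> 0%C.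
Proof.
  intros H Hz. assert (Hp : 0 < Cmod (f z)) by now apply Cmod_gt_0.
  destruct (proj1 (ccontP _ _) H _ Hp) as [d [Hd Hd']].
  exists d. split; auto. intros w Hw E.
  specialize (Hd' _ Hw). replace (z + (w - z))%C with w in Hd' by ring.
  rewrite E in Hd'. replace (0 - f z)%C with (- f z)%C in Hd' by ring.
  rewrite Cmod_opp in Hd'. lra.
Qed.

Lemma cder_inv_id (z : C) : z <> 0%C -> cder Cinv z (- / (z * z))%C.
Proof.
  intros Hz. assert (Hp : 0 < Cmod z) by now apply Cmod_gt_0.
  apply cderP. intros eps He.
  set (m := Cmod z) in *.
  (* The error is [h^2 / ((z + h) z^2)]. For [|h| < m / 2] it is at most [2 |h|^2 / m^3], which the
     second bound turns into [eps * |h|]. *)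
  exists (Rmin (m / 2) (eps * (m * m * m) / 2)). split.
  { apply Rmin_glb_lt; [lra|]. apply Rdiv_lt_0_compat; [|lra].
    repeat apply Rmult_lt_0_compat; lra. }
  intros h Hh.
  assert (H1 : Cmod h < m / 2) by (eapply Rlt_le_trans; [exact Hh|apply Rmin_l]).
  assert (H2 : Cmod h < eps * (m * m * m) / 2) by (eapply Rlt_le_trans; [exact Hh|apply Rmin_r]).
  assert (H3 : m / 2 <= Cmod (z + h)).
  { assert (m <= Cmod (z + h) + Cmod h).
    { unfold m. replace z with ((z + h) + - h)%C at 1 by ring.
      eapply Rle_trans; [apply Cmod_triangle|]. rewrite Cmod_opp. lra. }
    lra. }
  assert (Hzh : (z + h)%C <> 0%C).
  { intros E. rewrite E, Cmod_0 in H3. lra. }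
  replace (/ (z + h) - / z - h * - / (z * z))%C with (h * h / ((z + h) * (z * z)))%C
    by (field; auto).
  rewrite Cmod_div by (repeat apply Cmult_neq_0; auto). rewrite !Cmod_mult. fold m.
  apply Rle_trans with (Cmod h * Cmod h / (m / 2 * (m * m))).
  - unfold Rdiv. apply Rmult_le_compat_l; [apply Rmult_le_pos; apply Cmod_ge_0|].
    apply Rinv_le_contravar; [repeat apply Rmult_lt_0_compat; lra|].
    apply Rmult_le_compat_r; [nra|exact H3].
  - replace (Cmod h * Cmod h / (m / 2 * (m * m))) with (Cmod h * (2 * Cmod h / (m * m * m)))
      by (field; lra).
    rewrite (Rmult_comm eps). apply Rmult_le_compat_l; [apply Cmod_ge_0|].
    apply Rmult_le_reg_r with (m * m * m); [repeat apply Rmult_lt_0_compat; lra|].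
    unfold Rdiv. rewrite Rmult_assoc, Rinv_l by (apply Rgt_not_eq; repeat apply Rmult_lt_0_compat; lra).
    lra.
Qed.

Lemma cder_inv (f : C -> C) (z a : C) : f z <> 0%C ->
  cder f z a -> cder (fun w => / f w)%C z (- a / (f z * f z))%C.
Proof.
  intros Hz H. eapply cder_eq; [exact (cder_comp _ _ _ _ _ (cder_inv_id _ Hz) H)|].
  field. auto.
Qed.

Lemma cder_div (f g : C -> C) (z a b : C) : g z <> 0%C ->
  cder f z a -> cder g z b ->
  cder (fun w => f w / g w)%C z ((a * g z - f z * b) / (g z * g z))%C.
Proof.
  intros Hz Hf Hg.
  eapply cder_eq; [exact (cder_mult _ _ _ _ _ Hf (cder_inv _ _ _ Hz Hg))|].
  simpl. field. auto.
Qed.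

Lemma Cmod_le_sum (z : C) : Cmod z <= Rabs (Re z) + Rabs (Im z).
Proof.
  destruct z as [x y].
  replace (Cmod (x, y)) with (Cmod (RtoC x + Ci * RtoC y)).
  - eapply Rle_trans; [apply Cmod_triangle|].
    rewrite Cmod_mult, Cmod_Ci, !Cmod_R. simpl. lra.
  - f_equal. unfold RtoC, Ci, Cplus, Cmult; simpl. f_equal; ring.
Qed.

Lemma im_le_Cmod (z : C) : Rabs (Im z) <= Cmod z.
Proof.
  destruct z as [x y]. eapply Rle_trans; [|apply Rmax_Cmod]. apply Rmax_r.
Qed.

Lemma Cmod_sub_sym (a b : C) : Cmod (a - b) = Cmod (b - a).
Proof. rewrite <- Cmod_opp. f_equal. ring. Qed.

Lemma Cmod_sub_ge (a b : C) : Cmod a - Cmod b <= Cmod (a - b).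
Proof.
  assert (Cmod a <= Cmod (a - b) + Cmod b).
  { replace a with ((a - b) + b)%C at 1 by ring. apply Cmod_triangle. }
  lra.
Qed.

Lemma Cmod_sum3 (a b c : C) : Cmod (a - c) <= Cmod (a - b) + Cmod (b - c).
Proof. replace (a - c)%C with ((a - b) + (b - c))%C by ring. apply Cmod_triangle. Qed.

Lemma Cexp_0 : Cexp 0 = 1%C.
Proof.
  unfold Cexp; simpl. rewrite exp_0, cos_0, sin_0. unfold RtoC. f_equal; ring.
Qed.

Lemma Cexp_plus (a b : C) : Cexp (a + b) = (Cexp a * Cexp b)%C.
Proof.
  destruct a as [a1 a2], b as [b1 b2]. unfold Cexp, Cmult, Cplus; simpl.
  rewrite exp_plus, cos_plus, sin_plus. f_equal; ring.
Qed.

Lemma Cexp_opp_l (a : C) : (Cexp (- a) * Cexp a = 1)%C.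
Proof. rewrite <- Cexp_plus. replace (- a + a)%C with (RtoC 0) by ring. apply Cexp_0. Qed.

Lemma Cexp_neq_0 (a : C) : Cexp a <> 0%C.
Proof.
  intros E. generalize (Cexp_opp_l a). rewrite E, Cmult_0_r.
  intros H. apply RtoC_inj in H. lra.
Qed.

Lemma Cexp_opp (a : C) : Cexp (- a) = (/ Cexp a)%C.
Proof.
  rewrite <- (Cmult_1_r (/ Cexp a)), <- (Cexp_opp_l a).
  field. apply Cexp_neq_0.
Qed.

Lemma Cmod_Cexp (a : C) : Cmod (Cexp a) = exp (Re a).
Proof.
  unfold Cexp, Cmod; simpl.
  replace (exp (Re a) * cos (Im a) * (exp (Re a) * cos (Im a) * 1) +
    exp (Re a) * sin (Im a) * (exp (Re a) * sin (Im a) * 1))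
   with (exp (Re a) * exp (Re a)).
  - apply sqrt_square. left. apply exp_pos.
  - generalize (sin2_cos2 (Im a)). unfold Rsqr. intros H.
    replace (exp (Re a) * cos (Im a) * (exp (Re a) * cos (Im a) * 1) +
    exp (Re a) * sin (Im a) * (exp (Re a) * sin (Im a) * 1))
     with (exp (Re a) * exp (Re a) * (sin (Im a) * sin (Im a) + cos (Im a) * cos (Im a))) by ring.
    rewrite H. ring.
Qed.

Lemma Cexp_RtoC (x : R) : Cexp (RtoC x) = RtoC (exp x).
Proof. unfold Cexp, RtoC; simpl. rewrite cos_0, sin_0. f_equal; ring. Qed.

(** The inequality [1 + y <= exp y] is used at [x] and at [- x]. The second use gives
    [exp x <= 1 / (1 - x)], which is at most [1 + x + 2 x^2] for [|x| <= 1/2]. *)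
Lemma exp_taylor1 (x : R) : Rabs x <= 1 / 2 -> Rabs (exp x - 1 - x) <= 2 * x ^ 2.
Proof.
  intros H. apply Rabs_le_between in H.
  generalize (exp_ineq1_le x) (exp_ineq1_le (- x)). intros H1 H2.
  rewrite Rabs_pos_eq by lra.
  assert (E : exp x * exp (- x) = 1).
  { rewrite <- exp_plus. replace (x + - x) with 0 by ring. apply exp_0. }
  generalize (exp_pos x). intros H3. nra.
Qed.

Lemma cos_taylor1 (y : R) : Rabs (cos y - 1) <= y ^ 2 / 2.
Proof.
  replace (cos y) with (cos (2 * (y / 2))) by (f_equal; field).
  rewrite cos_2a_sin.
  replace (1 - 2 * sin (y / 2) * sin (y / 2) - 1) with (- (2 * (sin (y / 2) * sin (y / 2)))) by ring.
  rewrite Rabs_Ropp, Rabs_pos_eq by nra.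
  assert (H : Rabs (sin (y / 2)) <= Rabs (y / 2)).
  { destruct (Rle_or_lt 0 (y / 2)) as [Hy|Hy].
    - rewrite (Rabs_pos_eq (y / 2)) by lra.
      destruct Hy as [Hy| <-]; [|rewrite sin_0, Rabs_R0; lra].
      apply Rabs_le. split; [|left; now apply sin_lt_x].
      destruct (Rle_or_lt (y / 2) PI).
      + generalize (sin_ge_0 (y / 2)). lra.
      + generalize (SIN_bound (y / 2)) PI2_1. lra.
    - rewrite (Rabs_left (y / 2)) by lra.
      rewrite <- Rabs_Ropp, <- sin_neg.
      apply Rabs_le. split; [|left; apply sin_lt_x; lra].
      destruct (Rle_or_lt (- (y / 2)) PI).
      + generalize (sin_ge_0 (- (y / 2))). lra.
      + generalize (SIN_bound (- (y / 2))) PI2_1. lra. }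
  apply Rsqr_le_abs_1 in H. unfold Rsqr in H. lra.
Qed.

Lemma Rabs_sin_le (y : R) : Rabs (sin y) <= Rabs y.
Proof.
  generalize (cos_taylor1 (2 * y)). rewrite cos_2a_sin.
  intros H.
  replace (1 - 2 * sin y * sin y - 1) with (- (2 * (sin y * sin y))) in H by ring.
  rewrite Rabs_Ropp, Rabs_pos_eq in H by nra.
  apply Rsqr_le_abs_0. unfold Rsqr. nra.
Qed.

Lemma sin_taylor1 (y : R) : Rabs y <= 1 -> Rabs (sin y - y) <= y ^ 2.
Proof.
  intros Hy.
  destruct (MVT_gen (fun t => sin t - t) 0 y (fun t => cos t - 1)) as [c [Hc E]].
  - intros t _. auto_derive; [trivial|ring].
  - intros t _. apply derivable_continuous_pt.
    apply derivable_pt_minus; [apply derivable_pt_sin|apply derivable_pt_id].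
  - rewrite sin_0, !Rminus_0_r in E. rewrite E, Rabs_mult.
    generalize (cos_taylor1 c). intros H.
    assert (Hcy : Rabs c <= Rabs y).
    { unfold Rmin, Rmax in Hc. destruct (Rle_dec 0 y);
      unfold Rabs; destruct (Rcase_abs c), (Rcase_abs y); lra. }
    assert (c ^ 2 <= Rabs y ^ 2) by (rewrite <- (pow2_abs c); apply pow_incr; split; [apply Rabs_pos|auto]).
    rewrite <- (pow2_abs y). simpl in *. generalize (Rabs_pos y). nra.
Qed.

Lemma Cexp_taylor1 (h : C) : Cmod h <= 1 / 2 -> Cmod (Cexp h - 1 - h) <= 10 * Cmod h ^ 2.
Proof.
  intros Hh.
  generalize (re_le_Cmod h) (im_le_Cmod h). 
  set (m := Cmod h) in *. intros Hx Hy.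
  destruct h as [x y]. simpl in Hx, Hy.
  assert (Hm : 0 <= m) by apply Cmod_ge_0.
  eapply Rle_trans; [apply Cmod_le_sum|]. simpl.
  generalize (exp_taylor1 x ltac:(lra)) (cos_taylor1 y) (sin_taylor1 y ltac:(lra)). intros H1 H2 H3.
  assert (Hx2 : x ^ 2 <= m ^ 2) by (rewrite <- (pow2_abs x); apply pow_incr; split; [apply Rabs_pos|auto]).
  assert (Hy2 : y ^ 2 <= m ^ 2) by (rewrite <- (pow2_abs y); apply pow_incr; split; [apply Rabs_pos|auto]).
  assert (He : 0 < exp x <= 2).
  { split; [apply exp_pos|].
    apply Rabs_le_between in H1. apply Rabs_le_between in Hx.
    assert (m ^ 2 <= 1 / 4) by (simpl; nra). lra. }
  replace (exp x * cos y + - (1) + - x) with ((exp x - 1 - x) + exp x * (cos y - 1)) by ring.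
  replace (exp x * sin y + - 0 + - y) with (exp x * (sin y - y) + (exp x - 1 - x) * y + x * y) by ring.
  assert (A1 : Rabs (exp x * (cos y - 1)) <= 2 * (m ^ 2 / 2)).
  { rewrite Rabs_mult, (Rabs_pos_eq (exp x)) by lra.
    apply Rmult_le_compat; try lra. apply Rabs_pos. }
  assert (A2 : Rabs (exp x * (sin y - y)) <= 2 * m ^ 2).
  { rewrite Rabs_mult, (Rabs_pos_eq (exp x)) by lra.
    apply Rmult_le_compat; try lra. apply Rabs_pos. }
  assert (A3 : Rabs ((exp x - 1 - x) * y) <= 2 * m ^ 2 * 1).
  { rewrite Rabs_mult. apply Rmult_le_compat; try apply Rabs_pos; lra. }
  assert (A4 : Rabs (x * y) <= m ^ 2).
  { rewrite Rabs_mult. simpl. rewrite Rmult_1_r. apply Rmult_le_compat; try apply Rabs_pos; lra. }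
  generalize (Rabs_triang (exp x - 1 - x) (exp x * (cos y - 1))).
  generalize (Rabs_triang (exp x * (sin y - y) + (exp x - 1 - x) * y) (x * y)).
  generalize (Rabs_triang (exp x * (sin y - y)) ((exp x - 1 - x) * y)).
  intros. nra.
Qed.

Lemma cder_Cexp (z : C) : cder Cexp z (Cexp z).
Proof.
  apply cderP. intros eps He.
  set (K := 10 * Cmod (Cexp z)).
  assert (HK : 0 < K) by (unfold K; rewrite Cmod_Cexp; generalize (exp_pos (Re z)); lra).
  exists (Rmin (1 / 2) (eps / K)). split.
  { apply Rmin_glb_lt; [lra|]. now apply Rdiv_lt_0_compat. }
  intros h Hh.
  assert (H1 : Cmod h < 1 / 2) by (eapply Rlt_le_trans; [exact Hh|apply Rmin_l]).
  assert (H2 : Cmod h < eps / K) by (eapply Rlt_le_trans; [exact Hh|apply Rmin_r]).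
  rewrite Cexp_plus.
  replace (Cexp z * Cexp h - Cexp z - h * Cexp z)%C with (Cexp z * (Cexp h - 1 - h))%C by ring.
  rewrite Cmod_mult.
  generalize (Cexp_taylor1 h ltac:(lra)). intros H3.
  apply Rle_trans with (K * Cmod h ^ 2).
  - unfold K. generalize (Cmod_ge_0 (Cexp z)). nra.
  - apply (Rmult_lt_compat_r K) in H2; auto.
    unfold Rdiv in H2. rewrite Rmult_assoc, Rinv_l in H2 by lra.
    generalize (Cmod_ge_0 h). intros. simpl. nra.
Qed.

Lemma cder_Rcpow (a : R) (z : C) : cder (Rcpow a) z (RtoC (ln a) * Rcpow a z)%C.
Proof.
  unfold Rcpow.
  eapply cder_eq.
  - apply (cder_comp Cexp (fun s => s * RtoC (ln a))%C); [apply cder_Cexp|].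
    apply cder_mult; [apply cder_id|apply cder_const].
  - simpl. ring.
Qed.

Lemma Rcpow_neq_0 (a : R) (z : C) : Rcpow a z <> 0%C.
Proof. apply Cexp_neq_0. Qed.

Lemma Rcpow_plus (a : R) (z w : C) : Rcpow a (z + w) = (Rcpow a z * Rcpow a w)%C.
Proof. unfold Rcpow. rewrite <- Cexp_plus. f_equal. ring. Qed.

Lemma Cmod_Rcpow (a : R) (z : C) : Cmod (Rcpow a z) = exp (Re z * ln a).
Proof. unfold Rcpow. rewrite Cmod_Cexp. f_equal. rewrite re_scal_r. reflexivity. Qed.

Lemma Rcpow_R (a x : R) : Rcpow a (RtoC x) = RtoC (exp (x * ln a)).
Proof. unfold Rcpow. rewrite <- RtoC_mult. apply Cexp_RtoC. Qed.

(** * Integrals along segments *)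

(** The domain is left general: differentiation under the integral needs joint continuity on the
    product of two lines, and continuity on C is another instance. *)
Definition rcont {U : UniformSpace} (f : U -> C) (t : U) : Prop :=
  @continuous U C_UniformSpace f t.

Definition CInt (f : R -> C) (a b : R) : C :=
  @RInt C_R_CompleteNormedModule f a b.

Lemma rcontP (f : R -> C) (t : R) :
  rcont f t <->
  forall eps : R, 0 < eps -> exists d : R, 0 < d /\
    forall u : R, Rabs (u - t) < d -> Cmod (f u - f t) < eps.
Proof.
  split.
  - intros H eps He.
    destruct (proj1 (filterlim_locally_ball_norm (F := locally t)
       (U := C_NormedModule) f (f t)) H (mkposreal eps He)) as [d Hd].
    exists d. split; [apply cond_pos|].
    intros u Hu. apply (Hd u). exact Hu.
  - intros H.
    apply (filterlim_locally_ball_norm (F := locally t) (U := C_NormedModule) f (f t)).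
    intros eps.
    destruct (H eps (cond_pos eps)) as [d [Hd Hd']].
    exists (mkposreal _ Hd). intros u Hu. apply Hd'. exact Hu.
Qed.

Lemma rcont_Re {U : UniformSpace} (f : U -> C) t : rcont f t -> continuous (fun u => Re (f u)) t.
Proof. 
  intros H. apply (continuous_comp f fst); [exact H|].
  destruct (f t). apply continuous_fst.
Qed.

Lemma rcont_Im {U : UniformSpace} (f : U -> C) t : rcont f t -> continuous (fun u => Im (f u)) t.
Proof. 
  intros H. apply (continuous_comp f snd); [exact H|].
  destruct (f t). apply continuous_snd.
Qed.

Lemma rcont_pair {U : UniformSpace} (f : U -> C) t :
  continuous (fun u => Re (f u)) t -> continuous (fun u => Im (f u)) t -> rcont f t.
Proof.
  intros H1 H2.
  assert (H : rcont (fun u => (Re (f u), Im (f u))) t).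
  { apply (continuous_comp_2 (fun u => Re (f u)) (fun u => Im (f u)) (fun a b => (a, b)) t H1 H2).
    intros P [e He]. exists e. intros [a b] Hy. apply He. exact Hy. }
  eapply continuous_ext; [|exact H]. intros u. simpl. now destruct (f u).
Qed.

Lemma rcont_comp {U : UniformSpace} (f : C -> C) (g : U -> C) t : ccont f (g t) -> rcont g t -> rcont (fun u => f (g u)) t.
Proof. intros Hf Hg. now apply (continuous_comp g f). Qed.

Lemma rcont_const {U : UniformSpace} (c : C) (t : U) : rcont (fun _ => c) t.
Proof. apply continuous_const. Qed.

Lemma rcont_RtoC {U : UniformSpace} (f : U -> R) t : continuous f t -> rcont (fun u => RtoC (f u)) t.
Proof. intros H. apply rcont_pair; [exact H|apply continuous_const]. Qed.

Lemma rcont_plus {U : UniformSpace} (f g : U -> C) t : rcont f t -> rcont g t -> rcont (fun u => f u + g u)%C t.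
Proof.
  intros Hf Hg. apply rcont_pair.
  - apply (continuous_plus (fun u => Re (f u)) (fun u => Re (g u))); now apply rcont_Re.
  - apply (continuous_plus (fun u => Im (f u)) (fun u => Im (g u))); now apply rcont_Im.
Qed.

Lemma rcont_mult {U : UniformSpace} (f g : U -> C) t : rcont f t -> rcont g t -> rcont (fun u => f u * g u)%C t.
Proof.
  intros Hf Hg. apply rcont_pair; simpl.
  - apply (continuous_minus (fun u => Re (f u) * Re (g u)) (fun u => Im (f u) * Im (g u)));
    apply (continuous_mult (K := R_AbsRing)); auto using rcont_Re, rcont_Im.
  - apply (continuous_plus (fun u => Re (f u) * Im (g u)) (fun u => Im (f u) * Re (g u)));
    apply (continuous_mult (K := R_AbsRing)); auto using rcont_Re, rcont_Im.
Qed.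

Lemma rcont_opp {U : UniformSpace} (f : U -> C) t : rcont f t -> rcont (fun u => - f u)%C t.
Proof.
  intros Hf. eapply continuous_ext; [|exact (rcont_mult _ _ _ (rcont_const (-(1)) t) Hf)].
  intros; simpl. ring.
Qed.

Lemma rcont_minus {U : UniformSpace} (f g : U -> C) t : rcont f t -> rcont g t -> rcont (fun u => f u - g u)%C t.
Proof. intros Hf Hg. now apply rcont_plus, rcont_opp. Qed.

Lemma ex_CInt (f : R -> C) a b :
  (forall t, Rmin a b <= t <= Rmax a b -> rcont f t) ->
  @ex_RInt C_R_NormedModule f a b.
Proof. intros H. apply (@ex_RInt_continuous C_R_CompleteNormedModule). exact H. Qed.

Lemma CInt_RI f a b : @ex_RInt C_R_NormedModule f a b ->
  CInt f a b = (RInt (fun t => Re (f t)) a b, RInt (fun t => Im (f t)) a b).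
Proof.
  intros H. apply (@RInt_correct C_R_CompleteNormedModule) in H.
  fold (CInt f a b) in H. destruct (CInt f a b) as [x y].
  apply injective_projections; simpl; symmetry; apply is_RInt_unique.
  - exact (is_RInt_fct_extend_fst (U := R_NormedModule) (V := R_NormedModule) _ _ _ _ H).
  - exact (is_RInt_fct_extend_snd (U := R_NormedModule) (V := R_NormedModule) _ _ _ _ H).
Qed.

Lemma ex_CInt_Re (f : R -> C) a b : @ex_RInt C_R_NormedModule f a b -> ex_RInt (fun t => Re (f t)) a b.
Proof.
  intros [l H]. exists (fst l).
  exact (is_RInt_fct_extend_fst (U := R_NormedModule) (V := R_NormedModule) _ _ _ _ H).
Qed.

Lemma ex_CInt_Im (f : R -> C) a b : @ex_RInt C_R_NormedModule f a b -> ex_RInt (fun t => Im (f t)) a b.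
Proof.
  intros [l H]. exists (snd l).
  exact (is_RInt_fct_extend_snd (U := R_NormedModule) (V := R_NormedModule) _ _ _ _ H).
Qed.

Lemma CInt_ext f g a b :
  (forall t, Rmin a b < t < Rmax a b -> f t = g t) -> CInt f a b = CInt g a b.
Proof. intros H. now apply (@RInt_ext C_R_CompleteNormedModule). Qed.

Lemma CInt_plus f g a b :
  @ex_RInt C_R_NormedModule f a b -> @ex_RInt C_R_NormedModule g a b ->
  CInt (fun t => f t + g t)%C a b = (CInt f a b + CInt g a b)%C.
Proof. intros Hf Hg. now apply (@RInt_plus C_R_CompleteNormedModule). Qed.

Lemma CInt_minus f g a b :
  @ex_RInt C_R_NormedModule f a b -> @ex_RInt C_R_NormedModule g a b ->
  CInt (fun t => f t - g t)%C a b = (CInt f a b - CInt g a b)%C.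
Proof. intros Hf Hg. now apply (@RInt_minus C_R_CompleteNormedModule). Qed.

(** The integral is linear over the real field only, so a complex factor is handled through real and
    imaginary parts. *)
Lemma CInt_scal (c : C) f a b :
  @ex_RInt C_R_NormedModule f a b ->
  CInt (fun t => c * f t)%C a b = (c * CInt f a b)%C.
Proof.
  intros Hf. destruct c as [x y].
  pose proof (RInt_correct _ _ _ (ex_CInt_Re _ _ _ Hf)) as H1.
  pose proof (RInt_correct _ _ _ (ex_CInt_Im _ _ _ Hf)) as H2.
  rewrite (CInt_RI f) by assumption.
  apply (@is_RInt_unique C_R_CompleteNormedModule).
  apply (is_RInt_fct_extend_pair (U := R_NormedModule) (V := R_NormedModule)).
  - apply (is_RInt_ext (fun t => minus (scal x (Re (f t))) (scal y (Im (f t))))).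
    { intros t _. reflexivity. }
    apply (is_RInt_minus (V := R_NormedModule)); apply (is_RInt_scal (V := R_NormedModule)); assumption.
  - apply (is_RInt_ext (fun t => plus (scal x (Im (f t))) (scal y (Re (f t))))).
    { intros t _. reflexivity. }
    apply (is_RInt_plus (V := R_NormedModule)); apply (is_RInt_scal (V := R_NormedModule)); assumption.
Qed.

Lemma CInt_const (c : C) a b : CInt (fun _ => c) a b = (RtoC (b - a) * c)%C.
Proof.
  unfold CInt. rewrite (@RInt_const C_R_CompleteNormedModule). apply scal_R_Cmult.
Qed.

Lemma CInt_bound f a b M : a <= b ->
  @ex_RInt C_R_NormedModule f a b ->
  (forall t, a <= t <= b -> Cmod (f t) <= M) -> Cmod (CInt f a b) <= (b - a) * M.
Proof.
  intros Hab Hf HM. rewrite Cmod_norm.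
  apply (norm_RInt_le_const (V := C_R_NormedModule) f); auto.
  - intros t Ht. rewrite <- Cmod_norm. now apply HM.
  - now apply (@RInt_correct C_R_CompleteNormedModule).
Qed.

Lemma CInt_Chasles f a b c :
  @ex_RInt C_R_NormedModule f a b -> @ex_RInt C_R_NormedModule f b c ->
  (CInt f a b + CInt f b c = CInt f a c)%C.
Proof. intros H1 H2. now apply (@RInt_Chasles C_R_CompleteNormedModule). Qed.


(** * Derivatives with respect to a real parameter and integrals over segments *)

Definition rder (f : R -> C) (t : R) (l : C) : Prop :=
  @is_derive R_AbsRing C_R_NormedModule f t l.

Lemma rderP (f : R -> C) (t : R) (l : C) :
  rder f t l <->
  forall eps : R, 0 < eps -> exists d : R, 0 < d /\
    forall h : R, Rabs h < d -> Cmod (f (t + h) - f t - RtoC h * l) <= eps * Rabs h.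
Proof.
  split.
  - intros [_ H] eps He.
    specialize (H t (fun P HP => HP) (mkposreal eps He)).
    destruct H as [d Hd]. exists d. split; [apply cond_pos|].
    intros h Hh.
    specialize (Hd (t + h)).
    assert (E : t + h - t = h) by ring.
    rewrite <- scal_R_Cmult.
    assert (B : @ball R_UniformSpace t d (t + h)).
    { change (Rabs (t + h - t) < d). now rewrite E. }
    specialize (Hd B). 
    change (norm (minus (t + h) t)) with (Rabs (t + h - t)) in Hd.
    change (minus (t + h) t) with (t + h - t) in Hd. rewrite E in Hd.
    rewrite Cmod_norm. exact Hd.
  - intros H. split.
    + apply is_linear_scal_l.
    + intros x Hx eps.
      apply (@is_filter_lim_locally_unique R_AbsRing R_NormedModule t x) in Hx. subst x.
      destruct (H eps (cond_pos eps)) as [d [Hd Hd']].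
      exists (mkposreal d Hd). intros y Hy.
      specialize (Hd' (y - t) Hy).
      assert (E : t + (y - t) = y) by (change (t + ((y:R) - t) = y); ring). rewrite E in Hd'.
      rewrite <- scal_R_Cmult, Cmod_norm in Hd'. exact Hd'.
Qed.

Lemma rder_cont f t l : rder f t l -> rcont f t.
Proof. intros H. apply (ex_derive_continuous (V := C_R_NormedModule)). now exists l. Qed.

Lemma rder_eq f t l l' : rder f t l -> l = l' -> rder f t l'.
Proof. now intros H <-. Qed.

Lemma rder_ext (f g : R -> C) t l : (forall u, f u = g u) -> rder f t l -> rder g t l.
Proof. intros E H. eapply is_derive_ext; [|exact H]. exact E. Qed.

Lemma rder_comp (f : C -> C) (g : R -> C) t a b :
  cder f (g t) a -> rder g t b -> rder (fun u => f (g u)) t (b * a)%C.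
Proof.
  intros Hf Hg. pose proof (rder_cont _ _ _ Hg) as Hc.
  apply rderP. intros eps He.
  set (K := Cmod a + Cmod b + 2).
  assert (HK : 2 <= K) by (unfold K; generalize (Cmod_ge_0 a) (Cmod_ge_0 b); lra).
  set (e := Rmin 1 (eps / K)).
  assert (He1 : 0 < e).
  { apply Rmin_glb_lt; [lra|]. apply Rdiv_lt_0_compat; lra. }
  assert (He2 : e <= 1) by apply Rmin_l.
  assert (He3 : e * K <= eps).
  { apply Rle_trans with (eps / K * K); [apply Rmult_le_compat_r; [lra|apply Rmin_r]|].
    unfold Rdiv. rewrite Rmult_assoc, Rinv_l; lra. }
  destruct (proj1 (cderP _ _ _) Hf e He1) as [d1 [Hd1 Hd1']].
  destruct (proj1 (rderP _ _ _) Hg e He1) as [d2 [Hd2 Hd2']].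
  destruct (proj1 (rcontP _ _) Hc d1 Hd1) as [d3 [Hd3 Hd3']].
  exists (Rmin d2 d3). split; [now apply Rmin_glb_lt|].
  intros h Hh.
  assert (H2 : Rabs h < d2) by (eapply Rlt_le_trans; [exact Hh|apply Rmin_l]).
  assert (H3 : Rabs (t + h - t) < d3).
  { replace (t + h - t) with h by ring. eapply Rlt_le_trans; [exact Hh|apply Rmin_r]. }
  specialize (Hd2' h H2). specialize (Hd3' _ H3). specialize (Hd1' _ Hd3').
  set (k := (g (t + h)%R - g t)%C) in *.
  replace (g t + k)%C with (g (t + h)) in Hd1' by (unfold k; ring).
  replace (f (g (t + h)%R) - f (g t) - RtoC h * (b * a))%C
    with ((f (g (t + h)%R) - f (g t) - k * a) + (k - RtoC h * b) * a)%C by ring.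
  eapply Rle_trans; [apply Cmod_triangle|]. rewrite Cmod_mult.
  assert (Hk : Cmod k <= (1 + Cmod b) * Rabs h).
  { replace k with ((k - RtoC h * b) + RtoC h * b)%C by ring.
    eapply Rle_trans; [apply Cmod_triangle|]. rewrite Cmod_mult, Cmod_R.
    generalize (Rabs_pos h). nra. }
  apply Rle_trans with (e * ((1 + Cmod b) * Rabs h) + e * Rabs h * Cmod a).
  - apply Rplus_le_compat.
    + eapply Rle_trans; [exact Hd1'|]. apply Rmult_le_compat_l; lra.
    + apply Rmult_le_compat_r; [apply Cmod_ge_0|exact Hd2'].
  - apply Rle_trans with (e * K * Rabs h).
    + unfold K. generalize (Rabs_pos h). nra.
    + apply Rmult_le_compat_r; [apply Rabs_pos|exact He3].
Qed.

Lemma rder_lin (p v : C) t : rder (fun u => p + RtoC u * v)%C t v.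
Proof.
  apply rderP. intros eps He. exists 1. split; [lra|]. intros h _.
  rewrite RtoC_plus.
  replace (p + (RtoC t + RtoC h) * v - (p + RtoC t * v) - RtoC h * v)%C with (RtoC 0) by ring.
  rewrite Cmod_0. apply Rmult_le_pos; [lra|apply Rabs_pos].
Qed.

Lemma CInt_FTC (F : R -> C) (f : R -> C) a b :
  (forall t, Rmin a b <= t <= Rmax a b -> rder F t (f t)) ->
  (forall t, Rmin a b <= t <= Rmax a b -> rcont f t) ->
  CInt f a b = (F b - F a)%C.
Proof.
  intros H1 H2. apply (@is_RInt_unique C_R_CompleteNormedModule).
  apply (@is_RInt_derive C_R_CompleteNormedModule F f a b H1 H2).
Qed.

Definition seg (f : C -> C) (p q : C) : C :=
  ((q - p) * CInt (fun t => f (p + RtoC t * (q - p))%C) 0 1)%C.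

Definition on_seg (p q z : C) : Prop :=
  exists t : R, 0 <= t <= 1 /\ z = (p + RtoC t * (q - p))%C.

Lemma seg_rcont f p q : (forall z, on_seg p q z -> ccont f z) ->
  forall t, 0 <= t <= 1 -> rcont (fun t => f (p + RtoC t * (q - p))%C) t.
Proof.
  intros H t Ht. apply (rcont_comp f (fun t => p + RtoC t * (q - p))%C).
  - apply H. exists t; auto.
  - eapply rder_cont. apply rder_lin.
Qed.

Lemma seg_ex f p q : (forall z, on_seg p q z -> ccont f z) ->
  forall a b, 0 <= a <= 1 -> 0 <= b <= 1 ->
  @ex_RInt C_R_NormedModule (fun t => f (p + RtoC t * (q - p))%C) a b.
Proof.
  intros H a b Ha Hb. apply ex_CInt. intros t Ht. apply seg_rcont; auto.
  unfold Rmin, Rmax in Ht. destruct (Rle_dec a b); lra.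
Qed.

Lemma seg_rev f p q : (forall z, on_seg p q z -> ccont f z) -> seg f q p = (- seg f p q)%C.
Proof.
  intros H. unfold seg.
  assert (E : CInt (fun t => f (q + RtoC t * (p - q))%C) 0 1 =
              CInt (fun t => f (p + RtoC t * (q - p))%C) 0 1).
  { set (g := fun t => f (p + RtoC t * (q - p))%C).
    pose proof (@RInt_comp_lin C_R_CompleteNormedModule g (-1) 1 0 1) as L.
    replace (-1 * 0 + 1) with 1 in L by ring. replace (-1 * 1 + 1) with 0 in L by ring.
    specialize (L (seg_ex f p q H 1 0 ltac:(lra) ltac:(lra))).
    rewrite <- (@opp_RInt_swap C_R_CompleteNormedModule g) in L
      by (apply (seg_ex f p q H); lra).
    assert (L2 : CInt (fun t => RtoC (-1) * f (q + RtoC t * (p - q)))%C 0 1 = (- CInt g 0 1)%C).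
    { transitivity (opp (@RInt C_R_CompleteNormedModule g 0 1)); [rewrite <- L|reflexivity].
      apply CInt_ext. intros t _. rewrite scal_R_Cmult. f_equal.
      unfold g. f_equal. rewrite RtoC_plus, RtoC_mult. ring. }
    rewrite CInt_scal in L2.
    2:{ apply ex_CInt. rewrite Rmin_left, Rmax_right by lra. intros t Ht. apply seg_rcont; auto.
        intros z [s [Hs ->]]. apply H. exists (1 - s). split; [lra|]. rewrite RtoC_minus. ring. }
    replace (CInt (fun t => f (q + RtoC t * (p - q))%C) 0 1) with
      (- (RtoC (-1) * CInt (fun t => f (q + RtoC t * (p - q))%C) 0 1))%C
      by ring.
    rewrite L2. ring. }
  rewrite E. ring.
Qed.

Lemma seg_mid f p q : (forall z, on_seg p q z -> ccont f z) ->
  seg f p q = (seg f p ((p + q) / 2) + seg f ((p + q) / 2) q)%C.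
Proof.
  intros H. unfold seg.
  assert (n2 : RtoC 2 <> 0%C) by (intros E; apply RtoC_inj in E; lra).
  set (g := fun t => f (p + RtoC t * (q - p))%C).
  assert (Hh : RtoC (1 / 2) = (/ 2)%C).
  { rewrite RtoC_div by lra. field. }
  assert (E1 : (RtoC (1/2) * CInt (fun t => f (p + RtoC t * ((p + q) / 2 - p))%C) 0 1)%C = CInt g 0 (1/2)).
  { pose proof (@RInt_comp_lin C_R_CompleteNormedModule g (1/2) 0 0 1) as L.
    replace (1 / 2 * 0 + 0) with 0 in L by ring. replace (1 / 2 * 1 + 0) with (1/2) in L by ring.
    specialize (L (seg_ex f p q H 0 (1/2) ltac:(lra) ltac:(lra))).
    unfold CInt at 2. rewrite <- L, <- CInt_scal.
    - apply CInt_ext. intros t _. rewrite scal_R_Cmult. f_equal.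
      unfold g. f_equal. rewrite RtoC_plus, RtoC_mult, Hh. field; auto.
    - apply ex_CInt. rewrite Rmin_left, Rmax_right by lra. intros t Ht. apply seg_rcont; auto.
      intros z [s [Hs ->]]. apply H. exists (s / 2). split; [lra|].
      rewrite RtoC_div by lra. field; auto. }
  assert (E2 : (RtoC (1/2) * CInt (fun t => f ((p + q) / 2 + RtoC t * (q - (p + q) / 2))%C) 0 1)%C = CInt g (1/2) 1).
  { pose proof (@RInt_comp_lin C_R_CompleteNormedModule g (1/2) (1/2) 0 1) as L.
    replace (1 / 2 * 0 + 1 / 2) with (1/2) in L by ring.
    replace (1 / 2 * 1 + 1 / 2) with 1 in L by field.
    specialize (L (seg_ex f p q H (1/2) 1 ltac:(lra) ltac:(lra))).
    unfold CInt at 2. rewrite <- L, <- CInt_scal.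
    - apply CInt_ext. intros t _. rewrite scal_R_Cmult. f_equal.
      unfold g. f_equal. rewrite RtoC_plus, RtoC_mult, Hh. field; auto.
    - apply ex_CInt. rewrite Rmin_left, Rmax_right by lra. intros t Ht. apply seg_rcont; auto.
      intros z [s [Hs ->]]. apply H. exists ((1 + s) / 2). split; [lra|].
      rewrite RtoC_div, RtoC_plus by lra. field; auto. }
  rewrite <- (CInt_Chasles g 0 (1/2) 1) by (apply (seg_ex f p q H); lra).
  rewrite <- E1, <- E2, Hh. field; auto.
Qed.

Lemma seg_FTC (F f : C -> C) p q :
  (forall z, on_seg p q z -> cder F z (f z)) ->
  (forall z, on_seg p q z -> ccont f z) -> seg f p q = (F q - F p)%C.
Proof.
  intros HF Hf. unfold seg.
  rewrite <- CInt_scal by (apply seg_ex; auto; lra).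
  rewrite (CInt_FTC (fun t => F (p + RtoC t * (q - p))%C)).
  - f_equal; f_equal; ring.
  - rewrite Rmin_left, Rmax_right by lra. intros t Ht.
    apply (rder_comp F (fun t => p + RtoC t * (q - p))%C); [|apply rder_lin].
    apply HF. exists t; auto.
  - rewrite Rmin_left, Rmax_right by lra. intros t Ht.
    apply rcont_mult; [apply rcont_const|]. now apply seg_rcont.
Qed.

Lemma seg_bound f p q M : (forall z, on_seg p q z -> ccont f z) ->
  (forall z, on_seg p q z -> Cmod (f z) <= M) -> Cmod (seg f p q) <= Cmod (q - p) * M.
Proof.
  intros Hf HM. unfold seg. rewrite Cmod_mult.
  apply Rmult_le_compat_l; [apply Cmod_ge_0|].
  rewrite <- (Rmult_1_l M). replace 1 with (1 - 0) at 2 by ring.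
  apply CInt_bound; [lra|apply seg_ex; auto; lra|].
  intros t Ht. apply HM. exists t; auto.
Qed.

Lemma seg_minus f g p q : (forall z, on_seg p q z -> ccont f z) ->
  (forall z, on_seg p q z -> ccont g z) ->
  seg (fun z => f z - g z)%C p q = (seg f p q - seg g p q)%C.
Proof.
  intros Hf Hg. unfold seg.
  rewrite (CInt_minus (fun t => f (p + RtoC t * (q - p))%C) (fun t => g (p + RtoC t * (q - p))%C))
    by (apply seg_ex; auto; lra).
  ring.
Qed.

Lemma on_seg_disc (c p q z : C) r :
  Cmod (p - c) <= r -> Cmod (q - c) <= r -> on_seg p q z -> Cmod (z - c) <= r.
Proof.
  intros Hp Hq [t [Ht ->]].
  replace (p + RtoC t * (q - p) - c)%C with (RtoC (1 - t) * (p - c) + RtoC t * (q - c))%C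
    by (rewrite RtoC_minus; ring).
  eapply Rle_trans; [apply Cmod_triangle|]. rewrite !Cmod_mult, !Cmod_R.
  rewrite !Rabs_pos_eq by lra. nra.
Qed.

(** * Goursat's theorem *)

Definition tri (f : C -> C) (a b c : C) : C := (seg f a b + seg f b c + seg f c a)%C.

Definition perim (a b c : C) : R := Cmod (b - a) + Cmod (c - b) + Cmod (a - c).

(** The bisection of Goursat's proof: one of the four midpoint triangles carries at least a quarter
    of the integral. The inner triangle is the default, which is correct once the three corner
    triangles have failed the test. *)
Definition quarter (f : C -> C) (t : C * C * C) : C * C * C :=
  let '(a, b, c) := t in
  let m := Cmod (tri f a b c) / 4 in
  let ab := ((a + b) / 2)%C in
  let bc := ((b + c) / 2)%C in
  let ca := ((c + a) / 2)%C in
  if Rle_dec m (Cmod (tri f a ab ca)) then (a, ab, ca)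
  else if Rle_dec m (Cmod (tri f ab b bc)) then (ab, b, bc)
  else if Rle_dec m (Cmod (tri f ca bc c)) then (ca, bc, c)
  else (ab, bc, ca).

(** The three inner edges are run through twice, in opposite directions, and cancel. *)
Lemma tri_split (f : C -> C) (c0 a b c : C) r :
  (forall z, Cmod (z - c0) <= r -> ccont f z) ->
  Cmod (a - c0) <= r -> Cmod (b - c0) <= r -> Cmod (c - c0) <= r ->
  let ab := ((a + b) / 2)%C in
  let bc := ((b + c) / 2)%C in
  let ca := ((c + a) / 2)%C in
  tri f a b c = (tri f a ab ca + tri f ab b bc + tri f ca bc c + tri f ab bc ca)%C.
Proof.
  intros Hf Ha Hb Hc ab bc ca.
  assert (M : forall p q, Cmod (p - c0) <= r -> Cmod (q - c0) <= r -> Cmod ((p + q) / 2 - c0) <= r).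
  { intros p q Hp Hq. apply (on_seg_disc c0 p q); auto. exists (1/2). split; [lra|].
    rewrite RtoC_div by lra. field. }
  assert (S : forall p q, Cmod (p - c0) <= r -> Cmod (q - c0) <= r -> forall z, on_seg p q z -> ccont f z).
  { intros p q Hp Hq z Hz. apply Hf. now apply (on_seg_disc c0 p q). }
  unfold tri.
  rewrite (seg_mid f a b), (seg_mid f b c), (seg_mid f c a) by (apply S; auto).
  fold ab bc ca.
  rewrite (seg_rev f ab ca), (seg_rev f bc ab), (seg_rev f ca bc) by (apply S; apply M; auto).
  ring.
Qed.

Lemma Cmod_half (a : C) : Cmod (a / 2) = Cmod a / 2.
Proof.
  rewrite Cmod_div by (intros E; apply RtoC_inj in E; lra).
  rewrite Cmod_R, Rabs_pos_eq by lra. reflexivity.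
Qed.

Lemma quarter_spec (f : C -> C) (c0 a b c a' b' c' : C) r :
  (forall z, Cmod (z - c0) <= r -> ccont f z) ->
  Cmod (a - c0) <= r -> Cmod (b - c0) <= r -> Cmod (c - c0) <= r ->
  quarter f (a, b, c) = (a', b', c') ->
  (Cmod (a' - c0) <= r /\ Cmod (b' - c0) <= r /\ Cmod (c' - c0) <= r) /\
  Cmod (tri f a b c) / 4 <= Cmod (tri f a' b' c') /\
  perim a' b' c' = perim a b c / 2 /\ Cmod (a' - a) <= perim a b c.
Proof.
  intros Hf Ha Hb Hc Q.
  assert (M : forall p q, Cmod (p - c0) <= r -> Cmod (q - c0) <= r -> Cmod ((p + q) / 2 - c0) <= r).
  { intros p q Hp Hq. apply (on_seg_disc c0 p q); auto. exists (1/2). split; [lra|].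
    rewrite RtoC_div by lra. field. }
  pose proof (tri_split f c0 a b c r Hf Ha Hb Hc) as T. cbv zeta in T.
  unfold quarter in Q.
  set (ab := ((a + b) / 2)%C) in *.
  set (bc := ((b + c) / 2)%C) in *.
  set (ca := ((c + a) / 2)%C) in *.
  assert (A1 : Cmod (ab - a) = Cmod (b - a) / 2) by (rewrite <- Cmod_half; f_equal; unfold ab; field).
  assert (A2 : Cmod (b - ab) = Cmod (b - a) / 2) by (rewrite <- Cmod_half; f_equal; unfold ab; field).
  assert (A3 : Cmod (bc - b) = Cmod (c - b) / 2) by (rewrite <- Cmod_half; f_equal; unfold bc; field).
  assert (A4 : Cmod (c - bc) = Cmod (c - b) / 2) by (rewrite <- Cmod_half; f_equal; unfold bc; field).
  assert (A5 : Cmod (ca - c) = Cmod (a - c) / 2) by (rewrite <- Cmod_half; f_equal; unfold ca; field).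
  assert (A6 : Cmod (a - ca) = Cmod (a - c) / 2) by (rewrite <- Cmod_half; f_equal; unfold ca; field).
  assert (B1 : Cmod (ca - ab) = Cmod (c - b) / 2) by (rewrite <- Cmod_half; f_equal; unfold ca, ab; field).
  assert (B2 : Cmod (ab - bc) = Cmod (a - c) / 2) by (rewrite <- Cmod_half; f_equal; unfold bc, ab; field).
  assert (B3 : Cmod (bc - ca) = Cmod (b - a) / 2) by (rewrite <- Cmod_half; f_equal; unfold ca, bc; field).
  assert (B1' : Cmod (ab - ca) = Cmod (c - b) / 2) by (rewrite Cmod_sub_sym; auto).
  assert (B2' : Cmod (bc - ab) = Cmod (a - c) / 2) by (rewrite Cmod_sub_sym; auto).
  assert (B3' : Cmod (ca - bc) = Cmod (b - a) / 2) by (rewrite Cmod_sub_sym; auto).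
  assert (C1 : Cmod (ca - a) = Cmod (a - c) / 2) by (rewrite Cmod_sub_sym; auto).
  pose proof (Cmod_ge_0 (b - a)). pose proof (Cmod_ge_0 (c - b)). pose proof (Cmod_ge_0 (a - c)).
  assert (Z : Cmod (a - a) = 0) by (replace (a - a)%C with (RtoC 0) by ring; apply Cmod_0).
  unfold perim.
  destruct (Rle_dec _ (Cmod (tri f a ab ca))) as [h1|h1].
  { injection Q as <- <- <-. repeat split; auto; try (apply M; auto); lra. }
  destruct (Rle_dec _ (Cmod (tri f ab b bc))) as [h2|h2].
  { injection Q as <- <- <-. repeat split; auto; try (apply M; auto); lra. }
  destruct (Rle_dec _ (Cmod (tri f ca bc c))) as [h3|h3].
  { injection Q as <- <- <-. repeat split; auto; try (apply M; auto); lra. }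
  injection Q as <- <- <-. repeat split; auto; try (apply M; auto); try lra.
  assert (Cmod (tri f a b c) <= Cmod (tri f a ab ca) + Cmod (tri f ab b bc) +
    Cmod (tri f ca bc c) + Cmod (tri f ab bc ca)).
  { rewrite T. do 3 (eapply Rle_trans; [apply Cmod_triangle|]; apply Rplus_le_compat_r). lra. }
  lra.
Qed.

(** The limit is the supremum of the lower ends [u n - 2 * K / 2 ^ n], each of which lies below
    every upper end [u n + 2 * K / 2 ^ n]. The explicit rate is needed to compare the distance of
    the limit point with the size of the triangle. *)
Lemma geometric_cauchy_R (u : nat -> R) K : (forall n, Rabs (u (S n) - u n) <= K / 2 ^ n) ->
  exists x, forall n, Rabs (u n - x) <= 2 * K / 2 ^ n.
Proof.
  intros H.
  assert (HP : forall n, 0 < 2 ^ n) by (intros; apply pow_lt; lra).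
  assert (E : forall n, 2 * K / 2 ^ S n = K / 2 ^ n) by (intros; simpl; field; generalize (HP n); lra).
  assert (E2 : forall n, 2 * K / 2 ^ n = K / 2 ^ n + K / 2 ^ n) by (intros; field; generalize (HP n); lra).
  assert (K0 : forall n, 0 <= K / 2 ^ n) by (intros n; eapply Rle_trans; [apply Rabs_pos|apply H]).
  assert (D : forall n m, Rabs (u (n + m)%nat - u n) <= 2 * K / 2 ^ n - 2 * K / 2 ^ (n + m)).
  { intros n m. induction m as [|m IH].
    - rewrite Nat.add_0_r, !Rminus_diag, Rabs_R0. lra.
    - rewrite Nat.add_succ_r, E. specialize (H (n + m)%nat).
      replace (u (S (n + m)) - u n) with ((u (S (n + m)) - u (n + m)%nat) + (u (n + m)%nat - u n)) by ring.
      eapply Rle_trans; [apply Rabs_triang|]. rewrite (E2 (n + m)%nat) in IH. lra. }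
  destruct (completeness (fun y => exists n, y = u n - 2 * K / 2 ^ n)) as [x [Hx1 Hx2]].
  - exists (u 0%nat + 2 * K / 2 ^ 0). intros y [n ->].
    specialize (D 0%nat n). rewrite Nat.add_0_l in D. apply Rabs_le_between in D.
    pose proof (K0 n). rewrite (E2 n) in *. lra.
  - eexists. now exists 0%nat.
  - exists x. intros n. apply Rabs_le. split.
    + assert (x <= u n + 2 * K / 2 ^ n); [|lra]. apply Hx2. intros y [m ->].
      destruct (Nat.le_ge_cases n m) as [L|L].
      * replace m with (n + (m - n))%nat by lia. specialize (D n (m - n)%nat).
        apply Rabs_le_between in D. pose proof (K0 (n + (m - n))%nat).
        rewrite (E2 (n + (m - n))%nat) in *. lra.
      * specialize (D m (n - m)%nat). replace (m + (n - m))%nat with n in D by lia.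
        apply Rabs_le_between in D. pose proof (K0 n). rewrite (E2 n) in *. lra.
    + assert (u n - 2 * K / 2 ^ n <= x); [|lra]. apply Hx1. now exists n.
Qed.

Lemma geometric_cauchy_C (u : nat -> C) K : (forall n, Cmod (u (S n) - u n) <= K / 2 ^ n) ->
  exists p, forall n, Cmod (u n - p) <= 4 * K / 2 ^ n.
Proof.
  intros H.
  destruct (geometric_cauchy_R (fun n => Re (u n)) K) as [x Hx].
  { intros n. eapply Rle_trans; [|apply H]. 
    replace (Re (u (S n)) - Re (u n)) with (Re (u (S n) - u n)%C) by reflexivity.
    apply re_le_Cmod. }
  destruct (geometric_cauchy_R (fun n => Im (u n)) K) as [y Hy].
  { intros n. eapply Rle_trans; [|apply H]. 
    replace (Im (u (S n)) - Im (u n)) with (Im (u (S n) - u n)%C) by reflexivity.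
    apply im_le_Cmod. }
  exists (x, y). intros n. eapply Rle_trans; [apply Cmod_le_sum|].
  specialize (Hx n). specialize (Hy n).
  change (Re (u n - (x, y))%C) with (Re (u n) - x). 
  change (Im (u n - (x, y))%C) with (Im (u n) - y).
  replace (4 * K / 2 ^ n) with (2 * K / 2 ^ n + 2 * K / 2 ^ n) by (field; apply pow_nonzero; lra).
  lra.
Qed.

Lemma le_pow2_0 (x K : R) : (forall n, x <= K / 2 ^ n) -> x <= 0.
Proof.
  intros H. apply Rnot_lt_le. intros Hx.
  assert (HK : 0 < K) by (specialize (H 0%nat); simpl in H; lra).
  destruct (Pow_x_infinity 2 ltac:(rewrite Rabs_pos_eq; lra) (K / x + 1)) as [N HN].
  specialize (HN N (Nat.le_refl N)). rewrite Rabs_pos_eq in HN by (left; apply pow_lt; lra).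
  specialize (H N). assert (P : 0 < 2 ^ N) by (apply pow_lt; lra).
  apply (Rmult_le_compat_r (2 ^ N)) in H; [|lra].
  unfold Rdiv in H. rewrite Rmult_assoc, Rinv_l, Rmult_1_r in H by lra.
  assert (K / x * x = K) by (field; lra).
  assert ((K / x + 1) * x <= 2 ^ N * x) by (apply Rmult_le_compat_r; lra).
  lra.
Qed.

Theorem goursat (f : C -> C) (c0 a b c : C) r :
  (forall z, Cmod (z - c0) <= r -> exists l, cder f z l) ->
  Cmod (a - c0) <= r -> Cmod (b - c0) <= r -> Cmod (c - c0) <= r ->
  tri f a b c = 0%C.
Proof.
  intros Hd Ha Hb Hc.
  assert (Hf : forall z, Cmod (z - c0) <= r -> ccont f z).
  { intros z Hz. destruct (Hd z Hz) as [l Hl]. eapply cder_cont; eauto. }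
  set (t := fun n => Nat.iter n (quarter f) (a, b, c)).
  set (A := fun n => fst (fst (t n))). set (B := fun n => snd (fst (t n))). set (D := fun n => snd (t n)).
  assert (Et : forall n, t n = (A n, B n, D n)).
  { intros n. unfold A, B, D. now destruct (t n) as [[? ?] ?]. }
  assert (Q : forall n, quarter f (A n, B n, D n) = (A (S n), B (S n), D (S n))).
  { intros n. rewrite <- Et, <- Et. reflexivity. }
  set (d := perim a b c). set (I := Cmod (tri f a b c)).
  assert (Inv : forall n, (Cmod (A n - c0) <= r /\ Cmod (B n - c0) <= r /\ Cmod (D n - c0) <= r) /\
     I / 4 ^ n <= Cmod (tri f (A n) (B n) (D n)) /\ perim (A n) (B n) (D n) = d / 2 ^ n).
  { induction n as [|n [[Ia [Ib Ic]] [I1 I2]]].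
    - repeat split; auto.
      + change (I / 4 ^ 0 <= I). simpl. lra.
      + change (d = d / 2 ^ 0). simpl. field.
    - destruct (quarter_spec f c0 _ _ _ _ _ _ r Hf Ia Ib Ic (Q n)) as [J1 [J2 [J3 J4]]].
      split; auto. split.
      + eapply Rle_trans; [|exact J2]. simpl.
        replace (I / (4 * 4 ^ n)) with (I / 4 ^ n / 4) by (field; apply pow_nonzero; lra).
        lra.
      + rewrite J3, I2. simpl. field. apply pow_nonzero; lra. }
  destruct (geometric_cauchy_C A d) as [p Hp].
  { intros n. destruct (Inv n) as [[Ia [Ib Ic]] [I1 I2]]. rewrite <- I2.
    apply (quarter_spec f c0 _ _ _ _ _ _ r Hf Ia Ib Ic (Q n)). }
  assert (Hpr : Cmod (p - c0) <= r).
  { assert (Cmod (p - c0) - r <= 0); [|lra]. apply (le_pow2_0 _ (4 * d)). intros n.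
    specialize (Hp n). destruct (Inv n) as [[Ia _] _]. rewrite Cmod_sub_sym in Hp.
    generalize (Cmod_sum3 p (A n) c0). lra. }
  destruct (Hd p Hpr) as [l Hl].
  assert (Hd0 : 0 <= d) by (unfold d, perim; generalize (Cmod_ge_0 (b - a)) (Cmod_ge_0 (c - b)) (Cmod_ge_0 (a - c)); lra).
  assert (K : forall eta, 0 < eta -> I <= 5 * eta * d ^ 2).
  { intros eta Heta.
    destruct (proj1 (cderP _ _ _) Hl eta Heta) as [del [Hdel Hdel']].
    assert (exists n, 5 * d / 2 ^ n < del) as [n Hn].
    { apply NNPP. intros N. assert (del <= 0); [|lra]. apply (le_pow2_0 _ (5 * d)).
      intros n. apply Rnot_lt_le. intros H. apply N. now exists n. }
    destruct (Inv n) as [[Ia [Ib Ic]] [I1 I2]]. specialize (Hp n).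
    set (dn := d / 2 ^ n) in *.
    assert (Hdn : 0 <= dn) by (unfold dn; apply Rmult_le_pos; [auto|left; apply Rinv_0_lt_compat, pow_lt; lra]).
    assert (E5 : 5 * d / 2 ^ n = 5 * dn) by (unfold dn, Rdiv; ring).
    assert (E4 : 4 * d / 2 ^ n = 4 * dn) by (unfold dn, Rdiv; ring).
    rewrite E5 in Hn. rewrite E4 in Hp.
    (* The linear approximation at the limit point [p] has the primitive [Aff], so its integral over
       the triangle is 0 and only the remainder counts. Points of the [n]-th triangle are within
       [5 * dn] of [p]: [4 * dn] from its first vertex to [p], and [dn] for the perimeter. *)
    set (aff := fun z => (f p + (z - p) * l)%C).
    set (Aff := fun z => (f p * z + / 2 * l * ((z - p) * (z - p)))%C).
    assert (Haff : forall z, cder Aff z (aff z)).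
    { intros z. unfold Aff, aff.
      assert (H1 : cder (fun z => z - p)%C z 1).
      { eapply cder_eq; [apply cder_minus; [apply cder_id|apply cder_const]|ring]. }
      eapply cder_eq; [apply cder_plus; [apply cder_scal, cder_id|apply cder_scal, cder_mult; exact H1]|].
      simpl. field. }
    assert (Haff' : forall z, cder aff z l).
    { intros z. unfold aff.
      eapply cder_eq; [apply cder_plus; [apply cder_const|apply cder_mult; [apply cder_minus; [apply cder_id|apply cder_const]|apply cder_const]]|].
      simpl. ring. }
    assert (Caff : forall z, ccont aff z) by (intros z; eapply cder_cont; apply Haff').
    assert (Va : Cmod (A n - A n) <= dn).
    { replace (A n - A n)%C with (RtoC 0) by ring. now rewrite Cmod_0. }
    assert (Vb : Cmod (B n - A n) <= dn).
    { rewrite <- I2. unfold perim. generalize (Cmod_ge_0 (D n - B n)) (Cmod_ge_0 (A n - D n)). lra. }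
    assert (Vc : Cmod (D n - A n) <= dn).
    { rewrite <- I2, Cmod_sub_sym. unfold perim. generalize (Cmod_ge_0 (D n - B n)) (Cmod_ge_0 (B n - A n)). lra. }
    assert (Bd : forall u v, Cmod (u - A n) <= dn -> Cmod (v - A n) <= dn -> Cmod (u - c0) <= r -> Cmod (v - c0) <= r ->
      Cmod (seg f u v - seg aff u v) <= Cmod (v - u) * (5 * eta * dn)).
    { intros u v Hu Hv Hu' Hv'.
      assert (Cf : forall z, on_seg u v z -> ccont f z).
      { intros z Hz. apply Hf. now apply (on_seg_disc c0 u v). }
      rewrite <- seg_minus by auto.
      apply seg_bound.
      - intros z Hz. apply (rcont_minus (U := C_UniformSpace)); [now apply Cf|apply Caff].
      - intros z Hz. pose proof (on_seg_disc (A n) u v z dn Hu Hv Hz) as Hz'.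
        assert (Hzp : Cmod (z - p) <= 5 * dn) by (generalize (Cmod_sum3 z (A n) p); lra).
        specialize (Hdel' (z - p)%C ltac:(lra)).
        replace (p + (z - p))%C with z in Hdel' by ring.
        unfold aff. replace (f z - (f p + (z - p) * l))%C with (f z - f p - (z - p) * l)%C by ring.
        eapply Rle_trans; [exact Hdel'|]. nra. }
    assert (T0 : tri aff (A n) (B n) (D n) = 0%C).
    { unfold tri. rewrite !(seg_FTC Aff aff) by auto. ring. }
    assert (T1 : Cmod (tri f (A n) (B n) (D n)) <= dn * (5 * eta * dn)).
    { replace (tri f (A n) (B n) (D n)) with (tri f (A n) (B n) (D n) - tri aff (A n) (B n) (D n))%C
        by (rewrite T0; ring).
      unfold tri.
      replace (seg f (A n) (B n) + seg f (B n) (D n) + seg f (D n) (A n) -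
         (seg aff (A n) (B n) + seg aff (B n) (D n) + seg aff (D n) (A n)))%C
       with ((seg f (A n) (B n) - seg aff (A n) (B n)) + (seg f (B n) (D n) - seg aff (B n) (D n)) +
         (seg f (D n) (A n) - seg aff (D n) (A n)))%C by ring.
      rewrite <- I2 at 1. unfold perim.
      eapply Rle_trans; [apply Cmod_triangle|].
      rewrite Rmult_plus_distr_r. apply Rplus_le_compat; [|apply Bd; auto].
      eapply Rle_trans; [apply Cmod_triangle|].
      rewrite Rmult_plus_distr_r. apply Rplus_le_compat; apply Bd; auto. }
    assert (P : 0 < 2 ^ n) by (apply pow_lt; lra).
    assert (P4 : 4 ^ n = 2 ^ n * 2 ^ n) by (rewrite <- Rpow_mult_distr; f_equal; lra).
    assert (I / 4 ^ n <= 5 * eta * d ^ 2 / 4 ^ n).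
    { eapply Rle_trans; [exact I1|]. eapply Rle_trans; [exact T1|]. right.
      unfold dn. rewrite P4. field. lra. }
    assert (P4' : 0 < 4 ^ n) by (apply pow_lt; lra).
    apply (Rmult_le_compat_r (4 ^ n)) in H; [|lra].
    unfold Rdiv in H. rewrite !Rmult_assoc, Rinv_l in H by lra. lra. }
  apply Cmod_eq_0. fold I. apply Rle_antisym; [|apply Cmod_ge_0].
  apply Rnot_lt_le. intros HI.
  (* For this value of [eta] the bound is at most [I / 2], which contradicts [0 < I]. *)
  specialize (K (I / (10 * (d ^ 2 + 1)))).
  assert (P : 0 < d ^ 2 + 1) by nra.
  assert (HH : 0 < I / (10 * (d ^ 2 + 1))) by (apply Rdiv_lt_0_compat; lra).
  specialize (K HH).
  replace (5 * (I / (10 * (d ^ 2 + 1))) * d ^ 2) with (I / 2 * (d ^ 2 / (d ^ 2 + 1))) in K by (field; lra).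
  assert (d ^ 2 / (d ^ 2 + 1) <= 1).
  { apply Rmult_le_reg_r with (d ^ 2 + 1); auto. unfold Rdiv. rewrite Rmult_assoc, Rinv_l; lra. }
  nra.
Qed.

(** Only continuity and vanishing triangle integrals are assumed, so that the same statement serves
    after Goursat's theorem and in the proof of Morera's. The difference of two values of the
    primitive is an integral over a short segment, where [f] is nearly constant. *)
Theorem primitive_disc (f : C -> C) (c0 : C) r :
  (forall z, Cmod (z - c0) < r -> ccont f z) ->
  (forall a b c, Cmod (a - c0) < r -> Cmod (b - c0) < r -> Cmod (c - c0) < r -> tri f a b c = 0%C) ->
  forall z, Cmod (z - c0) < r -> cder (seg f c0) z (f z).
Proof.
  intros Hf HT z Hz.
  assert (Hr : 0 < r) by (generalize (Cmod_ge_0 (z - c0)); lra).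
  assert (S : forall p q, Cmod (p - c0) < r -> Cmod (q - c0) < r -> forall z, on_seg p q z -> ccont f z).
  { intros p q Hp Hq w Hw. apply Hf.
    apply Rle_lt_trans with (Rmax (Cmod (p - c0)) (Cmod (q - c0))); [|now apply Rmax_lub_lt].
    apply (on_seg_disc c0 p q); auto; [apply Rmax_l|apply Rmax_r]. }
  assert (H0 : Cmod (c0 - c0) < r) by (replace (c0 - c0)%C with (RtoC 0) by ring; now rewrite Cmod_0).
  apply cderP. intros eps He.
  destruct (proj1 (ccontP _ _) (Hf z Hz) eps He) as [d [Hd Hd']].
  exists (Rmin d (r - Cmod (z - c0))). split; [apply Rmin_glb_lt; lra|].
  intros h Hh.
  assert (H1 : Cmod h < d) by (eapply Rlt_le_trans; [exact Hh|apply Rmin_l]).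
  assert (H2 : Cmod h < r - Cmod (z - c0)) by (eapply Rlt_le_trans; [exact Hh|apply Rmin_r]).
  assert (H3 : Cmod (z + h - c0) < r).
  { replace (z + h - c0)%C with ((z - c0) + h)%C by ring. eapply Rle_lt_trans; [apply Cmod_triangle|lra]. }
  pose proof (HT c0 z (z + h)%C H0 Hz H3) as T. unfold tri in T.
  rewrite (seg_rev f c0 (z + h)) in T by (apply S; auto).
  assert (E : (seg f c0 (z + h) - seg f c0 z = seg f z (z + h))%C).
  { rewrite <- (Cplus_0_r (seg f c0 (z + h) - seg f c0 z)%C), <- T. ring. }
  rewrite E.
  assert (Ec : (h * f z)%C = seg (fun _ => f z) z (z + h)%C).
  { unfold seg. rewrite CInt_const. rewrite Rminus_0_r. ring. }
  rewrite Ec, <- seg_minus; [| apply S; auto|intros; apply (rcont_const (U := C_UniformSpace))].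
  replace (Cmod h) with (Cmod (z + h - z)) by (f_equal; ring).
  rewrite Rmult_comm. apply seg_bound.
  - intros w Hw. apply (rcont_minus (U := C_UniformSpace)); [revert w Hw; now apply S|apply rcont_const].
  - intros w [t [Ht ->]]. replace (z + h - z)%C with h by ring. left. apply Hd'.
    rewrite Cmod_mult, Cmod_R, Rabs_pos_eq by lra.
    generalize (Cmod_ge_0 h). nra.
Qed.

(** * Cauchy's formula and power series *)

Lemma rcont_bounded (H : R -> C) a b : a <= b -> (forall t, rcont H t) ->
  exists M, 0 <= M /\ forall t, a <= t <= b -> Cmod (H t) <= M.
Proof.
  intros Hab Hc.
  destruct (continuity_ab_maj (fun t => Cmod (H t)) a b Hab) as [m [Hm _]].
  - intros t _. apply continuity_pt_filterlim.
    intros P [e He]. destruct (proj1 (rcontP _ _) (Hc t) e (cond_pos e)) as [d [Hd Hd']].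
    exists (mkposreal d Hd). intros u Hu. apply He.
    change (Rabs (Cmod (H u) - Cmod (H t)) < e).
    apply Rle_lt_trans with (Cmod (H u - H t)); [|now apply Hd'].
    apply Rabs_le. split; [|apply Cmod_sub_ge].
    rewrite Cmod_sub_sym. generalize (Cmod_sub_ge (H t) (H u)). lra.
  - exists (Cmod (H m)). split; [apply Cmod_ge_0|exact Hm].
Qed.

Lemma rder_RI (f : R -> C) t (a b : R) :
  is_derive (fun u => Re (f u)) t a -> is_derive (fun u => Im (f u)) t b -> rder f t (a, b).
Proof.
  intros Ha Hb.
  apply rderP. intros eps He. assert (He2 : 0 < eps / 2) by lra.
  destruct Ha as [_ Ha]. destruct Hb as [_ Hb].
  destruct (Ha t (fun P HP => HP) (mkposreal _ He2)) as [d1 Hd1].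
  destruct (Hb t (fun P HP => HP) (mkposreal _ He2)) as [d2 Hd2].
  exists (Rmin d1 d2). split; [apply Rmin_glb_lt; apply cond_pos|].
  intros h Hh.
  assert (E : t + h - t = h) by ring.
  assert (B1 : @ball R_UniformSpace t d1 (t + h)).
  { change (Rabs (t + h - t) < d1). rewrite E. eapply Rlt_le_trans; [exact Hh|apply Rmin_l]. }
  assert (B2 : @ball R_UniformSpace t d2 (t + h)).
  { change (Rabs (t + h - t) < d2). rewrite E. eapply Rlt_le_trans; [exact Hh|apply Rmin_r]. }
  specialize (Hd1 _ B1). specialize (Hd2 _ B2).
  change (Rabs (Re (f (t + h)) - Re (f t) - (t + h - t) * a) <= eps / 2 * Rabs (t + h - t)) in Hd1.
  change (Rabs (Im (f (t + h)) - Im (f t) - (t + h - t) * b) <= eps / 2 * Rabs (t + h - t)) in Hd2.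
  rewrite E in Hd1, Hd2.
  eapply Rle_trans; [apply Cmod_le_sum|].
  replace (Re (f (t + h)%R - f t - RtoC h * (a, b))) with (Re (f (t + h)) - Re (f t) - h * a)
    by (unfold Re, Im; simpl; ring).
  replace (Im (f (t + h)%R - f t - RtoC h * (a, b))) with (Im (f (t + h)) - Im (f t) - h * b)
    by (unfold Re, Im; simpl; ring).
  lra.
Qed.

Lemma rder_Re (f : R -> C) t l : rder f t l -> is_derive (fun u => Re (f u)) t (Re l).
Proof.
  intros H. pose proof (proj1 (rderP _ _ _) H) as H'. split; [apply is_linear_scal_l|].
  intros x Hx eps. apply (@is_filter_lim_locally_unique R_AbsRing R_NormedModule t x) in Hx. subst x.
  destruct (H' eps (cond_pos eps)) as [d [Hd Hd']].
  exists (mkposreal d Hd). intros y Hy.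
  change (Rabs (Re (f y) - Re (f t) - (y - t) * Re l) <= eps * Rabs (y - t)).
  specialize (Hd' (y - t) Hy).
  assert (E : t + (y - t) = y) by (change (t + ((y:R) - t) = y); ring). rewrite E in Hd'.
  eapply Rle_trans; [|exact Hd']. eapply Rle_trans; [|apply re_le_Cmod].
  right. f_equal. unfold Re, Im; simpl; ring.
Qed.

Lemma rder_Im (f : R -> C) t l : rder f t l -> is_derive (fun u => Im (f u)) t (Im l).
Proof.
  intros H. pose proof (proj1 (rderP _ _ _) H) as H'. split; [apply is_linear_scal_l|].
  intros x Hx eps. apply (@is_filter_lim_locally_unique R_AbsRing R_NormedModule t x) in Hx. subst x.
  destruct (H' eps (cond_pos eps)) as [d [Hd Hd']].
  exists (mkposreal d Hd). intros y Hy.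
  change (Rabs (Im (f y) - Im (f t) - (y - t) * Im l) <= eps * Rabs (y - t)).
  specialize (Hd' (y - t) Hy).
  assert (E : t + (y - t) = y) by (change (t + ((y:R) - t) = y); ring). rewrite E in Hd'.
  eapply Rle_trans; [|exact Hd']. eapply Rle_trans; [|apply im_le_Cmod].
  right. f_equal. unfold Re, Im; simpl; ring.
Qed.

Lemma rder_CInt_param (g dg : R -> R -> C) (a b x d : R) : 0 < d ->
  (forall t v, Rabs (t - x) < d -> rder (fun u => g u v) t (dg t v)) ->
  (forall v, rcont (U := prod_UniformSpace R_UniformSpace R_UniformSpace)
     (fun p => dg (fst p) (snd p)) (x, v)) ->
  (forall t v, Rabs (t - x) < d -> rcont (g t) v) ->
  rder (fun t => CInt (g t) a b) x (CInt (dg x) a b).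
Proof.
  intros Hd Hder Hc Hg.
  assert (L : locally x (fun t => Rabs (t - x) < d)).
  { exists (mkposreal d Hd). intros y Hy. exact Hy. }
  assert (Ex : forall t, Rabs (t - x) < d -> @ex_RInt C_R_NormedModule (g t) a b).
  { intros t Ht. apply ex_CInt. intros v _. now apply Hg. }
  assert (x0 : Rabs (x - x) < d) by (rewrite Rminus_diag, Rabs_R0; auto).
  assert (Cdg : forall v, rcont (dg x) v).
  { intros v. apply (continuous_comp (fun v => (x, v)) (fun p => dg (fst p) (snd p))); [|apply Hc].
    intros P [e He]. exists e. intros y Hy. apply He. split; [apply ball_center|exact Hy]. }
  assert (Exd : @ex_RInt C_R_NormedModule (dg x) a b) by (apply ex_CInt; auto).
  rewrite (CInt_RI (dg x)) by auto.
  (* [P] stands for [Re] or [Im]; the real Leibniz rule is applied to each of them. *)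
  assert (C2 : forall (P : C -> R), (forall (U : UniformSpace) (f : U -> C) t, rcont f t -> continuous (fun u => P (f u)) t) ->
     (forall (f : R -> C) t l, rder f t l -> is_derive (fun u => P (f u)) t (P l)) ->
     ex_RInt (fun v => P (dg x v)) a b ->
     (forall t, Rabs (t - x) < d -> ex_RInt (fun v => P (g t v)) a b) ->
     is_derive (fun t => RInt (fun v => P (g t v)) a b) x (RInt (fun v => P (dg x v)) a b)).
  { intros P HP1 HP2 HP3 HP4.
    replace (RInt (fun v => P (dg x v)) a b)
      with (RInt (fun t : R => Derive (fun u : R => P (g u t)) x) a b).
    2:{ apply RInt_ext. intros v _. apply is_derive_unique, HP2. now apply Hder. }
    apply (is_derive_RInt_param (fun u v => P (g u v))).
    - refine (filter_imp _ _ _ L). intros t Ht v _. eexists. apply HP2. now apply Hder.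
    - intros v _.
      apply (continuity_2d_pt_ext_loc (fun u v => P (dg u v))).
      + exists (mkposreal d Hd). intros u w Hu _. symmetry. apply is_derive_unique, HP2. now apply Hder.
      + apply continuity_2d_pt_filterlim.
        apply (HP1 (prod_UniformSpace R_UniformSpace R_UniformSpace) (fun p => dg (fst p) (snd p))). apply Hc.
    - refine (filter_imp _ _ _ L). exact HP4. }
  assert (Ev : forall t, Rabs (t - x) < d -> CInt (g t) a b = (RInt (fun v => Re (g t v)) a b, RInt (fun v => Im (g t v)) a b)).
  { intros t Ht. apply CInt_RI; auto. }
  assert (R1 : rder (fun t => (RInt (fun v => Re (g t v)) a b, RInt (fun v => Im (g t v)) a b)) x
     (RInt (fun t => Re (dg x t)) a b, RInt (fun t => Im (dg x t)) a b)).
  { apply rder_RI; simpl.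
    - apply (C2 Re); [apply @rcont_Re|apply rder_Re| |]; intros; now apply ex_CInt_Re; auto.
    - apply (C2 Im); [apply @rcont_Im|apply rder_Im| |]; intros; now apply ex_CInt_Im; auto. }
  eapply is_derive_ext_loc; [|exact R1].
  refine (filter_imp _ _ _ L). intros t Ht. symmetry. now apply Ev.
Qed.

Definition cis (t : R) : C := Cexp (Ci * RtoC t).

Lemma Cmod_cis t : Cmod (cis t) = 1.
Proof.
  unfold cis. rewrite Cmod_Cexp. simpl. replace (0 * t - 1 * 0) with 0 by ring. apply exp_0.
Qed.

Lemma rder_cis t : rder cis t (Ci * cis t)%C.
Proof.
  unfold cis. apply (rder_comp Cexp (fun u => Ci * RtoC u)%C); [apply cder_Cexp|].
  eapply rder_ext; [|apply (rder_lin 0 Ci t)]. intros; simpl; ring.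
Qed.

Lemma rcont_cis t : rcont cis t.
Proof. eapply rder_cont, rder_cis. Qed.

Lemma cis_2PI : cis (2 * PI) = 1%C.
Proof.
  unfold cis, Cexp. simpl.
  replace (0 * (2 * PI) - 1 * 0) with 0 by ring.
  replace (0 * 0 + 1 * (2 * PI)) with (2 * PI) by ring.
  rewrite exp_0, cos_2PI, sin_2PI. unfold RtoC. f_equal; ring.
Qed.

Lemma cis_0 : cis 0 = 1%C.
Proof. unfold cis. rewrite Cmult_0_r. apply Cexp_0. Qed.

(** * Cauchy's formula on a circle for functions with continuous derivative *)

Section Circle.
Variable r : R.
Hypothesis Hr : 0 < r.

Definition circ (t : R) : C := (RtoC r * cis t)%C.

Lemma Cmod_circ t : Cmod (circ t) = r.
Proof. unfold circ. rewrite Cmod_mult, Cmod_cis, Cmod_R, Rabs_pos_eq; lra. Qed.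

Lemma rcont_circ t : rcont circ t.
Proof. apply rcont_mult; [apply rcont_const|apply rcont_cis]. Qed.

Lemma circ_gap (w : C) t : r - Cmod w <= Cmod (circ t - w).
Proof. rewrite <- (Cmod_circ t). apply Cmod_sub_ge. Qed.

Lemma circ_neq (w : C) t : Cmod w < r -> (circ t - w)%C <> 0%C.
Proof. intros Hw E. generalize (circ_gap w t). rewrite E, Cmod_0. lra. Qed.

Lemma circ_neq0 t : circ t <> 0%C.
Proof. intros E. generalize (Cmod_circ t). rewrite E, Cmod_0. lra. Qed.

Lemma rcont_circ_inv (w : C) t : Cmod w < r -> rcont (fun t => / (circ t - w))%C t.
Proof.
  intros Hw. apply (rcont_comp Cinv (fun t => circ t - w)%C).
  - eapply cder_cont. apply cder_inv_id. now apply circ_neq.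
  - apply rcont_minus; [apply rcont_circ|apply rcont_const].
Qed.

(** The circle is contracted onto [w] along [w + u (circ t - w)]. In the derivative with respect to
    [u] the kernel cancels and [f (z u t) * circ t] remains, which is a derivative in [t] of a
    periodic function, so the integral does not depend on [u]. Its values at [u = 1] and [u = 0] are
    the two sides. Continuity of [f] allows differentiation under the integral. *)
Theorem cauchy_formula_C1 (F f : C -> C) R0 (w : C) : r < R0 -> Cmod w < r ->
  (forall z, Cmod z < R0 -> cder F z (f z)) ->
  (forall z, Cmod z < R0 -> ccont f z) ->
  CInt (fun t => F (circ t) * (circ t * / (circ t - w)))%C 0 (2 * PI) =
  (F w * CInt (fun t => circ t * / (circ t - w)) 0 (2 * PI))%C.
Proof.
  intros HR Hw HF Hf.
  assert (CF : forall z, Cmod z < R0 -> ccont F z) by (intros z Hz; eapply cder_cont; eauto).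
  set (k := fun t => (circ t * / (circ t - w))%C).
  assert (Ck : forall t, rcont k t).
  { intros t. apply rcont_mult; [apply rcont_circ|now apply rcont_circ_inv]. }
  set (z := fun u t => (w + RtoC u * (circ t - w))%C).
  (* The parameter [u] may leave [0, 1] by less than [d]: the contracted circle then stays within
     radius [r * (1 + 2 * d) = R0]. *)
  set (d := (R0 - r) / (2 * r)).
  assert (Hd : 0 < d) by (apply Rdiv_lt_0_compat; lra).
  assert (Hdr : 2 * d * r = R0 - r) by (unfold d; field; lra).
  assert (Zb : forall x u t, 0 <= x <= 1 -> Rabs (u - x) < d -> Cmod (z u t) < R0).
  { intros x u t Hx Hu. unfold z.
    replace (w + RtoC u * (circ t - w))%C with (RtoC (1 - u) * w + RtoC u * circ t)%C
      by (rewrite RtoC_minus; ring).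
    eapply Rle_lt_trans; [apply Cmod_triangle|]. rewrite !Cmod_mult, !Cmod_R, Cmod_circ.
    assert (Rabs (1 - u) <= 1 - x + Rabs (u - x)).
    { replace (1 - u) with ((1 - x) + - (u - x)) by ring.
      eapply Rle_trans; [apply Rabs_triang|]. rewrite Rabs_Ropp, (Rabs_pos_eq (1 - x)); lra. }
    assert (Rabs u <= x + Rabs (u - x)).
    { replace u with (x + (u - x)) at 1 by ring.
      eapply Rle_trans; [apply Rabs_triang|]. rewrite (Rabs_pos_eq x); lra. }
    generalize (Rabs_pos (1 - u)) (Rabs_pos u) (Cmod_ge_0 w). nra. }
  assert (Cz : forall u t, rcont (z u) t).
  { intros u t. unfold z. apply rcont_plus; [apply rcont_const|].
    apply rcont_mult; [apply rcont_const|].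
    apply rcont_minus; [apply rcont_circ|apply rcont_const]. }
  assert (Der : forall x, 0 <= x <= 1 ->
     rder (fun u => CInt (fun t => F (z u t) * k t)%C 0 (2 * PI)) x
       (CInt (fun t => f (z x t) * circ t)%C 0 (2 * PI))).
  { intros x Hx.
    apply (rder_CInt_param (fun u t => F (z u t) * k t)%C (fun u t => f (z u t) * circ t)%C 0 (2 * PI) x d Hd).
    - intros u t Hu. 
      eapply rder_eq; [apply (rder_comp (fun y => F y * k t)%C (fun u => z u t))|].
      + apply cder_mult; [apply HF; eapply Zb; eauto|apply cder_const].
      + apply rder_lin.
      + simpl. unfold k. field. now apply circ_neq.
    - intros v. apply rcont_mult.
      + apply (rcont_comp f (fun p : R * R => z (fst p) (snd p))).
        * apply Hf. apply (Zb x); [auto|]. simpl. rewrite Rminus_diag, Rabs_R0; auto.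
        * unfold z. apply rcont_plus; [apply rcont_const|].
          apply rcont_mult.
          -- apply rcont_RtoC. apply continuous_fst.
          -- apply rcont_minus; [|apply rcont_const].
             apply (continuous_comp snd circ); [apply continuous_snd|apply rcont_circ].
      + apply (continuous_comp snd circ); [apply continuous_snd|apply rcont_circ].
    - intros u t Hu. apply rcont_mult; [|apply Ck].
      apply (rcont_comp F (z u)); [|apply Cz]. apply CF. eapply Zb; eauto. }
  assert (Zero : forall x, 0 <= x <= 1 -> CInt (fun t => f (z x t) * circ t)%C 0 (2 * PI) = 0%C).
  { intros x Hx.
    assert (x0 : Rabs (x - x) < d) by (rewrite Rminus_diag, Rabs_R0; auto).
    assert (Cfz : forall t, rcont (fun t => f (z x t) * circ t)%C t).
    { intros t. apply rcont_mult; [|apply rcont_circ].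
      apply (rcont_comp f (z x)); [|apply Cz]. apply Hf. eapply Zb; eauto. }
    assert (Cc : cis (2 * PI) = cis 0) by (rewrite cis_2PI, cis_0; reflexivity).
    (* The primitive in [t] is [F (z x t) / (x * Ci)], so [x = 0] needs one of its own; there the
       integrand is a constant times [circ]. *)
    destruct (Req_dec x 0) as [->|Hx0].
    - assert (E : CInt (fun t => f (z 0 t) * circ t)%C 0 (2 * PI) = CInt (fun t => f w * circ t)%C 0 (2 * PI)).
      { apply CInt_ext. intros t _. do 2 f_equal. unfold z. ring. }
      rewrite E.
      rewrite (CInt_FTC (fun t => f w * (/ Ci * circ t))%C).
      + unfold circ. rewrite Cc. ring.
      + intros t _. apply (rder_eq _ _ (Ci * cis t * (f w * / Ci * RtoC r))%C).
        * eapply rder_ext; [|apply (rder_comp (fun y => y * (f w * / Ci) * RtoC r)%C cis t (f w * / Ci * RtoC r)%C (Ci * cis t)%C)].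
          -- intros u. simpl. unfold circ. ring.
          -- eapply cder_eq; [apply cder_mult; [apply cder_mult; [apply cder_id|apply cder_const]|apply cder_const]|simpl; ring].
          -- apply rder_cis.
        * unfold circ. field. apply Ci_nz.
      + intros t _. apply rcont_mult; [apply rcont_const|apply rcont_circ].
    - assert (HI : (RtoC x * Ci)%C <> 0%C).
      { apply Cmult_neq_0; [|apply Ci_nz]. intros E. apply RtoC_inj in E. auto. }
      assert (E : (RtoC x * Ci * CInt (fun t => f (z x t) * circ t) 0 (2 * PI))%C = 0%C).
      { rewrite <- CInt_scal by (apply ex_CInt; auto).
        rewrite (CInt_FTC (fun t => F (z x t))).
        - unfold z, circ. rewrite Cc. ring.
        - intros t _. eapply rder_eq; [apply (rder_comp F (z x) t (f (z x t)) (RtoC x * RtoC r * (Ci * cis t))%C)|].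
          + apply HF. eapply Zb; eauto.
          + eapply rder_eq; [eapply rder_ext; [|apply (rder_comp (fun y => w + RtoC x * (RtoC r * y - w))%C cis t (RtoC x * RtoC r)%C)]|].
            * intros u. reflexivity.
            * eapply cder_eq; [apply cder_plus; [apply cder_const|apply cder_scal, cder_minus; [apply cder_scal, cder_id|apply cder_const]]|simpl; ring].
            * apply rder_cis.
            * ring.
          + unfold circ. ring.
        - intros t _. apply rcont_mult; [apply rcont_const|apply Cfz]. }
      apply NNPP. intros N. revert E. apply Cmult_neq_0; auto. }
  set (Phi := fun u => CInt (fun t => F (z u t) * k t)%C 0 (2 * PI)) in *.
  assert (E01 : Phi 1 = Phi 0).
  { assert (E : (Phi 1 - Phi 0)%C = 0%C).
    { rewrite <- (CInt_FTC Phi (fun _ => 0%C) 0 1).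
      - rewrite CInt_const. ring.
      - rewrite Rmin_left, Rmax_right by lra. intros t Ht. rewrite <- (Zero t Ht). now apply Der.
      - intros t _. apply rcont_const. }
    replace (Phi 1) with (Phi 1 - Phi 0 + Phi 0)%C by ring. rewrite E. ring. }
  transitivity (Phi 1).
  { unfold Phi. apply CInt_ext. intros t _. unfold z, k. do 2 f_equal. ring. }
  rewrite E01. unfold Phi.
  rewrite <- CInt_scal by (apply ex_CInt; auto).
  apply CInt_ext. intros t _. f_equal. f_equal. unfold z. ring.
Qed.

End Circle.

Fixpoint csum (f : nat -> C) (n : nat) : C :=
  match n with O => 0%C | S m => (csum f m + f m)%C end.

Lemma csum_ext f g n : (forall k, (k < n)%nat -> f k = g k) -> csum f n = csum g n.
Proof.
  induction n as [|n IH]; intros H; simpl; auto.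
  rewrite IH, H by (intros; auto with arith). reflexivity.
Qed.

Lemma csum_scal (c : C) f n : csum (fun k => c * f k)%C n = (c * csum f n)%C.
Proof. induction n as [|n IH]; simpl; [ring|rewrite IH; ring]. Qed.

Lemma le_geom_0 (x K q : R) : 0 <= q < 1 -> (forall n, x <= K * q ^ S n) -> x <= 0.
Proof.
  intros Hq H. apply Rnot_lt_le. intros Hx.
  assert (HK : 0 < K).
  { specialize (H 0%nat). simpl in H. rewrite Rmult_1_r in H. nra. }
  destruct (pow_lt_1_zero q ltac:(rewrite Rabs_pos_eq; lra) (x / K) ltac:(now apply Rdiv_lt_0_compat)) as [N HN].
  specialize (HN (S N) ltac:(lia)). rewrite Rabs_pos_eq in HN by (apply pow_le; lra).
  specialize (H N). apply (Rmult_lt_compat_l K) in HN; auto.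
  replace (K * (x / K)) with x in HN by (field; lra). lra.
Qed.

Lemma RtoC_2PI_neq : RtoC (2 * PI) <> 0%C.
Proof. intros E. apply RtoC_inj in E. generalize PI_RGT_0. lra. Qed.

Section Circle2.
Variable r : R.
Hypothesis Hr : 0 < r.
Notation gam := (circ r).

Lemma rcont_circ_ninv n t : rcont (fun t => / gam t ^ n)%C t.
Proof.
  apply (rcont_comp (fun z => / z ^ n)%C gam); [|apply rcont_circ; auto].
  eapply cder_cont. apply (cder_inv (fun z => z ^ n)%C).
  - apply Cpow_nz. now apply circ_neq0.
  - apply cder_pow, cder_id.
Qed.

Lemma rcont_kernel (w : C) t : Cmod w < r -> rcont (fun t => gam t * / (gam t - w))%C t.
Proof. intros Hw. apply rcont_mult; [apply rcont_circ; auto|now apply rcont_circ_inv]. Qed.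

(** This is the finite geometric series of the kernel with its exact remainder. [H] is an arbitrary
    continuous function on the circle, since the case [H = 1] is needed as well as boundary values
    of holomorphic functions. *)
Lemma cauchy_kernel_expansion (H : R -> C) (w : C) n : Cmod w < r -> (forall t, rcont H t) ->
  CInt (fun t => H t * (gam t * / (gam t - w)))%C 0 (2 * PI) =
  (csum (fun k => w ^ k * CInt (fun t => H t * / gam t ^ k) 0 (2 * PI))%C n +
   w ^ n * CInt (fun t => H t * / gam t ^ n * (gam t * / (gam t - w)))%C 0 (2 * PI))%C.
Proof.
  intros Hw HH. induction n as [|n IH].
  - simpl. rewrite Cplus_0_l, Cmult_1_l. apply CInt_ext. intros t _. 
    replace (/ 1)%C with (RtoC 1) by field. ring.
  - rewrite IH. cbn [csum].
    rewrite <- Cplus_assoc. f_equal.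
    assert (C1 : forall k t, rcont (fun t => H t * / gam t ^ k)%C t).
    { intros k t. apply rcont_mult; [apply HH|apply rcont_circ_ninv]. }
    assert (C2 : forall k t, rcont (fun t => H t * / gam t ^ k * (gam t * / (gam t - w)))%C t).
    { intros k t. apply rcont_mult; [apply C1|now apply rcont_kernel]. }
    replace (w ^ S n)%C with (w ^ n * w)%C by (simpl; ring).
    rewrite <- Cmult_assoc, <- Cmult_plus_distr_l. f_equal.
    rewrite <- CInt_scal by (apply ex_CInt; auto).
    rewrite <- CInt_plus.
    + apply CInt_ext. intros t _. simpl. field. repeat split.
      * now apply circ_neq.
      * apply Cpow_nz. now apply circ_neq0.
      * now apply circ_neq0.
    + apply ex_CInt; auto.
    + apply ex_CInt. intros t _. apply rcont_mult; [apply rcont_const|apply C2].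
Qed.

Lemma cauchy_kernel_remainder (H : R -> C) (w : C) M n : Cmod w < r -> (forall t, rcont H t) ->
  (forall t, 0 <= t <= 2 * PI -> Cmod (H t) <= M) ->
  Cmod (CInt (fun t => H t * (gam t * / (gam t - w)))%C 0 (2 * PI) -
   csum (fun k => w ^ k * CInt (fun t => H t * / gam t ^ k) 0 (2 * PI))%C n)
  <= 2 * PI * (M * (r / (r - Cmod w))) * (Cmod w / r) ^ n.
Proof.
  intros Hw HH HM. pose proof PI_RGT_0.
  rewrite (cauchy_kernel_expansion H w n) by auto.
  match goal with |- Cmod (?a + ?b - ?a) <= _ => replace (a + b - a)%C with b by ring end.
  rewrite Cmod_mult, Cmod_pow.
  assert (P : 0 < r ^ n) by (apply pow_lt; auto).
  apply Rle_trans with (Cmod w ^ n * ((2 * PI - 0) * (M * / r ^ n * (r / (r - Cmod w))))).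
  - apply Rmult_le_compat_l; [apply pow_le, Cmod_ge_0|].
    apply CInt_bound; [lra| |].
    + apply ex_CInt. intros t _. apply rcont_mult; [|now apply rcont_kernel].
      apply rcont_mult; [apply HH|apply rcont_circ_ninv].
    + intros t Ht. rewrite !Cmod_mult.
      rewrite !Cmod_inv by (try (apply Cpow_nz); first [now apply circ_neq0|now apply circ_neq]).
      rewrite Cmod_pow, Cmod_circ by auto.
      pose proof (circ_gap r Hr w t).
      apply Rmult_le_compat.
      * apply Rmult_le_pos; [apply Cmod_ge_0|left; now apply Rinv_0_lt_compat].
      * apply Rmult_le_pos; [lra|left; apply Rinv_0_lt_compat; lra].
      * apply Rmult_le_compat_r; [left; now apply Rinv_0_lt_compat|auto].
      * apply Rmult_le_compat_l; [lra|]. apply Rinv_le_contravar; lra.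
  - right. unfold Rdiv. rewrite Rpow_mult_distr, pow_inv. field. split; lra.
Qed.

(** In the expansion for [H = 1] only the term [k = 0] survives, because [gam t ^ (- k)] has a
    periodic primitive for [k > 0], and the remainder tends to 0 geometrically. *)
Lemma CInt_kernel (w : C) : Cmod w < r ->
  CInt (fun t => gam t * / (gam t - w))%C 0 (2 * PI) = RtoC (2 * PI).
Proof.
  intros Hw.
  assert (E : forall n, csum (fun k => w ^ k * CInt (fun t => 1 * / gam t ^ k)%C 0 (2 * PI))%C (S n) = RtoC (2 * PI)).
  { induction n as [|n IH].
    - simpl. replace (CInt (fun t => 1 * / 1)%C 0 (2 * PI)) with (RtoC (2 * PI)).
      + ring.
      + rewrite CInt_const. rewrite Rminus_0_r. field.
    - cbn [csum] in *. rewrite IH.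
      replace (CInt (fun t => 1 * / gam t ^ S n)%C 0 (2 * PI)) with (RtoC 0); [ring|].
      set (c := (- (Ci * RtoC (INR (S n))))%C).
      assert (Hn : RtoC (INR (S n)) <> 0%C).
      { intros F. apply RtoC_inj in F. revert F. now apply not_0_INR. }
      assert (Hc : c <> 0%C).
      { intros F. apply (Cmult_neq_0 Ci (RtoC (INR (S n)))); auto using Ci_nz.
        rewrite <- (Copp_0). rewrite <- F. unfold c. ring. }
      assert (X : (c * CInt (fun t => 1 * / gam t ^ S n) 0 (2 * PI))%C = 0%C).
      { assert (CC : forall t, rcont (fun t => 1 * / gam t ^ S n)%C t).
        { intros t. apply rcont_mult; [apply rcont_const|apply rcont_circ_ninv]. }
        rewrite <- CInt_scal by (apply ex_CInt; auto).
        rewrite (CInt_FTC (fun t => / gam t ^ S n)%C).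
        - unfold circ. rewrite cis_2PI, cis_0. ring.
        - intros t _. pose proof (circ_neq0 r Hr t) as G.
          eapply rder_eq; [apply (rder_comp (fun z => / (RtoC r * z) ^ S n)%C cis)|].
          + apply (cder_inv (fun z => (RtoC r * z) ^ S n)%C).
            * apply Cpow_nz. exact G.
            * apply cder_pow. apply cder_scal, cder_id.
          + apply rder_cis.
          + cbn [pred]. fold (gam t). unfold c. simpl Cpow.
            assert (G' : cis t <> 0%C) by apply Cexp_neq_0.
            assert (Rr : RtoC r <> 0%C) by (intros F; apply RtoC_inj in F; lra).
            unfold circ. field. repeat split; auto.
            apply Cpow_nz. apply G.
        - intros t _. apply rcont_mult; [apply rcont_const|apply CC]. }
      apply NNPP. intros N. revert X. apply Cmult_neq_0; auto. }
  assert (Cmod (CInt (fun t => gam t * / (gam t - w))%C 0 (2 * PI) - RtoC (2 * PI)) <= 0).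
  { apply (le_geom_0 _ (2 * PI * (1 * (r / (r - Cmod w)))) (Cmod w / r)).
    - split.
      + apply Rmult_le_pos; [apply Cmod_ge_0|left; now apply Rinv_0_lt_compat].
      + apply Rmult_lt_reg_r with r; auto. unfold Rdiv. rewrite Rmult_assoc, Rinv_l; lra.
    - intros n. 
      replace (CInt (fun t => gam t * / (gam t - w))%C 0 (2 * PI)) with
        (CInt (fun t => 1 * (gam t * / (gam t - w)))%C 0 (2 * PI)) by (apply CInt_ext; intros; ring).
      rewrite <- (E n).
      apply (cauchy_kernel_remainder (fun _ => 1%C)); auto.
      + intros; apply rcont_const.
      + intros. rewrite Cmod_1. lra. }
  assert (X : (CInt (fun t => gam t * / (gam t - w))%C 0 (2 * PI) - RtoC (2 * PI))%C = 0%C).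
  { apply Cmod_eq_0. apply Rle_antisym; auto. apply Cmod_ge_0. }
  rewrite <- (Cplus_0_r (RtoC (2 * PI))), <- X. ring.
Qed.

(** A second-order Taylor bound on the kernel, uniform in [t], integrates directly to the
    derivative, so joint continuity need not be discussed in the complex variable. *)
Lemma cder_CInt_kernel (H : R -> C) (k0 k1 : C -> R -> C) (w : C) d K : 0 < d ->
  (forall t, rcont H t) ->
  (forall h t, Cmod h < d -> rcont (k0 (w + h)%C) t) -> (forall t, rcont (k1 w) t) ->
  (forall h t, Cmod h < d -> Cmod (k0 (w + h)%C t - k0 w t - h * k1 w t) <= K * Cmod h ^ 2) ->
  cder (fun w => CInt (fun t => H t * k0 w t)%C 0 (2 * PI)) w (CInt (fun t => H t * k1 w t)%C 0 (2 * PI)).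
Proof.
  intros Hd HH C0 C1 E. pose proof PI_RGT_0 as HPI.
  destruct (rcont_bounded H 0 (2 * PI) ltac:(lra) HH) as [M [M0 HM]].
  assert (C0' : forall t, rcont (k0 w) t).
  { intros t. replace w with (w + 0)%C by ring. apply C0. rewrite Cmod_0. auto. }
  assert (HK : 0 <= K).
  { specialize (E (RtoC (d / 2)) 0). rewrite Cmod_R, Rabs_pos_eq in E by lra. specialize (E ltac:(lra)).
    assert (0 < (d / 2) ^ 2) by (apply pow_lt; lra).
    match type of E with Cmod ?x <= _ => pose proof (Cmod_ge_0 x) end. nra. }
  set (L := 2 * PI * (M * K) + 1). assert (HL : 0 < L) by (unfold L; assert (0 <= M * K) by nra; nra).
  apply cderP. intros eps He.
  exists (Rmin d (eps / L)). split; [apply Rmin_glb_lt; auto; now apply Rdiv_lt_0_compat|].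
  intros h Hh.
  assert (H1 : Cmod h < d) by (eapply Rlt_le_trans; [exact Hh|apply Rmin_l]).
  assert (H2 : Cmod h < eps / L) by (eapply Rlt_le_trans; [exact Hh|apply Rmin_r]).
  assert (X0 : forall t, rcont (fun t => H t * k0 (w + h)%C t)%C t) by (intros; apply rcont_mult; auto).
  assert (X1 : forall t, rcont (fun t => H t * k0 w t)%C t) by (intros; apply rcont_mult; auto).
  assert (X2 : forall t, rcont (fun t => h * (H t * k1 w t))%C t).
  { intros; apply rcont_mult; [apply rcont_const|apply rcont_mult; auto]. }
  rewrite <- CInt_scal by (apply ex_CInt; intros; apply rcont_mult; auto).
  rewrite <- (CInt_minus (fun t => H t * k0 (w + h)%C t)%C (fun t => H t * k0 w t)%C) by (apply ex_CInt; auto).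
  rewrite <- (CInt_minus (fun t => H t * k0 (w + h)%C t - H t * k0 w t)%C (fun t => h * (H t * k1 w t))%C);
    [|apply ex_CInt; intros; apply rcont_minus; auto|apply ex_CInt; intros; apply X2].
  eapply Rle_trans; [apply (CInt_bound _ _ _ (M * (K * Cmod h ^ 2)))|].
  - lra.
  - apply ex_CInt; intros. apply rcont_minus; [apply rcont_minus|]; auto.
  - intros t Ht. replace (H t * k0 (w + h)%C t - H t * k0 w t - h * (H t * k1 w t))%C
      with (H t * (k0 (w + h)%C t - k0 w t - h * k1 w t))%C by ring.
    rewrite Cmod_mult. apply Rmult_le_compat; auto; apply Cmod_ge_0.
  - apply Rle_trans with (L * Cmod h * Cmod h).
    + unfold L. generalize (Cmod_ge_0 h). intros. simpl. assert (0 <= M * K) by nra. nra.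
    + apply Rmult_le_compat_r; [apply Cmod_ge_0|].
      apply (Rmult_lt_compat_l L) in H2; auto.
      replace (L * (eps / L)) with eps in H2 by (field; lra). lra.
Qed.

Lemma rcont_inv_gap n (w : C) t : Cmod w < r -> rcont (fun t => / (gam t - w) ^ n)%C t.
Proof.
  intros Hw. apply (rcont_comp (fun z => / z ^ n)%C (fun t => gam t - w)%C).
  - eapply cder_cont. apply (cder_inv (fun z => z ^ n)%C).
    + apply Cpow_nz. now apply circ_neq.
    + apply cder_pow, cder_id.
  - apply rcont_minus; [apply rcont_circ; auto|apply rcont_const].
Qed.

Lemma inv_pow_taylor (d : R) n : 0 < d -> exists K, 0 <= K /\
  forall u h : C, d <= Cmod u -> Cmod h <= d / 2 ->
  Cmod (/ (u - h) ^ n - / u ^ n - h * (RtoC (INR n) * / u ^ S n)) <= K * Cmod h ^ 2.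
Proof.
  intros Hd. induction n as [|n [K [HK IH]]].
  - exists 0. split; [lra|]. intros u h Hu Hh. simpl.
    replace (/ 1 - / 1 - h * (0 * / (u * 1)))%C with (RtoC 0) by ring. rewrite Cmod_0. lra.
  - set (i := / d). assert (Hi : 0 < i) by now apply Rinv_0_lt_compat.
    assert (I0 : 0 <= i ^ n) by (apply pow_le; lra).
    assert (N0 : 0 <= INR n) by apply pos_INR.
    exists (K * (2 * i) + (i ^ n + INR n * i ^ n) * (2 * i ^ 3) + INR n * i ^ S (S (S n))).
    assert (I3 : 0 <= i ^ 3) by (apply pow_le; lra).
    assert (In3 : 0 <= i ^ S (S (S n))) by (apply pow_le; lra).
    split. { assert (0 <= INR n * i ^ n) by nra. assert (0 <= INR n * i ^ S (S (S n))) by nra. nra. }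
    intros u h Hu Hh.
    assert (Huh : d / 2 <= Cmod (u - h)) by (generalize (Cmod_sub_ge u h); lra).
    assert (Nu : u <> 0%C) by (intros E; rewrite E, Cmod_0 in Hu; lra).
    assert (Nuh : (u - h)%C <> 0%C) by (intros E; rewrite E, Cmod_0 in Huh; lra).
    set (e := (/ (u - h) ^ n - / u ^ n - h * (RtoC (INR n) * / u ^ S n))%C) in *.
    assert (Pn : (u ^ n)%C <> 0%C) by now apply Cpow_nz.
    assert (Pn' : ((u - h) ^ n)%C <> 0%C) by now apply Cpow_nz.
    replace (/ (u - h) ^ S n - / u ^ S n - h * (RtoC (INR (S n)) * / u ^ S (S n)))%C
      with (e * / (u - h) + (/ u ^ n * (1 + RtoC (INR n) * (h * / u))) * (h * h * (/ u ^ 2 * / (u - h)))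
        + h * h * (RtoC (INR n) * / u ^ S (S (S n))))%C.
    2:{ unfold e. rewrite S_INR, RtoC_plus. simpl. field. auto. }
    assert (A1 : Cmod (/ (u - h)) <= 2 * i).
    { rewrite Cmod_inv by auto. replace (2 * i) with (/ (d / 2)) by (unfold i; field; lra).
      apply Rinv_le_contravar; lra. }
    assert (A2 : forall m, Cmod (/ u ^ m) <= i ^ m).
    { intros m. rewrite Cmod_inv by now apply Cpow_nz. unfold i. rewrite pow_inv, Cmod_pow.
      apply Rinv_le_contravar; [now apply pow_lt|]. apply pow_incr; lra. }
    assert (A3 : Cmod (1 + RtoC (INR n) * (h * / u)) <= 1 + INR n).
    { eapply Rle_trans; [apply Cmod_triangle|]. rewrite Cmod_1, !Cmod_mult, Cmod_R, Rabs_pos_eq, Cmod_inv by auto.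
      apply Rplus_le_compat_l. rewrite <- (Rmult_1_r (INR n)) at 2. apply Rmult_le_compat_l; auto.
      apply Rmult_le_reg_r with (Cmod u); [lra|]. rewrite Rmult_assoc, Rinv_l; lra. }
    assert (H2 : 0 <= Cmod h ^ 2) by (apply pow_le, Cmod_ge_0).
    eapply Rle_trans; [apply Cmod_triangle|]. rewrite !Rmult_plus_distr_r.
    apply Rplus_le_compat; [eapply Rle_trans; [apply Cmod_triangle|]; apply Rplus_le_compat|].
    + rewrite Cmod_mult.
      apply Rle_trans with (K * Cmod h ^ 2 * (2 * i)); [|lra].
      apply Rmult_le_compat; [apply Cmod_ge_0|apply Cmod_ge_0|now apply IH|exact A1].
    + rewrite !Cmod_mult. 
      apply Rle_trans with (i ^ n * (1 + INR n) * (Cmod h * Cmod h * (i ^ 2 * (2 * i)))); [|right; ring].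
      apply Rmult_le_compat.
      * apply Rmult_le_pos; apply Cmod_ge_0.
      * repeat apply Rmult_le_pos; apply Cmod_ge_0.
      * apply Rmult_le_compat; auto; apply Cmod_ge_0.
      * apply Rmult_le_compat_l; [apply Rmult_le_pos; apply Cmod_ge_0|].
        apply Rmult_le_compat; auto; apply Cmod_ge_0.
    + rewrite !Cmod_mult, Cmod_R, Rabs_pos_eq by auto.
      apply Rle_trans with (Cmod h * Cmod h * (INR n * i ^ S (S (S n)))); [|right; ring].
      apply Rmult_le_compat_l; [apply Rmult_le_pos; apply Cmod_ge_0|].
      apply Rmult_le_compat_l; auto.
Qed.

Lemma cder_cauchy_kernel (H : R -> C) (w : C) n : Cmod w < r -> (forall t, rcont H t) ->
  cder (fun w => CInt (fun t => H t * / (gam t - w) ^ n)%C 0 (2 * PI)) w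
    (CInt (fun t => H t * (RtoC (INR n) * / (gam t - w) ^ S n))%C 0 (2 * PI)).
Proof.
  intros Hw HH. set (d := r - Cmod w). assert (Hd : 0 < d) by (unfold d; lra).
  destruct (inv_pow_taylor d n Hd) as [K [HK E]].
  apply (cder_CInt_kernel H (fun w t => / (gam t - w) ^ n)%C
    (fun w t => RtoC (INR n) * / (gam t - w) ^ S n)%C w (d / 2) K).
  - lra.
  - auto.
  - intros h t Hh. apply rcont_inv_gap; auto.
    eapply Rle_lt_trans; [apply Cmod_triangle|]. unfold d in *. lra.
  - intros t. apply rcont_mult; [apply rcont_const|now apply rcont_inv_gap].
  - intros h t Hh. replace (gam t - (w + h))%C with (gam t - w - h)%C by ring.
    apply E; [apply circ_gap; auto|lra].
Qed.

Theorem cauchy_formula_C1' (F f : C -> C) R0 (w : C) : r < R0 -> Cmod w < r ->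
  (forall z, Cmod z < R0 -> cder F z (f z)) ->
  (forall z, Cmod z < R0 -> ccont f z) ->
  F w = (/ RtoC (2 * PI) * CInt (fun t => (F (gam t) * gam t) * / (gam t - w)) 0 (2 * PI))%C.
Proof.
  intros HR Hw HF Hf.
  replace (CInt (fun t => (F (gam t) * gam t) * / (gam t - w))%C 0 (2 * PI)) with
    (CInt (fun t => F (gam t) * (gam t * / (gam t - w)))%C 0 (2 * PI)) by (apply CInt_ext; intros; ring).
  rewrite (cauchy_formula_C1 r Hr F f R0 w), CInt_kernel by auto.
  field. apply RtoC_2PI_neq.
Qed.

End Circle2.

(** Cauchy's formula represents [F] by kernels [1 / (gam t - z) ^ n], which can be differentiated
    again and again. Two orders are extracted because [F] will be a primitive of the function of
    interest: the first makes that function holomorphic, as Morera's theorem requires, and the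
    second makes its derivative holomorphic. *)
Lemma C1_analytic (F f : C -> C) R0 :
  (forall z, Cmod z < R0 -> cder F z (f z)) ->
  (forall z, Cmod z < R0 -> ccont f z) ->
  forall w, Cmod w < R0 -> (exists l, cder f w l) /\ exists l, cder (C_derive f) w l.
Proof.
  intros HF Hf w Hw.
  set (r := (Cmod w + R0) / 2).
  assert (H0 : 0 <= Cmod w) by apply Cmod_ge_0.
  assert (Hr : 0 < r) by (unfold r; lra).
  assert (Hwr : Cmod w < r) by (unfold r; lra).
  assert (HrR : r < R0) by (unfold r; lra).
  set (H := fun t => (/ RtoC (2 * PI) * (F (circ r t) * circ r t))%C).
  assert (CH : forall t, rcont H t).
  { intros t. apply rcont_mult; [apply rcont_const|apply rcont_mult; [|now apply rcont_circ]].
    apply (rcont_comp F (circ r)); [|now apply rcont_circ].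
    eapply cder_cont. apply HF. rewrite Cmod_circ; auto. }
  assert (CI : forall n z t, Cmod z < r -> rcont (fun t => H t * / (circ r t - z) ^ n)%C t).
  { intros. apply rcont_mult; auto. now apply rcont_inv_gap. }
  assert (EF : forall z, Cmod z < r -> F z = CInt (fun t => H t * / (circ r t - z) ^ 1)%C 0 (2 * PI)).
  { intros z Hz. rewrite (cauchy_formula_C1' r Hr F f R0 z) by auto.
    rewrite <- CInt_scal.
    - apply CInt_ext. intros t _. unfold H. rewrite Cpow_1_r. ring.
    - apply ex_CInt. intros t _. apply rcont_mult; [|now apply rcont_circ_inv].
      apply rcont_mult; [|now apply rcont_circ].
      apply (rcont_comp F (circ r)); [|now apply rcont_circ].
      eapply cder_cont. apply HF. rewrite Cmod_circ; auto. }
  assert (NB : forall z, Cmod z < r -> forall y, Cmod (y - z) < r - Cmod z -> Cmod y < r).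
  { intros z Hz y Hy. replace y with (z + (y - z))%C by ring. eapply Rle_lt_trans; [apply Cmod_triangle|]. lra. }
  assert (Ef : forall z, Cmod z < r -> f z = CInt (fun t => H t * / (circ r t - z) ^ 2)%C 0 (2 * PI)).
  { intros z Hz. apply (cder_unique F z); [apply HF; lra|].
    apply (cder_ext_loc (fun w => CInt (fun t => H t * / (circ r t - w) ^ 1)%C 0 (2 * PI)) F z _ (r - Cmod z)); [lra| |].
    - intros y Hy. symmetry. apply EF. now apply (NB z).
    - eapply cder_eq; [now apply cder_cauchy_kernel|].
      apply CInt_ext. intros t _. simpl. ring. }
  assert (D2 : forall z, Cmod z < r -> cder f z (CInt (fun t => H t * (RtoC (INR 2) * / (circ r t - z) ^ 3)) 0 (2 * PI))%C).
  { intros z Hz.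
    apply (cder_ext_loc (fun w => CInt (fun t => H t * / (circ r t - w) ^ 2)%C 0 (2 * PI)) f z _ (r - Cmod z)); [lra| |].
    - intros y Hy. symmetry. apply Ef. now apply (NB z).
    - now apply cder_cauchy_kernel. }
  set (G := fun t => (RtoC (INR 2) * H t)%C).
  assert (CG : forall t, rcont G t) by (intros t; apply rcont_mult; [apply rcont_const|auto]).
  assert (E2 : forall z, Cmod z < r -> C_derive f z = CInt (fun t => G t * / (circ r t - z) ^ 3)%C 0 (2 * PI)).
  { intros z Hz. rewrite (is_C_derive_unique _ _ _ (D2 z Hz)). apply CInt_ext. intros t _. unfold G. ring. }
  split; [eexists; now apply D2|].
  eexists.
  apply (cder_ext_loc (fun w => CInt (fun t => G t * / (circ r t - w) ^ 3)%C 0 (2 * PI)) (C_derive f) w _ (r - Cmod w)); [lra| |].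
  - intros y Hy. symmetry. apply E2. now apply (NB w).
  - now apply cder_cauchy_kernel.
Qed.

Lemma cder_shift (f : C -> C) (c0 z l : C) : cder f (c0 + z)%C l <-> cder (fun w => f (c0 + w)%C) z l.
Proof.
  split; intros H.
  - eapply cder_eq; [apply (cder_comp f (fun w => c0 + w)%C); [exact H|]|].
    + apply cder_plus; [apply cder_const|apply cder_id].
    + ring.
  - eapply cder_eq; [eapply cder_ext; [|apply (cder_comp (fun w => f (c0 + w)%C) (fun w => w - c0)%C)]|].
    + intros w. simpl. f_equal. ring.
    + replace (c0 + z - c0)%C with z by ring. exact H.
    + apply cder_minus; [apply cder_id|apply cder_const].
    + ring.
Qed.

(** * Holomorphic functions on a disc: Morera, Taylor, Cauchy's estimate, uniform limits, identity
    theorem *)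

Definition holo_disc (f : C -> C) (c0 : C) (r : R) : Prop :=
  forall z, Cmod (z - c0) < r -> exists l, cder f z l.

Theorem morera (f : C -> C) (c0 : C) r :
  (forall z, Cmod (z - c0) < r -> ccont f z) ->
  (forall a b c, Cmod (a - c0) < r -> Cmod (b - c0) < r -> Cmod (c - c0) < r -> tri f a b c = 0%C) ->
  holo_disc f c0 r.
Proof.
  intros Hf HT z Hz.
  pose proof (primitive_disc f c0 r Hf HT) as P.
  destruct (C1_analytic (fun w => seg f c0 (c0 + w)) (fun w => f (c0 + w)%C) r) with (w := (z - c0)%C) as [[l Hl] _]; auto.
  - intros w Hw. apply (proj1 (cder_shift (seg f c0) c0 w _)). apply P. now replace (c0 + w - c0)%C with w by ring.
  - intros w Hw. apply (rcont_comp (U := C_UniformSpace) f (fun w => c0 + w)%C).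
    + apply Hf. now replace (c0 + w - c0)%C with w by ring.
    + eapply (cder_cont (fun w => c0 + w)%C). apply cder_plus; [apply cder_const|apply cder_id].
  - exists l. apply cder_shift in Hl. now replace (c0 + (z - c0))%C with z in Hl by ring.
Qed.

Lemma holo_tri (f : C -> C) (c0 : C) r : holo_disc f c0 r ->
  forall a b c, Cmod (a - c0) < r -> Cmod (b - c0) < r -> Cmod (c - c0) < r -> tri f a b c = 0%C.
Proof.
  intros Hf a b c Ha Hb Hc.
  set (m := Rmax (Cmod (a - c0)) (Rmax (Cmod (b - c0)) (Cmod (c - c0)))).
  assert (Hm : m < r) by (repeat apply Rmax_lub_lt; auto).
  apply (goursat f c0 a b c m).
  - intros z Hz. apply Hf. lra.
  - apply Rmax_l.
  - eapply Rle_trans; [|apply Rmax_r]. apply Rmax_l.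
  - eapply Rle_trans; [|apply Rmax_r]. apply Rmax_r.
Qed.

Lemma holo_C_derive (f : C -> C) (c0 : C) r : holo_disc f c0 r ->
  forall z, Cmod (z - c0) < r -> cder f z (C_derive f z).
Proof. intros Hf z Hz. apply C_derive_correct; [exact 0%C|]. destruct (Hf z Hz) as [l Hl]. now exists l. Qed.

Lemma holo_cont (f : C -> C) (c0 : C) r : holo_disc f c0 r ->
  forall z, Cmod (z - c0) < r -> ccont f z.
Proof. intros Hf z Hz. destruct (Hf z Hz) as [l Hl]. eapply cder_cont; eauto. Qed.

Theorem holo_derive_holo (f : C -> C) (c0 : C) r : holo_disc f c0 r -> holo_disc (C_derive f) c0 r.
Proof.
  intros Hf z Hz.
  assert (P := primitive_disc f c0 r (holo_cont f c0 r Hf) (holo_tri f c0 r Hf)).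
  set (g := fun w => f (c0 + w)%C).
  assert (Sh : forall w, Cmod w < r -> Cmod (c0 + w - c0) < r).
  { intros w Hw. now replace (c0 + w - c0)%C with w by ring. }
  assert (Dg : forall w, Cmod w < r -> C_derive g w = C_derive f (c0 + w)%C).
  { intros w Hw. apply is_C_derive_unique. apply (proj1 (cder_shift f c0 w _)).
    apply (holo_C_derive f c0 r); auto. }
  destruct (C1_analytic (fun w => seg f c0 (c0 + w)) g r) with (w := (z - c0)%C) as [_ [l Hl]]; auto.
  - intros w Hw. apply (proj1 (cder_shift (seg f c0) c0 w _)). apply P. auto.
  - intros w Hw. apply (rcont_comp (U := C_UniformSpace) f (fun w => c0 + w)%C).
    + apply (holo_cont f c0 r); auto.
    + eapply (cder_cont (fun w => c0 + w)%C). apply cder_plus; [apply cder_const|apply cder_id].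
  - exists l. replace z with (c0 + (z - c0))%C by ring. apply cder_shift.
    apply (cder_ext_loc (C_derive g) _ _ _ (r - Cmod (z - c0))); [lra| |exact Hl].
    intros w Hw. apply Dg. replace w with ((z - c0) + (w - (z - c0)))%C by ring.
    eapply Rle_lt_trans; [apply Cmod_triangle|]. lra.
Qed.

Lemma cauchy_formula_disc (f : C -> C) (c0 : C) R0 r : 0 < r -> r < R0 -> holo_disc f c0 R0 ->
  forall w, Cmod w < r ->
  f (c0 + w)%C = (/ RtoC (2 * PI) * CInt (fun t => (f (c0 + circ r t) * circ r t) * / (circ r t - w)) 0 (2 * PI))%C.
Proof.
  intros Hr HR Hf w Hw.
  assert (Sh : forall w, Cmod w < R0 -> Cmod (c0 + w - c0) < R0).
  { intros v Hv. now replace (c0 + v - c0)%C with v by ring. }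
  apply (cauchy_formula_C1' r Hr (fun w => f (c0 + w)%C) (fun w => C_derive f (c0 + w)%C) R0); auto.
  - intros z Hz. apply (proj1 (cder_shift f c0 z _)). apply (holo_C_derive f c0 R0); auto.
  - intros z Hz. apply (rcont_comp (U := C_UniformSpace) (C_derive f) (fun w => c0 + w)%C).
    + apply (holo_cont (C_derive f) c0 R0); auto. now apply holo_derive_holo.
    + eapply (cder_cont (fun w => c0 + w)%C). apply cder_plus; [apply cder_const|apply cder_id].
Qed.

Lemma rcont_on_circ (f : C -> C) (c0 : C) R0 r : 0 < r -> r < R0 -> holo_disc f c0 R0 ->
  forall t, rcont (fun t => f (c0 + circ r t))%C t.
Proof.
  intros Hr HR Hf t. apply (rcont_comp f (fun t => c0 + circ r t)%C).
  - apply (holo_cont f c0 R0); auto. replace (c0 + circ r t - c0)%C with (circ r t) by ring.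
    rewrite Cmod_circ; auto.
  - apply rcont_plus; [apply rcont_const|now apply rcont_circ].
Qed.

Theorem taylor_disc (f : C -> C) (c0 : C) R0 r : 0 < r -> r < R0 -> holo_disc f c0 R0 ->
  exists (a : nat -> C) M, 0 <= M /\ forall w n, Cmod w < r ->
    Cmod (f (c0 + w)%C - csum (fun k => w ^ k * a k)%C n) <= M * (r / (r - Cmod w)) * (Cmod w / r) ^ n.
Proof.
  intros Hr HR Hf. pose proof PI_RGT_0 as HPI.
  set (H := fun t => (/ RtoC (2 * PI) * f (c0 + circ r t))%C).
  assert (HH : forall t, rcont H t).
  { intros t. apply rcont_mult; [apply rcont_const|now apply (rcont_on_circ f c0 R0 r)]. }
  destruct (rcont_bounded H 0 (2 * PI) ltac:(lra) HH) as [M [M0 HM]].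
  exists (fun k => CInt (fun t => H t * / circ r t ^ k)%C 0 (2 * PI)), (2 * PI * M).
  split; [nra|]. intros w n Hw.
  replace (f (c0 + w)%C) with (CInt (fun t => H t * (circ r t * / (circ r t - w)))%C 0 (2 * PI)).
  - eapply Rle_trans; [apply (cauchy_kernel_remainder r Hr H w M n); auto|]. right; ring.
  - rewrite (cauchy_formula_disc f c0 R0 r Hr HR Hf w Hw).
    rewrite <- CInt_scal.
    + apply CInt_ext. intros t _. unfold H. ring.
    + apply ex_CInt. intros t _. apply rcont_mult; [|now apply rcont_circ_inv].
      apply rcont_mult; [|now apply rcont_circ]. now apply (rcont_on_circ f c0 R0 r).
Qed.

Theorem cauchy_estimate (f : C -> C) (c0 : C) R0 r M : 0 < r -> r < R0 -> holo_disc f c0 R0 ->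
  (forall z, Cmod (z - c0) = r -> Cmod (f z) <= M) -> Cmod (C_derive f c0) <= M / r.
Proof.
  intros Hr HR Hf HM. pose proof PI_RGT_0 as HPI.
  set (H := fun t => (/ RtoC (2 * PI) * (f (c0 + circ r t) * circ r t))%C).
  assert (Z : Cmod 0 < r) by (rewrite Cmod_0; auto).
  assert (HH : forall t, rcont H t).
  { intros t. apply rcont_mult; [apply rcont_const|apply rcont_mult; [|now apply rcont_circ]].
    now apply (rcont_on_circ f c0 R0 r). }
  assert (E : C_derive f c0 = CInt (fun t => H t * (RtoC (INR 1) * / (circ r t - 0) ^ 2))%C 0 (2 * PI)).
  { apply is_C_derive_unique. change (cder f c0 (CInt (fun t => H t * (RtoC (INR 1) * / (circ r t - 0) ^ 2))%C 0 (2 * PI))).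
    rewrite <- (Cplus_0_r c0) at 1. apply cder_shift.
    apply (cder_ext_loc (fun w => CInt (fun t => H t * / (circ r t - w) ^ 1)%C 0 (2 * PI)) _ _ _ r Hr).
    - intros w Hw. replace (w - 0)%C with w in Hw by ring.
      rewrite (cauchy_formula_disc f c0 R0 r Hr HR Hf w Hw).
      rewrite <- CInt_scal.
      + apply CInt_ext. intros t _. unfold H. rewrite Cpow_1_r. ring.
      + apply ex_CInt. intros t _. apply rcont_mult; [|now apply rcont_circ_inv].
        apply rcont_mult; [|now apply rcont_circ]. now apply (rcont_on_circ f c0 R0 r).
    - apply (cder_cauchy_kernel r Hr H 0 1); auto. }
  rewrite E.
  eapply Rle_trans; [apply (CInt_bound _ _ _ (/ (2 * PI) * (M / r)))|].
  - lra.
  - apply ex_CInt. intros t _. apply rcont_mult; auto. apply rcont_mult; [apply rcont_const|].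
    now apply rcont_inv_gap.
  - intros t Ht. unfold H. simpl INR. replace (circ r t - 0)%C with (circ r t) by ring.
    pose proof (circ_neq0 r Hr t) as G.
    replace (/ RtoC (2 * PI) * (f (c0 + circ r t) * circ r t) * (1 * / circ r t ^ 2))%C
      with (/ RtoC (2 * PI) * (f (c0 + circ r t) / circ r t))%C
      by (field; split; auto; apply RtoC_2PI_neq).
    rewrite Cmod_mult, Cmod_inv, Cmod_R, Rabs_pos_eq, Cmod_div, Cmod_circ by (auto using RtoC_2PI_neq; lra).
    apply Rmult_le_compat_l; [left; apply Rinv_0_lt_compat; lra|].
    apply Rmult_le_compat_r; [left; now apply Rinv_0_lt_compat|].
    apply HM. replace (c0 + circ r t - c0)%C with (circ r t) by ring. now apply Cmod_circ.
  - right. field. lra.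
Qed.

(** Morera's theorem applies: the limit is continuous, and its triangle integrals are limits of
    zeros. *)
Theorem holo_uniform_limit (fn : nat -> C -> C) (f : C -> C) (c0 : C) r :
  (forall n, holo_disc (fn n) c0 r) ->
  (forall eps, 0 < eps -> exists N, forall z, Cmod (z - c0) < r -> Cmod (fn N z - f z) <= eps) ->
  holo_disc f c0 r.
Proof.
  intros Hn HU.
  assert (Cf : forall z, Cmod (z - c0) < r -> ccont f z).
  { intros z Hz. apply ccontP. intros eps He.
    destruct (HU (eps / 4) ltac:(lra)) as [N HN].
    destruct (proj1 (ccontP _ _) (holo_cont _ c0 r (Hn N) z Hz) (eps / 4) ltac:(lra)) as [d [Hd Hd']].
    exists (Rmin d (r - Cmod (z - c0))). split; [apply Rmin_glb_lt; lra|].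
    intros h Hh.
    assert (H1 : Cmod h < d) by (eapply Rlt_le_trans; [exact Hh|apply Rmin_l]).
    assert (H2 : Cmod h < r - Cmod (z - c0)) by (eapply Rlt_le_trans; [exact Hh|apply Rmin_r]).
    assert (H3 : Cmod (z + h - c0) < r).
    { replace (z + h - c0)%C with ((z - c0) + h)%C by ring. eapply Rle_lt_trans; [apply Cmod_triangle|lra]. }
    specialize (Hd' h H1).
    generalize (HN _ H3) (HN _ Hz) (Cmod_sum3 (f (z + h)%C) (fn N (z + h)%C) (f z))
      (Cmod_sum3 (fn N (z + h)%C) (fn N z) (f z)) (Cmod_sub_sym (f (z + h)%C) (fn N (z + h)%C)). lra. }
  apply morera; auto.
  intros a b c Ha Hb Hc.
  assert (S : forall g p q, (forall z, Cmod (z - c0) < r -> ccont g z) -> Cmod (p - c0) < r -> Cmod (q - c0) < r -> forall z, on_seg p q z -> ccont g z).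
  { intros g p q Hg Hp Hq w Hw. apply Hg.
    apply Rle_lt_trans with (Rmax (Cmod (p - c0)) (Cmod (q - c0))); [|now apply Rmax_lub_lt].
    apply (on_seg_disc c0 p q); auto; [apply Rmax_l|apply Rmax_r]. }
  assert (S' : forall p q, Cmod (p - c0) < r -> Cmod (q - c0) < r -> forall z, on_seg p q z -> Cmod (z - c0) < r).
  { intros p q Hp Hq w Hw.
    apply Rle_lt_trans with (Rmax (Cmod (p - c0)) (Cmod (q - c0))); [|now apply Rmax_lub_lt].
    apply (on_seg_disc c0 p q); auto; [apply Rmax_l|apply Rmax_r]. }
  assert (K : forall eps, 0 < eps -> Cmod (tri f a b c) <= perim a b c * eps).
  { intros eps He. destruct (HU eps He) as [N HN].
    pose proof (holo_tri (fn N) c0 r (Hn N) a b c Ha Hb Hc) as T.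
    assert (Cn := holo_cont _ c0 r (Hn N)).
    rewrite <- Cmod_opp.
    replace (- tri f a b c)%C with (tri (fn N) a b c - tri f a b c)%C by (rewrite T; ring).
    assert (Bd : forall p q, Cmod (p - c0) < r -> Cmod (q - c0) < r ->
       Cmod (seg (fn N) p q - seg f p q) <= Cmod (q - p) * eps).
    { intros p q Hp Hq. rewrite <- seg_minus by (apply S; auto).
      apply seg_bound.
      - intros z Hz. apply (rcont_minus (U := C_UniformSpace)); [apply Cn|apply Cf]; now apply (S' p q).
      - intros z Hz. apply HN. now apply (S' p q). }
    unfold tri, perim.
    replace (seg (fn N) a b + seg (fn N) b c + seg (fn N) c a - (seg f a b + seg f b c + seg f c a))%C
     with ((seg (fn N) a b - seg f a b) + (seg (fn N) b c - seg f b c) + (seg (fn N) c a - seg f c a))%C by ring.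
    eapply Rle_trans; [apply Cmod_triangle|].
    rewrite Rmult_plus_distr_r. apply Rplus_le_compat; [|apply Bd; auto].
    eapply Rle_trans; [apply Cmod_triangle|].
    rewrite Rmult_plus_distr_r. apply Rplus_le_compat; apply Bd; auto. }
  apply Cmod_eq_0. apply Rle_antisym; [|apply Cmod_ge_0].
  apply Rnot_lt_le. intros HI.
  assert (P0 : 0 <= perim a b c) by (unfold perim; generalize (Cmod_ge_0 (b - a)) (Cmod_ge_0 (c - b)) (Cmod_ge_0 (a - c)); lra).
  specialize (K (Cmod (tri f a b c) / (2 * (perim a b c + 1)))).
  assert (0 < Cmod (tri f a b c) / (2 * (perim a b c + 1))) by (apply Rdiv_lt_0_compat; lra).
  specialize (K H).
  replace (perim a b c * (Cmod (tri f a b c) / (2 * (perim a b c + 1)))) with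
    (Cmod (tri f a b c) / 2 * (perim a b c / (perim a b c + 1))) in K by (field; lra).
  assert (perim a b c / (perim a b c + 1) <= 1).
  { apply Rmult_le_reg_r with (perim a b c + 1); [lra|]. unfold Rdiv. rewrite Rmult_assoc, Rinv_l; lra. }
  nra.
Qed.

(** All Taylor coefficients at the centre vanish: if the first [n] are 0, then [a n * x ^ n] equals
    minus a remainder of order [x ^ (n + 1)] on a real interval. Vanishing on such an interval is
    the only form in which the theorem is needed. *)
Theorem identity_disc (f : C -> C) (c0 : C) R0 d : 0 < d -> holo_disc f c0 R0 ->
  (forall x : R, Rabs x < d -> f (c0 + RtoC x)%C = 0%C) ->
  forall z, Cmod (z - c0) < R0 -> f z = 0%C.
Proof.
  intros Hd Hf H0 z Hz.
  set (r := (Cmod (z - c0) + R0) / 2).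
  pose proof (Cmod_ge_0 (z - c0)) as Hz0.
  assert (Hr : 0 < r) by (unfold r; lra).
  assert (Hzr : Cmod (z - c0) < r) by (unfold r; lra).
  assert (HrR : r < R0) by (unfold r; lra).
  destruct (taylor_disc f c0 R0 r Hr HrR Hf) as [a [M [M0 T]]].
  assert (A : forall n k, (k < n)%nat -> a k = 0%C).
  { induction n as [|n IH]; [lia|]. intros k Hk.
    destruct (Nat.eq_dec k n) as [->|]; [|apply IH; lia].
    assert (S0 : forall w, csum (fun k => w ^ k * a k)%C n = 0%C).
    { intros w. rewrite (csum_ext _ (fun k => 0 * 0)%C).
      - rewrite csum_scal. ring.
      - intros j Hj. rewrite (IH j Hj). ring. }
    apply NNPP. intros Na. assert (Ha : 0 < Cmod (a n)) by now apply Cmod_gt_0.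
    (* The last bound makes the remainder [2 * M * (x / r) ^ (n + 1)] smaller than half of
       [|a n| * x ^ n]; the other two keep [x] on the interval of zeros and [r / (r - x)] below
       2. *)
    set (x := Rmin (Rmin (d / 2) (r / 2)) (Cmod (a n) * r ^ S n / (4 * (M + 1)))).
    assert (P : 0 < r ^ S n) by (apply pow_lt; auto).
    assert (Hx0 : 0 < x).
    { repeat apply Rmin_glb_lt; try lra. apply Rdiv_lt_0_compat; [now apply Rmult_lt_0_compat|lra]. }
    assert (Hx1 : x <= d / 2) by (eapply Rle_trans; [apply Rmin_l|apply Rmin_l]).
    assert (Hx2 : x <= r / 2) by (eapply Rle_trans; [apply Rmin_l|apply Rmin_r]).
    assert (Hx3 : x <= Cmod (a n) * r ^ S n / (4 * (M + 1))) by apply Rmin_r.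
    specialize (T (RtoC x) (S n)). cbn [csum] in T. rewrite S0, H0 in T by (rewrite Rabs_pos_eq; lra).
    rewrite Cmod_R, Rabs_pos_eq in T by lra. specialize (T ltac:(lra)).
    replace (0 - (0 + RtoC x ^ n * a n))%C with (- (RtoC x ^ n * a n))%C in T by ring.
    rewrite Cmod_opp, Cmod_mult, Cmod_pow, Cmod_R, Rabs_pos_eq in T by lra.
    assert (Px : 0 < x ^ n) by (apply pow_lt; auto).
    assert (L1 : r / (r - x) <= 2).
    { apply Rmult_le_reg_r with (r - x); [lra|]. unfold Rdiv. rewrite Rmult_assoc, Rinv_l; lra. }
    assert (T2 : x ^ n * Cmod (a n) <= M * 2 * (x / r) ^ S n).
    { eapply Rle_trans; [exact T|]. apply Rmult_le_compat_r.
      - apply pow_le. apply Rmult_le_pos; [lra|left; now apply Rinv_0_lt_compat].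
      - nra. }
    unfold Rdiv in T2. rewrite Rpow_mult_distr, pow_inv in T2.
    change (x ^ S n) with (x * x ^ n) in T2.
    assert (T3 : Cmod (a n) * r ^ S n <= M * 2 * x).
    { apply Rmult_le_reg_l with (x ^ n); auto.
      apply Rmult_le_reg_r with (/ r ^ S n); [now apply Rinv_0_lt_compat|].
      replace (x ^ n * (Cmod (a n) * r ^ S n) * / r ^ S n) with (x ^ n * Cmod (a n)) by (field; lra).
      eapply Rle_trans; [exact T2|]. right; ring. }
    assert (T4 : x * (4 * (M + 1)) <= Cmod (a n) * r ^ S n).
    { apply (Rmult_le_compat_r (4 * (M + 1))) in Hx3; [|lra].
      unfold Rdiv in Hx3. rewrite (Rmult_assoc _ (/ _)), Rinv_l in Hx3 by lra. lra. }
    nra. }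
  assert (K : Cmod (f z) <= 0).
  { apply (le_geom_0 _ (M * (r / (r - Cmod (z - c0)))) (Cmod (z - c0) / r)).
    - split.
      + apply Rmult_le_pos; [apply Cmod_ge_0|left; now apply Rinv_0_lt_compat].
      + apply Rmult_lt_reg_r with r; auto. unfold Rdiv. rewrite Rmult_assoc, Rinv_l; lra.
    - intros n. specialize (T (z - c0)%C (S n) Hzr).
      rewrite (csum_ext _ (fun k => 0 * 0)%C), csum_scal in T by (intros k Hk; rewrite (A (S n) k Hk); ring).
      replace (c0 + (z - c0))%C with z in T by ring.
      replace (f z - 0 * csum (fun _ => 0) (S n))%C with (f z) in T by ring.
      exact T. }
  apply Cmod_eq_0. apply Rle_antisym; auto. apply Cmod_ge_0.
Qed.

(** * The entire function 1 / Gamma *)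

Definition clim (u : nat -> C) (l : C) : Prop :=
  forall eps, 0 < eps -> exists N, forall n, (N <= n)%nat -> Cmod (u n - l) < eps.

Lemma clim_unique u l1 l2 : clim u l1 -> clim u l2 -> l1 = l2.
Proof.
  intros H1 H2. apply NNPP. intros N.
  assert (P : 0 < Cmod (l1 - l2)).
  { apply Cmod_gt_0. intros E. apply N. apply Ceq_minus. exact E. }
  destruct (H1 (Cmod (l1 - l2) / 2) ltac:(lra)) as [n1 Hn1].
  destruct (H2 (Cmod (l1 - l2) / 2) ltac:(lra)) as [n2 Hn2].
  specialize (Hn1 (n1 + n2)%nat ltac:(lia)). specialize (Hn2 (n1 + n2)%nat ltac:(lia)).
  rewrite Cmod_sub_sym in Hn1. generalize (Cmod_sum3 l1 (u (n1 + n2)%nat) l2). lra.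
Qed.

Lemma clim_ext_ev u v l N0 : (forall n, (N0 <= n)%nat -> u n = v n) -> clim u l -> clim v l.
Proof.
  intros E H eps He. destruct (H eps He) as [N HN]. exists (N + N0)%nat. intros n Hn.
  rewrite <- E by lia. apply HN. lia.
Qed.

Lemma clim_const c : clim (fun _ => c) c.
Proof.
  intros eps He. exists 0%nat. intros. replace (c - c)%C with (RtoC 0) by ring. now rewrite Cmod_0.
Qed.

Lemma clim_comp (f : C -> C) u l : ccont f l -> clim u l -> clim (fun n => f (u n)) (f l).
Proof.
  intros Hf Hu eps He.
  destruct (proj1 (ccontP _ _) Hf eps He) as [d [Hd Hd']].
  destruct (Hu d Hd) as [N HN]. exists N. intros n Hn. specialize (Hd' _ (HN n Hn)).
  now replace (l + (u n - l))%C with (u n) in Hd' by ring.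
Qed.

Lemma clim_plus u v a b : clim u a -> clim v b -> clim (fun n => u n + v n)%C (a + b)%C.
Proof.
  intros Hu Hv eps He.
  destruct (Hu (eps / 2) ltac:(lra)) as [N1 H1]. destruct (Hv (eps / 2) ltac:(lra)) as [N2 H2].
  exists (N1 + N2)%nat. intros n Hn. specialize (H1 n ltac:(lia)). specialize (H2 n ltac:(lia)).
  replace (u n + v n - (a + b))%C with ((u n - a) + (v n - b))%C by ring.
  eapply Rle_lt_trans; [apply Cmod_triangle|lra].
Qed.

Lemma clim_scal c u a : clim u a -> clim (fun n => c * u n)%C (c * a)%C.
Proof.
  intros Hu. apply (clim_comp (fun z => c * z)%C); auto.
  eapply cder_cont. apply cder_scal, cder_id.
Qed.

Lemma clim_mult u v a b : clim u a -> clim v b -> clim (fun n => u n * v n)%C (a * b)%C.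
Proof.
  intros Hu Hv.
  assert (S : forall w c, clim w c -> clim (fun n => w n * w n)%C (c * c)%C).
  { intros w c Hw. apply (clim_comp (fun z => z * z)%C); auto. eapply cder_cont. apply cder_sqr. }
  pose proof (S _ _ (clim_plus _ _ _ _ Hu Hv)) as H1.
  pose proof (S _ _ (clim_plus _ _ _ _ Hu (clim_scal (-(1)) _ _ Hv))) as H2.
  pose proof (clim_scal (/ 4) _ _ (clim_plus _ _ _ _ H1 (clim_scal (-(1)) _ _ H2))) as H3.
  match type of H3 with clim ?w ?c => replace (a * b)%C with c by field end.
  eapply (clim_ext_ev _ _ _ 0); [|exact H3]. intros n _. simpl. field.
Qed.

Lemma clim_inv (u : nat -> C) (l : C) : l <> 0%C -> clim u l -> clim (fun n => / u n)%C (/ l)%C.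
Proof. intros Hl Hu. apply (clim_comp Cinv); auto. eapply cder_cont. now apply cder_inv_id. Qed.

Lemma clim_RtoC (u : nat -> R) (l : R) : is_lim_seq u l -> clim (fun n => RtoC (u n)) (RtoC l).
Proof.
  intros H eps He. apply is_lim_seq_spec in H. destruct (H (mkposreal eps He)) as [N HN].
  exists N. intros n Hn. rewrite <- RtoC_minus, Cmod_R. now apply HN.
Qed.

Lemma clim_Re u l : clim u l -> is_lim_seq (fun n => Re (u n)) (Re l).
Proof.
  intros H. apply is_lim_seq_spec. intros eps. destruct (H eps (cond_pos eps)) as [N HN].
  exists N. intros n Hn. eapply Rle_lt_trans; [|apply (HN n Hn)].
  change (Re (u n) - Re l) with (Re (u n - l)%C). apply re_le_Cmod.
Qed.

Lemma clim_Im u l : clim u l -> is_lim_seq (fun n => Im (u n)) (Im l).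
Proof.
  intros H. apply is_lim_seq_spec. intros eps. destruct (H eps (cond_pos eps)) as [N HN].
  exists N. intros n Hn. eapply Rle_lt_trans; [|apply (HN n Hn)].
  change (Im (u n) - Im l) with (Im (u n - l)%C). apply im_le_Cmod.
Qed.

Lemma clim_RI u l : is_lim_seq (fun n => Re (u n)) (Re l) -> is_lim_seq (fun n => Im (u n)) (Im l) -> clim u l.
Proof.
  intros H1 H2 eps He. apply is_lim_seq_spec in H1. apply is_lim_seq_spec in H2.
  assert (He2 : 0 < eps / 2) by lra.
  destruct (H1 (mkposreal _ He2)) as [N1 HN1]. destruct (H2 (mkposreal _ He2)) as [N2 HN2].
  exists (N1 + N2)%nat. intros n Hn. specialize (HN1 n ltac:(lia)). specialize (HN2 n ltac:(lia)).
  eapply Rle_lt_trans; [apply Cmod_le_sum|]. simpl in *.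
  unfold Re, Im in *; simpl in *. unfold Rminus in *. lra.
Qed.

Lemma Clim_seq_clim u l : clim u l -> Clim_seq u = l.
Proof.
  intros H. unfold Clim_seq.
  rewrite (is_lim_seq_unique _ _ (clim_Re _ _ H)), (is_lim_seq_unique _ _ (clim_Im _ _ H)).
  simpl. now destruct l.
Qed.

Lemma clim_cauchy u :
  (forall eps, 0 < eps -> exists N, forall n m, (N <= n)%nat -> (N <= m)%nat -> Cmod (u n - u m) < eps) ->
  exists l, clim u l.
Proof.
  intros H.
  assert (X : forall P : C -> R, (forall a b, Rabs (P a - P b) <= Cmod (a - b)) ->
    exists x : R, is_lim_seq (fun n => P (u n)) x).
  { intros P HP. apply ex_lim_seq_cauchy_corr. intros eps.
    destruct (H eps (cond_pos eps)) as [N HN]. exists N. intros n m Hn Hm.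
    eapply Rle_lt_trans; [apply HP|]. now apply HN. }
  destruct (X Re) as [x Hx]. { intros a b. change (Re a - Re b) with (Re (a - b)%C). apply re_le_Cmod. }
  destruct (X Im) as [y Hy]. { intros a b. change (Im a - Im b) with (Im (a - b)%C). apply im_le_Cmod. }
  exists (x, y). now apply clim_RI.
Qed.

Lemma clim_Cmod_le u l M N0 : clim u l -> (forall n, (N0 <= n)%nat -> Cmod (u n) <= M) -> Cmod l <= M.
Proof.
  intros H HM. apply Rnot_lt_le. intros HL.
  destruct (H (Cmod l - M) ltac:(lra)) as [N HN].
  specialize (HN (N + N0)%nat ltac:(lia)). specialize (HM (N + N0)%nat ltac:(lia)).
  rewrite Cmod_sub_sym in HN. generalize (Cmod_sub_ge l (u (N + N0)%nat)). lra.
Qed.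

(** * Locally uniform convergence of Gauss's product *)

Fixpoint cprod (u : nat -> C) (n : nat) : C :=
  match n with O => 1%C | S m => (cprod u m * u m)%C end.

Fixpoint rsum (u : nat -> R) (n : nat) : R :=
  match n with O => 0 | S m => rsum u m + u m end.

(** Each factor is compared with [1 + c k <= exp (c k)]. The bound on the distance from 1 is the one
    that yields a uniform Cauchy criterion. *)
Lemma cprod_bound (u : nat -> C) (c : nat -> R) n : (forall k, Cmod (u k - 1) <= c k) ->
  Cmod (cprod u n) <= exp (rsum c n) /\ Cmod (cprod u n - 1) <= exp (rsum c n) - 1.
Proof.
  intros H. induction n as [|n [IH1 IH2]]; simpl.
  - rewrite Cmod_1, exp_0. replace (1 - 1)%C with (RtoC 0) by ring. rewrite Cmod_0. lra.
  - specialize (H n). pose proof (Cmod_ge_0 (u n - 1)) as H0.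
    assert (Hu : Cmod (u n) <= 1 + c n).
    { replace (u n) with (1 + (u n - 1))%C by ring. eapply Rle_trans; [apply Cmod_triangle|]. rewrite Cmod_1. lra. }
    pose proof (exp_ineq1_le (c n)) as He. pose proof (exp_pos (rsum c n)) as Hp.
    rewrite exp_plus. split.
    + rewrite Cmod_mult. apply Rmult_le_compat; try apply Cmod_ge_0; lra.
    + replace (cprod u n * u n - 1)%C with (cprod u n * (u n - 1) + (cprod u n - 1))%C by ring.
      eapply Rle_trans; [apply Cmod_triangle|]. rewrite Cmod_mult.
      apply Rle_trans with (exp (rsum c n) * c n + (exp (rsum c n) - 1)).
      * apply Rplus_le_compat; auto. apply Rmult_le_compat; auto; apply Cmod_ge_0.
      * nra.
Qed.

(** The reciprocals of the terms of Gauss's product have no poles: each is entire, and they converge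
    at every [s]. *)
Definition rgamma_n (n : nat) (s : C) : C :=
  (Crising s n * / (RtoC (INR (fact n)) * Rcpow (INR n) s))%C.

(* The quotient of two consecutive terms of Gauss's product; it is 1 + O(1/n^2). *)
Definition gauss_factor (n : nat) (s : C) : C :=
  ((1 + s / RtoC (INR (S n))) * Cexp (s * RtoC (ln (INR n) - ln (INR (S n)))))%C.

Lemma fact_neq_C n : RtoC (INR (fact n)) <> 0%C.
Proof. intros E. apply RtoC_inj in E. now apply INR_fact_neq_0 in E. Qed.

Lemma INR_S_neq_C n : RtoC (INR (S n)) <> 0%C.
Proof. intros E. apply RtoC_inj in E. revert E. now apply not_0_INR. Qed.

Lemma Rcpow_quot a b s : (Cexp (s * RtoC (ln a - ln b)) = Rcpow a s / Rcpow b s)%C.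
Proof.
  unfold Rcpow. unfold Cdiv. rewrite <- Cexp_opp, <- Cexp_plus. f_equal. rewrite RtoC_minus. ring.
Qed.

Lemma rgamma_n_S n s : rgamma_n (S n) s = (rgamma_n n s * gauss_factor n s)%C.
Proof.
  unfold rgamma_n, gauss_factor. rewrite Rcpow_quot.
  change (Crising s (S n)) with (Crising s n * (s + RtoC (INR (S n))))%C.
  change (fact (S n)) with (S n * fact n)%nat. rewrite mult_INR, RtoC_mult.
  field. repeat split; auto using fact_neq_C, INR_S_neq_C, Rcpow_neq_0.
Qed.

Lemma rgamma_n_prod n m s :
  rgamma_n (n + m) s = (rgamma_n n s * cprod (fun k => gauss_factor (n + k) s) m)%C.
Proof.
  induction m as [|m IH].
  - rewrite Nat.add_0_r. simpl. ring.
  - rewrite Nat.add_succ_r, rgamma_n_S, IH. simpl. ring.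
Qed.

(** The first-order parts [s / (n + 1)] and [s (ln n - ln (n + 1))] cancel up to
    [|s| (1/n - 1/(n + 1))], and all products of two small quantities are of that order too. The
    bound is a telescoping difference so that it can be summed explicitly; 54 is not sharp. *)
Lemma gauss_factor_bound K n s : 0 <= K -> Cmod s <= K -> (1 <= n)%nat -> 4 * K <= INR n ->
  Cmod (gauss_factor n s - 1) <= 54 * (K + K ^ 2) * (/ INR n - / INR (S n)).
Proof.
  intros HK Hs Hn1 HnK. unfold gauss_factor. rewrite S_INR.
  assert (Hx : 1 <= INR n) by (apply (le_INR 1); auto).
  set (x := INR n) in *.
  assert (L1 : ln x - ln (x + 1) <= - / (x + 1)).
  { rewrite <- ln_div by lra.
    generalize (exp_ineq1_le (ln (x / (x + 1)))). rewrite exp_ln by (apply Rdiv_lt_0_compat; lra).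
    replace (- / (x + 1)) with (x / (x + 1) - 1) by (field; lra). lra. }
  assert (L2 : - / x <= ln x - ln (x + 1)).
  { replace (ln x - ln (x + 1)) with (- (ln ((x + 1) / x))) by (rewrite ln_div by lra; ring).
    generalize (exp_ineq1_le (ln ((x + 1) / x))). rewrite exp_ln by (apply Rdiv_lt_0_compat; lra).
    replace ((x + 1) / x) with (1 + / x) by (field; lra). lra. }
  set (t := ln x - ln (x + 1)) in *.
  set (d := / x - / (x + 1)).
  assert (Hd : d = / (x * (x + 1))) by (unfold d; field; lra).
  assert (ix : 0 < / x) by (apply Rinv_0_lt_compat; lra).
  assert (ix1 : 0 < / (x + 1)) by (apply Rinv_0_lt_compat; lra).
  assert (Hd0 : 0 < d) by (rewrite Hd; apply Rinv_0_lt_compat; nra).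
  assert (Hq : / x * / x <= 2 * d).
  { rewrite Hd. replace (/ x * / x) with ((x + 1) / x * / (x * (x + 1))) by (field; lra).
    apply Rmult_le_compat_r; [rewrite <- Hd; lra|].
    apply Rmult_le_reg_r with x; [lra|]. unfold Rdiv. rewrite Rmult_assoc, Rinv_l; lra. }
  set (z := (s / RtoC (x + 1))%C). set (y := (s * RtoC t)%C).
  assert (Nx : RtoC (x + 1) <> 0%C) by (intros E; apply RtoC_inj in E; lra).
  assert (Hz : Cmod z <= K * / x).
  { unfold z. rewrite Cmod_div, Cmod_R, Rabs_pos_eq by (auto; lra).
    apply Rmult_le_compat; auto; [apply Cmod_ge_0|lra|]. unfold d in Hd0. lra. }
  assert (Hy : Cmod y <= K * / x).
  { unfold y. rewrite Cmod_mult, Cmod_R. apply Rmult_le_compat; auto; [apply Cmod_ge_0|apply Rabs_pos|].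
    apply Rabs_le. lra. }
  assert (Hzy : Cmod (z + y) <= K * d).
  { replace (z + y)%C with (s * RtoC (/ (x + 1) + t))%C.
    - rewrite Cmod_mult, Cmod_R. apply Rmult_le_compat; auto; [apply Cmod_ge_0|apply Rabs_pos|].
      unfold d. apply Rabs_le. lra.
    - unfold z, y. rewrite RtoC_plus, RtoC_inv by lra. field. auto. }
  assert (Kx : K * / x <= 1 / 4).
  { apply Rmult_le_reg_r with x; [lra|]. rewrite Rmult_assoc, Rinv_l; lra. }
  assert (Kx0 : 0 <= K * / x) by nra.
  generalize (Cexp_taylor1 y ltac:(lra)). intros HE.
  assert (HE2 : Cmod (Cexp y - 1 - y) <= 20 * (K ^ 2 * d)).
  { eapply Rle_trans; [exact HE|].
    assert (Cmod y ^ 2 <= (K * / x) ^ 2) by (apply pow_incr; split; [apply Cmod_ge_0|auto]).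
    replace ((K * / x) ^ 2) with (K ^ 2 * (/ x * / x)) in H by ring.
    assert (0 <= K ^ 2) by nra. nra. }
  replace ((1 + z) * Cexp y - 1)%C with ((z + y) + z * y + (1 + z) * (Cexp y - 1 - y))%C by ring.
  eapply Rle_trans; [apply Cmod_triangle|].
  assert (H1 : Cmod ((z + y) + z * y) <= K * d + K ^ 2 * (2 * d)).
  { eapply Rle_trans; [apply Cmod_triangle|]. rewrite Cmod_mult. apply Rplus_le_compat; auto.
    apply Rle_trans with ((K * / x) * (K * / x)); [apply Rmult_le_compat; auto; apply Cmod_ge_0|].
    replace (K * / x * (K * / x)) with (K ^ 2 * (/ x * / x)) by ring.
    apply Rmult_le_compat_l; nra. }
  assert (H2 : Cmod ((1 + z) * (Cexp y - 1 - y)) <= 2 * (20 * (K ^ 2 * d))).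
  { rewrite Cmod_mult. apply Rmult_le_compat; auto; try apply Cmod_ge_0.
    eapply Rle_trans; [apply Cmod_triangle|]. rewrite Cmod_1. lra. }
  assert (0 <= K * d) by nra. assert (0 <= K ^ 2 * d) by (apply Rmult_le_pos; nra). nra.
Qed.

Lemma rsum_telescope (n m : nat) c : (1 <= n)%nat -> 0 <= c ->
  rsum (fun k => c * (/ INR (n + k) - / INR (S (n + k)))) m <= c / INR n.
Proof.
  intros Hn Hc.
  assert (E : rsum (fun k => c * (/ INR (n + k) - / INR (S (n + k)))) m = c * (/ INR n - / INR (n + m))).
  { induction m as [|m IH]; cbn [rsum].
    - rewrite Nat.add_0_r. ring.
    - rewrite IH, Nat.add_succ_r. ring. }
  rewrite E. unfold Rdiv. apply Rmult_le_compat_l; auto.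
  assert (0 < / INR (n + m)) by (apply Rinv_0_lt_compat, lt_0_INR; lia). lra.
Qed.

Lemma rgamma_n_step K n m s : 0 <= K -> Cmod s <= K -> (1 <= n)%nat -> 4 * K <= INR n ->
  Cmod (rgamma_n (n + m) s) <= Cmod (rgamma_n n s) * exp (54 * (K + K ^ 2) / INR n) /\
  Cmod (rgamma_n (n + m) s - rgamma_n n s) <= Cmod (rgamma_n n s) * (exp (54 * (K + K ^ 2) / INR n) - 1).
Proof.
  intros HK Hs Hn HnK.
  set (cc := 54 * (K + K ^ 2)).
  assert (Hcc : 0 <= cc) by (unfold cc; nra).
  destruct (cprod_bound (fun k => gauss_factor (n + k) s) (fun k => cc * (/ INR (n + k) - / INR (S (n + k)))) m) as [B1 B2].
  { intros k. apply gauss_factor_bound; auto; [lia|]. rewrite plus_INR. generalize (pos_INR k). lra. }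
  pose proof (rsum_telescope n m cc Hn Hcc) as T.
  assert (E : exp (rsum (fun k => cc * (/ INR (n + k) - / INR (S (n + k)))) m) <= exp (cc / INR n)).
  { destruct T as [T|T]; [left; now apply exp_increasing|rewrite T; lra]. }
  rewrite rgamma_n_prod. split.
  - rewrite Cmod_mult. apply Rmult_le_compat_l; [apply Cmod_ge_0|lra].
  - match goal with |- Cmod (?a * ?b - ?a) <= _ => replace (a * b - a)%C with (a * (b - 1))%C by ring end.
    rewrite Cmod_mult. apply Rmult_le_compat_l; [apply Cmod_ge_0|lra].
Qed.

(** A crude bound at one index; from there on [rgamma_n_step] controls all later terms. With an
    index proportional to [K] the two together also give the growth of 1/Gamma. *)
Lemma rgamma_n_bound K n s : 0 <= K -> Cmod s <= K -> (1 <= n)%nat ->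
  Cmod (rgamma_n n s) <= K * (1 + K) ^ n * exp (K * ln (INR n)).
Proof.
  intros HK Hs Hn. unfold rgamma_n.
  assert (HC : forall m, Cmod (Crising s m) <= K * (1 + K) ^ m * INR (fact m)).
  { induction m as [|m IH].
    - simpl. lra.
    - change (Crising s (S m)) with (Crising s m * (s + RtoC (INR (S m))))%C.
      change (fact (S m)) with (S m * fact m)%nat. rewrite mult_INR, Cmod_mult.
      replace (K * (1 + K) ^ S m * (INR (S m) * INR (fact m))) with
        (K * (1 + K) ^ m * INR (fact m) * ((1 + K) * INR (S m))) by (simpl; ring).
      apply Rmult_le_compat; auto; try apply Cmod_ge_0.
      eapply Rle_trans; [apply Cmod_triangle|]. rewrite Cmod_R, Rabs_pos_eq by apply pos_INR.
      rewrite S_INR. generalize (pos_INR m). nra. }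
  rewrite Cmod_mult, Cmod_inv, Cmod_mult, Cmod_R, Cmod_Rcpow by
    (apply Cmult_neq_0; auto using fact_neq_C, Rcpow_neq_0).
  assert (F : 0 < INR (fact n)) by (apply lt_0_INR, lt_O_fact).
  rewrite Rabs_pos_eq by lra.
  rewrite Rinv_mult, <- exp_Ropp.
  apply Rle_trans with (K * (1 + K) ^ n * INR (fact n) * (/ INR (fact n) * exp (K * ln (INR n)))).
  - apply Rmult_le_compat; auto; [apply Cmod_ge_0| |].
    + apply Rmult_le_pos; [left; now apply Rinv_0_lt_compat|left; apply exp_pos].
    + apply Rmult_le_compat_l; [left; now apply Rinv_0_lt_compat|].
      assert (L : - (Re s * ln (INR n)) <= K * ln (INR n)).
      { assert (0 <= ln (INR n)).
        { rewrite <- ln_1. apply le_INR in Hn. destruct Hn as [h|h]; [left; apply ln_increasing; simpl in *; lra|].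
          simpl in h. rewrite <- h. lra. }
        generalize (re_le_Cmod s). intros Hre. apply Rabs_le_between in Hre. nra. }
      destruct L as [L|L]; [left; now apply exp_increasing|rewrite L; lra].
  - right. field. lra.
Qed.

Lemma nat_above (x : R) : exists n, x <= INR n /\ (1 <= n)%nat /\ INR n <= Rabs x + 2.
Proof.
  destruct (nfloor_ex (Rabs x) (Rabs_pos x)) as [n [H1 H2]].
  exists (S n). rewrite S_INR. repeat split; [|lia|lra].
  generalize (Rle_abs x). lra.
Qed.

Lemma exp_small eps : 0 < eps -> exists d, 0 < d /\ forall x, 0 <= x <= d -> exp x - 1 <= eps.
Proof.
  intros He. exists (Rmin (1 / 2) (eps / 3)). split; [apply Rmin_glb_lt; lra|].
  intros x Hx. assert (x <= 1 / 2) by (eapply Rle_trans; [apply Hx|apply Rmin_l]).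
  assert (x <= eps / 3) by (eapply Rle_trans; [apply Hx|apply Rmin_r]).
  generalize (exp_taylor1 x ltac:(rewrite Rabs_pos_eq; lra)). intros T. apply Rabs_le_between in T.
  simpl in T. nra.
Qed.

Lemma rgamma_n_unif K eps : 0 <= K -> 0 < eps -> exists N, forall n m s, (N <= n)%nat -> Cmod s <= K ->
  Cmod (rgamma_n (n + m) s - rgamma_n n s) <= eps.
Proof.
  intros HK He.
  (* [N0] is the anchor from which every later term is bounded by [B]; beyond [N1] the relative
     variation is at most [eps / (B + 1)]. *)
  destruct (nat_above (4 * K)) as [N0 [H1 [H2 _]]].
  set (cc := 54 * (K + K ^ 2)). assert (Hcc : 0 <= cc) by (unfold cc; nra).
  set (B := K * (1 + K) ^ N0 * exp (K * ln (INR N0)) * exp (cc / INR N0)).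
  assert (HB : 0 <= B).
  { unfold B. repeat apply Rmult_le_pos; auto; try (left; apply exp_pos). apply pow_le; lra. }
  destruct (exp_small (eps / (B + 1))) as [d [Hd Hd']]; [apply Rdiv_lt_0_compat; lra|].
  destruct (nat_above (cc / d)) as [N1 [H3 [H4 _]]].
  exists (N0 + N1)%nat. intros n m s Hn Hs.
  assert (HnN0 : INR N0 <= INR n) by (apply le_INR; lia).
  assert (HnN1 : INR N1 <= INR n) by (apply le_INR; lia).
  assert (Hn1 : 1 <= INR n) by (apply (le_INR 1); lia).
  destruct (rgamma_n_step K n m s HK Hs ltac:(lia) ltac:(lra)) as [_ S2]. fold cc in S2.
  eapply Rle_trans; [exact S2|].
  assert (B1 : Cmod (rgamma_n n s) <= B).
  { replace n with (N0 + (n - N0))%nat by lia.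
    destruct (rgamma_n_step K N0 (n - N0) s HK Hs H2 H1) as [S1 _]. eapply Rle_trans; [exact S1|].
    unfold B. fold cc. apply Rmult_le_compat_r; [left; apply exp_pos|]. now apply rgamma_n_bound. }
  assert (Hc : 0 <= cc / INR n <= d).
  { split; [apply Rmult_le_pos; auto; left; apply Rinv_0_lt_compat; lra|].
    apply Rmult_le_reg_r with (INR n); [lra|]. unfold Rdiv. rewrite Rmult_assoc, Rinv_l, Rmult_1_r by lra.
    apply Rle_trans with (d * (cc / d)); [right; field; lra|]. apply Rmult_le_compat_l; lra. }
  specialize (Hd' _ Hc).
  assert (0 <= exp (cc / INR n) - 1) by (generalize (exp_ineq1_le (cc / INR n)); lra).
  apply Rle_trans with (B * (eps / (B + 1))).
  - apply Rmult_le_compat; auto. apply Cmod_ge_0.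
  - apply Rle_trans with ((B + 1) * (eps / (B + 1))); [|right; field; lra].
    apply Rmult_le_compat_r; [left; apply Rdiv_lt_0_compat; lra|lra].
Qed.

Definition rgamma (s : C) : C := Clim_seq (fun n => rgamma_n n s).

Lemma rgamma_clim s : clim (fun n => rgamma_n n s) (rgamma s).
Proof.
  destruct (clim_cauchy (fun n => rgamma_n n s)) as [l Hl].
  - intros eps He. destruct (rgamma_n_unif (Cmod s) (eps / 4) (Cmod_ge_0 s) ltac:(lra)) as [N HN].
    exists N. intros n m Hn Hm.
    assert (H1 := HN N (n - N)%nat s (le_n N) (Rle_refl _)).
    assert (H2 := HN N (m - N)%nat s (le_n N) (Rle_refl _)).
    replace (N + (n - N))%nat with n in H1 by lia. replace (N + (m - N))%nat with m in H2 by lia.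
    rewrite Cmod_sub_sym in H2. generalize (Cmod_sum3 (rgamma_n n s) (rgamma_n N s) (rgamma_n m s)). lra.
  - unfold rgamma. rewrite (Clim_seq_clim _ _ Hl). exact Hl.
Qed.

Lemma rgamma_n_entire n : is_entire (rgamma_n n).
Proof.
  intros s.
  assert (HC : forall m, exists l, cder (fun s => Crising s m) s l).
  { induction m as [|m [l IH]].
    - exists 1%C. apply cder_id.
    - eexists. apply (cder_mult (fun s => Crising s m) (fun s => s + RtoC (INR (S m)))%C); [exact IH|].
      apply cder_plus; [apply cder_id|apply cder_const]. }
  destruct (HC n) as [l Hl]. eexists.
  apply (cder_mult (fun s => Crising s n) (fun s => / (RtoC (INR (fact n)) * Rcpow (INR n) s))%C); [exact Hl|].
  apply (cder_inv (fun s => RtoC (INR (fact n)) * Rcpow (INR n) s)%C).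
  - apply Cmult_neq_0; auto using fact_neq_C, Rcpow_neq_0.
  - apply cder_scal, cder_Rcpow.
Qed.

Lemma rgamma_entire : is_entire rgamma.
Proof.
  intros s. set (K := Cmod s + 1).
  assert (HK : 0 <= K) by (unfold K; generalize (Cmod_ge_0 s); lra).
  apply (holo_uniform_limit rgamma_n rgamma 0 K).
  - intros n z _. apply rgamma_n_entire.
  - intros eps He. destruct (rgamma_n_unif K eps HK He) as [N HN]. exists N. intros z Hz.
    replace (z - 0)%C with z in Hz by ring.
    rewrite Cmod_sub_sym.
    apply (clim_Cmod_le (fun n => rgamma_n n z - rgamma_n N z)%C _ _ N).
    + apply clim_plus; [apply rgamma_clim|apply clim_const].
    + intros n Hn. replace n with (N + (n - N))%nat by lia. apply HN; [lia|lra].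
  - replace (s - 0)%C with s by ring. unfold K. lra.
Qed.

Lemma CGamma_rgamma s : rgamma s <> 0%C -> CGamma s = (/ rgamma s)%C.
Proof.
  intros Hs. apply Clim_seq_clim.
  destruct (rgamma_clim s (Cmod (rgamma s)) ltac:(now apply Cmod_gt_0)) as [N HN].
  apply (clim_ext_ev (fun n => / rgamma_n n s)%C _ _ N); [|now apply clim_inv; [|apply rgamma_clim]].
  intros n Hn. specialize (HN n Hn).
  assert (Hc : Crising s n <> 0%C).
  { intros E. unfold rgamma_n in HN. rewrite E in HN.
    replace (0 * / (RtoC (INR (fact n)) * Rcpow (INR n) s) - rgamma s)%C with (- rgamma s)%C in HN by ring.
    rewrite Cmod_opp in HN. lra. }
  unfold rgamma_n. field. repeat split; auto using fact_neq_C, Rcpow_neq_0.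
Qed.

Lemma Crising_shift s n : (s * Crising (s + 1) n = Crising s n * (s + RtoC (INR (S n))))%C.
Proof.
  induction n as [|n IH].
  - simpl. ring.
  - change (Crising (s + 1) (S n)) with (Crising (s + 1) n * (s + 1 + RtoC (INR (S n))))%C.
    change (Crising s (S n)) with (Crising s n * (s + RtoC (INR (S n))))%C.
    rewrite Cmult_assoc, IH, (S_INR (S n)), RtoC_plus. ring.
Qed.

Lemma clim_inv_INR (c : C) : clim (fun n => c / RtoC (INR n))%C 0.
Proof.
  replace (RtoC 0) with (c * RtoC 0)%C by ring.
  apply (clim_ext_ev (fun n => c * RtoC (/ INR n))%C _ _ 1).
  - intros n Hn. rewrite RtoC_inv; [reflexivity|]. apply not_0_INR. lia.
  - apply clim_scal, clim_RtoC.
    exact (is_lim_seq_inv INR p_infty is_lim_seq_INR ltac:(discriminate)).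
Qed.

(** By [Crising_shift] the [n]-th terms of the two sides differ by the factor [1 + (s + 1) / n],
    which tends to 1. *)
Lemma rgamma_shift s : rgamma s = (s * rgamma (s + 1))%C.
Proof.
  apply (clim_unique (fun n => s * rgamma_n n (s + 1))%C).
  - apply (clim_ext_ev (fun n => rgamma_n n s * (1 + (s + 1) / RtoC (INR n)))%C _ _ 1).
    + intros n Hn. assert (Nn : RtoC (INR n) <> 0%C) by (destruct n; [lia|apply INR_S_neq_C]).
      unfold rgamma_n. rewrite Rcpow_plus.
      transitivity ((s * Crising (s + 1) n) * / (RtoC (INR (fact n)) * (Rcpow (INR n) s * Rcpow (INR n) 1)))%C; [|ring].
      rewrite Crising_shift.
      replace (Rcpow (INR n) 1) with (RtoC (INR n)).
      * rewrite S_INR, RtoC_plus. field. repeat split; auto using fact_neq_C, Rcpow_neq_0.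
      * rewrite Rcpow_R, Rmult_1_l, exp_ln; [reflexivity|]. apply lt_0_INR. lia.
    + replace (rgamma s) with (rgamma s * (1 + 0))%C by ring.
      apply clim_mult; [apply rgamma_clim|]. apply clim_plus; [apply clim_const|apply clim_inv_INR].
  - apply clim_scal, rgamma_clim.
Qed.

Lemma Crising_1 n : Crising 1 n = RtoC (INR (fact (S n))).
Proof.
  induction n as [|n IH]; [reflexivity|].
  change (Crising 1 (S n)) with (Crising 1 n * (1 + RtoC (INR (S n))))%C.
  rewrite IH. change (fact (S (S n))) with (S (S n) * fact (S n))%nat.
  rewrite mult_INR, (S_INR (S n)), RtoC_mult, RtoC_plus. ring.
Qed.

Lemma rgamma_1 : rgamma 1 = 1%C.
Proof.
  apply (clim_unique (fun n => rgamma_n n 1)); [apply rgamma_clim|].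
  apply (clim_ext_ev (fun n => 1 + 1 / RtoC (INR n))%C _ _ 1).
  - intros n Hn. assert (Nn : RtoC (INR n) <> 0%C) by (destruct n; [lia|apply INR_S_neq_C]).
    unfold rgamma_n. rewrite Crising_1, Rcpow_R, Rmult_1_l, exp_ln by (apply lt_0_INR; lia).
    change (fact (S n)) with (S n * fact n)%nat. rewrite mult_INR, RtoC_mult, S_INR, RtoC_plus.
    field. split; auto using fact_neq_C.
  - assert (H := clim_plus _ _ _ _ (clim_const 1) (clim_inv_INR 1)). rewrite Cplus_0_r in H. exact H.
Qed.

(** * Reflection and duplication *)

(** These integrals yield Euler's sine product: up to a constant [wallis 0 z] is [sin (PI * z) / z],
    the recurrence in [n] splits off one factor [1 - z^2 / n^2] at a time, and
    [wallis n z / wallis n 0] tends to 1. *)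
Definition wallis (n : nat) (z : R) : R := RInt (fun t => cos (2 * z * t) * cos t ^ (2 * n)) 0 (PI / 2).

Lemma ex_derive_cont (f : R -> R) t : ex_derive f t -> continuous f t.
Proof. apply (@ex_derive_continuous R_AbsRing R_NormedModule). Qed.

Lemma ex_RInt_cont (f : R -> R) a b : (forall t, continuous f t) -> ex_RInt f a b.
Proof. intros H. apply (@ex_RInt_continuous R_CompleteNormedModule). auto. Qed.

Lemma wallis_cont n z t : continuous (fun t => cos (2 * z * t) * cos t ^ (2 * n)) t.
Proof. apply ex_derive_cont. auto_derive. auto. Qed.

Lemma wallis_rec n z :
  (2 * INR (S n) ^ 2 - 2 * z ^ 2) * wallis (S n) z = INR (S n) * (2 * INR (S n) - 1) * wallis n z.
Proof.
  set (N := INR (S n)).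
  assert (EN : INR (2 * n) = 2 * N - 2) by (unfold N; rewrite mult_INR, (S_INR n); simpl; ring).
  unfold wallis. replace (2 * S n)%nat with (S (S (2 * n))) by lia.
  set (m := (2 * n)%nat) in *.
  (* [T] collects the boundary terms of two integrations by parts. It vanishes at both ends, since
     [cos (PI / 2) = 0] and [sin 0 = 0], so the integral of [T'] is 0, and that is the
     recurrence. *)
  set (T := fun t => N * cos (2 * z * t) * cos t ^ S m * sin t - z * sin (2 * z * t) * cos t ^ S (S m)).
  set (T' := fun t => (2 * N ^ 2 - 2 * z ^ 2) * (cos (2 * z * t) * cos t ^ S (S m)) -
     N * (2 * N - 1) * (cos (2 * z * t) * cos t ^ m)).
  assert (WC : forall z p t, continuous (fun t => cos (2 * z * t) * cos t ^ p) t).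
  { intros. apply ex_derive_cont. auto_derive. auto. }
  assert (I : is_RInt T' 0 (PI / 2) (T (PI / 2) - T 0)).
  { apply (@is_RInt_derive R_CompleteNormedModule T T').
    - intros t _. unfold T, T'. auto_derive; [auto|].
      change (INR (S (S m))) with (INR (S m) + 1). change (match m with 0%nat => 1 | S _ => INR m + 1 end) with (INR (S m)).
      rewrite !S_INR, EN. simpl pow.
      set (p := cos t ^ m). generalize (sin2_cos2 t). unfold Rsqr. intros H.
      assert (H' : sin t * sin t = 1 - cos t * cos t) by lra.
      match goal with |- ?l = ?r => assert (E : l - r = N * (2 * N - 1) * cos (2 * z * t) * p * (1 - cos t * cos t - sin t * sin t)) by ring end.
      rewrite H' in E. lra.
    - intros t _. apply ex_derive_cont. unfold T'. auto_derive. auto. }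
  assert (T0 : T (PI / 2) - T 0 = 0).
  { unfold T. rewrite cos_PI2, Rmult_0_r, sin_0. rewrite !pow_i by lia. ring. }
  rewrite T0 in I.
  assert (I2 : is_RInt T' 0 (PI / 2)
    ((2 * N ^ 2 - 2 * z ^ 2) * RInt (fun t => cos (2 * z * t) * cos t ^ S (S m)) 0 (PI / 2) -
     N * (2 * N - 1) * RInt (fun t => cos (2 * z * t) * cos t ^ m) 0 (PI / 2))).
  { unfold T'. apply (is_RInt_minus (V := R_NormedModule)); apply (is_RInt_scal (V := R_NormedModule));
    apply (@RInt_correct R_CompleteNormedModule), ex_RInt_cont; intros; apply WC. }
  apply (@is_RInt_unique R_CompleteNormedModule) in I. apply (@is_RInt_unique R_CompleteNormedModule) in I2.
  rewrite I in I2. lra.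
Qed.

Lemma wallis_0 z : z <> 0 -> wallis 0 z = sin (PI * z) / (2 * z).
Proof.
  intros Hz. unfold wallis.
  assert (I : is_RInt (fun t => cos (2 * z * t) * cos t ^ (2 * 0)) 0 (PI / 2)
    (sin (2 * z * (PI / 2)) / (2 * z) - sin (2 * z * 0) / (2 * z))).
  { apply (@is_RInt_derive R_CompleteNormedModule (fun t => sin (2 * z * t) / (2 * z))).
    - intros t _. auto_derive; [auto|]. simpl. field. auto.
    - intros t _. apply wallis_cont. }
  rewrite (@is_RInt_unique R_CompleteNormedModule _ _ _ _ I). rewrite Rmult_0_r, sin_0.
  replace (2 * z * (PI / 2)) with (PI * z) by field. field. auto.
Qed.

Lemma wallis_00 : wallis 0 0 = PI / 2.
Proof.
  unfold wallis. rewrite (RInt_ext _ (fun _ => 1)).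
  - rewrite RInt_const. simpl. unfold scal; simpl; unfold mult; simpl. lra.
  - intros t _. rewrite Rmult_0_r, Rmult_0_l, cos_0. simpl. ring.
Qed.

Lemma wallis_pos n : 0 < wallis n 0.
Proof.
  induction n as [|n IH].
  - rewrite wallis_00. generalize PI_RGT_0. lra.
  - pose proof (wallis_rec n 0) as H.
    assert (HN : 1 <= INR (S n)) by (apply (le_INR 1); lia).
    assert (0 < INR (S n) * (2 * INR (S n) - 1)) by nra.
    assert (0 < (2 * INR (S n) ^ 2 - 2 * 0 ^ 2) * wallis (S n) 0) by (rewrite H; apply Rmult_lt_0_compat; auto).
    nra.
Qed.

Lemma t_cos_le_sin t : 0 <= t <= PI / 2 -> t * cos t <= sin t.
Proof.
  intros Ht. 
  destruct (MVT_gen (fun t => sin t - t * cos t) 0 t (fun t => t * sin t)) as [c [Hc E]].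
  - intros u _. auto_derive; [trivial|ring].
  - intros u _. apply continuity_pt_filterlim. apply (ex_derive_cont (fun t => sin t - t * cos t)). auto_derive. trivial.
  - rewrite Rmin_left, Rmax_right in Hc by lra.
    assert (0 <= sin c) by (apply sin_ge_0; lra).
    rewrite sin_0 in E. assert (0 <= c * sin c * (t - 0)) by (repeat apply Rmult_le_pos; lra). lra.
Qed.

(** The inequalities [1 - cos (2 z t) <= 2 z^2 t^2] and [t cos t <= sin t] bound the difference of
    the integrands by [2 z^2 sin^2 t cos^(2n) t]. The integral of this is a difference of two values
    at [z = 0], which the recurrence evaluates. *)
Lemma wallis_close n z : Rabs (wallis (S n) 0 - wallis (S n) z) <= 2 * z ^ 2 / (2 * INR (S n) - 1) * wallis (S n) 0.
Proof.
  assert (HN : 1 <= INR (S n)) by (apply (le_INR 1); lia).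
  pose proof PI_RGT_0 as HPI.
  pose proof (wallis_rec n 0) as W0.
  assert (W1 : wallis n 0 - wallis (S n) 0 = wallis (S n) 0 / (2 * INR (S n) - 1)).
  { replace (wallis n 0) with (2 * INR (S n) / (2 * INR (S n) - 1) * wallis (S n) 0).
    - field. lra.
    - apply Rmult_eq_reg_l with (INR (S n) * (2 * INR (S n) - 1)); [|nra].
      rewrite <- W0. field. lra. }
  replace (2 * z ^ 2 / (2 * INR (S n) - 1) * wallis (S n) 0) with (2 * z ^ 2 * (wallis n 0 - wallis (S n) 0))
    by (rewrite W1; field; lra).
  assert (E1 : is_RInt (fun t => cos (2 * 0 * t) * cos t ^ (2 * S n) - cos (2 * z * t) * cos t ^ (2 * S n)) 0 (PI / 2)
    (wallis (S n) 0 - wallis (S n) z)).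
  { apply (is_RInt_minus (V := R_NormedModule));
    apply (@RInt_correct R_CompleteNormedModule), ex_RInt_cont; intros; apply wallis_cont. }
  assert (E2 : is_RInt (fun t => 2 * z ^ 2 * (cos (2 * 0 * t) * cos t ^ (2 * n) - cos (2 * 0 * t) * cos t ^ (2 * S n))) 0 (PI / 2)
    (2 * z ^ 2 * (wallis n 0 - wallis (S n) 0))).
  { apply (is_RInt_scal (V := R_NormedModule)), (is_RInt_minus (V := R_NormedModule));
    apply (@RInt_correct R_CompleteNormedModule), ex_RInt_cont; intros; apply wallis_cont. }
  apply (norm_RInt_le (V := R_NormedModule) _ _ 0 (PI / 2) _ _ ltac:(lra)) with (2 := E1) (3 := E2).
  intros t Ht. change (norm ?x) with (Rabs x).
  replace (2 * 0 * t) with 0 by ring. rewrite cos_0.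
  replace (2 * S n)%nat with (2 * n + 2)%nat by lia. rewrite pow_add.
  set (p := cos t ^ (2 * n)).
  assert (Hp : 0 <= p) by (unfold p; rewrite pow_mult; apply pow_le; nra).
  replace (1 * (p * cos t ^ 2) - cos (2 * z * t) * (p * cos t ^ 2)) with (- (cos (2 * z * t) - 1) * cos t ^ 2 * p) by ring.
  replace (2 * z ^ 2 * (1 * p - 1 * (p * cos t ^ 2))) with (2 * z ^ 2 * (1 - cos t ^ 2) * p) by ring.
  rewrite Rabs_mult, (Rabs_pos_eq p) by auto. apply Rmult_le_compat_r; auto.
  replace (1 - cos t ^ 2) with (sin t ^ 2) by (generalize (sin2_cos2 t); unfold Rsqr; simpl; lra).
  rewrite Rabs_mult, Rabs_Ropp, (Rabs_pos_eq (cos t ^ 2)) by (simpl; nra).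
  apply Rle_trans with ((2 * z * t) ^ 2 / 2 * cos t ^ 2).
  - apply Rmult_le_compat_r; [simpl; nra|apply cos_taylor1].
  - replace ((2 * z * t) ^ 2 / 2 * cos t ^ 2) with (2 * z ^ 2 * (t * cos t) ^ 2) by field.
    apply Rmult_le_compat_l; [simpl; nra|].
    apply pow_incr. split; [|now apply t_cos_le_sin].
    apply Rmult_le_pos; [lra|]. apply cos_ge_0; lra.
Qed.

Fixpoint sine_prod (z : R) (n : nat) : R :=
  match n with O => 1 | S m => sine_prod z m * (1 - z ^ 2 / INR (S m) ^ 2) end.

Lemma sine_prod_wallis z n : wallis 0 z / wallis 0 0 = sine_prod z n * (wallis n z / wallis n 0).
Proof.
  induction n as [|n IH].
  - simpl. ring.
  - rewrite IH. cbn [sine_prod]. rewrite Rmult_assoc. f_equal.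
    pose proof (wallis_rec n z) as Wz. pose proof (wallis_rec n 0) as W0.
    assert (HN : 1 <= INR (S n)) by (apply (le_INR 1); lia).
    pose proof (wallis_pos n) as P1. pose proof (wallis_pos (S n)) as P2.
    set (N := INR (S n)) in *.
    assert (c0 : 0 < N * (2 * N - 1)) by nra.
    replace (wallis n z) with ((2 * N ^ 2 - 2 * z ^ 2) * wallis (S n) z / (N * (2 * N - 1)))
      by (rewrite Wz; field; lra).
    replace (wallis n 0) with ((2 * N ^ 2 - 2 * 0 ^ 2) * wallis (S n) 0 / (N * (2 * N - 1)))
      by (rewrite W0; field; lra).
    field. repeat split; lra.
Qed.

Lemma is_lim_seq_inv_odd : is_lim_seq (fun n => / (2 * INR (S n) - 1)) 0.
Proof.
  apply (is_lim_seq_le_le (fun _ => 0) _ (fun n => / INR (S n))).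
  - intros n. assert (HN : 1 <= INR (S n)) by (apply (le_INR 1); lia). split.
    + left. apply Rinv_0_lt_compat. lra.
    + apply Rinv_le_contravar; lra.
  - apply is_lim_seq_const.
  - apply (is_lim_seq_incr_1 (fun n => / INR n)).
    exact (is_lim_seq_inv INR p_infty is_lim_seq_INR ltac:(discriminate)).
Qed.

Lemma sine_prod_lim z : z <> 0 -> is_lim_seq (sine_prod z) (sin (PI * z) / (PI * z)).
Proof.
  intros Hz. pose proof PI_RGT_0 as HPI.
  assert (HR : is_lim_seq (fun n => wallis n z / wallis n 0) 1).
  { apply is_lim_seq_incr_1.
    apply (is_lim_seq_le_le (fun n => 1 - 2 * z ^ 2 * / (2 * INR (S n) - 1)) _ (fun n => 1 + 2 * z ^ 2 * / (2 * INR (S n) - 1))).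
    - intros n. pose proof (wallis_close n z) as W. pose proof (wallis_pos (S n)) as P.
      assert (HN : 1 <= INR (S n)) by (apply (le_INR 1); lia).
      set (c := 2 * z ^ 2 * / (2 * INR (S n) - 1)).
      change (2 * z ^ 2 / (2 * INR (S n) - 1)) with c in W.
      assert (E : Rabs (1 - wallis (S n) z / wallis (S n) 0) <= c).
      { replace (1 - wallis (S n) z / wallis (S n) 0) with ((wallis (S n) 0 - wallis (S n) z) * / wallis (S n) 0) by (field; lra).
        rewrite Rabs_mult, (Rabs_pos_eq (/ _)) by (left; now apply Rinv_0_lt_compat).
        apply Rmult_le_reg_r with (wallis (S n) 0); auto. rewrite Rmult_assoc, Rinv_l; lra. }
      apply Rabs_le_between in E. lra.
    - replace (Finite 1) with (Finite (1 - 2 * z ^ 2 * 0)) by (f_equal; ring).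
      apply is_lim_seq_minus'; [apply is_lim_seq_const|].
      apply (is_lim_seq_scal_l _ (2 * z ^ 2) 0). apply is_lim_seq_inv_odd.
    - replace (Finite 1) with (Finite (1 + 2 * z ^ 2 * 0)) by (f_equal; ring).
      apply is_lim_seq_plus'; [apply is_lim_seq_const|].
      apply (is_lim_seq_scal_l _ (2 * z ^ 2) 0). apply is_lim_seq_inv_odd. }
  assert (E0 : wallis 0 z / wallis 0 0 = sin (PI * z) / (PI * z)).
  { rewrite wallis_0, wallis_00 by auto. field. split; lra. }
  assert (HQ : is_lim_seq (fun n => wallis 0 z / wallis 0 0 / (wallis n z / wallis n 0)) (sin (PI * z) / (PI * z) / 1)).
  { rewrite E0. apply is_lim_seq_div'; [apply is_lim_seq_const|exact HR|lra]. }
  replace (sin (PI * z) / (PI * z) / 1) with (sin (PI * z) / (PI * z)) in HQ by (field; lra).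
  apply is_lim_seq_spec in HR. destruct (HR (mkposreal (1/2) ltac:(lra))) as [N HN].
  apply (is_lim_seq_ext_loc (fun n => wallis 0 z / wallis 0 0 / (wallis n z / wallis n 0))); auto.
  exists N. intros n Hn. specialize (HN n Hn). simpl in HN. apply Rabs_lt_between in HN.
  rewrite (sine_prod_wallis z n). field.
  pose proof (wallis_pos n). split; [lra|].
  intros E. rewrite E in HN. unfold Rdiv in HN. lra.
Qed.

Lemma Crising_sine z n : (Crising (RtoC z) n * Crising (- RtoC z) n =
  - RtoC (z ^ 2 * sine_prod z n * INR (fact n) ^ 2))%C.
Proof.
  induction n as [|n IH].
  - simpl. rewrite !RtoC_mult. ring.
  - change (Crising (RtoC z) (S n)) with (Crising (RtoC z) n * (RtoC z + RtoC (INR (S n))))%C.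
    change (Crising (- RtoC z) (S n)) with (Crising (- RtoC z) n * (- RtoC z + RtoC (INR (S n))))%C.
    transitivity ((Crising (RtoC z) n * Crising (- RtoC z) n) * ((RtoC z + RtoC (INR (S n))) * (- RtoC z + RtoC (INR (S n)))))%C; [ring|].
    rewrite IH. change (fact (S n)) with (S n * fact n)%nat. cbn [sine_prod]. rewrite mult_INR.
    assert (HN : INR (S n) <> 0) by (apply not_0_INR; lia).
    replace (z ^ 2 * (sine_prod z n * (1 - z ^ 2 / INR (S n) ^ 2)) * (INR (S n) * INR (fact n)) ^ 2)
      with (z ^ 2 * sine_prod z n * INR (fact n) ^ 2 * ((z + INR (S n)) * (- z + INR (S n)))) by (field; auto).
    rewrite (RtoC_mult (z ^ 2 * sine_prod z n * INR (fact n) ^ 2)), (RtoC_mult (z + INR (S n))), !RtoC_plus, RtoC_opp. ring.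
Qed.

Lemma Csin_RtoC x : Csin (RtoC x) = RtoC (sin x).
Proof.
  unfold Csin, Cexp. simpl.
  replace (0 * x - 1 * 0) with 0 by ring. replace (0 * 0 + 1 * x) with x by ring.
  rewrite Ropp_0, exp_0, cos_neg, sin_neg.
  unfold Cminus, Cplus, Copp, Cdiv, Cinv, Cmult, RtoC, Ci; simpl. apply injective_projections; simpl; field.
Qed.

Lemma cder_Csin z : exists l, cder Csin z l.
Proof.
  unfold Csin. eexists.
  apply (cder_mult (fun z => Cexp (Ci * z) - Cexp (- (Ci * z)))%C (fun _ => / (2 * Ci))%C); [|apply cder_const].
  apply cder_minus.
  - apply (cder_comp Cexp (fun z => Ci * z)%C); [apply cder_Cexp|apply cder_scal, cder_id].
  - apply (cder_comp Cexp (fun z => - (Ci * z))%C); [apply cder_Cexp|apply cder_opp, cder_scal, cder_id].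
Qed.

Lemma entire_holo f c r : is_entire f -> holo_disc f c r.
Proof. intros H z _. apply H. Qed.

Lemma identity_entire (f g : C -> C) : is_entire f -> is_entire g ->
  (forall x : R, 0 < x -> f (RtoC x) = g (RtoC x)) -> forall z, f z = g z.
Proof.
  intros Hf Hg E z.
  assert (X : (f z - g z)%C = 0%C).
  { apply (identity_disc (fun z => f z - g z)%C 1 (Cmod (z - 1) + 1) 1 Rlt_0_1).
    - intros w _. destruct (Hf w) as [a Ha]. destruct (Hg w) as [b Hb]. exists (a - b)%C. now apply cder_minus.
    - intros x Hx. rewrite <- RtoC_plus, E; [ring|]. apply Rabs_lt_between in Hx. lra.
    - lra. }
  rewrite <- (Cplus_0_r (g z)), <- X. ring.
Qed.

Lemma is_entire_lin (f : C -> C) (a b : C) : is_entire f -> is_entire (fun s => f (a * s + b)%C).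
Proof.
  intros Hf s. destruct (Hf (a * s + b)%C) as [l Hl]. eexists.
  apply (cder_comp f (fun s => a * s + b)%C); [exact Hl|].
  apply cder_plus; [apply cder_scal, cder_id|apply cder_const].
Qed.

Lemma is_entire_mult (f g : C -> C) : is_entire f -> is_entire g -> is_entire (fun s => f s * g s)%C.
Proof. intros Hf Hg s. destruct (Hf s) as [a Ha]. destruct (Hg s) as [b Hb]. eexists. apply cder_mult; eauto. Qed.

Lemma is_entire_ext (f g : C -> C) : (forall s, f s = g s) -> is_entire f -> is_entire g.
Proof. intros E Hf s. destruct (Hf s) as [a Ha]. exists a. apply (cder_ext f); auto. Qed.

Lemma PI_neq_C : RtoC PI <> 0%C.
Proof. intros E. apply RtoC_inj in E. generalize PI_RGT_0. lra. Qed.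

(** On the positive reals the numerators pair up as [(j + x) (j - x)], so the product of the two
    Gauss terms is a partial sine product; the identity theorem does the rest. The argument [- s]
    rather than [1 - s] makes this pairing exact, and one shift leads from one form to the other. *)
Lemma rgamma_opp s : (rgamma s * rgamma (- s) = - (s * Csin (RtoC PI * s) / RtoC PI))%C.
Proof.
  revert s.
  assert (E1 : is_entire (fun s => rgamma s * rgamma (- s))%C).
  { apply is_entire_mult; [apply rgamma_entire|].
    apply (is_entire_ext (fun s => rgamma (-(1) * s + 0)%C)).
    - intros s. f_equal. ring.
    - apply (is_entire_lin rgamma), rgamma_entire. }
  assert (E2 : is_entire (fun s => - (s * Csin (RtoC PI * s) / RtoC PI))%C).
  { apply (is_entire_ext (fun s => (- / RtoC PI) * s * Csin (RtoC PI * s + 0))%C).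
    - intros s. rewrite Cplus_0_r. unfold Cdiv. ring.
    - apply (is_entire_mult (fun s => (- / RtoC PI) * s)%C (fun s => Csin (RtoC PI * s + 0))).
      + intros s. eexists. apply cder_scal, cder_id.
      + apply (is_entire_lin Csin). intros s. apply cder_Csin. }
  apply (identity_entire _ _ E1 E2). intros x Hx.
  apply (clim_unique (fun n => rgamma_n n (RtoC x) * rgamma_n n (- RtoC x))%C).
  - apply clim_mult; apply rgamma_clim.
  - rewrite <- RtoC_mult, Csin_RtoC.
    apply (clim_ext_ev (fun n => - RtoC (x ^ 2) * RtoC (sine_prod x n))%C _ _ 0).
    + intros n _. unfold rgamma_n.
      transitivity ((Crising (RtoC x) n * Crising (- RtoC x) n) / (RtoC (INR (fact n)) ^ 2 * (Rcpow (INR n) (RtoC x) * Rcpow (INR n) (- RtoC x))))%C.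
      * rewrite Crising_sine, <- Rcpow_plus.
        replace (RtoC x + - RtoC x)%C with (RtoC 0) by ring.
        replace (Rcpow (INR n) 0) with (RtoC 1) by (unfold Rcpow; rewrite Cmult_0_l, Cexp_0; reflexivity).
        rewrite !RtoC_mult, !RtoC_pow. field. apply fact_neq_C.
      * field. repeat split; auto using fact_neq_C, Rcpow_neq_0.
    + replace (- (RtoC x * RtoC (sin (PI * x)) / RtoC PI))%C with (- RtoC (x ^ 2) * RtoC (sin (PI * x) / (PI * x)))%C.
      * apply clim_scal, clim_RtoC, sine_prod_lim. lra.
      * assert (RtoC x <> 0%C) by (intros E; apply RtoC_inj in E; lra).
        rewrite RtoC_div, RtoC_mult, RtoC_pow by (apply Rmult_integral_contrapositive; generalize PI_RGT_0; split; lra).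
        field. split; auto using PI_neq_C.
Qed.

Theorem rgamma_reflection s : (rgamma s * rgamma (1 - s) = Csin (RtoC PI * s) / RtoC PI)%C.
Proof.
  destruct (classic (s = 0%C)) as [->|Hs].
  - rewrite (rgamma_shift 0), !Cmult_0_l, Cmult_0_r, Csin_RtoC, sin_0. unfold Cdiv. ring.
  - generalize (rgamma_opp s). rewrite (rgamma_shift (- s)).
    replace (- s + 1)%C with (1 - s)%C by ring. intros E.
    transitivity ((rgamma s * (- s * rgamma (1 - s))) * (- / s))%C; [field; auto|].
    rewrite E. field. split; auto using PI_neq_C.
Qed.

(** The zeros of all the sines and reciprocal Gamma factors below, as well as 0 and 1, are integers.
    On this open set every division is legitimate, and its complement consists of isolated
    points. *)
Definition nonint (s : C) : Prop := forall m : Z, s <> RtoC (IZR m).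

Lemma Csin_eq_0 w : Csin w = 0%C -> Im w = 0 /\ sin (Re w) = 0.
Proof.
  intros H. unfold Csin in H.
  assert (E : Cexp (Ci * w) = Cexp (- (Ci * w))).
  { apply Ceq_minus.
    assert (N : (2 * Ci)%C <> 0%C) by (apply Cmult_neq_0; [intros F; apply RtoC_inj in F; lra|apply Ci_nz]).
    transitivity ((Cexp (Ci * w) - Cexp (- (Ci * w))) / (2 * Ci) * (2 * Ci))%C; [|rewrite H; ring].
    field. apply Ci_nz. }
  assert (E1 : Cmod (Cexp (Ci * w)) = Cmod (Cexp (- (Ci * w)))) by now rewrite E.
  rewrite !Cmod_Cexp in E1. apply exp_inv in E1.
  assert (Hy : Im w = 0).
  { destruct w as [x y]. simpl in E1. simpl. lra. }
  split; auto.
  destruct w as [x y]. simpl in Hy. subst y. simpl.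
  change (Csin (RtoC x) = 0%C) in H. rewrite Csin_RtoC in H. now apply RtoC_inj in H.
Qed.

Lemma sin_nonint s : nonint s -> Csin (RtoC PI * s) <> 0%C.
Proof.
  intros Hs E. apply Csin_eq_0 in E. rewrite im_scal_l, re_scal_l in E. destruct E as [E1 E2].
  apply sin_eq_0_0 in E2. destruct E2 as [k Hk].
  pose proof PI_RGT_0. apply (Hs k). destruct s as [x y]. simpl in *.
  assert (x = IZR k) by (apply Rmult_eq_reg_l with PI; lra).
  assert (y = 0) by nra. unfold RtoC. now subst.
Qed.

Lemma rgamma_nonint s : nonint s -> rgamma s <> 0%C.
Proof.
  intros Hs E. apply (sin_nonint s Hs).
  pose proof (rgamma_reflection s) as H. rewrite E, Cmult_0_l in H.
  transitivity (Csin (RtoC PI * s) / RtoC PI * RtoC PI)%C; [field; apply PI_neq_C|].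
  rewrite <- H. ring.
Qed.

Lemma nonint_open s : nonint s -> exists r, 0 < r /\ forall w, Cmod (w - s) < r -> nonint w.
Proof.
  intros Hs.
  destruct (ccont_neq0_loc (fun s => Csin (RtoC PI * s)) s) as [r [Hr H]].
  - destruct (cder_Csin (RtoC PI * s)) as [l Hl].
    eapply cder_cont. apply (cder_comp Csin (fun s => RtoC PI * s)%C); [exact Hl|apply cder_scal, cder_id].
  - now apply sin_nonint.
  - exists r. split; auto. intros w Hw m E. apply (H w Hw). rewrite E, <- RtoC_mult, Csin_RtoC.
    rewrite sin_eq_0_1; auto. exists m. ring.
Qed.

Lemma nonint_1m s : nonint s -> nonint (1 - s)%C.
Proof.
  intros H m E. apply (H (1 - m)%Z). rewrite minus_IZR, RtoC_minus, <- E. ring.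
Qed.

Lemma nonint_half s : nonint s -> nonint (s / 2)%C.
Proof.
  intros H m E. apply (H (2 * m)%Z). rewrite mult_IZR, RtoC_mult, <- E. field.
Qed.

Lemma rgamma_half_neq : rgamma (/ 2) <> 0%C.
Proof.
  apply rgamma_nonint. intros m E.
  rewrite <- RtoC_inv in E by lra. apply RtoC_inj in E.
  assert (H : IZR (2 * m) = IZR 1) by (rewrite mult_IZR, <- E; simpl; lra).
  apply eq_IZR in H. lia.
Qed.

(** * Legendre's duplication formula up to a constant *)

Lemma Crising_dup w n : (Crising (w / 2) n * Crising ((w + 1) / 2) n * 2 ^ (2 * n + 2) = Crising w (2 * n + 1))%C.
Proof.
  induction n as [|n IH].
  - simpl. field.
  - replace (2 * S n + 1)%nat with (S (S (2 * n + 1))) by lia.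
    change (Crising w (S (S (2 * n + 1)))) with
      (Crising w (2 * n + 1) * (w + RtoC (INR (S (2 * n + 1)))) * (w + RtoC (INR (S (S (2 * n + 1))))))%C.
    change (Crising (w / 2) (S n)) with (Crising (w / 2) n * (w / 2 + RtoC (INR (S n))))%C.
    change (Crising ((w + 1) / 2) (S n)) with (Crising ((w + 1) / 2) n * ((w + 1) / 2 + RtoC (INR (S n))))%C.
    rewrite <- IH. replace (2 * S n + 2)%nat with (S (S (2 * n + 2))) by lia.
    rewrite !S_INR, !plus_INR, !mult_INR, !RtoC_plus, !RtoC_mult. simpl. rewrite RtoC_plus. field.
Qed.

Definition dup_const (n : nat) : C :=
  (RtoC (INR (fact n)) ^ 2 * Rcpow (INR n) (/ 2) * 2 ^ (2 * n + 2) / RtoC (INR (fact (2 * n + 1))))%C.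

Lemma rgamma_n_dup w n :
  rgamma_n (2 * n + 1) w = (rgamma_n n (w / 2) * rgamma_n n ((w + 1) / 2) * dup_const n *
    Cexp (w * RtoC (ln (INR n) - ln (INR (2 * n + 1)))))%C.
Proof.
  unfold rgamma_n. rewrite <- Crising_dup, Rcpow_quot. unfold dup_const.
  assert (E : (Rcpow (INR n) (w / 2) * Rcpow (INR n) ((w + 1) / 2) = Rcpow (INR n) w * Rcpow (INR n) (/ 2))%C).
  { rewrite <- !Rcpow_plus. f_equal. field. }
  set (a := Rcpow (INR n) (w / 2)) in *. set (b := Rcpow (INR n) ((w + 1) / 2)) in *.
  assert (Ha : a <> 0%C) by apply Rcpow_neq_0. assert (Hb : b <> 0%C) by apply Rcpow_neq_0.
  transitivity (Crising (w / 2) n * Crising ((w + 1) / 2) n * 2 ^ (2 * n + 2) *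
    (Rcpow (INR n) w * Rcpow (INR n) (/ 2)) / (RtoC (INR (fact (2 * n + 1))) * Rcpow (INR (2 * n + 1)) w * (a * b)))%C.
  - rewrite <- E. field. repeat split; auto using fact_neq_C, Rcpow_neq_0.
  - field. repeat split; auto using fact_neq_C, Rcpow_neq_0.
Qed.

Lemma clim_subseq u l (phi : nat -> nat) : (forall n, (n <= phi n)%nat) -> clim u l -> clim (fun n => u (phi n)) l.
Proof.
  intros Hp H eps He. destruct (H eps He) as [N HN]. exists N. intros n Hn. apply HN. specialize (Hp n). lia.
Qed.

Lemma clim_dup_ratio w : clim (fun n => Cexp (w * RtoC (ln (INR n) - ln (INR (2 * n + 1)))))%C (Rcpow 2 (- w)).
Proof.
  unfold Rcpow. replace (- w * RtoC (ln 2))%C with (w * RtoC (ln (/ 2)))%C.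
  2:{ rewrite ln_Rinv, RtoC_opp by lra. ring. }
  apply (clim_comp Cexp); [eapply cder_cont, cder_Cexp|]. apply clim_scal, clim_RtoC.
  apply (is_lim_seq_ext_loc (fun n => ln (/ (2 + / INR n)))).
  - exists 1%nat. intros n Hn. assert (0 < INR n) by (apply lt_0_INR; lia).
    rewrite <- ln_div.
    + f_equal. rewrite plus_INR, mult_INR. simpl. field. lra.
    + auto.
    + apply lt_0_INR. lia.
  - apply (is_lim_seq_continuous (fun x => ln x)).
    + apply continuity_pt_filterlim. apply (ex_derive_cont ln). auto_derive. lra.
    + replace (/ 2) with (/ (2 + 0)) by (f_equal; ring).
      apply (is_lim_seq_inv (fun n => 2 + / INR n) (2 + 0)).
      * apply is_lim_seq_plus'; [apply is_lim_seq_const|].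
        exact (is_lim_seq_inv INR p_infty is_lim_seq_INR ltac:(discriminate)).
      * intros E. injection E. lra.
Qed.

(** The finite identity [rgamma_n_dup] has a factor [dup_const] independent of [w]. At [w = 1] all
    the other factors converge, the divisors to a nonzero limit, so [dup_const] converges too,
    without Stirling's formula. The value of the constant is irrelevant, since only a logarithmic
    derivative is taken later. *)
Theorem rgamma_duplication : exists kappa : C, kappa <> 0%C /\
  forall w, rgamma w = (kappa * Rcpow 2 (- w) * rgamma (w / 2) * rgamma ((w + 1) / 2))%C.
Proof.
  assert (Sub : forall n, (n <= 2 * n + 1)%nat) by (intros; lia).
  assert (H1 := clim_subseq _ _ _ Sub (rgamma_clim 1)). rewrite rgamma_1 in H1.
  assert (HD : clim (fun n => rgamma_n n (1 / 2) * rgamma_n n ((1 + 1) / 2) * Cexp (1 * RtoC (ln (INR n) - ln (INR (2 * n + 1)))))%C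
    (rgamma (1 / 2) * rgamma ((1 + 1) / 2) * Rcpow 2 (- (1)))%C).
  { apply clim_mult; [apply clim_mult; apply rgamma_clim|apply clim_dup_ratio]. }
  replace ((1 + 1) / 2)%C with (RtoC 1) in HD by field. rewrite rgamma_1 in HD.
  replace (1 / 2)%C with (/ 2)%C in HD by field.
  set (c := (rgamma (/ 2) * 1 * Rcpow 2 (- (1)))%C) in *.
  assert (Hc : c <> 0%C).
  { unfold c. apply Cmult_neq_0; [apply Cmult_neq_0; auto using rgamma_half_neq, C1_nz|apply Rcpow_neq_0]. }
  assert (HK : clim dup_const (/ c)%C).
  { pose proof (clim_mult _ _ _ _ H1 (clim_inv _ _ Hc HD)) as HM. rewrite Cmult_1_l in HM.
    destruct (HD (Cmod c) ltac:(now apply Cmod_gt_0)) as [N HN].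
    apply (clim_ext_ev _ _ _ N) with (2 := HM). intros n Hn. specialize (HN n Hn). simpl in HN.
    rewrite rgamma_n_dup.
    replace ((1 + 1) / 2)%C with (RtoC 1) by field. replace (1 / 2)%C with (/ 2)%C by field.
    set (p := rgamma_n n (/ 2)) in *. set (q := rgamma_n n 1) in *. set (e := Cexp _) in *.
    assert (Hne : (p * q * e)%C <> 0%C).
    { intros E. rewrite E in HN. replace (0 - c)%C with (- c)%C in HN by ring. rewrite Cmod_opp in HN. lra. }
    assert (p <> 0%C /\ q <> 0%C /\ e <> 0%C) as [Hp [Hq He]].
    { repeat split; intros E; apply Hne; rewrite E; ring. }
    field. auto. }
  exists (/ c)%C. split.
  { intros E. apply C1_nz. rewrite <- (Cinv_r c Hc), E. ring. }
  intros w. apply (clim_unique (fun n => rgamma_n (2 * n + 1) w)).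
  - apply (clim_subseq _ _ _ Sub (rgamma_clim w)).
  - apply (clim_ext_ev (fun n => dup_const n * Cexp (w * RtoC (ln (INR n) - ln (INR (2 * n + 1)))) * rgamma_n n (w / 2) * rgamma_n n ((w + 1) / 2))%C _ _ 0).
    + intros n _. rewrite rgamma_n_dup. ring.
    + repeat apply clim_mult; auto using rgamma_clim, clim_dup_ratio.
Qed.

(** * Polya's proof of the theta functional equation *)

Lemma rsum_ext f g n : (forall k, (k < n)%nat -> f k = g k) -> rsum f n = rsum g n.
Proof.
  induction n as [|n IH]; intros H; simpl; auto.
  rewrite IH, H by (intros; auto with arith). reflexivity.
Qed.

Lemma rsum_plus f g n : rsum (fun k => f k + g k) n = rsum f n + rsum g n.
Proof. induction n as [|n IH]; simpl; [ring|rewrite IH; ring]. Qed.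

Lemma rsum_scal c f n : rsum (fun k => c * f k) n = c * rsum f n.
Proof. induction n as [|n IH]; simpl; [ring|rewrite IH; ring]. Qed.

Lemma rsum_le f g n : (forall k, (k < n)%nat -> f k <= g k) -> rsum f n <= rsum g n.
Proof.
  induction n as [|n IH]; intros H; simpl; [lra|].
  apply Rplus_le_compat; [apply IH; auto with arith|apply H; lia].
Qed.

Lemma rsum_abs f n : Rabs (rsum f n) <= rsum (fun k => Rabs (f k)) n.
Proof.
  induction n as [|n IH]; simpl; [rewrite Rabs_R0; lra|].
  eapply Rle_trans; [apply Rabs_triang|lra].
Qed.

Lemma rsum_split f n m : rsum f (n + m) = rsum f n + rsum (fun k => f (n + k)%nat) m.
Proof.
  induction m as [|m IH]; [rewrite Nat.add_0_r; simpl; ring|].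
  rewrite Nat.add_succ_r. simpl. rewrite IH. ring.
Qed.

Lemma rsum_shift f n : rsum f (S n) = f 0%nat + rsum (fun k => f (S k)) n.
Proof. change (S n) with (1 + n)%nat. rewrite rsum_split. simpl. ring. Qed.

Lemma rsum_rev f n : rsum f n = rsum (fun k => f (n - 1 - k)%nat) n.
Proof.
  induction n as [|n IH]; [reflexivity|].
  rewrite (rsum_shift (fun k => f (S n - 1 - k)%nat)). cbn [rsum]. rewrite IH.
  replace (S n - 1 - 0)%nat with n by lia. rewrite Rplus_comm. f_equal.
  apply rsum_ext. intros k Hk. f_equal. lia.
Qed.

Lemma rsum_nonneg f n : (forall k, 0 <= f k) -> 0 <= rsum f n.
Proof. intros H. induction n as [|n IH]; simpl; [lra|]. generalize (H n). lra. Qed.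

Lemma rsum_geom_le C q f n : 0 <= q < 1 -> (forall k, f k <= C * q ^ k) -> 0 <= C -> rsum f n <= C / (1 - q).
Proof.
  intros Hq Hf HC.
  assert (E : rsum (fun k => C * q ^ k) n = C / (1 - q) - C / (1 - q) * q ^ n).
  { induction n as [|n IH]; simpl; [field; lra|rewrite IH; field; lra]. }
  eapply Rle_trans; [apply rsum_le; intros k _; apply Hf|]. rewrite E.
  assert (0 <= C / (1 - q) * q ^ n).
  { apply Rmult_le_pos; [apply Rmult_le_pos; auto; left; apply Rinv_0_lt_compat; lra|apply pow_le; lra]. }
  lra.
Qed.

Lemma is_lim_rsum (a : nat -> nat -> R) (A : nat -> R) n :
  (forall j, is_lim_seq (fun q => a q j) (A j)) -> is_lim_seq (fun q => rsum (a q) n) (rsum A n).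
Proof.
  intros H. induction n as [|n IH]; simpl; [apply is_lim_seq_const|].
  apply is_lim_seq_plus'; auto.
Qed.

Lemma geom_lim A C q : 0 <= q < 1 -> 0 <= C -> (forall j, Rabs (A j) <= C * q ^ j) ->
  exists L : R, is_lim_seq (rsum A) L /\ forall n, Rabs (L - rsum A n) <= C / (1 - q) * q ^ n.
Proof.
  intros Hq HC HA.
  assert (T : forall n m, Rabs (rsum A (n + m) - rsum A n) <= C / (1 - q) * q ^ n).
  { intros n m. rewrite rsum_split. replace (rsum A n + rsum (fun k => A (n + k)%nat) m - rsum A n)
      with (rsum (fun k => A (n + k)%nat) m) by ring.
    eapply Rle_trans; [apply rsum_abs|].
    replace (C / (1 - q) * q ^ n) with (C * q ^ n / (1 - q)) by (field; lra).
    apply rsum_geom_le; auto; [|apply Rmult_le_pos; auto; apply pow_le; lra].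
    intros k. eapply Rle_trans; [apply HA|]. rewrite pow_add. right; ring. }
  assert (HK : 0 <= C / (1 - q)) by (apply Rmult_le_pos; auto; left; apply Rinv_0_lt_compat; lra).
  destruct (proj2 (ex_lim_seq_cauchy_corr (rsum A))) as [L HL].
  { intros eps.
    assert (0 < eps / (2 * (C / (1 - q) + 1))) by (apply Rdiv_lt_0_compat; [apply cond_pos|lra]).
    destruct (pow_lt_1_zero q ltac:(rewrite Rabs_pos_eq; lra) _ H) as [N HN].
    specialize (HN N ltac:(lia)). rewrite Rabs_pos_eq in HN by (apply pow_le; lra).
    assert (B : C / (1 - q) * q ^ N < eps / 2).
    { apply Rle_lt_trans with ((C / (1 - q) + 1) * q ^ N); [apply Rmult_le_compat_r; [apply pow_le; lra|lra]|].
      apply (Rmult_lt_compat_l (C / (1 - q) + 1)) in HN; [|lra].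
      eapply Rlt_le_trans; [exact HN|]. right. field. lra. }
    exists N. intros n m Hn Hm.
    pose proof (T N (n - N)%nat) as T1. pose proof (T N (m - N)%nat) as T2.
    replace (N + (n - N))%nat with n in T1 by lia. replace (N + (m - N))%nat with m in T2 by lia.
    apply Rabs_le_between in T1. apply Rabs_le_between in T2. apply Rabs_lt_between. lra. }
  exists L. split; auto. intros n.
  assert (H1 : is_lim_seq (fun m => rsum A (m + n) - rsum A n) (L - rsum A n)).
  { apply is_lim_seq_minus'; [now apply is_lim_seq_incr_n|apply is_lim_seq_const]. }
  apply is_lim_seq_abs in H1. simpl in H1.
  change (Rbar_le (Rabs (L - rsum A n)) (C / (1 - q) * q ^ n)).
  refine (is_lim_seq_le _ _ _ _ _ H1 (is_lim_seq_const _)).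
  intros m. simpl. rewrite Nat.add_comm. apply T.
Qed.

(** Beyond a cut-off [J] the geometric majorant bounds the tails uniformly in [n], and the first [J]
    terms converge one by one. The number [N n] of terms may vary with [n], because [a n] vanishes
    from [N n] on. *)
Lemma tannery (a : nat -> nat -> R) (A : nat -> R) (N : nat -> nat) C q Q0 : 0 <= q < 1 -> 0 <= C ->
  (forall n j, (Q0 <= n)%nat -> Rabs (a n j) <= C * q ^ j) ->
  (forall n j, (N n <= j)%nat -> a n j = 0) ->
  (forall j, is_lim_seq (fun n => a n j) (A j)) ->
  exists L : R, is_lim_seq (rsum A) L /\ is_lim_seq (fun n => rsum (a n) (N n)) L.
Proof.
  intros Hq HC Ha HN HA.
  assert (HAb : forall j, Rabs (A j) <= C * q ^ j).
  { intros j. pose proof (is_lim_seq_abs _ _ (HA j)) as H1. simpl in H1.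
    change (Rbar_le (Rabs (A j)) (C * q ^ j)).
    refine (is_lim_seq_le_loc _ _ _ _ _ H1 (is_lim_seq_const _)).
    exists Q0. intros n Hn. now apply Ha. }
  destruct (geom_lim A C q Hq HC HAb) as [L [HL HL']].
  exists L. split; auto.
  assert (HK : 0 <= C / (1 - q)) by (apply Rmult_le_pos; auto; left; apply Rinv_0_lt_compat; lra).
  assert (F : forall n J, (Q0 <= n)%nat -> Rabs (rsum (a n) (N n) - rsum (a n) J) <= C / (1 - q) * q ^ J).
  { intros n J Hn.
    assert (E : rsum (a n) (N n) = rsum (a n) (J + N n)).
    { rewrite Nat.add_comm, rsum_split.
      rewrite (rsum_ext (fun k => a n (N n + k)%nat) (fun _ => 0 * 0)) by (intros; rewrite HN by lia; ring).
      rewrite rsum_scal. ring. }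
    rewrite E, rsum_split. 
    replace (rsum (a n) J + rsum (fun k => a n (J + k)%nat) (N n) - rsum (a n) J)
      with (rsum (fun k => a n (J + k)%nat) (N n)) by ring.
    eapply Rle_trans; [apply rsum_abs|].
    replace (C / (1 - q) * q ^ J) with (C * q ^ J / (1 - q)) by (field; lra).
    apply rsum_geom_le; auto; [|apply Rmult_le_pos; auto; apply pow_le; lra].
    intros k. eapply Rle_trans; [now apply Ha|]. rewrite pow_add. right; ring. }
  apply is_lim_seq_spec. intros eps.
  assert (0 < eps / (3 * (C / (1 - q) + 1))) by (apply Rdiv_lt_0_compat; [apply cond_pos|lra]).
  destruct (pow_lt_1_zero q ltac:(rewrite Rabs_pos_eq; lra) _ H) as [J HJ].
  specialize (HJ J ltac:(lia)). rewrite Rabs_pos_eq in HJ by (apply pow_le; lra).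
  assert (B : C / (1 - q) * q ^ J < eps / 3).
  { apply Rle_lt_trans with ((C / (1 - q) + 1) * q ^ J); [apply Rmult_le_compat_r; [apply pow_le; lra|lra]|].
    apply (Rmult_lt_compat_l (C / (1 - q) + 1)) in HJ; [|lra].
    eapply Rlt_le_trans; [exact HJ|]. right. field. lra. }
  pose proof (is_lim_rsum a A J HA) as HJl. apply is_lim_seq_spec in HJl.
  assert (E3 : 0 < eps / 3) by (generalize (cond_pos eps); lra).
  destruct (HJl (mkposreal _ E3)) as [N1 HN1].
  exists (Q0 + N1)%nat. intros n Hn. specialize (HN1 n ltac:(lia)). simpl in HN1.
  specialize (F n J ltac:(lia)). specialize (HL' J).
  apply Rabs_le_between in F. apply Rabs_le_between in HL'. apply Rabs_lt_between in HN1.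
  apply Rabs_lt_between. lra.
Qed.

(* [walk m l] is the binomial coefficient C(2m, m + l) / 4^m. *)
Fixpoint walk (m : nat) (l : Z) : R :=
  match m with
  | O => if Z.eqb l 0 then 1 else 0
  | S m' => (walk m' (l - 1) + 2 * walk m' l + walk m' (l + 1)) / 4
  end.

Lemma walk_nonneg m l : 0 <= walk m l.
Proof.
  revert l. induction m as [|m IH]; intros l; simpl.
  - destruct (Z.eqb l 0); lra.
  - generalize (IH (l - 1)%Z) (IH l) (IH (l + 1)%Z). lra.
Qed.

Lemma walk_supp m l : (Z.of_nat m < Z.abs l)%Z -> walk m l = 0.
Proof.
  revert l. induction m as [|m IH]; intros l H; simpl.
  - destruct (Z.eqb_spec l 0); [lia|reflexivity].
  - rewrite !IH by lia. lra.
Qed.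

Lemma walk_sym m l : walk m (- l) = walk m l.
Proof.
  revert l. induction m as [|m IH]; intros l; simpl.
  - destruct (Z.eqb_spec l 0), (Z.eqb_spec (- l) 0); try lia; reflexivity.
  - replace (- l - 1)%Z with (- (l + 1))%Z by ring. replace (- l + 1)%Z with (- (l - 1))%Z by ring.
    rewrite !IH. lra.
Qed.

(** The quotient of neighbouring binomial coefficients, written without division so that it also
    holds outside the support and follows linearly from Pascal's rule. *)
Lemma walk_ratio m l : (INR m + IZR l + 1) * walk m (l + 1) = (INR m - IZR l) * walk m l.
Proof.
  revert l. induction m as [|m IH]; intros l.
  - simpl. destruct (Z.eqb_spec (l + 1) 0) as [E|E], (Z.eqb_spec l 0) as [F|F]; try lia.
    + replace l with (-1)%Z by lia. simpl. lra.
    + subst. lra.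
    + ring.
  - rewrite S_INR. cbn [walk].
    replace (l + 1 - 1)%Z with l by ring. 
    pose proof (IH l) as H1. pose proof (IH (l + 1)%Z) as H2. pose proof (IH (l - 1)%Z) as H3.
    replace (l - 1 + 1)%Z with l in H3 by ring. rewrite minus_IZR in H3. rewrite plus_IZR in H2.
    set (x := walk m l) in *. set (y := walk m (l + 1)) in *. set (z := walk m (l + 1 + 1)) in *. set (w := walk m (l - 1)) in *.
    lra.
Qed.

Lemma walk_0_S m : walk (S m) 0 = walk m 0 * ((2 * INR m + 1) / (2 * INR m + 2)).
Proof.
  cbn [walk]. rewrite <- (walk_sym m (0 - 1)). 
  replace (- (0 - 1))%Z with (0 + 1)%Z by ring.
  pose proof (walk_ratio m 0) as H. rewrite Rplus_0_r, Rminus_0_r in H.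
  generalize (pos_INR m). intros Hm.
  replace (walk m (0 + 1)) with (INR m * walk m 0 / (INR m + 1)) by (rewrite <- H; field; lra).
  field. lra.
Qed.

Lemma walk_0_pos m : 0 < walk m 0.
Proof.
  induction m as [|m IH]; [simpl; lra|]. rewrite walk_0_S.
  generalize (pos_INR m). intros. apply Rmult_lt_0_compat; auto. apply Rdiv_lt_0_compat; lra.
Qed.

(** The sequence [m * (walk m 0)^2] increases and is bounded because [(2 m + 1) * (walk m 0)^2]
    decreases. The limit need not be known: the functional equation at [x = 1] determines it. *)
Lemma walk_0_asymptotic : exists c : R, is_lim_seq (fun m => sqrt (INR m) * walk m 0) c.
Proof.
  assert (B : forall m, (2 * INR m + 1) * walk m 0 ^ 2 <= 1).
  { induction m as [|m IH]; [simpl; lra|]. rewrite walk_0_S, S_INR. generalize (pos_INR m). intros Hm.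
    eapply Rle_trans; [|exact IH].
    replace ((2 * (INR m + 1) + 1) * (walk m 0 * ((2 * INR m + 1) / (2 * INR m + 2))) ^ 2) with
      ((2 * INR m + 1) * walk m 0 ^ 2 * ((2 * INR m + 3) * (2 * INR m + 1) / (2 * INR m + 2) ^ 2)) by (field; lra).
    rewrite <- (Rmult_1_r ((2 * INR m + 1) * walk m 0 ^ 2)) at 2. apply Rmult_le_compat_l.
    - apply Rmult_le_pos; [lra|apply pow2_ge_0].
    - apply Rmult_le_reg_r with ((2 * INR m + 2) ^ 2); [apply pow_lt; lra|].
      unfold Rdiv. rewrite Rmult_assoc, Rinv_l by (apply pow_nonzero; lra). nra. }
  destruct (ex_finite_lim_seq_incr (fun m => INR m * walk m 0 ^ 2) 1) as [y Hy].
  - intros m. rewrite walk_0_S, S_INR. generalize (pos_INR m). intros Hm.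
    replace ((INR m + 1) * (walk m 0 * ((2 * INR m + 1) / (2 * INR m + 2))) ^ 2) with
      (walk m 0 ^ 2 * ((2 * INR m + 1) ^ 2 / (4 * (INR m + 1)))) by (field; lra).
    rewrite (Rmult_comm (INR m)). apply Rmult_le_compat_l; [apply pow2_ge_0|].
    apply Rmult_le_reg_r with (4 * (INR m + 1)); [lra|].
    unfold Rdiv. rewrite Rmult_assoc, Rinv_l by lra. nra.
  - intros m. eapply Rle_trans; [|apply (B m)]. generalize (pos_INR m) (pow2_ge_0 (walk m 0)). intros. nra.
  - exists (sqrt y). apply (is_lim_seq_ext (fun m => sqrt (INR m * walk m 0 ^ 2))).
    + intros m. rewrite sqrt_mult by (try apply pos_INR; apply pow2_ge_0).
      f_equal. simpl. rewrite Rmult_1_r. apply sqrt_square. left. apply walk_0_pos.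
    + apply (is_lim_seq_continuous sqrt); auto. apply continuity_pt_sqrt.
      change (Rbar_le 0 y). refine (is_lim_seq_le _ _ _ _ _ (is_lim_seq_const 0) Hy).
      intros m. apply Rmult_le_pos; [apply pos_INR|apply pow2_ge_0].
Qed.

Definition sym_sum (f : Z -> R) (K : nat) : R :=
  f 0%Z + rsum (fun k => f (Z.of_nat (S k)) + f (- Z.of_nat (S k))%Z) K.

Lemma sym_sum_ext (f g : Z -> R) K : (forall k, f k = g k) -> sym_sum f K = sym_sum g K.
Proof. intros H. unfold sym_sum. rewrite H. f_equal. apply rsum_ext. intros k _. now rewrite !H. Qed.

Lemma sym_sum_lin (f g h : Z -> R) K :
  sym_sum (fun k => (f k + 2 * g k + h k) / 4) K = (sym_sum f K + 2 * sym_sum g K + sym_sum h K) / 4.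
Proof. unfold sym_sum. induction K as [|K IH]; cbn [rsum]; lra. Qed.

(** The Fourier side: the distribution after [m] steps of the lazy walk on the cycle Z/n started at
    0, whose eigenvalues are [cos^2 (PI j / n)]. *)
Definition cyc_walk (n m : nat) (r : Z) : R :=
  / INR n * rsum (fun j => cos (PI * INR j / INR n) ^ (2 * m) * cos (2 * (PI * INR j / INR n) * IZR r)) n.

Lemma cyc_walk_S n m r : cyc_walk n (S m) r =
  (cyc_walk n m (r - 1) + 2 * cyc_walk n m r + cyc_walk n m (r + 1)) / 4.
Proof.
  unfold cyc_walk.
  transitivity (/ INR n * (/ 4 * (rsum (fun j => cos (PI * INR j / INR n) ^ (2 * m) * cos (2 * (PI * INR j / INR n) * IZR (r - 1))) n
   + 2 * rsum (fun j => cos (PI * INR j / INR n) ^ (2 * m) * cos (2 * (PI * INR j / INR n) * IZR r)) n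
   + rsum (fun j => cos (PI * INR j / INR n) ^ (2 * m) * cos (2 * (PI * INR j / INR n) * IZR (r + 1))) n))).
  2:{ lra. }
  f_equal. rewrite <- rsum_scal, <- !rsum_plus, <- rsum_scal. apply rsum_ext. intros j _.
  set (a := PI * INR j / INR n). rewrite minus_IZR, plus_IZR.
  replace (2 * a * (IZR r - 1)) with (2 * a * IZR r - 2 * a) by ring.
  replace (2 * a * (IZR r + 1)) with (2 * a * IZR r + 2 * a) by ring.
  rewrite cos_minus, cos_plus, (cos_2a_cos a).
  replace (2 * S m)%nat with (2 * m + 2)%nat by lia. rewrite pow_add. set (p := cos a ^ (2 * m)). simpl pow. field.
Qed.

Lemma cyc_walk_0 n r : (0 < n)%nat -> cyc_walk n 0 r = if Z.eqb (r mod Z.of_nat n) 0 then 1 else 0.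
Proof.
  intros Hn. assert (Nn : INR n <> 0) by (apply not_0_INR; lia).
  unfold cyc_walk. 
  rewrite (rsum_ext _ (fun j => cos (INR j * (2 * PI * IZR r / INR n)))).
  2:{ intros j _. rewrite Nat.mul_0_r. simpl pow. rewrite Rmult_1_l. f_equal. field. auto. }
  destruct (Z.eqb_spec (r mod Z.of_nat n) 0) as [E|E].
  - apply Z.mod_divide in E; [|lia]. destruct E as [k ->].
    rewrite (rsum_ext _ (fun j => 1 * 1)).
    + assert (S1 : forall p, rsum (fun _ => 1 * 1) p = INR p).
      { induction p as [|p IH]; [reflexivity|]. rewrite S_INR. simpl. rewrite IH. ring. }
      rewrite S1. field. auto.
    + intros j _. replace (INR j * (2 * PI * IZR (k * Z.of_nat n) / INR n)) with (0 + 2 * IZR (Z.of_nat j * k) * PI).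
      * assert (P : forall z : Z, cos (0 + 2 * IZR z * PI) = 1).
        { intros z. destruct (Z_le_gt_dec 0 z) as [h|h].
          - destruct (Z_of_nat_complete z h) as [p ->]. rewrite <- INR_IZR_INZ, cos_period. apply cos_0.
          - destruct (Z_of_nat_complete (- z) ltac:(lia)) as [p Hp].
            rewrite <- cos_neg. replace (- (0 + 2 * IZR z * PI)) with (0 + 2 * INR p * PI).
            + rewrite cos_period. apply cos_0.
            + rewrite INR_IZR_INZ, <- Hp, opp_IZR. ring. }
        rewrite P. ring.
      * rewrite !mult_IZR, <- !INR_IZR_INZ. field. auto.
  - set (x := 2 * PI * IZR r / INR n).
    (* Multiplication by [2 * sin (x / 2)] makes the sum of cosines telescope. *)
    assert (T : forall p, 2 * sin (x / 2) * rsum (fun j => cos (INR j * x)) p = sin (INR p * x - x / 2) + sin (x / 2)).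
    { induction p as [|p IH].
      - cbn [rsum]. rewrite Rmult_0_l. replace (0 - x / 2) with (- (x / 2)) by ring. rewrite sin_neg. ring.
      - cbn [rsum]. rewrite Rmult_plus_distr_l, IH, S_INR.
        replace ((INR p + 1) * x - x / 2) with (INR p * x + x / 2) by field.
        rewrite sin_minus, sin_plus. ring. }
    specialize (T n).
    replace (INR n * x - x / 2) with (2 * IZR r * PI - x / 2) in T by (unfold x; field; auto).
    rewrite sin_minus in T.
    assert (S0 : sin (2 * IZR r * PI) = 0).
    { apply sin_eq_0_1. exists (2 * r)%Z. rewrite mult_IZR. ring. }
    assert (C0 : cos (2 * IZR r * PI) = 1).
    { replace (2 * IZR r * PI) with (2 * (IZR r * PI)) by ring. rewrite cos_2a_sin.
      rewrite (sin_eq_0_1 (IZR r * PI)) by (exists r; reflexivity). ring. }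
    rewrite S0, C0 in T.
    assert (Ns : sin (x / 2) <> 0).
    { intros F. apply sin_eq_0_0 in F. destruct F as [k Hk]. apply E.
      apply Z.mod_divide; [lia|]. exists k. apply eq_IZR. rewrite mult_IZR, <- INR_IZR_INZ.
      apply Rmult_eq_reg_r with (PI / INR n).
      - transitivity (x / 2); [unfold x; field; auto|rewrite Hk; field; auto].
      - apply Rgt_not_eq, Rdiv_lt_0_compat; [apply PI_RGT_0|apply lt_0_INR; lia]. }
    assert (Z0 : rsum (fun j => cos (INR j * x)) n = 0).
    { apply Rmult_eq_reg_l with (2 * sin (x / 2)); [|lra]. rewrite T. ring. }
    rewrite Z0. ring.
Qed.

Lemma sym_sum_single (f : Z -> R) K (k0 : Z) : (Z.abs k0 <= Z.of_nat K)%Z ->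
  (forall k, k <> k0 -> f k = 0) -> sym_sum f K = f k0.
Proof.
  intros H0 Hf. unfold sym_sum. induction K as [|K IH].
  - replace k0 with 0%Z by lia. simpl. ring.
  - cbn [rsum]. destruct (Z_le_gt_dec (Z.abs k0) (Z.of_nat K)) as [h|h].
    + rewrite <- Rplus_assoc, IH by auto. rewrite (Hf (Z.of_nat (S K))), (Hf (- Z.of_nat (S K))%Z) by lia. ring.
    + rewrite (Hf 0%Z) by lia.
      rewrite (rsum_ext _ (fun _ => 0 * 0)) by (intros k Hk; rewrite !Hf by lia; ring). rewrite rsum_scal.
      destruct (Z_le_gt_dec 0 k0).
      * rewrite (Hf (- Z.of_nat (S K))%Z) by lia. replace k0 with (Z.of_nat (S K)) by lia. ring.
      * rewrite (Hf (Z.of_nat (S K))%Z) by lia. replace k0 with (- Z.of_nat (S K))%Z by lia. ring.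
Qed.

(* Both sides satisfy the recursion of the lazy random walk on the cycle of length [n]. *)
Lemma cyc_walk_periodize n K m r : (0 < n)%nat ->
  (Z.of_nat m < (Z.of_nat K + 1) * Z.of_nat n - Z.abs r)%Z ->
  cyc_walk n m r = sym_sum (fun k => walk m (r + k * Z.of_nat n)) K.
Proof.
  intros Hn. revert r. induction m as [|m IH]; intros r Hr.
  - rewrite cyc_walk_0 by auto. destruct (Z.eqb_spec (r mod Z.of_nat n) 0) as [E|E].
    + apply Z.mod_divide in E; [|lia]. destruct E as [k ->].
      rewrite (sym_sum_single _ K (- k)).
      * replace (k * Z.of_nat n + - k * Z.of_nat n)%Z with 0%Z by ring. reflexivity.
      * rewrite Z.abs_mul in Hr. nia.
      * intros k' Hk'. simpl. destruct (Z.eqb_spec (k * Z.of_nat n + k' * Z.of_nat n) 0); [nia|reflexivity].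
    + rewrite (sym_sum_single _ K 0); [|lia|].
      * simpl. destruct (Z.eqb_spec (r + 0) 0); [|reflexivity]. exfalso. apply E.
        replace r with 0%Z by lia. apply Z.mod_0_l. lia.
      * intros k _. simpl. destruct (Z.eqb_spec (r + k * Z.of_nat n) 0) as [F|F]; [|reflexivity].
        exfalso. apply E. apply Z.mod_divide; [lia|]. exists (- k)%Z. lia.
  - rewrite cyc_walk_S, !IH by lia. rewrite <- sym_sum_lin.
    apply sym_sum_ext. intros k. cbn [walk].
    replace (r - 1 + k * Z.of_nat n)%Z with (r + k * Z.of_nat n - 1)%Z by ring.
    replace (r + 1 + k * Z.of_nat n)%Z with (r + k * Z.of_nat n + 1)%Z by ring.
    reflexivity.
Qed.

Lemma exp_pow_INR a n : exp a ^ n = exp (a * INR n).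
Proof.
  induction n as [|n IH]; [rewrite Rmult_0_r, exp_0; reflexivity|].
  rewrite S_INR. simpl. rewrite IH, <- exp_plus. f_equal. ring.
Qed.

Lemma exp_le_compat a b : a <= b -> exp a <= exp b.
Proof. intros [H|H]; [left; now apply exp_increasing|rewrite H; lra]. Qed.

Lemma is_lim_eq (u : nat -> R) (l l' : R) : is_lim_seq u l -> l = l' -> is_lim_seq u l'.
Proof. now intros H <-. Qed.

Lemma is_lim_opp (u : nat -> R) (l : R) : is_lim_seq u l -> is_lim_seq (fun n => - u n) (- l).
Proof. exact (proj1 (is_lim_seq_opp u l)). Qed.

Lemma is_lim_exp (u : nat -> R) (l : R) : is_lim_seq u l -> is_lim_seq (fun n => exp (u n)) (exp l).
Proof.
  intros H. apply (is_lim_seq_continuous exp); auto.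
  apply derivable_continuous_pt, derivable_pt_exp.
Qed.

Definition theta_term (x : R) (j : nat) : R := exp (- (PI * INR (S j) ^ 2 * x)).

(** [1 + 2 * psi x] is Jacobi's theta function at [x]. *)
Definition psi (x : R) : R := real (Lim_seq (rsum (theta_term x))).

Lemma theta_term_geom x j : 0 < x -> theta_term x j <= exp (- (PI * x)) * exp (- (PI * x)) ^ j.
Proof.
  intros Hx. change (exp (- (PI * x)) * exp (- (PI * x)) ^ j) with (exp (- (PI * x)) ^ S j).
  rewrite exp_pow_INR. apply exp_le_compat.
  assert (1 <= INR (S j)) by (apply (le_INR 1); lia).
  assert (0 < PI * x) by (apply Rmult_lt_0_compat; auto; apply PI_RGT_0).
  assert (INR (S j) <= INR (S j) ^ 2) by (set (y := INR (S j)) in *; simpl; nra).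
  assert (PI * x * INR (S j) <= PI * x * INR (S j) ^ 2) by (apply Rmult_le_compat_l; lra).
  lra.
Qed.

Lemma exp_neg_lt1 a : 0 < a -> 0 <= exp (- a) < 1.
Proof.
  intros Ha. split; [left; apply exp_pos|]. rewrite <- exp_0. apply exp_increasing. lra.
Qed.

Lemma PI_x_pos x : 0 < x -> 0 < PI * x.
Proof. intros. apply Rmult_lt_0_compat; auto. apply PI_RGT_0. Qed.

Lemma psi_lim x : 0 < x -> is_lim_seq (rsum (theta_term x)) (psi x).
Proof.
  intros Hx.
  destruct (geom_lim (theta_term x) (exp (- (PI * x))) (exp (- (PI * x)))) as [L [HL _]].
  - apply exp_neg_lt1. now apply PI_x_pos.
  - left; apply exp_pos.
  - intros j. rewrite Rabs_pos_eq by (left; apply exp_pos). now apply theta_term_geom.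
  - unfold psi. rewrite (is_lim_seq_unique _ _ HL). exact HL.
Qed.

Lemma rsum_psi_le x n : 0 < x -> rsum (theta_term x) n <= psi x.
Proof.
  intros Hx. change (Rbar_le (rsum (theta_term x) n) (psi x)).
  refine (is_lim_seq_le_loc _ _ _ _ _ (is_lim_seq_const _) (psi_lim x Hx)).
  exists n. intros m Hm. replace m with (n + (m - n))%nat by lia. rewrite rsum_split.
  assert (0 <= rsum (fun k => theta_term x (n + k)) (m - n)) by (apply rsum_nonneg; intros; left; apply exp_pos).
  lra.
Qed.

(** The case [r = 0] of the periodization on a cycle of odd length: [j] and [n - j] give the same
    even power of a cosine, and only [j = 0] is unpaired. It is a finite form of Poisson summation
    for the Gaussian. *)
Lemma theta_finite q m K : (m < (K + 1) * (2 * q + 1))%nat ->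
  1 + 2 * rsum (fun j => cos (PI * INR (S j) / INR (2 * q + 1)) ^ (2 * m)) q =
  INR (2 * q + 1) * (walk m 0 + 2 * rsum (fun k => walk m (Z.of_nat (S k) * Z.of_nat (2 * q + 1))) K).
Proof.
  intros HK. set (n := (2 * q + 1)%nat).
  assert (Hn : INR n <> 0) by (apply not_0_INR; unfold n; lia).
  pose proof (cyc_walk_periodize n K m 0 ltac:(unfold n; lia) ltac:(fold n in HK; simpl Z.abs; nia)) as P.
  assert (E2 : sym_sum (fun k => walk m (0 + k * Z.of_nat n)) K =
    walk m 0 + 2 * rsum (fun k => walk m (Z.of_nat (S k) * Z.of_nat n)) K).
  { unfold sym_sum. rewrite <- rsum_scal. f_equal. apply rsum_ext. intros k _.
    rewrite <- (walk_sym m (0 + - Z.of_nat (S k) * Z.of_nat n)).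
    replace (- (0 + - Z.of_nat (S k) * Z.of_nat n))%Z with (Z.of_nat (S k) * Z.of_nat n)%Z by ring.
    rewrite Z.add_0_l. ring. }
  rewrite E2 in P. rewrite <- P. unfold cyc_walk. rewrite <- Rmult_assoc, Rinv_r, Rmult_1_l by auto.
  set (g := fun j => cos (PI * INR j / INR n) ^ (2 * m)).
  rewrite (rsum_ext (fun j => cos (PI * INR j / INR n) ^ (2 * m) * cos (2 * (PI * INR j / INR n) * 0)) g)
    by (intros j _; unfold g; cbv beta; rewrite Rmult_0_r, cos_0; ring).
  assert (En : rsum g n = rsum g (S (q + q))) by (f_equal; unfold n; lia).
  rewrite En, rsum_shift, rsum_split.
  assert (G0 : g 0%nat = 1).
  { unfold g. simpl (INR 0). replace (PI * 0 / INR n) with 0 by (field; auto). rewrite cos_0. apply pow1. }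
  assert (GR : rsum (fun k => g (S (q + k))) q = rsum (fun k => g (S k)) q).
  { rewrite rsum_rev. apply rsum_ext. intros k Hk. unfold g.
    replace (INR (S (q + (q - 1 - k)))) with (INR n - INR (S k)).
    - replace (PI * (INR n - INR (S k)) / INR n) with (PI - PI * INR (S k) / INR n) by (field; auto).
      rewrite cos_minus, cos_PI, sin_PI.
      replace (-1 * cos (PI * INR (S k) / INR n) + 0 * sin (PI * INR (S k) / INR n))
        with (- cos (PI * INR (S k) / INR n)) by ring.
      rewrite !pow_mult. f_equal. ring.
    - rewrite <- minus_INR by (unfold n; lia). f_equal. unfold n. lia. }
  rewrite G0, GR. unfold g. ring.
Qed.

(** The first bound is asymptotically sharp at 0 and serves for the limit of the terms; the second
    holds with a uniform constant and serves as a majorant. Both come from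
    [1 - cos x = 2 sin^2 (x / 2)] and [t cos t <= sin t]. *)
Lemma cos_upper x : 0 <= x <= PI / 2 -> cos x <= exp (- (x ^ 2 / 2 * (1 - x ^ 2 / 4))) /\ cos x <= exp (- (x ^ 2 / 4)).
Proof.
  intros Hx.
  assert (H1 : x / 2 * cos (x / 2) <= sin (x / 2)) by (apply t_cos_le_sin; lra).
  assert (Hc : 0 <= cos x) by (apply cos_ge_0; lra).
  assert (Hc2 : 0 <= cos (x / 2)) by (apply cos_ge_0; lra).
  assert (E : cos x = 1 - 2 * sin (x / 2) * sin (x / 2)).
  { replace x with (2 * (x / 2)) at 1 by field. apply cos_2a_sin. }
  generalize (sin2_cos2 (x / 2)). unfold Rsqr. intros S2.
  assert (H2 : (x / 2 * cos (x / 2)) ^ 2 <= sin (x / 2) ^ 2).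
  { apply pow_incr. split; auto. apply Rmult_le_pos; lra. }
  assert (H3 : sin (x / 2) ^ 2 <= (x / 2) ^ 2).
  { rewrite <- (pow2_abs (sin (x / 2))), <- (pow2_abs (x / 2)). apply pow_incr. split; [apply Rabs_pos|apply Rabs_sin_le]. }
  assert (C2 : cos (x / 2) ^ 2 = 1 - sin (x / 2) ^ 2) by (simpl; lra).
  rewrite Rpow_mult_distr, C2 in H2.
  assert (Hx2 : 0 <= (x / 2) ^ 2) by apply pow2_ge_0.
  assert (A : forall a, 1 - cos x >= a -> cos x <= exp (- a)).
  { intros a Ha. generalize (exp_ineq1_le (- a)). lra. }
  split; apply A.
  - assert ((x / 2) ^ 2 * (1 - (x / 2) ^ 2) <= sin (x / 2) ^ 2).
    { eapply Rle_trans; [|exact H2]. apply Rmult_le_compat_l; auto. lra. }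
    replace (x ^ 2 / 2 * (1 - x ^ 2 / 4)) with (2 * ((x / 2) ^ 2 * (1 - (x / 2) ^ 2))) by field.
    simpl in *. lra.
  - assert (sin (x / 2) ^ 2 <= 1 / 2) by (simpl; lra).
    assert ((x / 2) ^ 2 * (1 / 2) <= sin (x / 2) ^ 2).
    { eapply Rle_trans; [|exact H2]. apply Rmult_le_compat_l; auto. lra. }
    replace (x ^ 2 / 4) with (2 * ((x / 2) ^ 2 * (1 / 2))) by field.
    simpl in *. lra.
Qed.

Lemma one_minus_lower y : 0 <= y < 1 -> exp (- (y / (1 - y))) <= 1 - y.
Proof.
  intros Hy. rewrite exp_Ropp.
  apply Rmult_le_reg_l with (exp (y / (1 - y))); [apply exp_pos|].
  rewrite Rinv_r by (apply Rgt_not_eq, exp_pos).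
  generalize (exp_ineq1_le (y / (1 - y))). intros H.
  replace 1 with ((1 + y / (1 - y)) * (1 - y)) at 1 by (field; lra).
  apply Rmult_le_compat_r; lra.
Qed.

Lemma cos_lower x : 0 <= x -> x ^ 2 < 2 -> exp (- (x ^ 2 / 2 / (1 - x ^ 2 / 2))) <= cos x.
Proof.
  intros H0 Hx. eapply Rle_trans; [apply one_minus_lower; generalize (pow2_ge_0 x); lra|].
  generalize (cos_taylor1 x). intros H. apply Rabs_le_between in H. lra.
Qed.

Lemma walk_quotient_S m l : walk m (Z.of_nat (S l)) / walk m 0 =
  (INR m - INR l) / (INR m + INR l + 1) * (walk m (Z.of_nat l) / walk m 0).
Proof.
  pose proof (walk_ratio m (Z.of_nat l)) as H. rewrite <- INR_IZR_INZ in H.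
  replace (Z.of_nat l + 1)%Z with (Z.of_nat (S l)) in H by lia.
  generalize (pos_INR m) (pos_INR l) (walk_0_pos m). intros.
  replace (walk m (Z.of_nat (S l))) with ((INR m - INR l) * walk m (Z.of_nat l) / (INR m + INR l + 1))
    by (rewrite <- H; field; lra).
  field. lra.
Qed.

Lemma walk_quotient_nonneg m l : 0 <= walk m l / walk m 0.
Proof.
  apply Rmult_le_pos; [apply walk_nonneg|]. left. apply Rinv_0_lt_compat, walk_0_pos.
Qed.

(** The quotient is the product of [(m - i) / (m + i + 1)] over [i < L]. Each factor is at most
    [exp (- (2 i + 1) / (m + L))], and the odd numbers [2 i + 1] add up to [L^2]. The lower bound
    has the same proof with [m - L]. *)
Lemma walk_upper m L : (L <= m)%nat -> walk m (Z.of_nat L) / walk m 0 <= exp (- (INR L ^ 2 / (INR m + INR L))).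
Proof.
  intros HL.
  assert (A : forall i, (i <= L)%nat -> walk m (Z.of_nat i) / walk m 0 <= exp (- (INR i ^ 2 / (INR m + INR L)))).
  { induction i as [|i IH]; intros Hi.
    - simpl Z.of_nat. rewrite Rdiv_diag by (apply Rgt_not_eq, walk_0_pos).
      simpl INR. replace (- (0 ^ 2 / (INR m + INR L))) with 0 by (unfold Rdiv; ring). rewrite exp_0. lra.
    - rewrite walk_quotient_S.
      assert (i + 1 <= L)%nat by lia.
      assert (H1 : INR i + 1 <= INR L) by (rewrite <- S_INR; apply le_INR; lia).
      assert (H2 : INR L <= INR m) by (apply le_INR; lia).
      generalize (pos_INR i). intros H0.
      apply Rle_trans with (exp (- ((2 * INR i + 1) / (INR m + INR L))) * exp (- (INR i ^ 2 / (INR m + INR L)))).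
      + apply Rmult_le_compat; [|apply walk_quotient_nonneg| |apply IH; lia].
        * apply Rmult_le_pos; [lra|]. left. apply Rinv_0_lt_compat. lra.
        * apply Rle_trans with (exp (- ((2 * INR i + 1) / (INR m + INR i + 1)))).
          -- replace ((INR m - INR i) / (INR m + INR i + 1)) with (1 + - ((2 * INR i + 1) / (INR m + INR i + 1))) by (field; lra).
             apply exp_ineq1_le.
          -- apply exp_le_compat, Ropp_le_contravar. apply Rmult_le_compat_l; [lra|].
             apply Rinv_le_contravar; lra.
      + rewrite <- exp_plus, S_INR. right. f_equal. field. lra. }
  apply A. lia.
Qed.

Lemma walk_lower m L : (L < m)%nat -> exp (- (INR L ^ 2 / (INR m - INR L))) <= walk m (Z.of_nat L) / walk m 0.
Proof.
  intros HL. assert (HLm : INR L < INR m) by (apply lt_INR; lia).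
  assert (A : forall i, (i <= L)%nat -> exp (- (INR i ^ 2 / (INR m - INR L))) <= walk m (Z.of_nat i) / walk m 0).
  { induction i as [|i IH]; intros Hi.
    - simpl Z.of_nat. rewrite Rdiv_diag by (apply Rgt_not_eq, walk_0_pos).
      simpl INR. replace (- (0 ^ 2 / (INR m - INR L))) with 0 by (unfold Rdiv; ring). rewrite exp_0. lra.
    - rewrite walk_quotient_S.
      assert (H1 : INR i + 1 <= INR L) by (rewrite <- S_INR; apply le_INR; lia).
      generalize (pos_INR i). intros H0.
      apply Rle_trans with (exp (- ((2 * INR i + 1) / (INR m - INR L))) * exp (- (INR i ^ 2 / (INR m - INR L)))).
      + rewrite <- exp_plus, S_INR. right. f_equal. field. lra.
      + apply Rmult_le_compat; try (left; apply exp_pos); [|apply IH; lia].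
        apply Rle_trans with (exp (- ((2 * INR i + 1) / (INR m - INR i)))).
        * apply exp_le_compat, Ropp_le_contravar. apply Rmult_le_compat_l; [lra|].
          apply Rinv_le_contravar; lra.
        * rewrite exp_Ropp.
          replace ((INR m - INR i) / (INR m + INR i + 1)) with (/ (1 + (2 * INR i + 1) / (INR m - INR i))) by (field; lra).
          apply Rinv_le_contravar; [|apply exp_ineq1_le].
          assert (0 < (2 * INR i + 1) / (INR m - INR i)) by (apply Rdiv_lt_0_compat; lra). lra. }
  apply A. lia.
Qed.

Section ThetaLimit.
Variable tau : R.
Hypothesis Htau : 0 < tau.

Definition odd_n (q : nat) : nat := (2 * q + 1)%nat.
(** The diffusive scale: with about [tau * n^2] steps the powers of cosines and the quotients of
    binomials both converge, to theta terms at [PI * tau] and at [/ (PI * tau)]. *)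
Definition steps (q : nat) : nat := Z.to_nat (up (tau * INR (odd_n q) ^ 2)).

Lemma odd_n_ge q : 1 <= INR (odd_n q) /\ INR q <= INR (odd_n q).
Proof. split; [apply (le_INR 1)|apply le_INR]; unfold odd_n; lia. Qed.

Lemma steps_bound q : tau * INR (odd_n q) ^ 2 <= INR (steps q) <= tau * INR (odd_n q) ^ 2 + 1.
Proof.
  destruct (odd_n_ge q) as [H1 _]. unfold steps.
  set (x := tau * INR (odd_n q) ^ 2).
  assert (Hx : 0 < x) by (apply Rmult_lt_0_compat; auto; apply pow_lt; lra).
  destruct (archimed x) as [A1 A2].
  rewrite INR_IZR_INZ, Z2Nat.id by (apply le_IZR; lra). lra.
Qed.

Lemma lim_inv_n : is_lim_seq (fun q => / INR (odd_n q)) 0.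
Proof.
  apply (is_lim_seq_le_le_loc (fun _ => 0) _ (fun q => / INR q)).
  - exists 1%nat. intros q Hq. destruct (odd_n_ge q) as [H1 H2].
    assert (0 < INR q) by (apply lt_0_INR; lia). split; [left; apply Rinv_0_lt_compat; lra|].
    apply Rinv_le_contravar; lra.
  - apply is_lim_seq_const.
  - exact (is_lim_seq_inv INR p_infty is_lim_seq_INR ltac:(discriminate)).
Qed.

Definition rho (q : nat) : R := INR (steps q) / INR (odd_n q) ^ 2.

Lemma rho_bound q : tau <= rho q <= tau + / INR (odd_n q) ^ 2.
Proof.
  destruct (odd_n_ge q) as [H1 _]. pose proof (steps_bound q) as [S1 S2]. unfold rho.
  assert (P : 0 < INR (odd_n q) ^ 2) by (apply pow_lt; lra).
  split.
  - apply Rmult_le_reg_r with (INR (odd_n q) ^ 2); auto. unfold Rdiv. rewrite Rmult_assoc, Rinv_l; lra.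
  - apply Rmult_le_reg_r with (INR (odd_n q) ^ 2); auto. unfold Rdiv.
    rewrite Rmult_assoc, Rinv_l, Rmult_plus_distr_r, Rinv_l; lra.
Qed.

Lemma lim_rho : is_lim_seq rho tau.
Proof.
  apply (is_lim_seq_le_le (fun _ => tau) _ (fun q => tau + / INR (odd_n q) * / INR (odd_n q))).
  - intros q. pose proof (rho_bound q) as [H1 H2]. split; auto.
    eapply Rle_trans; [exact H2|]. right. f_equal. simpl. rewrite Rmult_1_r, Rinv_mult. reflexivity.
  - apply is_lim_seq_const.
  - eapply is_lim_eq; [apply is_lim_seq_plus'; [apply is_lim_seq_const|apply is_lim_seq_mult'; apply lim_inv_n]|ring].
Qed.

Lemma steps_infty : filterlim steps Hierarchy.eventually Hierarchy.eventually.
Proof.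
  intros P [N HN]. destruct (nat_above (INR N / tau)) as [Q [HQ _]].
  exists Q. intros q Hq. apply HN. apply INR_le.
  destruct (odd_n_ge q) as [H1 H2]. destruct (steps_bound q) as [H3 _].
  apply le_INR in Hq.
  assert (INR N <= tau * INR q).
  { apply Rle_trans with (tau * (INR N / tau)); [right; field; lra|]. apply Rmult_le_compat_l; lra. }
  assert (INR q <= INR (odd_n q) ^ 2) by (simpl; nra). nra.
Qed.

Definition cos_part (q j : nat) : R :=
  if Nat.ltb j q then cos (PI * INR (S j) / INR (odd_n q)) ^ (2 * steps q) else 0.

Definition walk_part (q k : nat) : R :=
  walk (steps q) (Z.of_nat (S k) * Z.of_nat (odd_n q)) / walk (steps q) 0.

Lemma cos_part_arg q j : (j < q)%nat -> 0 <= PI * INR (S j) / INR (odd_n q) <= PI / 2.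
Proof.
  intros Hj. destruct (odd_n_ge q) as [H1 _].
  assert (H2 : 2 * INR (S j) <= INR (odd_n q)).
  { replace 2 with (INR 2) by reflexivity. rewrite <- mult_INR. apply le_INR. unfold odd_n. lia. }
  pose proof PI_RGT_0. pose proof (pos_INR (S j)). split.
  - apply Rmult_le_pos; [apply Rmult_le_pos; lra|left; apply Rinv_0_lt_compat; lra].
  - apply Rmult_le_reg_r with (INR (odd_n q)); [lra|]. unfold Rdiv. rewrite Rmult_assoc, Rinv_l by lra. nra.
Qed.

Lemma pow_exp_le x a n : 0 <= x -> x <= exp a -> x ^ n <= exp (a * INR n).
Proof. intros H0 H. rewrite <- exp_pow_INR. apply pow_incr; auto. Qed.

Lemma pow_exp_ge x a n : exp a <= x -> exp (a * INR n) <= x ^ n.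
Proof. intros H. rewrite <- exp_pow_INR. apply pow_incr. split; auto. left; apply exp_pos. Qed.

Lemma cos_part_dom q j : Rabs (cos_part q j) <= 1 * exp (- tau) ^ j.
Proof.
  unfold cos_part. destruct (Nat.ltb_spec j q) as [Hj|Hj].
  2:{ rewrite Rabs_R0, Rmult_1_l. apply pow_le. left; apply exp_pos. }
  pose proof (cos_part_arg q j Hj) as Hx. set (x := PI * INR (S j) / INR (odd_n q)) in *.
  assert (Hc : 0 <= cos x) by (apply cos_ge_0; lra).
  rewrite Rabs_pos_eq by (now apply pow_le).
  eapply Rle_trans; [apply (pow_exp_le _ (- (x ^ 2 / 4))); auto; now apply cos_upper|].
  rewrite Rmult_1_l, exp_pow_INR. apply exp_le_compat.
  destruct (odd_n_ge q) as [H1 _]. destruct (steps_bound q) as [H3 _].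
  rewrite mult_INR. simpl (INR 2).
  assert (Hx2 : x ^ 2 * INR (odd_n q) ^ 2 = PI ^ 2 * INR (S j) ^ 2) by (unfold x; field; lra).
  assert (HPI : 2 < PI) by (generalize PI2_1; lra).
  assert (Hj1 : INR j <= INR (S j) ^ 2) by (rewrite S_INR; generalize (pos_INR j); simpl; nra).
  assert (P2 : 4 <= PI ^ 2) by (simpl; nra).
  assert (x ^ 2 * INR (steps q) >= 4 * tau * INR j).
  { apply Rle_ge. apply Rle_trans with (x ^ 2 * (tau * INR (odd_n q) ^ 2)).
    - replace (x ^ 2 * (tau * INR (odd_n q) ^ 2)) with (tau * (PI ^ 2 * INR (S j) ^ 2)) by (rewrite <- Hx2; ring).
      replace (4 * tau * INR j) with (tau * (4 * INR j)) by ring. apply Rmult_le_compat_l; [lra|].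
      generalize (pos_INR j). intros. nra.
    - apply Rmult_le_compat_l; auto. apply pow2_ge_0. }
  assert (0 <= tau * INR j) by (apply Rmult_le_pos; [lra|apply pos_INR]). lra.
Qed.

(** A squeeze: with [y = PI (j + 1) / n] and [m] steps both bounds on [cos y ^ (2 m)] have the
    exponent [- y^2 m (1 + o(1))], and [y^2 m] equals [PI^2 (j + 1)^2 * rho]. *)
Lemma cos_part_lim j : is_lim_seq (fun q => cos_part q j) (theta_term (PI * tau) j).
Proof.
  set (b := PI ^ 2 * INR (S j) ^ 2).
  set (y := fun q => PI * INR (S j) * / INR (odd_n q)).
  assert (Ly : is_lim_seq (fun q => y q ^ 2) 0).
  { apply (is_lim_seq_ext (fun q => b * (/ INR (odd_n q) * / INR (odd_n q)))).
    - intros q. unfold y, b. destruct (odd_n_ge q). field. lra.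
    - eapply is_lim_eq; [apply is_lim_seq_mult'; [apply is_lim_seq_const|apply is_lim_seq_mult'; apply lim_inv_n]|ring]. }
  assert (Ey : forall q, y q ^ 2 * INR (steps q) = b * rho q).
  { intros q. unfold y, b, rho. destruct (odd_n_ge q). field. lra. }
  assert (Ev : exists Q, forall q, (Q <= q)%nat -> y q ^ 2 < 1).
  { apply is_lim_seq_spec in Ly. destruct (Ly (mkposreal 1 Rlt_0_1)) as [Q HQ]. exists Q. intros q Hq.
    specialize (HQ q Hq). simpl in HQ. apply Rabs_lt_between in HQ. simpl. lra. }
  destruct Ev as [Q HQ].
  unfold theta_term. replace (PI * INR (S j) ^ 2 * (PI * tau)) with (b * tau) by (unfold b; ring).
  apply (is_lim_seq_le_le_loc (fun q => exp (- (b * rho q / (1 - y q ^ 2 / 2)))) _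
     (fun q => exp (- (b * rho q * (1 - y q ^ 2 / 4))))).
  - exists (Q + S j)%nat. intros q Hq. specialize (HQ q ltac:(lia)).
    unfold cos_part. destruct (Nat.ltb_spec j q) as [Hj|Hj]; [|lia].
    pose proof (cos_part_arg q j Hj) as Hx.
    change (PI * INR (S j) / INR (odd_n q)) with (y q) in *.
    assert (Hc : 0 <= cos (y q)) by (apply cos_ge_0; lra).
    split.
    + eapply Rle_trans; [|apply (pow_exp_ge _ (- (y q ^ 2 / 2 / (1 - y q ^ 2 / 2)))), cos_lower; lra].
      apply exp_le_compat. rewrite mult_INR, <- Ey. simpl (INR 2). right. field. lra.
    + eapply Rle_trans; [apply (pow_exp_le _ (- (y q ^ 2 / 2 * (1 - y q ^ 2 / 4)))); auto; now apply cos_upper|].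
      apply exp_le_compat. rewrite mult_INR, <- Ey. simpl (INR 2). right. field.
  - apply is_lim_exp. eapply is_lim_eq.
    + apply is_lim_opp. apply is_lim_seq_div'.
      * apply is_lim_seq_mult'; [apply is_lim_seq_const|apply lim_rho].
      * apply is_lim_seq_minus'; [apply is_lim_seq_const|].
        apply is_lim_seq_div'; [exact Ly|apply is_lim_seq_const|lra].
      * lra.
    + field.
  - apply is_lim_exp. eapply is_lim_eq.
    + apply is_lim_opp. apply is_lim_seq_mult'.
      * apply is_lim_seq_mult'; [apply is_lim_seq_const|apply lim_rho].
      * apply is_lim_seq_minus'; [apply is_lim_seq_const|].
        apply is_lim_seq_div'; [exact Ly|apply is_lim_seq_const|lra].
    + field.
Qed.

Lemma walk_part_zero q k : (steps q <= k)%nat -> walk_part q k = 0.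
Proof.
  intros H. unfold walk_part. rewrite walk_supp; [unfold Rdiv; ring|].
  unfold odd_n. nia.
Qed.

(** With [L = (k + 1) n <= m] the exponent [L^2 / (m + L)] of [walk_upper] is at least
    [L^2 / (2 m)]. From [Q0] on [tau * n^2 >= 1], so that rounding costs only a factor 2,
    [m <= 2 tau n^2]; this is the origin of [4 * tau]. *)
Lemma walk_part_dom : exists Q0, forall q k, (Q0 <= q)%nat -> Rabs (walk_part q k) <= 1 * exp (- / (4 * tau)) ^ k.
Proof.
  destruct (nat_above (/ tau)) as [Q0 [HQ _]]. exists Q0. intros q k Hq.
  unfold walk_part. rewrite Rabs_pos_eq by apply walk_quotient_nonneg.
  rewrite <- Nat2Z.inj_mul. set (L := (S k * odd_n q)%nat).
  destruct (Nat.le_gt_cases L (steps q)) as [HL|HL].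
  2:{ rewrite walk_supp by lia. rewrite Rmult_1_l. unfold Rdiv. rewrite Rmult_0_l. apply pow_le. left; apply exp_pos. }
  eapply Rle_trans; [now apply walk_upper|].
  rewrite Rmult_1_l, exp_pow_INR. apply exp_le_compat.
  destruct (odd_n_ge q) as [H1 H2]. destruct (steps_bound q) as [_ H3].
  apply le_INR in HL. apply le_INR in Hq.
  assert (HLe : INR L = (INR k + 1) * INR (odd_n q)) by (unfold L; rewrite mult_INR, S_INR; ring).
  pose proof (pos_INR k) as Hk.
  assert (T1 : 1 <= tau * INR (odd_n q) ^ 2).
  { assert (tau * / tau <= tau * INR (odd_n q)) by (apply Rmult_le_compat_l; lra). rewrite Rinv_r in H by lra.
    assert (INR (odd_n q) <= INR (odd_n q) ^ 2) by (simpl; nra). nra. }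
  assert (P : 0 < INR (steps q) + INR L) by (rewrite HLe in *; nra).
  replace (- / (4 * tau) * INR k) with (- (INR k / (4 * tau))) by (field; lra).
  apply Ropp_le_contravar.
  apply Rmult_le_reg_r with (4 * tau * (INR (steps q) + INR L)); [apply Rmult_lt_0_compat; lra|].
  replace (INR k / (4 * tau) * (4 * tau * (INR (steps q) + INR L))) with (INR k * (INR (steps q) + INR L)) by (field; lra).
  replace (INR L ^ 2 / (INR (steps q) + INR L) * (4 * tau * (INR (steps q) + INR L))) with (4 * tau * INR L ^ 2) by (field; lra).
  apply Rle_trans with (INR k * (4 * (tau * INR (odd_n q) ^ 2))).
  - apply Rmult_le_compat_l; auto. lra.
  - rewrite HLe, Rpow_mult_distr.
    replace (4 * tau * ((INR k + 1) ^ 2 * INR (odd_n q) ^ 2)) with ((INR k + 1) ^ 2 * (4 * (tau * INR (odd_n q) ^ 2))) by ring.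
    apply Rmult_le_compat_r; [lra|simpl; nra].
Qed.

Lemma walk_part_lim k : is_lim_seq (fun q => walk_part q k) (theta_term (/ (PI * tau)) k).
Proof.
  set (a := INR (S k)).
  assert (Ha : 0 < a) by (apply lt_0_INR; lia).
  unfold theta_term. fold a. pose proof PI_RGT_0 as HPI.
  replace (PI * a ^ 2 * / (PI * tau)) with (a ^ 2 / tau) by (field; lra).
  set (x := fun q => / INR (odd_n q)).
  assert (Lx : is_lim_seq (fun q => a * x q) 0).
  { eapply is_lim_eq; [apply is_lim_seq_mult'; [apply is_lim_seq_const|apply lim_inv_n]|ring]. }
  assert (Ev : exists Q, forall q, (Q <= q)%nat -> a * x q < tau).
  { apply is_lim_seq_spec in Lx. destruct (Lx (mkposreal tau Htau)) as [Q HQ]. exists Q. intros q Hq.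
    specialize (HQ q Hq). simpl in HQ. apply Rabs_lt_between in HQ. lra. }
  destruct Ev as [Q HQ].
  apply (is_lim_seq_le_le_loc (fun q => exp (- (a ^ 2 / (rho q - a * x q)))) _
     (fun q => exp (- (a ^ 2 / (rho q + a * x q))))).
  - exists Q. intros q Hq. specialize (HQ q Hq).
    pose proof (rho_bound q) as [Hr _]. destruct (odd_n_ge q) as [H1 _].
    unfold walk_part. rewrite <- Nat2Z.inj_mul. set (L := (S k * odd_n q)%nat).
    assert (HLe : INR L = a * INR (odd_n q)) by (unfold L; rewrite mult_INR; reflexivity).
    assert (Hx0 : 0 < x q) by (apply Rinv_0_lt_compat; lra).
    assert (Em : INR (steps q) = rho q * INR (odd_n q) ^ 2) by (unfold rho; field; lra).
    assert (EL : INR L = a * x q * INR (odd_n q) ^ 2) by (rewrite HLe; unfold x; field; lra).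
    assert (PN : 0 < INR (odd_n q) ^ 2) by (apply pow_lt; lra).
    assert (HLm : INR L < INR (steps q)).
    { rewrite Em, EL. apply Rmult_lt_compat_r; lra. }
    apply INR_lt in HLm.
    assert (E2 : forall d, d <> 0 -> INR L ^ 2 / (d * INR (odd_n q) ^ 2) = a ^ 2 / d).
    { intros d Hd. rewrite HLe. field. split; auto; lra. }
    assert (0 < a * x q) by (apply Rmult_lt_0_compat; lra).
    split.
    + eapply Rle_trans; [|now apply walk_lower]. right. do 2 f_equal.
      rewrite <- E2 by lra. f_equal. rewrite Em, EL. ring.
    + eapply Rle_trans; [apply walk_upper; lia|]. right. do 2 f_equal.
      rewrite <- (E2 (rho q + a * x q)) by lra. f_equal. rewrite Em, EL. ring.
  - apply is_lim_exp. eapply is_lim_eq.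
    + apply is_lim_opp. apply is_lim_seq_div'; [apply is_lim_seq_const| |].
      * apply is_lim_seq_minus'; [apply lim_rho|exact Lx].
      * lra.
    + field. lra.
  - apply is_lim_exp. eapply is_lim_eq.
    + apply is_lim_opp. apply is_lim_seq_div'; [apply is_lim_seq_const| |].
      * apply is_lim_seq_plus'; [apply lim_rho|exact Lx].
      * lra.
    + field. lra.
Qed.

Lemma theta_limit (c : R) : is_lim_seq (fun m => sqrt (INR m) * walk m 0) c ->
  (1 + 2 * psi (PI * tau)) * sqrt tau = c * (1 + 2 * psi (/ (PI * tau))).
Proof.
  intros Hc. pose proof (PI_x_pos tau Htau) as HP.
  assert (HP' : 0 < / (PI * tau)) by now apply Rinv_0_lt_compat.
  destruct (tannery cos_part (theta_term (PI * tau)) (fun q => q) 1 (exp (- tau)) 0) as [L1 [A1 B1]].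
  - now apply exp_neg_lt1.
  - lra.
  - intros n j _. apply cos_part_dom.
  - intros n j H. unfold cos_part. destruct (Nat.ltb_spec j n); [lia|reflexivity].
  - apply cos_part_lim.
  - destruct walk_part_dom as [Q0 HQ0].
    destruct (tannery walk_part (theta_term (/ (PI * tau))) steps 1 (exp (- / (4 * tau))) Q0) as [L2 [A2 B2]]; auto.
    + apply exp_neg_lt1. apply Rinv_0_lt_compat. lra.
    + lra.
    + apply walk_part_zero.
    + apply walk_part_lim.
    + assert (L1 = psi (PI * tau)) as ->.
      { assert (Finite L1 = Finite (psi (PI * tau))) as E; [|now injection E].
        rewrite <- (is_lim_seq_unique _ _ A1). apply is_lim_seq_unique. now apply psi_lim. }
      assert (L2 = psi (/ (PI * tau))) as ->.
      { assert (Finite L2 = Finite (psi (/ (PI * tau)))) as E; [|now injection E].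
        rewrite <- (is_lim_seq_unique _ _ A2). apply is_lim_seq_unique. now apply psi_lim. }
      (* The factor [sqrt (rho q)] is [sqrt m / n]: it turns [n * walk m 0] in [theta_finite] into
         the convergent [sqrt m * walk m 0]. *)
      assert (F : forall q, (1 + 2 * rsum (cos_part q) q) * sqrt (rho q) =
         sqrt (INR (steps q)) * walk (steps q) 0 * (1 + 2 * rsum (walk_part q) (steps q))).
      { intros q. destruct (odd_n_ge q) as [H1 _]. 
        pose proof (theta_finite q (steps q) (steps q) ltac:(nia)) as T. fold (odd_n q) in T.
        rewrite (rsum_ext (cos_part q) (fun j => cos (PI * INR (S j) / INR (odd_n q)) ^ (2 * steps q))).
        2:{ intros k Hk. unfold cos_part. destruct (Nat.ltb_spec k q); [reflexivity|lia]. }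
        rewrite T. unfold walk_part.
        pose proof (walk_0_pos (steps q)) as W.
        rewrite (rsum_ext (fun k => walk (steps q) (Z.of_nat (S k) * Z.of_nat (odd_n q)) / walk (steps q) 0) (fun k => / walk (steps q) 0 * walk (steps q) (Z.of_nat (S k) * Z.of_nat (odd_n q)))) by (intros; unfold Rdiv; ring).
        rewrite rsum_scal. set (SS := rsum _ _).
        assert (Es : sqrt (INR (steps q)) = INR (odd_n q) * sqrt (rho q)).
        { pose proof (rho_bound q) as [R1 _].
          replace (INR (steps q)) with (INR (odd_n q) ^ 2 * rho q) by (unfold rho; field; lra).
          rewrite sqrt_mult by (try apply pow2_ge_0; lra). f_equal. simpl. rewrite Rmult_1_r. apply sqrt_square. lra. }
        rewrite Es. field. lra. }
      assert (LL : is_lim_seq (fun q => (1 + 2 * rsum (cos_part q) q) * sqrt (rho q)) ((1 + 2 * psi (PI * tau)) * sqrt tau)).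
      { apply is_lim_seq_mult'.
        - apply is_lim_seq_plus'; [apply is_lim_seq_const|]. apply is_lim_seq_mult'; [apply is_lim_seq_const|exact B1].
        - apply (is_lim_seq_continuous sqrt); [apply continuity_pt_sqrt; lra|apply lim_rho]. }
      assert (LR : is_lim_seq (fun q => (1 + 2 * rsum (cos_part q) q) * sqrt (rho q)) (c * (1 + 2 * psi (/ (PI * tau))))).
      { eapply is_lim_seq_ext; [intros q; symmetry; apply F|].
        apply is_lim_seq_mult'.
        - apply (is_lim_seq_subseq (fun m => sqrt (INR m) * walk m 0) c steps); auto. apply steps_infty.
        - apply is_lim_seq_plus'; [apply is_lim_seq_const|]. apply is_lim_seq_mult'; [apply is_lim_seq_const|exact B2]. }
      apply is_lim_seq_unique in LL. apply is_lim_seq_unique in LR. rewrite LL in LR. now injection LR.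
Qed.

End ThetaLimit.

Theorem theta_functional_equation x : 0 < x -> (1 + 2 * psi x) * sqrt x = 1 + 2 * psi (/ x).
Proof.
  intros Hx. pose proof PI_RGT_0 as HPI.
  destruct walk_0_asymptotic as [c Hc].
  assert (T : forall x, 0 < x -> (1 + 2 * psi x) * sqrt (x / PI) = c * (1 + 2 * psi (/ x))).
  { intros y Hy. pose proof (theta_limit (y / PI) ltac:(now apply Rdiv_lt_0_compat) c Hc) as T.
    replace (PI * (y / PI)) with y in T by (field; lra). exact T. }
  assert (P0 : forall y, 0 < y -> 0 < 1 + 2 * psi y).
  { intros y Hy. generalize (rsum_psi_le y 0 Hy). simpl. lra. }
  (* At [x = 1] both sides contain the same positive value of theta, which cancels and leaves
     [c = sqrt (1 / PI)]. *)
  pose proof (T 1 Rlt_0_1) as T1. rewrite Rinv_1 in T1.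
  pose proof (P0 1 Rlt_0_1) as P1.
  assert (Ec : c = sqrt (1 / PI)) by nra.
  pose proof (T x Hx) as Tx. rewrite Ec in Tx.
  replace (x / PI) with (x * (1 / PI)) in Tx by (field; lra).
  assert (HS : 0 < sqrt (1 / PI)) by (apply sqrt_lt_R0, Rdiv_lt_0_compat; lra).
  rewrite sqrt_mult in Tx by (try (left; apply Rdiv_lt_0_compat); lra). nra.
Qed.

(** * Euler's integral for Gamma on the positive reals *)

Definition contR (f : R -> R) : Prop := forall t, continuous f t.

Lemma contR_mult f g : contR f -> contR g -> contR (fun t => f t * g t).
Proof. intros Hf Hg t. apply (continuous_mult (K := R_AbsRing)); auto. Qed.

Lemma contR_plus f g : contR f -> contR g -> contR (fun t => f t + g t).
Proof. intros Hf Hg t. apply (continuous_plus (V := R_NormedModule)); auto. Qed.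

Lemma contR_const c : contR (fun _ => c).
Proof. intros t. apply continuous_const. Qed.

Lemma contR_rsum (f : nat -> R -> R) n : (forall k, contR (f k)) -> contR (fun t => rsum (fun k => f k t) n).
Proof. intros H. induction n as [|n IH]; simpl; [apply contR_const|now apply contR_plus]. Qed.

Lemma contR_ex f a b : contR f -> ex_RInt f a b.
Proof. intros H. now apply ex_RInt_cont. Qed.

Lemma RIntR_plus f g a b : contR f -> contR g -> RInt (fun t => f t + g t) a b = RInt f a b + RInt g a b.
Proof. intros Hf Hg. apply (RInt_plus (V := R_CompleteNormedModule)); now apply contR_ex. Qed.

Lemma RIntR_minus f g a b : contR f -> contR g -> RInt (fun t => f t - g t) a b = RInt f a b - RInt g a b.
Proof. intros Hf Hg. apply (RInt_minus (V := R_CompleteNormedModule)); now apply contR_ex. Qed.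

Lemma RIntR_scal c f a b : contR f -> RInt (fun t => c * f t) a b = c * RInt f a b.
Proof. intros Hf. apply (RInt_scal (V := R_CompleteNormedModule)); now apply contR_ex. Qed.

Lemma RIntR_rsum (f : nat -> R -> R) a b n : (forall k, contR (f k)) ->
  RInt (fun t => rsum (fun k => f k t) n) a b = rsum (fun k => RInt (f k) a b) n.
Proof.
  intros H. induction n as [|n IH]; simpl.
  - rewrite RInt_const. apply Rmult_0_r.
  - rewrite RIntR_plus, IH; auto. now apply contR_rsum.
Qed.

Lemma RIntR_le f g a b : contR f -> contR g -> a <= b -> (forall t, a <= t <= b -> f t <= g t) ->
  RInt f a b <= RInt g a b.
Proof. intros Hf Hg Hab H. apply RInt_le; auto using contR_ex. intros; apply H; lra. Qed.

Lemma RIntR_nonneg f a b : contR f -> a <= b -> (forall t, 0 <= f t) -> 0 <= RInt f a b.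
Proof. intros Hf Hab H. apply RInt_ge_0; auto using contR_ex. Qed.

Lemma RIntR_Chasles f a b c : contR f -> RInt f a b + RInt f b c = RInt f a c.
Proof. intros Hf. apply (RInt_Chasles (V := R_CompleteNormedModule)); now apply contR_ex. Qed.

Lemma RIntR_mono f a b c d : contR f -> (forall t, 0 <= f t) -> c <= a -> a <= b -> b <= d ->
  RInt f a b <= RInt f c d.
Proof.
  intros Hf H0 H1 H2 H3.
  rewrite <- (RIntR_Chasles f c a d), <- (RIntR_Chasles f a b d) by auto.
  generalize (RIntR_nonneg f c a Hf H1 H0) (RIntR_nonneg f b d Hf H3 H0). lra.
Qed.

Lemma RIntR_FTC (F f : R -> R) a b : (forall t, is_derive F t (f t)) -> contR f -> RInt f a b = F b - F a.
Proof.
  intros HF Hf. apply (@is_RInt_unique R_CompleteNormedModule).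
  apply (@is_RInt_derive R_CompleteNormedModule F f); intros; auto.
Qed.

Definition tint (f : R -> R) (n : nat) : R := RInt f (- INR n) (INR n).

Lemma tint_mono f n m : contR f -> (forall t, 0 <= f t) -> (n <= m)%nat -> tint f n <= tint f m.
Proof.
  intros Hf H0 H. apply le_INR in H. generalize (pos_INR n). intros.
  apply RIntR_mono; auto; lra.
Qed.

Lemma lim_le_const (u : nat -> R) (l M : R) : is_lim_seq u l -> (forall n, u n <= M) -> l <= M.
Proof.
  intros H HM. change (Rbar_le l M). exact (is_lim_seq_le _ _ _ _ HM H (is_lim_seq_const M)).
Qed.

Lemma lim_ge_const (u : nat -> R) (l M : R) : is_lim_seq u l -> (forall n, M <= u n) -> M <= l.
Proof.
  intros H HM. change (Rbar_le M l). exact (is_lim_seq_le _ _ _ _ HM (is_lim_seq_const M) H).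
Qed.

Lemma lim_le_lim (u v : nat -> R) (l m : R) : is_lim_seq u l -> is_lim_seq v m -> (forall n, u n <= v n) -> l <= m.
Proof. intros Hu Hv H. change (Rbar_le l m). exact (is_lim_seq_le _ _ _ _ H Hu Hv). Qed.

Lemma incr_le_lim (u : nat -> R) (l : R) n : (forall n, u n <= u (S n)) -> is_lim_seq u l -> u n <= l.
Proof. intros Hi H. exact (is_lim_seq_incr_compare u l H Hi n). Qed.

Lemma lim_unique (u : nat -> R) (l m : R) : is_lim_seq u l -> is_lim_seq u m -> l = m.
Proof.
  intros H1 H2. apply is_lim_seq_unique in H1. apply is_lim_seq_unique in H2.
  rewrite H1 in H2. now injection H2.
Qed.

Section GammaIntegral.
Variable l : R.

(* The integrand x^(y-1) exp(-x) dx of Gamma(y) after the substitution x = exp (u + l);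
   the shift l absorbs the factors pi n^2 in the theta series. *)
Definition eker (y u : R) : R := exp (y * (u + l) - exp (u + l)).

Lemma eker_cont y : contR (eker y).
Proof. intros t. apply ex_derive_cont. unfold eker. auto_derive. auto. Qed.

Lemma eker_pos y u : 0 <= eker y u.
Proof. left. apply exp_pos. Qed.

Lemma eker_left y u : eker y u <= exp (y * (u + l)).
Proof. apply exp_le_compat. generalize (exp_pos (u + l)). lra. Qed.

(** The maximum of [exp ((y + 1) v - exp v)] over real [v], attained at [v = ln (y + 1)]. *)
Definition eker_K (y : R) : R := exp ((y + 1) * (ln (y + 1) - 1)).

Lemma eker_right y u : 0 < y -> eker y u <= eker_K y * exp (- (u + l)).
Proof.
  intros Hy. unfold eker, eker_K. rewrite <- exp_plus. apply exp_le_compat.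
  set (v := u + l).
  assert (E : exp v = (y + 1) * exp (v - ln (y + 1))).
  { rewrite <- (exp_ln (y + 1)) at 1 by lra. rewrite <- exp_plus. f_equal. ring. }
  generalize (exp_ineq1_le (v - ln (y + 1))). intros H. rewrite E. nra.
Qed.

Lemma lim_exp_neg (c a : R) : 0 < a -> is_lim_seq (fun n => exp (c - a * INR n)) 0.
Proof.
  intros Ha. apply (is_lim_seq_ext (fun n => exp c * exp (- a) ^ n)).
  - intros n. rewrite exp_pow_INR, <- exp_plus. f_equal. ring.
  - eapply is_lim_eq; [apply (is_lim_seq_scal_l _ (exp c) 0)|apply Rmult_0_r].
    apply is_lim_seq_geom. rewrite Rabs_pos_eq by (left; apply exp_pos). now apply exp_neg_lt1.
Qed.

Lemma eker_lim_left y : 0 < y -> is_lim_seq (fun n => eker y (- INR n)) 0.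
Proof.
  intros Hy. apply (is_lim_seq_le_le (fun _ => 0) _ (fun n => exp (y * l - y * INR n))).
  - intros n. split; [apply eker_pos|]. eapply Rle_trans; [apply eker_left|]. right. f_equal. ring.
  - apply is_lim_seq_const.
  - now apply lim_exp_neg.
Qed.

Lemma eker_lim_right y : 0 < y -> is_lim_seq (fun n => eker y (INR n)) 0.
Proof.
  intros Hy. apply (is_lim_seq_le_le (fun _ => 0) _ (fun n => eker_K y * exp (- l - 1 * INR n))).
  - intros n. split; [apply eker_pos|]. eapply Rle_trans; [now apply eker_right|]. right. f_equal. f_equal. ring.
  - apply is_lim_seq_const.
  - eapply is_lim_eq; [apply (is_lim_seq_scal_l _ (eker_K y) 0)|apply Rmult_0_r]. apply lim_exp_neg. lra.
Qed.

Lemma tint_eker_bounded y : 0 < y -> forall n, tint (eker y) n <= exp (y * l) / y + eker_K y * exp (- l).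
Proof.
  intros Hy n. unfold tint. generalize (pos_INR n). intros Hn.
  rewrite <- (RIntR_Chasles _ _ 0) by apply eker_cont.
  assert (C1 : contR (fun u => exp (y * (u + l)))) by (intros t; apply ex_derive_cont; auto_derive; auto).
  assert (C2 : contR (fun u => eker_K y * exp (- (u + l)))) by (intros t; apply ex_derive_cont; auto_derive; auto).
  apply Rplus_le_compat.
  - eapply Rle_trans; [apply (RIntR_le _ (fun u => exp (y * (u + l)))); auto using eker_cont; [lra|intros; apply eker_left]|].
    rewrite (RIntR_FTC (fun u => exp (y * (u + l)) / y)); auto.
    + rewrite Rplus_0_l. assert (0 < exp (y * (- INR n + l)) / y) by (apply Rdiv_lt_0_compat; [apply exp_pos|auto]). lra.
    + intros t. auto_derive; [auto|field; lra].
  - eapply Rle_trans; [apply (RIntR_le _ (fun u => eker_K y * exp (- (u + l)))); auto using eker_cont; intros; now apply eker_right|].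
    rewrite (RIntR_FTC (fun u => - (eker_K y * exp (- (u + l))))); auto.
    + rewrite Rplus_0_l. assert (0 < eker_K y * exp (- (INR n + l))) by (apply Rmult_lt_0_compat; apply exp_pos). lra.
    + intros t. auto_derive; [auto|ring].
Qed.

Lemma tint_incr f : contR f -> (forall t, 0 <= f t) -> forall n, tint f n <= tint f (S n).
Proof. intros. apply tint_mono; auto. Qed.

Definition eint (y : R) : R := real (Lim_seq (tint (eker y))).

Lemma eint_lim y : 0 < y -> is_lim_seq (tint (eker y)) (eint y).
Proof.
  intros Hy. destruct (ex_finite_lim_seq_incr (tint (eker y)) _ (tint_incr _ (eker_cont y) (eker_pos y)) (tint_eker_bounded y Hy)) as [L HL].
  unfold eint. rewrite (is_lim_seq_unique _ _ HL). exact HL.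
Qed.

Lemma eint_shift y : 0 < y -> eint (y + 1) = y * eint y.
Proof.
  intros Hy.
  assert (E : forall n, y * tint (eker y) n - tint (eker (y + 1)) n = eker y (INR n) - eker y (- INR n)).
  { intros n. unfold tint. rewrite <- RIntR_scal by apply eker_cont.
    assert (C1 : contR (fun t => y * eker y t)) by (apply contR_mult; [apply contR_const|apply eker_cont]).
    rewrite <- RIntR_minus by auto using eker_cont.
    apply RIntR_FTC.
    - intros t. unfold eker. auto_derive; [auto|].
      replace ((y + 1) * (t + l) - exp (t + l)) with ((t + l) + (y * (t + l) - exp (t + l))) by ring.
      rewrite (exp_plus (t + l) (y * (t + l) - exp (t + l))). unfold Rminus. ring.
    - intros t. apply (continuous_minus (V := R_NormedModule)); [apply C1|apply eker_cont]. }
  assert (L1 : is_lim_seq (fun n => y * tint (eker y) n - tint (eker (y + 1)) n) (y * eint y - eint (y + 1))).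
  { apply is_lim_seq_minus'; [apply is_lim_seq_mult'; [apply is_lim_seq_const|]|]; apply eint_lim; lra. }
  assert (L2 : is_lim_seq (fun n => y * tint (eker y) n - tint (eker (y + 1)) n) (0 - 0)).
  { eapply is_lim_seq_ext; [intros n; symmetry; apply E|].
    apply is_lim_seq_minus'; [now apply eker_lim_right|now apply eker_lim_left]. }
  pose proof (lim_unique _ _ _ L1 L2). lra.
Qed.

Lemma eint_1 : eint 1 = 1.
Proof.
  assert (E : forall n, tint (eker 1) n = exp (- exp (l + - INR n)) - exp (- exp (l + INR n))).
  { intros n. unfold tint.
    rewrite (RIntR_FTC (fun u => - exp (- exp (u + l)))); [|intros t; unfold eker; auto_derive; auto|apply eker_cont].
    - rewrite (Rplus_comm (- INR n)), (Rplus_comm (INR n)). ring.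
    - replace (1 * (t + l) - exp (t + l)) with ((t + l) + - exp (t + l)) by ring. rewrite (exp_plus (t + l) (- exp (t + l))). ring. }
  apply (lim_unique (tint (eker 1))); [apply eint_lim; lra|].
  apply (is_lim_seq_ext (fun n => exp (- exp (l + - INR n)) - exp (- exp (l + INR n)))); [intros n; symmetry; apply E|].
  replace 1 with (exp (- 0) - 0) by (rewrite Ropp_0, exp_0; ring).
  apply is_lim_seq_minus'.
  - apply is_lim_exp, is_lim_opp.
    apply (is_lim_seq_ext (fun n => exp (l - 1 * INR n))); [intros n; f_equal; ring|]. apply lim_exp_neg; lra.
  - apply (is_lim_seq_le_le (fun _ => 0) _ (fun n => exp (- l - 1 * INR n))).
    + intros n. split; [left; apply exp_pos|]. apply exp_le_compat.
      generalize (exp_ineq1_le (l + INR n)). lra.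
    + apply is_lim_seq_const.
    + apply lim_exp_neg. lra.
Qed.

Lemma eint_fact n : eint (INR (S n)) = INR (fact n).
Proof.
  induction n as [|n IH]; [apply eint_1|].
  rewrite S_INR, eint_shift by (apply lt_0_INR; lia). rewrite IH.
  change (fact (S n)) with (S n * fact n)%nat. now rewrite mult_INR.
Qed.

(** The tangent of [exp] at [y * w], evaluated at [w] and at 0 and weighted by [y] and [1 - y]. *)
Lemma exp_convex y w : 0 <= y <= 1 -> exp (y * w) <= 1 + y * (exp w - 1).
Proof.
  intros Hy.
  assert (T1 : exp w >= exp (y * w) * (1 + (w - y * w))).
  { replace w with (y * w + (w - y * w)) at 1 by ring. rewrite exp_plus. apply Rle_ge.
    apply Rmult_le_compat_l; [left; apply exp_pos|apply exp_ineq1_le]. }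
  assert (T2 : 1 >= exp (y * w) * (1 + - (y * w))).
  { rewrite <- exp_0 at 1. replace 0 with (y * w + - (y * w)) at 1 by ring. rewrite exp_plus. apply Rle_ge.
    apply Rmult_le_compat_l; [left; apply exp_pos|apply exp_ineq1_le]. }
  set (e := exp (y * w)) in *. nra.
Qed.

Lemma eint_upper m y : (1 <= m)%nat -> 0 < y <= 1 -> eint (INR m + y) <= exp (y * ln (INR m)) * eint (INR m).
Proof.
  intros Hm Hy. assert (M1 : 1 <= INR m) by (apply (le_INR 1); auto).
  set (M := INR m) in *. set (c := exp (y * ln M)).
  (* With [x = exp v] this is [(x / M)^y <= 1 - y + y x / M], weighted by the integrand of
     Gamma(M). *)
  assert (P : forall u, eker (M + y) u <= c * (1 - y) * eker M u + c * y / M * eker (M + 1) u).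
  { intros u. unfold eker. set (v := u + l).
    pose proof (exp_convex y (v - ln M) ltac:(lra)) as H.
    replace ((M + y) * v - exp v) with (y * ln M + (y * (v - ln M)) + (M * v - exp v)) by ring.
    rewrite !exp_plus. fold c.
    replace ((M + 1) * v - exp v) with ((v - ln M) + ln M + (M * v - exp v)) by ring.
    rewrite !exp_plus, exp_ln by lra.
    set (E := exp (M * v - exp v)). assert (HE : 0 < E) by apply exp_pos. assert (Hc : 0 < c) by apply exp_pos.
    replace (c * (1 - y) * E + c * y / M * (exp (v - ln M) * M * E)) with (c * E * (1 + y * (exp (v - ln M) - 1))) by (field; lra).
    replace (c * exp (y * (v - ln M)) * E) with (c * E * exp (y * (v - ln M))) by ring.
    apply Rmult_le_compat_l; auto. left. now apply Rmult_lt_0_compat. }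
  assert (L : eint (M + y) <= c * (1 - y) * eint M + c * y / M * eint (M + 1)).
  { refine (lim_le_lim (tint (eker (M + y))) (fun n => c * (1 - y) * tint (eker M) n + c * y / M * tint (eker (M + 1)) n) _ _ _ _ _).
    - apply eint_lim. lra.
    - apply is_lim_seq_plus'; apply is_lim_seq_mult'; try apply is_lim_seq_const; apply eint_lim; lra.
    - intros n. unfold tint. rewrite <- !RIntR_scal by apply eker_cont.
      rewrite <- RIntR_plus by (apply contR_mult; auto using contR_const, eker_cont).
      apply RIntR_le; [apply eker_cont| |generalize (pos_INR n); lra|intros; apply P].
      apply contR_plus; apply contR_mult; auto using contR_const, eker_cont. }
  rewrite eint_shift in L by lra. 
  replace (c * (1 - y) * eint M + c * y / M * (M * eint M)) with (c * eint M) in L by (field; lra). exact L.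
Qed.

Lemma eint_lower m y : (1 <= m)%nat -> 0 < y <= 1 ->
  exp (y * ln (INR m)) * eint (INR m) * (1 - (1 - y) / INR m) <= eint (INR m + y).
Proof.
  intros Hm Hy. assert (M1 : 1 <= INR m) by (apply (le_INR 1); auto).
  set (M := INR m) in *. set (c := exp (y * ln M)). set (a := 1 - y).
  (* With [x = exp v] this is [(x / M)^(- a) >= 1 - a (x / M - 1)], weighted by the integrand of
     Gamma(M + 1). *)
  assert (P : forall u, c * (1 + a) / M * eker (M + 1) u + - (c * a / (M * M)) * eker (M + 1 + 1) u <= eker (M + y) u).
  { intros u. unfold eker. set (v := u + l). set (w := v - ln M).
    assert (H : 1 - a * (exp w - 1) <= exp (- (a * w))).
    { generalize (exp_ineq1_le (- (a * w))) (exp_ineq1_le w). unfold a. intros. nra. }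
    replace ((M + y) * v - exp v) with (y * ln M + (w + - (a * w)) + (M * v - exp v)) by (unfold a, w; ring).
    replace ((M + 1) * v - exp v) with (w + ln M + (M * v - exp v)) by (unfold w; ring).
    replace ((M + 1 + 1) * v - exp v) with (w + ln M + (w + ln M) + (M * v - exp v)) by (unfold w; ring).
    rewrite !exp_plus. fold c. rewrite exp_ln by lra.
    set (E := exp (M * v - exp v)). assert (HE : 0 < E) by apply exp_pos. assert (Hc : 0 < c) by apply exp_pos.
    assert (Hw : 0 < exp w) by apply exp_pos.
    replace (c * (1 + a) / M * (exp w * M * E) + - (c * a / (M * M)) * (exp w * M * (exp w * M) * E))
      with (c * E * exp w * (1 - a * (exp w - 1))) by (field; lra).
    replace (c * (exp w * exp (- (a * w))) * E) with (c * E * exp w * exp (- (a * w))) by ring.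
    apply Rmult_le_compat_l; auto. left. repeat apply Rmult_lt_0_compat; auto. }
  assert (L : c * (1 + a) / M * eint (M + 1) + - (c * a / (M * M)) * eint (M + 1 + 1) <= eint (M + y)).
  { refine (lim_le_lim (fun n => c * (1 + a) / M * tint (eker (M + 1)) n + - (c * a / (M * M)) * tint (eker (M + 1 + 1)) n) (tint (eker (M + y))) _ _ _ _ _).
    - apply is_lim_seq_plus'; apply is_lim_seq_mult'; try apply is_lim_seq_const; apply eint_lim; lra.
    - apply eint_lim. lra.
    - intros n. unfold tint. rewrite <- !RIntR_scal by apply eker_cont.
      rewrite <- RIntR_plus by (apply contR_mult; auto using contR_const, eker_cont).
      apply RIntR_le; [|apply eker_cont|generalize (pos_INR n); lra|intros; apply P].
      apply contR_plus; apply contR_mult; auto using contR_const, eker_cont. }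
  rewrite (eint_shift (M + 1)), (eint_shift M) in L by lra.
  eapply Rle_trans; [|exact L]. right. unfold a. field. lra.
Qed.

Lemma eint_pos y : 0 < y -> 0 < eint y.
Proof.
  intros Hy. apply Rlt_le_trans with (tint (eker y) 1).
  - unfold tint. apply RInt_gt_0; [simpl; lra|intros; apply exp_pos|intros; apply eker_cont].
  - apply (incr_le_lim (tint (eker y)) (eint y) 1); [|now apply eint_lim].
    apply tint_incr; [apply eker_cont|apply eker_pos].
Qed.

End GammaIntegral.

Fixpoint rising (x : R) (n : nat) : R :=
  match n with O => x | S m => rising x m * (x + INR (S m)) end.

Lemma eint_rising l y n : 0 < y -> eint l (y + INR (S n)) = rising y n * eint l y.
Proof.
  intros Hy. induction n as [|n IH].
  - simpl. now apply eint_shift.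
  - rewrite (S_INR (S n)), <- Rplus_assoc, eint_shift by (generalize (pos_INR (S n)); lra).
    rewrite IH. cbn [rising]. ring.
Qed.

Lemma Crising_R x n : Crising (RtoC x) n = RtoC (rising x n).
Proof.
  induction n as [|n IH]; [reflexivity|].
  change (Crising (RtoC x) (S n)) with (Crising (RtoC x) n * (RtoC x + RtoC (INR (S n))))%C.
  rewrite IH, <- RtoC_plus, <- RtoC_mult. reflexivity.
Qed.

Definition rgammaR_n (n : nat) (x : R) : R := rising x n * / (INR (fact n) * exp (x * ln (INR n))).

Lemma rgamma_n_R n x : rgamma_n n (RtoC x) = RtoC (rgammaR_n n x).
Proof.
  unfold rgamma_n, rgammaR_n. rewrite Crising_R, Rcpow_R, RtoC_mult, RtoC_inv, RtoC_mult; [reflexivity|].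
  apply Rmult_integral_contrapositive. split; [apply INR_fact_neq_0|apply Rgt_not_eq, exp_pos].
Qed.

(* As in the Bohr-Mollerup theorem, the bounds [eint_lower] and [eint_upper] come from
   convexity and identify Euler's integral with Gauss's limit. *)
Lemma rgamma_eint l y : 0 < y -> rgamma (RtoC y) = RtoC (/ eint l y).
Proof.
  assert (Base : forall y, 0 < y <= 1 -> rgamma (RtoC y) = RtoC (/ eint l y)).
  { clear y. intros y Hy.
    assert (E0 := eint_pos l y ltac:(lra)).
    apply (clim_unique (fun n => rgamma_n n (RtoC y))); [apply rgamma_clim|].
    apply (clim_ext_ev (fun n => RtoC (rgammaR_n n y)) _ _ 0); [intros; now rewrite rgamma_n_R|].
    apply clim_RtoC.
    set (r := fun n => exp (y * ln (1 + / INR n))).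
    assert (Lr : is_lim_seq r 1).
    { unfold r. apply (is_lim_eq _ (exp (y * ln (1 + 0)))); [|rewrite Rplus_0_r, ln_1, Rmult_0_r; apply exp_0].
      apply is_lim_exp, is_lim_seq_mult'; [apply is_lim_seq_const|].
      apply (is_lim_seq_continuous ln).
      - apply continuity_pt_filterlim, (ex_derive_cont ln). auto_derive. lra.
      - apply is_lim_seq_plus'; [apply is_lim_seq_const|].
        exact (is_lim_seq_inv INR p_infty is_lim_seq_INR ltac:(discriminate)). }
    assert (Lb : is_lim_seq (fun n => 1 - (1 - y) * / INR (S n)) 1).
    { eapply is_lim_eq; [apply is_lim_seq_minus'; [apply is_lim_seq_const|apply is_lim_seq_mult'; [apply is_lim_seq_const|]]|].
      - apply (is_lim_seq_incr_1 (fun n => / INR n)).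
        exact (is_lim_seq_inv INR p_infty is_lim_seq_INR ltac:(discriminate)).
      - ring. }
    apply (is_lim_seq_le_le_loc (fun n => / eint l y * (r n * (1 - (1 - y) * / INR (S n)))) _ (fun n => / eint l y * r n)).
    - exists 1%nat. intros n Hn.
      assert (N1 : 1 <= INR n) by (apply (le_INR 1); auto).
      pose proof (eint_upper l (S n) y ltac:(lia) Hy) as U. pose proof (eint_lower l (S n) y ltac:(lia) Hy) as D.
      rewrite (Rplus_comm _ y), eint_rising, eint_fact in U, D by lra.
      assert (Er : exp (y * ln (INR (S n))) = exp (y * ln (INR n)) * r n).
      { unfold r. rewrite <- exp_plus. f_equal. rewrite <- Rmult_plus_distr_l. f_equal.
        rewrite <- ln_mult by (try (assert (0 < / INR n) by (apply Rinv_0_lt_compat; lra)); lra).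
        f_equal. rewrite S_INR. field. lra. }
      rewrite Er in U, D. unfold rgammaR_n.
      set (F := INR (fact n)) in *. assert (HF : 0 < F) by (apply lt_0_INR, lt_O_fact).
      set (x := exp (y * ln (INR n))) in *. assert (Hx : 0 < x) by apply exp_pos.
      assert (HFx : 0 < F * x) by now apply Rmult_lt_0_compat.
      assert (Q : rising y n * / (F * x) = / eint l y * (rising y n * eint l y * / (F * x))) by (field; lra).
      rewrite Q. split; apply Rmult_le_compat_l; try (left; now apply Rinv_0_lt_compat).
      + apply Rmult_le_reg_r with (F * x); auto. rewrite (Rmult_assoc _ (/ (F * x))), Rinv_l by lra.
        eapply Rle_trans; [|rewrite Rmult_1_r; exact D]. right. unfold Rdiv. ring.
      + apply Rmult_le_reg_r with (F * x); auto. rewrite (Rmult_assoc _ (/ (F * x))), Rinv_l by lra.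
        rewrite Rmult_1_r. eapply Rle_trans; [exact U|]. right. ring.
    - eapply is_lim_eq; [apply is_lim_seq_mult'; [apply is_lim_seq_const|apply is_lim_seq_mult'; [exact Lr|exact Lb]]|ring].
    - eapply is_lim_eq; [apply is_lim_seq_mult'; [apply is_lim_seq_const|exact Lr]|ring]. }
  assert (Ind : forall n y, 0 < y <= INR (S n) -> rgamma (RtoC y) = RtoC (/ eint l y)).
  { clear y. induction n as [|n IH]; intros y Hy; [apply Base; simpl in Hy; lra|].
    destruct (Rle_or_lt y (INR (S n))) as [h|h]; [apply IH; lra|].
    rewrite (S_INR (S n)) in Hy. assert (1 <= INR (S n)) by (apply (le_INR 1); lia).
    destruct (Rle_or_lt y 1) as [h1|h1]; [apply Base; lra|].
    pose proof (IH (y - 1) ltac:(lra)) as H1. pose proof (rgamma_shift (RtoC (y - 1))) as H2.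
    rewrite H1, <- RtoC_plus in H2. replace (y - 1 + 1) with y in H2 by ring.
    pose proof (eint_shift l (y - 1) ltac:(lra)) as H3. replace (y - 1 + 1) with y in H3 by ring.
    pose proof (eint_pos l (y - 1) ltac:(lra)) as P1.
    assert (N : RtoC (y - 1) <> 0%C) by (intros E; apply RtoC_inj in E; lra).
    transitivity (RtoC (/ (y - 1)) * RtoC (/ eint l (y - 1)))%C.
    - rewrite H2, RtoC_inv by lra. field. auto.
    - rewrite <- RtoC_mult, H3. f_equal. field. lra. }
  intros Hy. destruct (nat_above y) as [n [H1 _]]. apply (Ind n). split; auto.
  rewrite S_INR. lra.
Qed.

(** * The Mellin transform of theta *)

Lemma psi_tail a x n : 0 < a -> a <= x ->
  0 <= psi x - rsum (theta_term x) n <= exp (- (PI * a)) / (1 - exp (- (PI * a))) * exp (- (PI * a)) ^ n.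
Proof.
  intros Ha Hx. pose proof PI_RGT_0 as HPI.
  pose proof (exp_neg_lt1 (PI * a) (PI_x_pos a Ha)) as Hq. set (q := exp (- (PI * a))) in *.
  split; [generalize (rsum_psi_le x n ltac:(lra)); lra|].
  destruct (geom_lim (theta_term x) q q Hq) as [L [HL HL']]; [lra| |].
  - intros j. rewrite Rabs_pos_eq by (left; apply exp_pos).
    eapply Rle_trans; [apply theta_term_geom; lra|].
    change (exp (- (PI * x)) ^ S j <= q ^ S j). apply pow_incr. split; [left; apply exp_pos|].
    apply exp_le_compat. apply Ropp_le_contravar, Rmult_le_compat_l; lra.
  - rewrite (lim_unique _ _ _ (psi_lim x ltac:(lra)) HL). specialize (HL' n).
    apply Rabs_le_between in HL'. lra.
Qed.

Lemma psi_nonneg x : 0 < x -> 0 <= psi x.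
Proof. intros Hx. exact (rsum_psi_le x 0 Hx). Qed.

Lemma geom_small K q eps : 0 <= K -> 0 <= q < 1 -> 0 < eps -> exists n, K * q ^ n < eps.
Proof.
  intros HK Hq He.
  destruct (pow_lt_1_zero q ltac:(rewrite Rabs_pos_eq; lra) (eps / (K + 1)) ltac:(apply Rdiv_lt_0_compat; lra)) as [N HN].
  specialize (HN N ltac:(lia)). rewrite Rabs_pos_eq in HN by (apply pow_le; lra).
  exists N. apply Rle_lt_trans with ((K + 1) * q ^ N); [apply Rmult_le_compat_r; [apply pow_le; lra|lra]|].
  apply (Rmult_lt_compat_l (K + 1)) in HN; [|lra]. eapply Rlt_le_trans; [exact HN|]. right. field. lra.
Qed.

Lemma theta_term_cont j : contR (fun x => theta_term x j).
Proof. intros x. apply ex_derive_cont. unfold theta_term. auto_derive. auto. Qed.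

Lemma psi_cont x : 0 < x -> continuous psi x.
Proof.
  intros Hx. apply filterlim_locally. intros eps.
  assert (Ha : 0 < x / 2) by lra.
  pose proof (exp_neg_lt1 (PI * (x / 2)) (PI_x_pos _ Ha)) as Hq.
  destruct (geom_small (exp (- (PI * (x / 2))) / (1 - exp (- (PI * (x / 2))))) _ (eps / 3)
    ltac:(apply Rmult_le_pos; [lra|left; apply Rinv_0_lt_compat; lra]) Hq ltac:(generalize (cond_pos eps); lra)) as [n Hn].
  pose proof (contR_rsum (fun k x => theta_term x k) n theta_term_cont x) as C.
  assert (E3 : 0 < eps / 3) by (generalize (cond_pos eps); lra).
  pose proof (proj1 (filterlim_locally _ _) C (mkposreal _ E3)) as [d Hd].
  assert (Hm : 0 < Rmin d (x / 2)) by (apply Rmin_glb_lt; [apply cond_pos|lra]).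
  exists (mkposreal _ Hm). intros y Hy.
  change (Rabs (y - x) < Rmin d (x / 2)) in Hy.
  assert (H1 : Rabs (y - x) < d) by (eapply Rlt_le_trans; [exact Hy|apply Rmin_l]).
  assert (H2 : Rabs (y - x) < x / 2) by (eapply Rlt_le_trans; [exact Hy|apply Rmin_r]).
  apply Rabs_lt_between in H2. specialize (Hd y H1).
  change (Rabs (rsum (theta_term y) n - rsum (theta_term x) n) < eps / 3) in Hd.
  apply Rabs_lt_between in Hd.
  pose proof (psi_tail (x / 2) x n Ha ltac:(lra)). pose proof (psi_tail (x / 2) y n Ha ltac:(lra)).
  change (Rabs (psi y - psi x) < eps). apply Rabs_lt_between. lra.
Qed.

Definition psiE (u : R) : R := psi (exp u).

Lemma psiE_cont : contR psiE.
Proof.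
  intros u. apply (continuous_comp exp psi); [apply ex_derive_cont; auto_derive; auto|].
  apply psi_cont, exp_pos.
Qed.

Lemma psiE_nonneg u : 0 <= psiE u.
Proof. apply psi_nonneg, exp_pos. Qed.

Lemma exp_lin_cont c : contR (fun u => exp (u * c)).
Proof. intros t. apply ex_derive_cont. auto_derive. auto. Qed.

Lemma psiE_reflect u : psiE (- u) = exp (u / 2) * psiE u + (exp (u / 2) - 1) / 2.
Proof.
  unfold psiE. pose proof (theta_functional_equation (exp u) (exp_pos u)) as T.
  rewrite <- exp_Ropp in T.
  replace (sqrt (exp u)) with (exp (u / 2)) in T.
  - lra.
  - replace (exp u) with (exp (u / 2) * exp (u / 2)) by (rewrite <- exp_plus; f_equal; field).
    symmetry. apply sqrt_square. left; apply exp_pos.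
Qed.

(** Both values are the inverse of [rgamma y], so no change of variables is needed. *)
Lemma eint_indep l y : 0 < y -> eint l y = eint 0 y.
Proof.
  intros Hy. pose proof (rgamma_eint l y Hy) as H1. rewrite (rgamma_eint 0 y Hy) in H1.
  apply RtoC_inj in H1. pose proof (eint_pos l y Hy). pose proof (eint_pos 0 y Hy).
  rewrite <- (Rinv_inv (eint l y)), <- H1, Rinv_inv. reflexivity.
Qed.

Lemma RIntR_fold f b : contR f -> RInt f (- b) b = RInt (fun u => f u + f (- u)) 0 b.
Proof.
  intros Hf.
  assert (C2 : contR (fun u => f (- u))).
  { intros t. apply (continuous_comp Ropp f); [apply ex_derive_cont; auto_derive; auto|apply Hf]. }
  rewrite RIntR_plus by auto. rewrite <- (RIntR_Chasles f (- b) 0 b) by auto.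
  rewrite Rplus_comm. f_equal.
  pose proof (@RInt_comp_lin R_CompleteNormedModule f (-1) 0 b 0) as L.
  replace (-1 * b + 0) with (- b) in L by ring. replace (-1 * 0 + 0) with 0 in L by ring.
  specialize (L (contR_ex f (- b) 0 Hf)). rewrite <- L.
  rewrite (RInt_ext _ (fun u => -1 * f (- u))).
  - rewrite RIntR_scal by auto.
    assert (E := RIntR_Chasles (fun u => f (- u)) 0 b 0 C2).
    rewrite (RInt_point 0) in E. change (zero : R) with 0 in E. lra.
  - intros u _. change (scal (-1) (f (-1 * u + 0))) with (-1 * f (-1 * u + 0)). do 2 f_equal. ring.
Qed.

Section Mellin.
Variable s : R.
Hypothesis Hs : 1 < s.
Variable Z : R.
Hypothesis HZ : is_lim_seq (rsum (fun m => exp (- s * ln (INR (S m))))) Z.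

(** The completed zeta function [pi^(-s/2) Gamma(s/2) zeta(s)], with [Z] for [zeta(s)]. *)
Definition Lam : R := exp (- (s / 2) * ln PI) * eint 0 (s / 2) * Z.

Definition lsh (m : nat) : R := ln (PI * INR (S m) ^ 2).

Lemma theta_eker m u : exp (u * (s / 2)) * theta_term (exp u) m = exp (- (lsh m * (s / 2))) * eker (lsh m) (s / 2) u.
Proof.
  unfold theta_term, eker. rewrite <- !exp_plus. f_equal.
  rewrite (exp_plus u (lsh m)). unfold lsh at 3. rewrite exp_ln.
  - ring.
  - apply Rmult_lt_0_compat; [apply PI_RGT_0|apply pow_lt, lt_0_INR; lia].
Qed.

Lemma lsh_factor m : exp (- (lsh m * (s / 2))) = exp (- (s / 2) * ln PI) * exp (- s * ln (INR (S m))).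
Proof.
  rewrite <- exp_plus. f_equal. unfold lsh. assert (0 < INR (S m)) by (apply lt_0_INR; lia).
  set (x := INR (S m)) in *. rewrite ln_mult by (try apply PI_RGT_0; apply pow_lt; auto).
  simpl pow. rewrite Rmult_1_r, ln_mult by auto. field.
Qed.

Definition mel (u : R) : R := exp (u * (s / 2)) * psiE u.

Lemma mel_cont : contR mel.
Proof. apply contR_mult; [apply exp_lin_cont|apply psiE_cont]. Qed.

Lemma mel_nonneg u : 0 <= mel u.
Proof. apply Rmult_le_pos; [left; apply exp_pos|apply psiE_nonneg]. Qed.

Definition melM (M : nat) (u : R) : R := rsum (fun m => exp (- (lsh m * (s / 2))) * eker (lsh m) (s / 2) u) M.

Lemma melM_eq M u : melM M u = exp (u * (s / 2)) * rsum (theta_term (exp u)) M.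
Proof. unfold melM. rewrite <- rsum_scal. apply rsum_ext. intros m _. symmetry. apply theta_eker. Qed.

Lemma melM_cont M : contR (melM M).
Proof. apply (contR_rsum (fun m u => exp (- (lsh m * (s / 2))) * eker (lsh m) (s / 2) u)). intros m. apply contR_mult; [apply contR_const|apply eker_cont]. Qed.

Lemma melM_nonneg M u : 0 <= melM M u.
Proof. apply rsum_nonneg. intros. apply Rmult_le_pos; left; apply exp_pos. Qed.

Lemma tint_melM_lim M : is_lim_seq (tint (melM M))
  (exp (- (s / 2) * ln PI) * eint 0 (s / 2) * rsum (fun m => exp (- s * ln (INR (S m)))) M).
Proof.
  apply (is_lim_seq_ext (fun n => rsum (fun m => exp (- (lsh m * (s / 2))) * tint (eker (lsh m) (s / 2)) n) M)).
  - intros n. unfold tint, melM.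
    rewrite (RIntR_rsum (fun m u => exp (- (lsh m * (s / 2))) * eker (lsh m) (s / 2) u)).
    + apply rsum_ext. intros m _. symmetry. apply RIntR_scal, eker_cont.
    + intros m. apply contR_mult; [apply contR_const|apply eker_cont].
  - eapply is_lim_eq.
    + apply (is_lim_rsum (fun n m => exp (- (lsh m * (s / 2))) * tint (eker (lsh m) (s / 2)) n)).
      intros m. apply is_lim_seq_mult'; [apply is_lim_seq_const|apply eint_lim; lra].
    + rewrite <- rsum_scal. apply rsum_ext. intros m _. rewrite eint_indep, lsh_factor by lra. ring.
Qed.

Lemma Gpos : 0 < exp (- (s / 2) * ln PI) * eint 0 (s / 2).
Proof. apply Rmult_lt_0_compat; [apply exp_pos|apply eint_pos; lra]. Qed.

Lemma melM_le_mel M u : melM M u <= mel u.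
Proof.
  rewrite melM_eq. apply Rmult_le_compat_l; [left; apply exp_pos|]. apply rsum_psi_le, exp_pos.
Qed.

Lemma zeta_partial_le M : rsum (fun m => exp (- s * ln (INR (S m)))) M <= Z.
Proof.
  apply (incr_le_lim (rsum (fun m => exp (- s * ln (INR (S m)))))); auto.
  intros n. cbn [rsum]. generalize (exp_pos (- s * ln (INR (S n)))). lra.
Qed.

(** On [-n, n] the argument [exp u] of theta is at least [exp (- n)], so the tail of the series is
    uniformly small there. The partial sums integrate term by term to at most [Lam], and the error
    is [c * q ^ M] with [q < 1]. *)
Lemma tint_mel_le n : tint mel n <= Lam.
Proof.
  set (a := exp (- INR n)). assert (Ha : 0 < a) by apply exp_pos.
  pose proof (exp_neg_lt1 (PI * a) (PI_x_pos _ Ha)) as Hq. set (q := exp (- (PI * a))) in *.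
  set (E := q / (1 - q)).
  assert (HE : 0 <= E) by (apply Rmult_le_pos; [lra|left; apply Rinv_0_lt_compat; lra]).
  set (c := tint (fun u => E * exp (u * (s / 2))) n).
  assert (Hc : 0 <= c).
  { apply RIntR_nonneg; [apply contR_mult; [apply contR_const|apply exp_lin_cont]|generalize (pos_INR n); lra|].
    intros t. apply Rmult_le_pos; auto. left; apply exp_pos. }
  assert (B : forall M, tint mel n <= Lam + c * q ^ M).
  { intros M. apply Rle_trans with (tint (melM M) n + c * q ^ M).
    - unfold c, tint. rewrite (Rmult_comm _ (q ^ M)).
      assert (C1 : contR (fun u => E * exp (u * (s / 2)))) by (apply contR_mult; [apply contR_const|apply exp_lin_cont]).
      rewrite <- RIntR_scal by auto.
      assert (C2 : contR (fun t => q ^ M * (E * exp (t * (s / 2))))) by (apply contR_mult; [apply contR_const|auto]).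
      rewrite <- RIntR_plus by auto using melM_cont.
      apply RIntR_le; [apply mel_cont|apply contR_plus; auto using melM_cont|generalize (pos_INR n); lra|].
      intros t Ht. rewrite melM_eq. unfold mel, psiE.
      pose proof (psi_tail a (exp t) M Ha ltac:(apply exp_le_compat; lra)) as T. fold q E in T.
      pose proof (exp_pos (t * (s / 2))). nra.
    - apply Rplus_le_compat_r.
      eapply Rle_trans; [apply (incr_le_lim _ _ n (tint_incr _ (melM_cont M) (melM_nonneg M)) (tint_melM_lim M))|].
      unfold Lam. apply Rmult_le_compat_l; [left; apply Gpos|apply zeta_partial_le].
  }
  refine (lim_ge_const (fun M => Lam + c * q ^ M) Lam _ _ B).
  eapply is_lim_eq; [apply is_lim_seq_plus'; [apply is_lim_seq_const|apply is_lim_seq_mult'; [apply is_lim_seq_const|]]|].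
  - apply is_lim_seq_geom. rewrite Rabs_pos_eq; lra.
  - ring.
Qed.

(** Everything is nonnegative, so the exchange of sum and integral splits into two inequalities: the
    truncated integrals stay below [Lam], and the partial sums in [M] stay below their limit. *)
Lemma tint_mel_lim : is_lim_seq (tint mel) Lam.
Proof.
  destruct (ex_finite_lim_seq_incr (tint mel) Lam (tint_incr _ mel_cont mel_nonneg) tint_mel_le) as [X HX].
  assert (X <= Lam) by (apply (lim_le_const _ _ _ HX); apply tint_mel_le).
  assert (Lam <= X).
  { refine (lim_le_const (fun M => exp (- (s / 2) * ln PI) * eint 0 (s / 2) * rsum (fun m => exp (- s * ln (INR (S m)))) M) Lam X _ _).
    - unfold Lam. apply is_lim_seq_mult'; [apply is_lim_seq_const|exact HZ].
    - intros M. refine (lim_le_lim _ _ _ _ (tint_melM_lim M) HX _).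
      intros n. apply RIntR_le; [apply melM_cont|apply mel_cont|generalize (pos_INR n); lra|].
      intros; apply melM_le_mel. }
  replace Lam with X by lra. exact HX.
Qed.

Definition fker (u : R) : R := psiE u * (exp (u * (s / 2)) + exp (u * ((1 - s) / 2))).

Lemma fker_cont : contR fker.
Proof. apply contR_mult; [apply psiE_cont|apply contR_plus; apply exp_lin_cont]. Qed.

Lemma fker_nonneg u : 0 <= fker u.
Proof. apply Rmult_le_pos; [apply psiE_nonneg|]. generalize (exp_pos (u * (s / 2))) (exp_pos (u * ((1 - s) / 2))). lra. Qed.

(** Riemann's symmetrization: the integral over the line is folded at [u = 0] and the values of
    theta at [- u] are replaced by the functional equation. The elementary part has the primitive
    [Gg], whose value at 0 produces the two polar terms. *)
Lemma fker_lim : is_lim_seq (fun n => RInt fker 0 (INR n)) (Lam - / (s - 1) + / s).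
Proof.
  set (g := fun u => / 2 * (exp (u * ((1 - s) / 2)) - exp (u * (- s / 2)))).
  set (Gg := fun u => / (1 - s) * exp (u * ((1 - s) / 2)) + / s * exp (u * (- s / 2))).
  assert (Cg : contR g) by (intros t; apply ex_derive_cont; unfold g; auto_derive; auto).
  assert (E : forall n, RInt fker 0 (INR n) = tint mel n - (Gg (INR n) - Gg 0)).
  { intros n. unfold tint. rewrite RIntR_fold by apply mel_cont.
    rewrite <- (RIntR_FTC Gg g); auto.
    - rewrite <- RIntR_minus; auto.
      + apply RInt_ext. intros u _. unfold fker, mel, g. rewrite psiE_reflect.
        replace (exp (u * ((1 - s) / 2))) with (exp (u / 2) * exp (- u * (s / 2))) by (rewrite <- exp_plus; apply f_equal; field).
        replace (exp (u * (- s / 2))) with (exp (- u * (s / 2))) by (apply f_equal; field). match goal with |- ?a = ?b => change (@eq R a b) end. field.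
      + apply contR_plus; [apply mel_cont|]. intros t.
        apply (continuous_comp Ropp mel); [apply ex_derive_cont; auto_derive; auto|apply mel_cont].
    - intros t. unfold Gg, g. auto_derive; [auto|]. field. split; lra. }
  apply (is_lim_seq_ext (fun n => tint mel n - (Gg (INR n) - Gg 0))); [intros n; symmetry; apply E|].
  assert (LG : is_lim_seq (fun n => Gg (INR n)) 0).
  { unfold Gg. eapply is_lim_eq; [apply is_lim_seq_plus'; apply is_lim_seq_mult'; try apply is_lim_seq_const|].
    - apply (is_lim_seq_ext (fun n => exp (0 - (s - 1) / 2 * INR n))); [intros; f_equal; field|]. apply lim_exp_neg. lra.
    - apply (is_lim_seq_ext (fun n => exp (0 - s / 2 * INR n))); [intros; f_equal; field|]. apply lim_exp_neg. lra.
    - ring. }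
  eapply is_lim_eq; [apply is_lim_seq_minus'; [apply tint_mel_lim|apply is_lim_seq_minus'; [exact LG|apply is_lim_seq_const]]|].
  unfold Gg. rewrite !Rmult_0_l, exp_0. field. split; lra.
Qed.

End Mellin.

(** * Expansion of the Mellin transform in even powers of [s - 1/2] *)

Definition coshs (x : R) (k : nat) : R := 2 * x ^ (2 * k) / INR (fact (2 * k)).

Lemma sum_n_rsum (f : nat -> R) n : sum_n f n = rsum f (S n).
Proof.
  induction n as [|n IH].
  - rewrite sum_O. simpl. ring.
  - rewrite sum_Sn, IH. reflexivity.
Qed.

Lemma exp_series_lim x : is_lim_seq (rsum (fun k => x ^ k / INR (fact k))) (exp x).
Proof.
  apply is_lim_seq_incr_1.
  pose proof (is_exp_Reals x) as H. unfold is_pseries, is_series in H.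
  apply (is_lim_seq_ext (sum_n (fun k => scal (pow_n x k) (/ INR (fact k))))); [|exact H].
  intros n. rewrite sum_n_rsum. apply rsum_ext. intros k _. rewrite pow_n_pow. reflexivity.
Qed.

Lemma coshs_lim x : is_lim_seq (rsum (coshs x)) (exp x + exp (- x)).
Proof.
  assert (L : is_lim_seq (fun n => rsum (fun k => x ^ k / INR (fact k)) n + rsum (fun k => (- x) ^ k / INR (fact k)) n) (exp x + exp (- x))).
  { apply is_lim_seq_plus'; apply exp_series_lim. }
  apply (is_lim_seq_subseq _ _ (fun n => (2 * n)%nat)) in L.
  - eapply is_lim_seq_ext; [|exact L]. intros n. induction n as [|n IH]; [simpl; ring|].
    replace (2 * S n)%nat with (S (S (2 * n))) by lia. cbn [rsum]. rewrite <- IH. cbn [rsum].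
    assert (E1 : (- x) ^ (2 * n) = x ^ (2 * n)) by (rewrite !pow_mult; f_equal; ring).
    change ((- x) ^ S (2 * n)) with (- x * (- x) ^ (2 * n)). change (x ^ S (2 * n)) with (x * x ^ (2 * n)).
    rewrite E1. unfold coshs. field. split; apply INR_fact_neq_0.
  - intros P [N HN]. exists N. intros n Hn. apply HN. lia.
Qed.

Lemma coshs_nonneg x k : 0 <= coshs x k.
Proof.
  unfold coshs. apply Rmult_le_pos; [|left; apply Rinv_0_lt_compat, lt_0_INR, lt_O_fact].
  rewrite pow_mult. apply Rmult_le_pos; [lra|apply pow_le, pow2_ge_0].
Qed.

Lemma coshs_cont k : contR (fun x => coshs x k).
Proof. intros t. apply ex_derive_cont. unfold coshs. auto_derive. auto. Qed.

(** The tail of a series with nonnegative coefficients increases with its argument; the value at [X]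
    therefore bounds the remainder over a whole interval of integration. *)
Lemma coshs_tail_mono x X K : 0 <= x <= X ->
  0 <= exp x + exp (- x) - rsum (coshs x) K <= exp X + exp (- X) - rsum (coshs X) K.
Proof.
  intros Hx. split.
  - pose proof (incr_le_lim (rsum (coshs x)) _ K ltac:(intros n; simpl; generalize (coshs_nonneg x n); lra) (coshs_lim x)). lra.
  - refine (lim_le_lim (fun M => rsum (coshs x) (M + K) - rsum (coshs x) K) (fun M => rsum (coshs X) (M + K) - rsum (coshs X) K) _ _ _ _ _).
    + apply is_lim_seq_minus'; [apply is_lim_seq_incr_n, coshs_lim|apply is_lim_seq_const].
    + apply is_lim_seq_minus'; [apply is_lim_seq_incr_n, coshs_lim|apply is_lim_seq_const].
    + intros M. rewrite (Nat.add_comm M K), !rsum_split.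
      assert (rsum (fun k => coshs x (K + k)) M <= rsum (fun k => coshs X (K + k)) M); [|lra].
      apply rsum_le. intros k _. unfold coshs.
      apply Rmult_le_compat_r; [left; apply Rinv_0_lt_compat, lt_0_INR, lt_O_fact|].
      apply Rmult_le_compat_l; [lra|]. apply pow_incr. lra.
Qed.

Definition mom (n k : nat) : R := RInt (fun u => psiE u * exp (u * / 4) * coshs (u / 2) k) 0 (INR n).

Lemma mom_cont k : contR (fun u => psiE u * exp (u * / 4) * coshs (u / 2) k).
Proof.
  apply contR_mult; [apply contR_mult; [apply psiE_cont|apply exp_lin_cont]|].
  intros t. apply (continuous_comp (fun u => u / 2) (fun x => coshs x k)); [apply ex_derive_cont; auto_derive; auto|apply coshs_cont].
Qed.

Lemma mom_nonneg_fun k u : 0 <= psiE u * exp (u * / 4) * coshs (u / 2) k.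
Proof. apply Rmult_le_pos; [apply Rmult_le_pos; [apply psiE_nonneg|left; apply exp_pos]|apply coshs_nonneg]. Qed.

Lemma mom_nonneg n k : 0 <= mom n k.
Proof. apply RIntR_nonneg; [apply mom_cont|apply pos_INR|apply mom_nonneg_fun]. Qed.

Lemma mom_incr k n : mom n k <= mom (S n) k.
Proof.
  apply RIntR_mono; try lra; [apply mom_cont|apply mom_nonneg_fun|apply pos_INR|]. rewrite S_INR. lra.
Qed.

(** The exponents [s / 2] and [(1 - s) / 2] are symmetric about [1 / 4]. Factoring out [exp (u / 4)]
    leaves a hyperbolic cosine, even in [s - 1/2]; this is where the symmetry between [s] and
    [1 - s] enters. *)
Lemma fker_cosh s u : fker s u = psiE u * exp (u * / 4) * (exp (u * (s - 1 / 2) / 2) + exp (- (u * (s - 1 / 2) / 2))).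
Proof.
  unfold fker. rewrite Rmult_assoc. f_equal. rewrite Rmult_plus_distr_l, <- !exp_plus. f_equal; f_equal; field.
Qed.

Lemma mom_sum n K z : rsum (fun k => mom n k * z ^ (2 * k)) K =
  RInt (fun u => psiE u * exp (u * / 4) * rsum (coshs (u * z / 2)) K) 0 (INR n).
Proof.
  unfold mom.
  rewrite (rsum_ext _ (fun k => RInt (fun u => z ^ (2 * k) * (psiE u * exp (u * / 4) * coshs (u / 2) k)) 0 (INR n))).
  - rewrite <- (RIntR_rsum (fun k u => z ^ (2 * k) * (psiE u * exp (u * / 4) * coshs (u / 2) k))).
    + apply RInt_ext. intros u _. rewrite <- rsum_scal. apply rsum_ext. intros k _. unfold coshs.
      replace (u * z / 2) with (u / 2 * z) by field. rewrite Rpow_mult_distr. unfold Rdiv. ring.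
    + intros k. apply contR_mult; [apply contR_const|apply mom_cont].
  - intros k _. rewrite RIntR_scal by apply mom_cont. ring.
Qed.

Lemma coshs_sum_cont z K : contR (fun u => psiE u * exp (u * / 4) * rsum (coshs (u * z / 2)) K).
Proof.
  apply contR_mult; [apply contR_mult; [apply psiE_cont|apply exp_lin_cont]|].
  apply (contR_rsum (fun k u => coshs (u * z / 2) k)). intros k t.
  apply (continuous_comp (fun u => u * z / 2) (fun x => coshs x k)); [apply ex_derive_cont; auto_derive; auto|apply coshs_cont].
Qed.

(* [eint 0 (s / 2)] is Gamma(s/2). The coefficients are the moments
   2 / (2k)! * int_0^oo psi(e^u) e^(u/4) (u/2)^(2k) du. *)
Theorem mellin_power_series (Zr : R -> R) :
  (forall s, 1 < s -> is_lim_seq (rsum (fun m => exp (- s * ln (INR (S m))))) (Zr s)) ->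
  exists a : nat -> R, (forall k, 0 <= a k) /\
  forall s, 1 < s -> is_lim_seq (rsum (fun k => a k * (s - 1 / 2) ^ (2 * k)))
    (exp (- (s / 2) * ln PI) * eint 0 (s / 2) * Zr s - / (s - 1) + / s).
Proof.
  intros HZ.
  set (J := fun s => Lam s (Zr s) - / (s - 1) + / s).
  assert (HJ : forall s, 1 < s -> is_lim_seq (fun n => RInt (fker s) 0 (INR n)) (J s)).
  { intros s Hs. apply fker_lim; auto. }
  assert (JI : forall s, 1 < s -> forall n, RInt (fker s) 0 (INR n) <= J s).
  { intros s Hs n. apply (incr_le_lim (fun n => RInt (fker s) 0 (INR n))); [|now apply HJ].
    intros m. apply RIntR_mono; try lra; [apply fker_cont|apply fker_nonneg|apply pos_INR|rewrite S_INR; lra]. }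
  assert (SU : forall s, 1 < s -> forall n K, rsum (fun k => mom n k * (s - 1 / 2) ^ (2 * k)) K <= RInt (fker s) 0 (INR n)).
  { intros s Hs n K. rewrite mom_sum.
    apply RIntR_le; [apply coshs_sum_cont|apply fker_cont|apply pos_INR|].
    intros u Hu. rewrite fker_cosh. apply Rmult_le_compat_l.
    - apply Rmult_le_pos; [apply psiE_nonneg|left; apply exp_pos].
    - assert (0 <= u * (s - 1 / 2) / 2) by (apply Rmult_le_pos; [apply Rmult_le_pos|]; lra).
      generalize (coshs_tail_mono (u * (s - 1 / 2) / 2) (u * (s - 1 / 2) / 2) K ltac:(lra)). lra. }
  (* At [s = 3/2] the variable [s - 1/2] is 1, so the sum of all the moments bounds each single
     one. *)
  assert (MB : forall k n, mom n k <= J (3 / 2)).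
  { intros k n. eapply Rle_trans; [|apply (JI (3/2)); lra].
    eapply Rle_trans; [|apply (SU (3/2) ltac:(lra) n (S k))].
    cbn [rsum]. replace (3 / 2 - 1 / 2) with 1 by field. rewrite pow1, Rmult_1_r.
    assert (0 <= rsum (fun k0 => mom n k0 * 1 ^ (2 * k0)) k).
    { apply rsum_nonneg. intros j. rewrite pow1. generalize (mom_nonneg n j). lra. }
    lra. }
  set (a := fun k => real (Lim_seq (fun n => mom n k))).
  assert (La : forall k, is_lim_seq (fun n => mom n k) (a k)).
  { intros k. destruct (ex_finite_lim_seq_incr (fun n => mom n k) _ (mom_incr k) (MB k)) as [L HL].
    unfold a. rewrite (is_lim_seq_unique _ _ HL). exact HL. }
  assert (a0 : forall k, 0 <= a k) by (intros k; apply (lim_ge_const _ _ _ (La k)); intros; apply mom_nonneg).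
  exists a. split; auto. intros s Hs. fold (Lam s (Zr s)). fold (J s).
  set (z := s - 1 / 2). assert (Hz : 0 < z) by (unfold z; lra).
  assert (z0 : forall k, 0 <= z ^ k) by (intros; apply pow_le; lra).
  assert (UB : forall K, rsum (fun k => a k * z ^ (2 * k)) K <= J s).
  { intros K. refine (lim_le_const (fun n => rsum (fun k => mom n k * z ^ (2 * k)) K) _ _ _ _).
    - apply (is_lim_rsum (fun n k => mom n k * z ^ (2 * k))). intros k.
      apply is_lim_seq_mult'; [apply La|apply is_lim_seq_const].
    - intros n. eapply Rle_trans; [apply (SU s Hs)|now apply JI]. }
  destruct (ex_finite_lim_seq_incr (rsum (fun k => a k * z ^ (2 * k))) (J s)) as [F HF]; auto.
  { intros n. cbn [rsum]. generalize (Rmult_le_pos _ _ (a0 n) (z0 (2 * n)%nat)). lra. }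
  assert (F <= J s) by (apply (lim_le_const _ _ _ HF UB)).
  (* The converse inequality: on a bounded interval the remainder of the cosh series is uniform in
     [u], so [K] can tend to infinity first and the length [n] of the interval afterwards. *)
  assert (J s <= F).
  { apply (lim_le_const _ _ _ (HJ s Hs)). intros n.
    set (W := RInt (fun u => psiE u * exp (u * / 4)) 0 (INR n)).
    assert (CW : contR (fun u => psiE u * exp (u * / 4))) by (apply contR_mult; [apply psiE_cont|apply exp_lin_cont]).
    set (X := INR n * z / 2).
    assert (B : forall K, RInt (fker s) 0 (INR n) <= F + (exp X + exp (- X) - rsum (coshs X) K) * W).
    { intros K.
      apply Rle_trans with (rsum (fun k => mom n k * z ^ (2 * k)) K + (exp X + exp (- X) - rsum (coshs X) K) * W).
      - rewrite mom_sum. unfold W. rewrite <- RIntR_scal by auto.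
        assert (C3 : contR (fun t => (exp X + exp (- X) - rsum (coshs X) K) * (psiE t * exp (t * / 4)))) by (apply contR_mult; [apply contR_const|auto]).
        rewrite <- RIntR_plus by auto using coshs_sum_cont.
        apply RIntR_le; [apply fker_cont|apply contR_plus; auto using coshs_sum_cont|apply pos_INR|].
        intros u Hu. rewrite fker_cosh. fold z.
        assert (Hx : 0 <= u * z / 2 <= X).
        { unfold X. split; [apply Rmult_le_pos; [apply Rmult_le_pos|]; lra|].
          apply Rmult_le_compat_r; [lra|]. apply Rmult_le_compat_r; lra. }
        pose proof (coshs_tail_mono _ _ K Hx) as T.
        assert (P : 0 <= psiE u * exp (u * / 4)) by (apply Rmult_le_pos; [apply psiE_nonneg|left; apply exp_pos]).
        nra.
      - apply Rplus_le_compat_r.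
        apply Rle_trans with (rsum (fun k => a k * z ^ (2 * k)) K).
        + apply rsum_le. intros k _. apply Rmult_le_compat_r; auto.
          apply (incr_le_lim (fun n => mom n k)); [apply mom_incr|apply La].
        + apply (incr_le_lim (rsum (fun k => a k * z ^ (2 * k)))); auto.
          intros m. cbn [rsum]. generalize (Rmult_le_pos _ _ (a0 m) (z0 (2 * m)%nat)). lra. }
    refine (lim_ge_const _ F _ _ B).
    eapply is_lim_eq; [apply is_lim_seq_plus'; [apply is_lim_seq_const|apply is_lim_seq_mult'; [apply is_lim_seq_minus'; [apply is_lim_seq_const|apply coshs_lim]|apply is_lim_seq_const]]|ring]. }
  replace (J s) with F by lra. exact HF.
Qed.

(** * Continuation of xi and growth classes *)

Lemma zeta_real (zeta : C -> C) s : is_riemann_zeta zeta -> 1 < s ->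
  zeta (RtoC s) = RtoC (Re (zeta (RtoC s))) /\
  is_lim_seq (rsum (fun m => exp (- s * ln (INR (S m))))) (Re (zeta (RtoC s))).
Proof.
  intros [_ Hz] Hs. specialize (Hz (RtoC s) Hs).
  set (u := fun n => exp (- s * ln (INR (S n)))).
  assert (E : forall n, sum_n (G := C_NormedModule) (fun n => Rcpow (INR (S n)) (- RtoC s)) n = RtoC (rsum u (S n))).
  { intros n. rewrite (sum_n_ext _ (fun n => RtoC (u n))).
    - induction n as [|n IH].
      + rewrite sum_O. unfold u. cbn [rsum]. now rewrite Rplus_0_l.
      + rewrite sum_Sn, IH. change (rsum u (S (S n))) with (rsum u (S n) + u (S n)). now rewrite RtoC_plus.
    - intros m. unfold u. now rewrite <- RtoC_opp, Rcpow_R. }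
  assert (L : filterlim (fun n => RtoC (rsum u (S n))) Hierarchy.eventually (locally (zeta (RtoC s)))).
  { eapply filterlim_ext; [exact E|]. exact Hz. }
  assert (L1 : is_lim_seq (fun n => rsum u (S n)) (Re (zeta (RtoC s)))).
  { apply (filterlim_comp _ _ _ (fun n => RtoC (rsum u (S n))) (fun z : C_UniformSpace => Re z) _ _ _ L).
    destruct (zeta (RtoC s)) as [x y]. apply (continuous_fst (U := R_UniformSpace) (V := R_UniformSpace) x y). }
  assert (L2 : is_lim_seq (fun n => 0) (Im (zeta (RtoC s)))).
  { apply (filterlim_comp _ _ _ (fun n => RtoC (rsum u (S n))) (fun z : C_UniformSpace => Im z) _ _ _ L).
    destruct (zeta (RtoC s)) as [x y]. apply (continuous_snd (U := R_UniformSpace) (V := R_UniformSpace) x y). }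
  split.
  - pose proof (lim_unique _ _ _ L2 (is_lim_seq_const 0)) as E0.
    destruct (zeta (RtoC s)) as [x y]. simpl in *. unfold RtoC. now subst.
  - apply is_lim_seq_incr_1. exact L1.
Qed.

Lemma csum_split f n m : csum f (n + m) = (csum f n + csum (fun k => f (n + k)%nat) m)%C.
Proof.
  induction m as [|m IH]; [rewrite Nat.add_0_r; simpl; ring|].
  rewrite Nat.add_succ_r. simpl. rewrite IH. ring.
Qed.

Lemma csum_bound (f : nat -> C) (g : nat -> R) n : (forall k, Cmod (f k) <= g k) -> Cmod (csum f n) <= rsum g n.
Proof.
  intros H. induction n as [|n IH]; simpl; [rewrite Cmod_0; lra|].
  eapply Rle_trans; [apply Cmod_triangle|]. generalize (H n). lra.
Qed.

(** * The entire function defined by an even power series with nonnegative coefficients *)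

Section EvenSeries.
Variable a : nat -> R.
Hypothesis a_pos : forall k, 0 <= a k.
Variable J : R -> R.
Hypothesis HJ : forall x, 1 / 2 < x -> is_lim_seq (rsum (fun k => a k * x ^ (2 * k))) (J x).

Definition even_partial (n : nat) (z : C) : C := csum (fun k => RtoC (a k) * z ^ (2 * k))%C n.

Definition even_series (z : C) : C := Clim_seq (fun n => even_partial n z).

Lemma even_term_bound x z k : 0 <= x -> Cmod z <= x -> Cmod (RtoC (a k) * z ^ (2 * k)) <= a k * x ^ (2 * k).
Proof.
  intros Hx Hz. rewrite Cmod_mult, Cmod_R, Rabs_pos_eq, Cmod_pow by auto.
  apply Rmult_le_compat_l; auto. apply pow_incr. split; [apply Cmod_ge_0|auto].
Qed.

Lemma even_incr x n : 0 <= x -> rsum (fun k => a k * x ^ (2 * k)) n <= rsum (fun k => a k * x ^ (2 * k)) (S n).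
Proof. intros Hx. cbn [rsum]. generalize (Rmult_le_pos _ _ (a_pos n) (pow_le x (2 * n) Hx)). lra. Qed.

(** As the coefficients are nonnegative, convergence at the real point [x] alone controls the tail
    on the whole disc [|z| <= x]. *)
Lemma even_cauchy x eps : 1 / 2 < x -> 0 < eps -> exists N, forall n m z, (N <= n)%nat -> Cmod z <= x ->
  Cmod (even_partial (n + m) z - even_partial n z) <= eps.
Proof.
  intros Hx He. pose proof (HJ x Hx) as H. apply is_lim_seq_spec in H.
  destruct (H (mkposreal eps He)) as [N HN]. exists N. intros n m z Hn Hz.
  unfold even_partial. rewrite csum_split.
  match goal with |- Cmod (?p + ?q - ?p) <= _ => replace (p + q - p)%C with q by ring end.
  eapply Rle_trans; [apply (csum_bound _ (fun k => a (n + k)%nat * x ^ (2 * (n + k))))|].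
  - intros k. apply even_term_bound; auto; lra.
  - pose proof (rsum_split (fun k => a k * x ^ (2 * k)) n m) as E. cbv beta in E.
    assert (HN' : Rabs (rsum (fun k => a k * x ^ (2 * k)) n - J x) < eps) by exact (HN n Hn).
    apply Rabs_lt_between in HN'.
    pose proof (incr_le_lim _ (J x) (n + m) (fun n => even_incr x n ltac:(lra)) (HJ x Hx)). lra.
Qed.

Lemma even_series_clim z : clim (fun n => even_partial n z) (even_series z).
Proof.
  destruct (clim_cauchy (fun n => even_partial n z)) as [l Hl].
  - intros eps He. assert (0 <= Cmod z) by apply Cmod_ge_0.
    destruct (even_cauchy (Cmod z + 1) (eps / 4) ltac:(lra) ltac:(lra)) as [N HN].
    exists N. intros n m Hn Hm.
    assert (H1 := HN N (n - N)%nat z (le_n N) ltac:(lra)).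
    assert (H2 := HN N (m - N)%nat z (le_n N) ltac:(lra)).
    replace (N + (n - N))%nat with n in H1 by lia. replace (N + (m - N))%nat with m in H2 by lia.
    rewrite Cmod_sub_sym in H2. generalize (Cmod_sum3 (even_partial n z) (even_partial N z) (even_partial m z)). lra.
  - unfold even_series. rewrite (Clim_seq_clim _ _ Hl). exact Hl.
Qed.

Lemma even_partial_entire n : is_entire (even_partial n).
Proof.
  intros z. induction n as [|n [l IH]].
  - exists (RtoC 0). apply (cder_const 0).
  - eexists. apply (cder_plus (even_partial n) (fun z => RtoC (a n) * z ^ (2 * n))%C); [exact IH|].
    apply cder_scal, cder_pow, cder_id.
Qed.

Lemma even_series_entire : is_entire even_series.
Proof.
  intros z. assert (Hz0 : 0 <= Cmod z) by apply Cmod_ge_0.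
  apply (holo_uniform_limit even_partial even_series 0 (Cmod z + 1)).
  - intros n w _. apply even_partial_entire.
  - intros eps He. destruct (even_cauchy (Cmod z + 1) eps ltac:(lra) He) as [N HN]. exists N. intros w Hw.
    replace (w - 0)%C with w in Hw by ring.
    rewrite Cmod_sub_sym.
    apply (clim_Cmod_le (fun n => even_partial n w - even_partial N w)%C _ _ N).
    + apply clim_plus; [apply even_series_clim|apply clim_const].
    + intros n Hn. replace n with (N + (n - N))%nat by lia. apply HN; [lia|lra].
  - replace (z - 0)%C with z by ring. lra.
Qed.

Lemma even_series_bound x z : 1 / 2 < x -> Cmod z <= x -> Cmod (even_series z) <= J x.
Proof.
  intros Hx Hz. apply (clim_Cmod_le _ _ _ 0 (even_series_clim z)). intros n _.
  eapply Rle_trans; [apply (csum_bound _ (fun k => a k * x ^ (2 * k))); intros; apply even_term_bound; auto; lra|].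
  apply (incr_le_lim (rsum (fun k => a k * x ^ (2 * k)))); auto. intros; apply even_incr; lra.
Qed.

Lemma even_series_real x : 1 / 2 < x -> even_series (RtoC x) = RtoC (J x).
Proof.
  intros Hx. apply (clim_unique (fun n => even_partial n (RtoC x))); [apply even_series_clim|].
  apply (clim_ext_ev (fun n => RtoC (rsum (fun k => a k * x ^ (2 * k)) n)) _ _ 0).
  - intros n _. induction n as [|n IH]; [reflexivity|].
    cbn [rsum]. rewrite RtoC_plus, IH, RtoC_mult, RtoC_pow. reflexivity.
  - apply clim_RtoC. now apply HJ.
Qed.

End EvenSeries.

(* Discs avoiding 1 and centred far away in the half plane Re > 1 cover the plane minus {1} and the real axis. *)
Lemma identity_punctured (D : C -> C) :
  (forall s, s <> RtoC 1 -> exists l, cder D s l) ->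
  (forall x : R, 1 < x -> D (RtoC x) = 0%C) -> forall s, s <> RtoC 1 -> D s = 0%C.
Proof.
  intros HD H0.
  assert (Hdisc : forall c, holo_disc D c (Cmod (1 - c))).
  { intros c z Hz. apply HD. intros ->. lra. }
  assert (Csq : forall z w, Cmod z ^ 2 < Cmod w ^ 2 -> Cmod z < Cmod w).
  { intros z w H. apply Rnot_le_lt. intros h. generalize (Cmod_ge_0 w). intros.
    assert (Cmod w ^ 2 <= Cmod z ^ 2) by (apply pow_incr; lra). lra. }
  assert (S1 : forall s, 1 < Re s -> D s = 0%C).
  { intros s Hs.
    (* The disc about [c] whose boundary passes through 1 contains [s] as soon as
       [2 c (Re s - 1) > |s|^2 - 1]; the bound 2 keeps a unit interval around [c] inside the ray. *)
    set (c := Rmax 2 (1 + Cmod s ^ 2 / (Re s - 1))).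
    assert (Hc2 : 2 <= c) by apply Rmax_l.
    assert (Hc : 1 + Cmod s ^ 2 / (Re s - 1) <= c) by apply Rmax_r.
    apply (identity_disc D (RtoC c) (Cmod (1 - RtoC c)) 1 Rlt_0_1); auto.
    - intros x Hx. rewrite <- RtoC_plus. apply H0. apply Rabs_lt_between in Hx. lra.
    - apply Csq. rewrite !Cmod2_alt. rewrite Cmod2_alt in Hc. destruct s as [x y]. simpl in *.
      assert (K : x * (x * 1) + y * (y * 1) <= (c - 1) * (x - 1)).
      { apply Rle_trans with ((x * (x * 1) + y * (y * 1)) / (x - 1) * (x - 1)); [right; field; lra|].
        apply Rmult_le_compat_r; lra. }
      nra. }
  assert (S2 : forall s, Im s <> 0 -> D s = 0%C).
  { intros s Hs.
    (* With this [T] the squared distance from [s] to the centre [2 + iT] is exactly [T^2], which is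
       below the squared radius [1 + T^2]. *)
    set (T := ((Re s - 2) ^ 2 + Im s ^ 2) / (2 * Im s)).
    apply (identity_disc D (2, T) (Cmod (1 - (2, T))) 1 Rlt_0_1); auto.
    - intros x Hx. apply S1. simpl. apply Rabs_lt_between in Hx. lra.
    - apply Csq. rewrite !Cmod2_alt. destruct s as [x y]. simpl in *.
      assert (K : 2 * y * T = (x - 2) ^ 2 + y ^ 2) by (unfold T; field; auto).
      nra. }
  (* A real [s] is a limit of nonreal points, where the value is already known to be 0. *)
  intros s Hs. destruct (Req_dec (Im s) 0) as [E|E]; [|now apply S2].
  apply NNPP. intros N.
  destruct (HD s Hs) as [l Hl].
  destruct (ccont_neq0_loc D s (cder_cont _ _ _ Hl) N) as [r [Hr Hr']].
  apply (Hr' (s + Ci * RtoC (r / 2))%C).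
  - replace (s + Ci * RtoC (r / 2) - s)%C with (Ci * RtoC (r / 2))%C by ring.
    rewrite Cmod_mult, Cmod_Ci, Cmod_R, Rabs_pos_eq; lra.
  - apply S2. destruct s as [x y]. simpl in *. lra.
Qed.

(** * Functions of size exp(O(r log r)) *)

Definition Lg (r : R) : R := (2 + r) * ln (2 + r).

(** The shift by 2 in [Lg] keeps it above 1, so a constant in front of the exponential can be
    absorbed into [K]. Since [Lg (a r + b)] is O([Lg r]), the class is invariant under affine
    changes of variable. *)
Definition gr (f : C -> C) : Prop :=
  exists K, 0 <= K /\ forall z, Cmod (f z) <= exp (K * Lg (Cmod z)).

Lemma ln2_half : 1 / 2 <= ln 2.
Proof. generalize ln_lt_2. lra. Qed.

Lemma ln_Lg r : 0 <= r -> 1 / 2 <= ln (2 + r).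
Proof. intros Hr. eapply Rle_trans; [apply ln2_half|]. apply ln_le; lra. Qed.

Lemma Lg_lin r : 0 <= r -> 2 + r <= 2 * Lg r.
Proof. intros Hr. unfold Lg. generalize (ln_Lg r Hr). nra. Qed.

Lemma Lg_ge1 r : 0 <= r -> 1 <= Lg r.
Proof. intros Hr. generalize (Lg_lin r Hr). lra. Qed.

Lemma Lg_mono r t : 0 <= r <= t -> Lg r <= Lg t.
Proof.
  intros H. unfold Lg. apply Rmult_le_compat; [lra|generalize (ln_Lg r ltac:(lra)); lra|lra|].
  apply ln_le; lra.
Qed.

Lemma Lg_affine a b : 0 <= a -> 0 <= b -> exists M, 0 <= M /\ forall r, 0 <= r -> Lg (a * r + b) <= M * Lg r.
Proof.
  intros Ha Hb. set (m := 1 + a + b). assert (Hm : 1 <= m) by (unfold m; lra).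
  assert (Hlm : 0 <= ln m) by (rewrite <- ln_1; apply ln_le; lra).
  exists (m * (1 + 2 * ln m)). split; [nra|]. intros r Hr.
  assert (H1 : 2 + (a * r + b) <= m * (2 + r)) by (unfold m; nra).
  unfold Lg. pose proof (ln_Lg r Hr) as L.
  apply Rle_trans with (m * (2 + r) * (ln m + ln (2 + r))).
  - apply Rmult_le_compat; auto; [nra| |].
    + generalize (ln_Lg (a * r + b) ltac:(nra)). lra.
    + rewrite <- ln_mult by lra. apply ln_le; nra.
  - assert (ln m + ln (2 + r) <= (1 + 2 * ln m) * ln (2 + r)) by nra.
    assert (0 <= m * (2 + r)) by nra. nra.
Qed.

Lemma gr_le (f : C -> C) K M : 0 <= K -> 0 <= M ->
  (forall z, Cmod (f z) <= M * exp (K * Lg (Cmod z))) -> gr f.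
Proof.
  intros HK HM H. exists (K + M). split; [lra|]. intros z.
  eapply Rle_trans; [apply H|].
  pose proof (Lg_ge1 (Cmod z) (Cmod_ge_0 z)) as L.
  rewrite Rmult_plus_distr_r, exp_plus, Rmult_comm. apply Rmult_le_compat_l; [left; apply exp_pos|].
  apply Rle_trans with (exp M); [generalize (exp_ineq1_le M); lra|]. apply exp_le_compat. nra.
Qed.

Lemma gr_ext f g : (forall z, f z = g z) -> gr f -> gr g.
Proof. intros E [K [HK H]]. exists K. split; auto. intros z. now rewrite <- E. Qed.

Lemma gr_const c : gr (fun _ => c).
Proof.
  apply (gr_le _ 0 (Cmod c)); [lra|apply Cmod_ge_0|]. intros z. rewrite Rmult_0_l, exp_0. lra.
Qed.

Lemma gr_id : gr (fun z => z).
Proof.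
  apply (gr_le _ 2 1); [lra|lra|]. intros z. rewrite Rmult_1_l.
  pose proof (Lg_lin (Cmod z) (Cmod_ge_0 z)). generalize (exp_ineq1_le (2 * Lg (Cmod z))). lra.
Qed.

Lemma gr_mult f g : gr f -> gr g -> gr (fun z => f z * g z)%C.
Proof.
  intros [K1 [HK1 H1]] [K2 [HK2 H2]]. exists (K1 + K2). split; [lra|]. intros z.
  rewrite Cmod_mult, Rmult_plus_distr_r, exp_plus. apply Rmult_le_compat; auto; apply Cmod_ge_0.
Qed.

Lemma gr_plus f g : gr f -> gr g -> gr (fun z => f z + g z)%C.
Proof.
  intros [K1 [HK1 H1]] [K2 [HK2 H2]]. apply (gr_le _ (K1 + K2) 2); [lra|lra|]. intros z.
  pose proof (Lg_ge1 (Cmod z) (Cmod_ge_0 z)) as L.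
  eapply Rle_trans; [apply Cmod_triangle|].
  assert (exp (K1 * Lg (Cmod z)) <= exp ((K1 + K2) * Lg (Cmod z))) by (apply exp_le_compat; nra).
  assert (exp (K2 * Lg (Cmod z)) <= exp ((K1 + K2) * Lg (Cmod z))) by (apply exp_le_compat; nra).
  generalize (H1 z) (H2 z). lra.
Qed.

Lemma gr_opp f : gr f -> gr (fun z => - f z)%C.
Proof. intros [K [HK H]]. exists K. split; auto. intros z. rewrite Cmod_opp. apply H. Qed.

Lemma gr_minus f g : gr f -> gr g -> gr (fun z => f z - g z)%C.
Proof. intros Hf Hg. exact (gr_plus _ _ Hf (gr_opp _ Hg)). Qed.

Lemma gr_affine f a b : gr f -> gr (fun z => f (a * z + b)%C).
Proof.
  intros [K [HK H]]. destruct (Lg_affine (Cmod a) (Cmod b) (Cmod_ge_0 a) (Cmod_ge_0 b)) as [M [HM HL]].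
  exists (K * M). split; [nra|]. intros z. eapply Rle_trans; [apply H|]. apply exp_le_compat.
  rewrite Rmult_assoc. apply Rmult_le_compat_l; auto.
  eapply Rle_trans; [|apply HL, Cmod_ge_0]. apply Lg_mono. split; [apply Cmod_ge_0|].
  eapply Rle_trans; [apply Cmod_triangle|]. rewrite Cmod_mult. lra.
Qed.

Lemma gr_derive f : is_entire f -> gr f -> gr (C_derive f).
Proof.
  intros Hf [K [HK H]]. destruct (Lg_affine 1 1 ltac:(lra) ltac:(lra)) as [M [HM HL]].
  exists (K * M). split; [nra|]. intros z.
  eapply Rle_trans; [apply (cauchy_estimate f z 2 1 (exp (K * (M * Lg (Cmod z))))); try lra|].
  - now apply entire_holo.
  - intros w Hw. eapply Rle_trans; [apply H|]. apply exp_le_compat. apply Rmult_le_compat_l; auto.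
    eapply Rle_trans; [|apply HL, Cmod_ge_0]. apply Lg_mono. split; [apply Cmod_ge_0|].
    replace w with (z + (w - z))%C by ring. eapply Rle_trans; [apply Cmod_triangle|]. lra.
  - rewrite Rmult_assoc. lra.
Qed.

(** The bound on Gauss's terms is taken at an index [N] proportional to [|s|]: about [N] factors of
    size [1 + K] give exp(O(|s| log |s|)), and the tail of the product costs only exp(O(K^2 / N)),
    that is exp(O(|s|)). The four factors are bounded separately, with exponents 1, 4, 5 and 30. *)
Lemma rgamma_gr : gr rgamma.
Proof.
  apply (gr_le _ 40 1); [lra|lra|]. intros s. rewrite Rmult_1_l.
  set (r := Cmod s). assert (Hr : 0 <= r) by apply Cmod_ge_0.
  set (K := r + 1). destruct (nat_above (4 * K)) as [N [H1 [H2 H3]]].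
  rewrite Rabs_pos_eq in H3 by (unfold K; lra).
  assert (B : Cmod (rgamma s) <= K * (1 + K) ^ N * exp (K * ln (INR N)) * exp (54 * (K + K ^ 2) / INR N)).
  { apply (clim_Cmod_le _ _ _ N (rgamma_clim s)). intros n Hn. replace n with (N + (n - N))%nat by lia.
    destruct (rgamma_n_step K N (n - N) s ltac:(unfold K; lra) ltac:(unfold K, r; lra) H2 H1) as [S1 _].
    eapply Rle_trans; [exact S1|]. apply Rmult_le_compat_r; [left; apply exp_pos|].
    apply rgamma_n_bound; auto; unfold K, r in *; lra. }
  eapply Rle_trans; [exact B|].
  pose proof (ln_Lg r Hr) as L. pose proof (Lg_lin r Hr) as L2.
  set (lr := ln (2 + r)) in *.
  assert (E1 : K <= exp (Lg r)).
  { apply Rle_trans with (exp lr); [unfold lr; rewrite exp_ln; unfold K; lra|]. apply exp_le_compat. unfold Lg. fold lr. nra. }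
  assert (E2 : (1 + K) ^ N <= exp (4 * Lg r)).
  { replace (1 + K) with (exp lr) by (unfold lr; rewrite exp_ln; unfold K; lra).
    rewrite exp_pow_INR. apply exp_le_compat. unfold Lg. fold lr.
    assert (INR N <= 4 * (2 + r)) by (unfold K in *; lra). nra. }
  assert (N1 : 1 <= INR N) by (apply (le_INR 1); auto).
  assert (E3 : exp (K * ln (INR N)) <= exp (5 * Lg r)).
  { apply exp_le_compat. unfold Lg. fold lr.
    assert (ln (INR N) <= 5 * lr).
    { apply Rle_trans with (ln (4 * (2 + r))); [apply ln_le; unfold K in *; lra|].
      rewrite ln_mult by lra. fold lr.
      assert (ln 4 <= 4 * lr); [|lra].
      replace 4 with (2 * 2) at 1 by ring. rewrite ln_mult by lra.
      assert (ln 2 <= lr) by (apply ln_le; lra). lra. }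
    unfold K. assert (0 <= ln (INR N)) by (rewrite <- ln_1; apply ln_le; lra). nra. }
  assert (E4 : exp (54 * (K + K ^ 2) / INR N) <= exp (30 * Lg r)).
  { apply exp_le_compat. apply Rle_trans with (14 * (2 + r)); [|lra].
    apply Rmult_le_reg_r with (INR N); [lra|]. unfold Rdiv. rewrite Rmult_assoc, Rinv_l, Rmult_1_r by lra.
    unfold K in *. nra. }
  replace (40 * Lg r) with (Lg r + 4 * Lg r + 5 * Lg r + 30 * Lg r) by ring.
  rewrite !exp_plus.
  assert (K0 : 0 <= K) by (unfold K; lra).
  assert (P2 : 0 <= (1 + K) ^ N) by (apply pow_le; lra).
  assert (P3 := exp_pos (K * ln (INR N))). assert (P4 := exp_pos (54 * (K + K ^ 2) / INR N)).
  assert (P12 : 0 <= K * (1 + K) ^ N) by now apply Rmult_le_pos.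
  assert (P123 : 0 <= K * (1 + K) ^ N * exp (K * ln (INR N))) by (apply Rmult_le_pos; lra).
  apply Rmult_le_compat; [exact P123|lra| |exact E4].
  apply Rmult_le_compat; [exact P12|lra| |exact E3].
  now apply Rmult_le_compat.
Qed.

(** * The recursion for xi_k *)

Lemma entire_cder f z : is_entire f -> cder f z (C_derive f z).
Proof. intros H. apply C_derive_correct; [exact 0%C|apply H]. Qed.

Lemma entire_derive f : is_entire f -> is_entire (C_derive f).
Proof.
  intros H z. apply (holo_derive_holo f z 1); [now apply entire_holo|].
  replace (z - z)%C with (RtoC 0) by ring. rewrite Cmod_0. lra.
Qed.

Definition egr (f : C -> C) : Prop := is_entire f /\ gr f.

Lemma egr_mult f g : egr f -> egr g -> egr (fun z => f z * g z)%C.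
Proof. intros [H1 H2] [H3 H4]. split; [now apply is_entire_mult|now apply gr_mult]. Qed.

Lemma egr_plus f g : egr f -> egr g -> egr (fun z => f z + g z)%C.
Proof.
  intros [H1 H2] [H3 H4]. split; [|now apply gr_plus].
  intros z. destruct (H1 z) as [a Ha]. destruct (H3 z) as [b Hb]. exists (a + b)%C. now apply cder_plus.
Qed.

Lemma egr_const c : egr (fun _ => c).
Proof. split; [|apply gr_const]. intros z. exists (RtoC 0). apply cder_const. Qed.

Lemma egr_id : egr (fun z => z).
Proof. split; [|apply gr_id]. intros z. exists (RtoC 1). apply cder_id. Qed.

Lemma egr_minus f g : egr f -> egr g -> egr (fun z => f z - g z)%C.
Proof.
  intros [H1 H2] [H3 H4]. split; [|now apply gr_minus].
  intros z. destruct (H1 z) as [a Ha]. destruct (H3 z) as [b Hb]. exists (a - b)%C. now apply cder_minus.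
Qed.

Lemma egr_affine f a b : egr f -> egr (fun z => f (a * z + b)%C).
Proof. intros [H1 H2]. split; [now apply is_entire_lin|now apply gr_affine]. Qed.

Lemma egr_derive f : egr f -> egr (C_derive f).
Proof. intros [H1 H2]. split; [now apply entire_derive|now apply gr_derive]. Qed.

Lemma egr_ext f g : (forall z, f z = g z) -> egr f -> egr g.
Proof. intros E [H1 H2]. split; [now apply (is_entire_ext f)|now apply (gr_ext f)]. Qed.

Lemma egr_rgamma : egr rgamma.
Proof. split; [apply rgamma_entire|apply rgamma_gr]. Qed.

Lemma INR_fact_le_pow n : INR (fact n) <= INR n ^ n.
Proof.
  assert (H : forall m, (m <= n)%nat -> INR (fact m) <= INR n ^ m).
  { induction m as [|m IH]; intros Hm; [simpl; lra|].
    change (fact (S m)) with (S m * fact m)%nat. rewrite mult_INR. simpl pow.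
    apply Rmult_le_compat; [apply pos_INR|apply pos_INR|apply le_INR; lia|apply IH; lia]. }
  now apply H.
Qed.

(** The summand 1 compensates the polar terms, because [s (s - 1) (- 1/(s - 1) + 1/s) = - 1]. With
    1/Gamma on the left instead of Gamma on the right both sides are holomorphic off 1, so agreement
    on the real ray [s > 1] suffices. *)
Theorem riemann_xi (zeta : C -> C) : is_riemann_zeta zeta ->
  exists xi0 : C -> C, egr xi0 /\
  forall s, s <> RtoC 1 -> (xi0 s * rgamma (s / 2) = s * (s - 1) * Rcpow PI (- (s / 2)) * zeta s)%C.
Proof.
  intros Hz. set (Zr := fun s => Re (zeta (RtoC s))).
  destruct (mellin_power_series Zr (fun s Hs => proj2 (zeta_real zeta s Hz Hs))) as [a [a0 Ha]].
  set (J := fun x => exp (- ((x + 1 / 2) / 2) * ln PI) * eint 0 ((x + 1 / 2) / 2) * Zr (x + 1 / 2) - / ((x + 1 / 2) - 1) + / (x + 1 / 2)).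
  assert (HJ : forall x, 1 / 2 < x -> is_lim_seq (rsum (fun k => a k * x ^ (2 * k))) (J x)).
  { intros x Hx. specialize (Ha (x + 1 / 2) ltac:(lra)). replace (x + 1 / 2 - 1 / 2) with x in Ha by ring. exact Ha. }
  set (F := even_series a).
  assert (EF : is_entire F) by (apply (even_series_entire a a0 J HJ)).
  assert (GF : gr F).
  { destruct (Lg_affine 1 1 ltac:(lra) ltac:(lra)) as [M [HM HL]].
    apply (gr_le _ M (1 + Rabs (Zr 2))); [auto|generalize (Rabs_pos (Zr 2)); lra|].
    intros z. set (r := Cmod z). assert (Hr : 0 <= r) by apply Cmod_ge_0.
    destruct (nat_above (r + 1)) as [n [N1 [N2 N3]]]. rewrite Rabs_pos_eq in N3 by lra.
    assert (Hn1 : 1 <= INR n) by (apply (le_INR 1); auto).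
    (* The radius is enlarged to [2 * n - 1/2], which corresponds to [s = 2 n]: there Gamma(s/2) is
       a factorial and the growth is explicit. *)
    eapply Rle_trans; [apply (even_series_bound a a0 J HJ (2 * INR n - 1 / 2)); fold r; lra|].
    unfold J. replace ((2 * INR n - 1 / 2 + 1 / 2)) with (2 * INR n) by ring.
    replace (2 * INR n / 2) with (INR n) by field.
    destruct n as [|n]; [lia|]. rewrite eint_fact.
    pose proof (proj2 (zeta_real zeta (2 * INR (S n)) Hz ltac:(lra))) as Zn.
    pose proof (proj2 (zeta_real zeta 2 Hz ltac:(lra))) as Z2.
    assert (ZZ : Zr (2 * INR (S n)) <= Zr 2).
    { refine (lim_le_lim _ _ _ _ Zn Z2 _). intros m. apply rsum_le. intros k _. apply exp_le_compat.
      assert (0 <= ln (INR (S k))) by (rewrite <- ln_1; apply ln_le; [lra|apply (le_INR 1); lia]).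
      nra. }
    assert (Z0 : 0 <= Zr (2 * INR (S n))).
    { apply (lim_ge_const _ _ _ Zn). intros m. apply rsum_nonneg. intros; left; apply exp_pos. }
    set (N := INR (S n)) in *.
    assert (HN : / (2 * N) <= / (2 * N - 1)) by (apply Rinv_le_contravar; lra).
    assert (Hpi : exp (- N * ln PI) <= 1).
    { rewrite <- exp_0. apply exp_le_compat.
      assert (0 <= ln PI) by (rewrite <- ln_1; apply ln_le; generalize PI2_1; lra). nra. }
    assert (Hf : INR (fact n) <= exp (M * Lg r)).
    { eapply Rle_trans; [apply INR_fact_le_pow|].
      apply Rle_trans with (N ^ n); [apply pow_incr; split; [apply pos_INR|unfold N; apply le_INR; lia]|].
      rewrite <- (exp_ln N) by lra. rewrite exp_pow_INR. apply exp_le_compat.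
      eapply Rle_trans; [|apply HL; auto]. rewrite Rmult_1_l. unfold Lg.
      rewrite (Rmult_comm (ln N)). apply Rmult_le_compat; [apply pos_INR| | |].
      - rewrite <- ln_1. apply ln_le; lra.
      - unfold N in N3. rewrite S_INR in N3. lra.
      - apply ln_le; lra. }
    apply Rle_trans with (exp (- N * ln PI) * INR (fact n) * Zr (2 * N)); [lra|].
    apply Rle_trans with (1 * exp (M * Lg r) * (1 + Rabs (Zr 2))); [|lra].
    pose proof (exp_pos (- N * ln PI)). pose proof (pos_INR (fact n)).
    apply Rmult_le_compat; auto.
    - apply Rmult_le_pos; lra.
    - apply Rmult_le_compat; lra.
    - generalize (Rle_abs (Zr 2)). lra. }
  assert (HFe : egr (fun s => F (1 * s + - (1 / 2))%C)) by (apply egr_affine; split; auto).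
  exists (fun s => s * (s - 1) * F (1 * s + - (1 / 2)) + 1)%C.
  split.
  { apply egr_plus; [|apply egr_const]. apply egr_mult; auto. apply (egr_mult (fun s => s) (fun s => s - 1)%C); [apply egr_id|].
    apply egr_minus; [apply egr_id|apply egr_const]. }
  assert (HD : forall s, s <> RtoC 1 ->
    ((s * (s - 1) * F (1 * s + - (1 / 2)) + 1) * rgamma (s / 2) - s * (s - 1) * Rcpow PI (- (s / 2)) * zeta s = 0)%C).
  { apply identity_punctured.
    - intros s Hs. destruct Hz as [Hz _]. destruct (Hz s Hs) as [l Hl].
      destruct (proj1 HFe s) as [l1 Hl1].
      destruct (is_entire_lin rgamma (/ 2) 0 rgamma_entire s) as [l2 Hl2].
      assert (Hp : exists l3, cder (fun s => Rcpow PI (- (s / 2))) s l3).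
      { eexists. apply (cder_comp (Rcpow PI) (fun s => - (s / 2))%C); [apply cder_Rcpow|].
        apply cder_opp. apply (cder_mult (fun s => s) (fun _ => / 2)%C); [apply cder_id|apply cder_const]. }
      destruct Hp as [l3 Hl3].
      assert (Hq : exists l4, cder (fun s => s * (s - 1))%C s l4).
      { eexists. apply cder_mult; [apply cder_id|apply cder_minus; [apply cder_id|apply cder_const]]. }
      destruct Hq as [l4 Hl4].
      eexists. apply cder_minus.
      + apply (cder_mult (fun s => s * (s - 1) * F (1 * s + - (1 / 2)) + 1)%C (fun s => rgamma (s / 2))).
        * apply cder_plus; [apply cder_mult; [exact Hl4|exact Hl1]|apply cder_const].
        * eapply cder_ext; [|exact Hl2]. intros w. simpl. f_equal. field.
      + apply cder_mult; [apply cder_mult; [exact Hl4|exact Hl3]|exact Hl].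
    - intros x Hx. rewrite (proj1 (zeta_real zeta x Hz Hx)). fold (Zr x).
      assert (N2 : RtoC 2 <> 0%C) by (intros E; apply RtoC_inj in E; lra).
      replace (1 * RtoC x + - (1 / 2))%C with (RtoC (x - 1 / 2)) by (rewrite RtoC_minus, RtoC_div by lra; ring).
      unfold F. rewrite (even_series_real a a0 J HJ) by lra.
      unfold J. replace (x - 1 / 2 + 1 / 2) with x by ring.
      replace (RtoC x / 2)%C with (RtoC (x / 2)) by (rewrite RtoC_div by lra; reflexivity).
      rewrite (rgamma_eint 0) by lra. rewrite <- RtoC_opp, Rcpow_R.
      pose proof (eint_pos 0 (x / 2) ltac:(lra)) as EP.
      rewrite <- !RtoC_minus, <- !RtoC_mult, <- RtoC_plus, <- RtoC_mult, <- RtoC_minus. f_equal.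
      field. repeat split; lra. }
  intros s Hs. specialize (HD s Hs).
  rewrite <- (Cplus_0_r (s * (s - 1) * Rcpow PI (- (s / 2)) * zeta s)), <- HD. ring.
Qed.

(** * The Gamma factors, the logarithmic derivative of chi and the functions [Z_k] *)

Definition gamA (s : C) : C := rgamma (s / 2).
Definition gamB (s : C) : C := rgamma ((1 - s) / 2).
Definition gamP (s : C) : C := (gamA s * gamB s)%C.

(* [gamP s * (1 / s + 1 / (s - 1))] without its removable singularities. *)
Definition gamQ (s : C) : C :=
  (/ 2 * rgamma (s / 2 + 1) * gamB s - / 2 * gamA s * rgamma ((1 - s) / 2 + 1))%C.

Lemma egr_gamA : egr gamA.
Proof.
  apply (egr_ext (fun s => rgamma (/ 2 * s + 0)%C)); [|apply (egr_affine rgamma), egr_rgamma].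
  intros s. unfold gamA. f_equal. field.
Qed.

Lemma egr_gamB : egr gamB.
Proof.
  apply (egr_ext (fun s => rgamma (- / 2 * s + / 2)%C)); [|apply (egr_affine rgamma), egr_rgamma].
  intros s. unfold gamB. f_equal. field.
Qed.

Lemma egr_gamP : egr gamP.
Proof. apply egr_mult; [apply egr_gamA|apply egr_gamB]. Qed.

Lemma egr_gamQ : egr gamQ.
Proof.
  apply egr_minus.
  - apply (egr_mult (fun s => / 2 * rgamma (s / 2 + 1))%C); [|apply egr_gamB].
    apply egr_mult; [apply egr_const|].
    apply (egr_ext (fun s => rgamma (/ 2 * s + 1)%C)); [|apply (egr_affine rgamma), egr_rgamma].
    intros s. f_equal. field.
  - apply (egr_mult (fun s => / 2 * gamA s)%C).
    + apply egr_mult; [apply egr_const|apply egr_gamA].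
    + apply (egr_ext (fun s => rgamma (- / 2 * s + (1 / 2 + 1))%C)); [|apply (egr_affine rgamma), egr_rgamma].
      intros s. f_equal. field.
Qed.

Lemma gamQ_eq (s : C) : s <> 0%C -> s <> RtoC 1 -> gamQ s = (gamP s * (/ s + / (s - 1)))%C.
Proof.
  intros H0 H1. unfold gamQ, gamP, gamA at 2, gamB at 2.
  assert (H1' : (s - 1)%C <> 0%C) by now apply Cminus_eq_contra.
  rewrite (rgamma_shift (s / 2)), (rgamma_shift ((1 - s) / 2)).
  unfold gamA, gamB. rewrite (rgamma_shift (s / 2)), (rgamma_shift ((1 - s) / 2)).
  field. auto.
Qed.

(* With A, B, P, Q, E for [gamA], [gamB], [gamP], [gamQ], [prefE]: off the integers
   omega = log pi + A'/A - B'/B and Z_k = A xi_k / (E P^k), which turns the recursion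
   for Z_k into this one. *)
Fixpoint xik (xi0 : C -> C) (k : nat) (s : C) : C :=
  match k with
  | O => xi0 s
  | S j => (gamP s * C_derive (xik xi0 j) s - gamQ s * xik xi0 j s
            - RtoC (INR j - 1 / 2) * C_derive gamP s * xik xi0 j s)%C
  end.

Lemma egr_xik xi0 k : egr xi0 -> egr (xik xi0 k).
Proof.
  intros H. induction k as [|k IH]; [exact H|].
  apply egr_minus; [apply egr_minus|].
  - apply egr_mult; [apply egr_gamP|now apply egr_derive].
  - apply egr_mult; [apply egr_gamQ|exact IH].
  - apply (egr_mult (fun s => RtoC (INR k - 1 / 2) * C_derive gamP s)%C); [|exact IH].
    apply egr_mult; [apply egr_const|apply egr_derive, egr_gamP].
Qed.

Lemma gamA_neq s : nonint s -> gamA s <> 0%C.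
Proof. intros H. now apply rgamma_nonint, nonint_half. Qed.

Lemma gamB_neq s : nonint s -> gamB s <> 0%C.
Proof. intros H. now apply rgamma_nonint, nonint_half, nonint_1m. Qed.

Lemma gamP_derive s : C_derive gamP s = (C_derive gamA s * gamB s + gamA s * C_derive gamB s)%C.
Proof.
  apply is_C_derive_unique. apply cder_mult; apply entire_cder; [apply egr_gamA|apply egr_gamB].
Qed.

(** Reflection at [s / 2] turns the sine into [gamA s * rgamma (1 - s / 2)], and duplication at
    [1 - s] turns Gamma(1 - s) into a constant times a power of 2 over
    [gamB s * rgamma (1 - s / 2)]. The common factor and the powers of 2 depending on [s] cancel. *)
Lemma chi_formula : exists c : C, c <> 0%C /\ forall s, nonint s -> chi s = (c * Rcpow PI s * gamA s / gamB s)%C.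
Proof.
  destruct rgamma_duplication as [kap [Hkap D]].
  exists (/ kap * 2)%C.
  assert (N2 : RtoC 2 <> 0%C) by (intros E; apply RtoC_inj in E; lra).
  split.
  { intros E. apply C1_nz. transitivity ((/ kap * 2) * (kap * / 2))%C; [field; auto|rewrite E; ring]. }
  intros s Hs. unfold chi.
  pose proof (gamB_neq s Hs) as HB.
  assert (HB2 : rgamma (1 - s / 2) <> 0%C) by (apply rgamma_nonint, nonint_1m, nonint_half; auto).
  assert (HG : rgamma (1 - s) <> 0%C) by (apply rgamma_nonint, nonint_1m; auto).
  rewrite CGamma_rgamma by auto. rewrite (D (1 - s)%C).
  replace ((1 - s + 1) / 2)%C with (1 - s / 2)%C by field. fold (gamB s).
  assert (Esin : Csin (RtoC PI * s / 2) = (RtoC PI * (gamA s * rgamma (1 - s / 2)))%C).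
  { unfold gamA. rewrite rgamma_reflection. replace (RtoC PI * (s / 2))%C with (RtoC PI * s / 2)%C by field.
    field. apply PI_neq_C. }
  rewrite Esin.
  assert (E1 : Rcpow PI (s - 1) = (Rcpow PI s / RtoC PI)%C).
  { assert (X : Rcpow PI s = (Rcpow PI (s - 1) * RtoC PI)%C).
    { replace s with ((s - 1) + 1)%C at 1 by ring. rewrite Rcpow_plus, Rcpow_R, Rmult_1_l, exp_ln by apply PI_RGT_0. reflexivity. }
    rewrite X. field. apply PI_neq_C. }
  assert (E2 : Rcpow 2 (- (1 - s)) = (Rcpow 2 s / 2)%C).
  { assert (X : Rcpow 2 s = (Rcpow 2 (- (1 - s)) * RtoC 2)%C).
    { replace s with (- (1 - s) + 1)%C at 1 by ring. rewrite Rcpow_plus, Rcpow_R, Rmult_1_l, exp_ln by lra. reflexivity. }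
    rewrite X. field. }
  rewrite E1, E2. assert (R2 : Rcpow 2 s <> 0%C) by apply Rcpow_neq_0.
  field. repeat split; auto using PI_neq_C.
Qed.

(** Since [nonint] is open, the formula for chi holds near [s] and may be differentiated; its
    unknown constant drops out of the logarithmic derivative. *)
Lemma omega_formula s : nonint s ->
  omega s = (RtoC (ln PI) + C_derive gamA s / gamA s - C_derive gamB s / gamB s)%C.
Proof.
  intros Hs. destruct chi_formula as [c [Hc E]].
  destruct (nonint_open s Hs) as [r [Hr Hr']].
  pose proof (gamA_neq s Hs) as HA. pose proof (gamB_neq s Hs) as HB.
  assert (HP : Rcpow PI s <> 0%C) by apply Rcpow_neq_0.
  unfold omega. rewrite (E s Hs).
  assert (D : cder (fun s => c * Rcpow PI s * gamA s / gamB s)%C s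
    (((c * (RtoC (ln PI) * Rcpow PI s) * gamA s + c * Rcpow PI s * C_derive gamA s) * gamB s -
      c * Rcpow PI s * gamA s * C_derive gamB s) / (gamB s * gamB s))%C).
  { apply (cder_div (fun s => c * Rcpow PI s * gamA s)%C gamB); auto.
    - apply (cder_mult (fun s => c * Rcpow PI s)%C gamA); [apply cder_scal, cder_Rcpow|apply entire_cder, egr_gamA].
    - apply entire_cder, egr_gamB. }
  rewrite (is_C_derive_unique chi s _ (cder_ext_loc _ chi s _ r Hr (fun w Hw => eq_sym (E w (Hr' w Hw))) D)).
  field. auto.
Qed.

Definition prefE (s : C) : C := (s * (s - 1) * Rcpow PI (- (s / 2)))%C.

Lemma prefE_neq s : nonint s -> prefE s <> 0%C.
Proof.
  intros H. unfold prefE. repeat apply Cmult_neq_0; [apply (H 0%Z)| |apply Rcpow_neq_0].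
  apply Cminus_eq_contra, (H 1%Z).
Qed.

Lemma prefE_der (s : C) : s <> 0%C -> s <> RtoC 1 ->
  cder prefE s (prefE s * (/ s + / (s - 1) - RtoC (ln PI) / 2))%C.
Proof.
  intros H0 H1. assert (H1' : (s - 1)%C <> 0%C) by now apply Cminus_eq_contra.
  eapply cder_eq.
  - apply (cder_mult (fun s => s * (s - 1))%C (fun s => Rcpow PI (- (s / 2)))).
    + apply cder_mult; [apply cder_id|apply cder_minus; [apply cder_id|apply cder_const]].
    + apply (cder_comp (Rcpow PI) (fun s => - (s / 2))%C); [apply cder_Rcpow|].
      apply cder_opp. apply (cder_mult (fun s => s) (fun _ => / 2)%C); [apply cder_id|apply cder_const].
  - unfold prefE. simpl. field. auto.
Qed.

(** The logarithmic form avoids [pred n], so that one algebraic computation covers every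
    exponent. *)
Lemma cder_pow_quot (f : C -> C) n z a : f z <> 0%C -> cder f z a ->
  cder (fun w => f w ^ n)%C z (RtoC (INR n) * a / f z * f z ^ n)%C.
Proof.
  intros H0 H. eapply cder_eq; [apply cder_pow; exact H|].
  destruct n; [simpl; field; auto|]. simpl pred. simpl Cpow. field. auto.
Qed.

(** Take the logarithmic derivative of [A / (E P^k)] and subtract [omega / 2]. The terms with
    [ln PI] cancel, [E] contributes [- (1/s + 1/(s - 1))], which becomes [Q] after multiplication by
    [P], and [A'/A - (A'/A - B'/B)/2] is half of [P'/P], which shifts the coefficient [- k] to
    [- (k - 1/2)]. *)
Lemma Zfun_formula (zeta xi0 : C -> C) k : egr xi0 ->
  (forall s, s <> RtoC 1 -> (xi0 s * gamA s = prefE s * zeta s)%C) ->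
  forall s, nonint s -> Zfun zeta k s = (xik xi0 k s * gamA s / (prefE s * gamP s ^ k))%C.
Proof.
  intros H0 HE. induction k as [|k IH]; intros s Hs.
  - simpl. rewrite (HE s (Hs 1%Z)). field. now apply prefE_neq.
  - destruct (nonint_open s Hs) as [r [Hr Hr']].
    pose proof (gamA_neq s Hs) as HA. pose proof (gamB_neq s Hs) as HB.
    pose proof (prefE_neq s Hs) as HEn.
    assert (HP : gamP s <> 0%C) by now apply Cmult_neq_0.
    assert (HPk : (gamP s ^ k)%C <> 0%C) by now apply Cpow_nz.
    pose proof (Hs 0%Z) as s0. pose proof (Hs 1%Z) as s1.
    assert (s1' : (s - 1)%C <> 0%C) by now apply Cminus_eq_contra.
    assert (D : cder (fun s => xik xi0 k s * gamA s / (prefE s * gamP s ^ k))%C s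
      ((C_derive (xik xi0 k) s + xik xi0 k s * (C_derive gamA s / gamA s - (/ s + / (s - 1) - RtoC (ln PI) / 2)
        - RtoC (INR k) * C_derive gamP s / gamP s)) * gamA s / (prefE s * gamP s ^ k))%C).
    { eapply cder_eq.
      - apply (cder_div (fun s => xik xi0 k s * gamA s)%C (fun s => prefE s * gamP s ^ k)%C).
        + now apply Cmult_neq_0.
        + apply cder_mult; apply entire_cder; [now apply egr_xik|apply egr_gamA].
        + apply cder_mult; [now apply prefE_der|].
          apply cder_pow_quot; auto. apply entire_cder, egr_gamP.
      - simpl. field. repeat split; auto. }
    cbn [Zfun].
    rewrite (is_C_derive_unique (Zfun zeta k) s _ (cder_ext_loc _ (Zfun zeta k) s _ r Hr (fun w Hw => eq_sym (IH w (Hr' w Hw))) D)).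
    rewrite IH, omega_formula by auto. cbn [xik].
    rewrite gamQ_eq, gamP_derive by auto. rewrite RtoC_minus, RtoC_div by lra.
    simpl Cpow. set (pk := (gamP s ^ k)%C) in *. unfold gamP in *.
    field. repeat split; auto.
Qed.

(** A single expression that also covers [k = 0], where the exponent is -1. *)
Lemma CpowZ_pred (z : C) k : z <> 0%C -> CpowZ z (Z.of_nat k - 1) = (z ^ k / z)%C.
Proof.
  intros Hz. destruct k as [|[|k]].
  - simpl. field. auto.
  - simpl. field. auto.
  - replace (Z.of_nat (S (S k)) - 1)%Z with (Z.of_nat (S k)) by lia.
    change (CpowZ z (Z.of_nat (S k))) with (z ^ Pos.to_nat (Pos.of_succ_nat k))%C. rewrite SuccNat2Pos.id_succ. simpl. field. auto.
Qed.

Lemma xi_formula_nonint (zeta xi0 : C -> C) k : egr xi0 ->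
  (forall s, s <> RtoC 1 -> (xi0 s * gamA s = prefE s * zeta s)%C) ->
  forall s, nonint s -> xi_formula zeta k s = xik xi0 k s.
Proof.
  intros H0 HE s Hs. unfold xi_formula.
  pose proof (gamA_neq s Hs) as HA. pose proof (gamB_neq s Hs) as HB. pose proof (prefE_neq s Hs) as HEn.
  rewrite (Zfun_formula zeta xi0 k H0 HE s Hs).
  rewrite (CGamma_rgamma (s / 2)) by exact HA. rewrite (CGamma_rgamma ((1 - s) / 2)) by exact HB.
  fold (gamA s) (gamB s).
  assert (HAi : (/ gamA s)%C <> 0%C).
  { intros E. apply C1_nz. rewrite <- (Cinv_r _ HA), E. ring. }
  rewrite CpowZ_pred by auto. rewrite !Cpow_inv by auto.
  unfold gamP. rewrite Cpow_mult_l.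
  assert (HAk : (gamA s ^ k)%C <> 0%C) by now apply Cpow_nz.
  assert (HBk : (gamB s ^ k)%C <> 0%C) by now apply Cpow_nz.
  replace (Rcpow PI (- (s / 2)) * (s * (s - 1)))%C with (prefE s) by (unfold prefE; ring).
  field. repeat split; auto.
Qed.

Lemma punctured_nonint s : exists r, 0 < r /\ forall w, w <> s -> Cmod (w - s) < r -> nonint w.
Proof.
  destruct (classic (nonint s)) as [H|H].
  - destruct (nonint_open s H) as [r [Hr Hr']]. exists r. auto.
  - apply not_all_ex_not in H. destruct H as [m H]. apply NNPP in H. subst s.
    exists 1. split; [lra|]. intros w Hw Hd n E. subst w.
    rewrite <- RtoC_minus, <- minus_IZR, Cmod_R, <- abs_IZR in Hd. apply lt_IZR in Hd.
    apply Hw. do 2 f_equal. lia.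
Qed.

Lemma fills_of_nonint (f g : C -> C) : is_entire g -> (forall s, nonint s -> f s = g s) -> fills_singularities f g.
Proof.
  intros Hg E s P HP.
  destruct (Hg s) as [l Hl]. pose proof (cder_cont g s l Hl P HP) as [d Hd].
  destruct (punctured_nonint s) as [r [Hr Hr']].
  assert (Hm : 0 < Rmin d (r / 2)) by (apply Rmin_glb_lt; [apply cond_pos|lra]).
  exists (mkposreal _ Hm). intros w Hw Hws.
  rewrite E.
  - apply Hd. eapply ball_le; [|exact Hw]. apply Rmin_l.
  - apply Hr'; auto.
    assert (Hw2 : ball s (r / 2) w) by (eapply ball_le; [|exact Hw]; apply Rmin_r).
    assert (Hr2 : 0 < r / 2) by lra.
    apply (C_NormedModule_mixin_compat2 s w (mkposreal _ Hr2)) in Hw2.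
    change (Cmod (w - s) < sqrt 2 * (r / 2)) in Hw2.
    assert (sqrt 2 <= 2).
    { rewrite <- (sqrt_square 2) at 2 by lra. apply sqrt_le_1_alt. lra. }
    nra.
Qed.

(** * The order of xi_k *)

Lemma gr_bigO (f : C -> C) alpha : gr f -> 1 < alpha -> bigO_exp_pow f alpha.
Proof.
  intros [K [HK H]] Ha. set (d := alpha - 1). assert (Hd : 0 < d) by (unfold d; lra).
  (* With [L = ln r] this threshold ensures [16 K <= d^2 L]. Then
     [exp (d L) >= (d L / 2)^2 >= 4 K L], so [4 K r L], a bound for [K * Lg r], is at most
     [r^(1 + d)]. *)
  exists 1, (exp (1 + 16 * K / (d * d))). intros s Hs.
  eapply Rle_trans; [apply H|]. rewrite Rmult_1_l. apply exp_le_compat.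
  set (r := Cmod s) in *. unfold Rpower, Lg.
  assert (Hdd : 0 <= 16 * K / (d * d)).
  { apply Rmult_le_pos; [lra|]. left. apply Rinv_0_lt_compat. nra. }
  assert (Hr2 : 2 <= r) by (generalize (exp_ineq1_le (1 + 16 * K / (d * d))); lra).
  set (L := ln r).
  assert (HL : 1 + 16 * K / (d * d) <= L).
  { rewrite <- (ln_exp (1 + _)). apply ln_le; [apply exp_pos|lra]. }
  assert (Er : r = exp L) by (unfold L; rewrite exp_ln; lra).
  assert (H1 : ln (2 + r) <= 2 * L).
  { apply Rle_trans with (ln (2 * r)); [apply ln_le; lra|]. rewrite ln_mult by lra. fold L.
    assert (ln 2 < 1) by (rewrite <- (ln_exp 1); apply ln_increasing; [lra|]; generalize (exp_ineq1 1); lra).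
    lra. }
  assert (H2 : 16 * K <= d * d * L).
  { apply Rle_trans with (d * d * (16 * K / (d * d))); [right; field; lra|].
    apply Rmult_le_compat_l; [nra|lra]. }
  assert (H3 : 4 * K * L <= exp (d * L)).
  { pose proof (exp_ineq1_le (d * L / 2)) as E.
    replace (d * L) with (d * L / 2 + d * L / 2) by field. rewrite exp_plus.
    assert (0 <= d * L / 2) by nra.
    apply Rle_trans with (d * L / 2 * (d * L / 2)); [nra|]. apply Rmult_le_compat; lra. }
  replace (alpha * L) with (L + d * L) by (unfold d; ring). rewrite exp_plus, <- Er.
  apply Rle_trans with (K * (2 * r * (2 * L))).
  - apply Rmult_le_compat_l; auto. apply Rmult_le_compat; try lra.
    generalize (ln_Lg r ltac:(lra)). lra.
  - replace (K * (2 * r * (2 * L))) with (r * (4 * K * L)) by ring. apply Rmult_le_compat_l; lra.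
Qed.

(** * Lower bounds at the odd integers *)

Lemma rgamma_neg_nat n : rgamma (- RtoC (INR n)) = 0%C.
Proof.
  induction n as [|n IH]; rewrite rgamma_shift.
  - simpl INR. ring.
  - replace (- RtoC (INR (S n)) + 1)%C with (- RtoC (INR n))%C; [rewrite IH; ring|].
    rewrite S_INR, RtoC_plus. ring.
Qed.

Lemma rgamma_derive_shift (s : C) :
  C_derive rgamma s = (rgamma (s + 1) + s * C_derive rgamma (s + 1))%C.
Proof.
  apply is_C_derive_unique.
  apply (cder_ext (fun z => z * rgamma (z + 1))%C); [intros z; now rewrite <- rgamma_shift|].
  eapply cder_eq.
  - apply cder_mult; [apply cder_id|].
    apply (cder_comp rgamma (fun z => z + 1)%C); [apply entire_cder, rgamma_entire|].
    apply cder_plus; [apply cder_id|apply cder_const].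
  - cbv beta. ring.
Qed.

(** In the differentiated equation [rgamma s = s * rgamma (s + 1)] the first term vanishes at
    [s = - (n + 1)], so each step multiplies the modulus by [n + 1]. *)
Lemma rgamma_derive_neg_nat n : Cmod (C_derive rgamma (- RtoC (INR n))) = INR (fact n).
Proof.
  induction n as [|n IH]; rewrite rgamma_derive_shift.
  - simpl INR. replace (- RtoC 0 + 1)%C with (RtoC 1) by ring. rewrite rgamma_1.
    replace (1 + - 0 * C_derive rgamma 1)%C with (RtoC 1) by ring. now rewrite Cmod_1.
  - replace (- RtoC (INR (S n)) + 1)%C with (- RtoC (INR n))%C by (rewrite S_INR, RtoC_plus; ring).
    rewrite rgamma_neg_nat, Cplus_0_l, Cmod_mult, Cmod_opp, Cmod_R, IH, Rabs_pos_eq by apply pos_INR.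
    rewrite <- mult_INR. reflexivity.
Qed.

Lemma rgamma_half_nat_S n :
  Cmod (rgamma (RtoC (INR n + 1 / 2))) = (INR n + 1 / 2) * Cmod (rgamma (RtoC (INR (S n) + 1 / 2))).
Proof.
  rewrite rgamma_shift, Cmod_mult, Cmod_R, Rabs_pos_eq by (generalize (pos_INR n); lra).
  rewrite <- RtoC_plus, S_INR. do 4 f_equal. ring.
Qed.

(** Each step of the recursion has the factor [n + 1/2 <= n + 1]. This keeps [n! / Gamma(n + 1/2)],
    and with it the derivative of [gamP] at [2 n + 1], away from 0. *)
Lemma rgamma_half_nat_lower n :
  Cmod (rgamma (/ 2)) <= INR (fact n) * Cmod (rgamma (RtoC (INR n + 1 / 2))).
Proof.
  induction n as [|n IH].
  - simpl INR. replace (RtoC (0 + 1 / 2)) with (/ 2)%C; [lra|].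
    rewrite <- RtoC_inv by lra. f_equal. field.
  - eapply Rle_trans; [apply IH|]. rewrite rgamma_half_nat_S, fact_simpl, mult_INR, S_INR.
    assert (0 <= INR (fact n) * Cmod (rgamma (RtoC (INR n + 1 + 1 / 2)))).
    { apply Rmult_le_pos; [apply pos_INR|apply Cmod_ge_0]. }
    nra.
Qed.

(** The true order of [n! / Gamma(n + 1/2)] is the square root of [n]; a linear bound suffices, as
    it will be cancelled by the factor [s - 1 = 2 n] of [prefE]. *)
Lemma rgamma_half_nat_upper n :
  INR (fact (S n)) * Cmod (rgamma (RtoC (INR (S n) + 1 / 2))) <= 2 * Cmod (rgamma (/ 2)) * INR (S n).
Proof.
  induction n as [|n IH].
  - pose proof (rgamma_half_nat_S 0) as E.
    replace (RtoC (INR 0 + 1 / 2)) with (/ 2)%C in E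
      by (rewrite <- RtoC_inv by lra; f_equal; simpl; field).
    rewrite E. simpl. lra.
  - pose proof (rgamma_half_nat_S (S n)) as E. rewrite E in IH.
    rewrite fact_simpl, mult_INR, (S_INR (S n)). rewrite (S_INR (S n)) in IH.
    set (x := INR (S n)) in *. assert (Hx : 1 <= x) by (unfold x; rewrite S_INR; generalize (pos_INR n); lra).
    set (F := INR (fact (S n))) in *. set (B := Cmod (rgamma (RtoC (x + 1 + 1 / 2)))) in *.
    set (g := Cmod (rgamma (/ 2))) in *.
    assert (0 <= F * B) by (apply Rmult_le_pos; [apply pos_INR|apply Cmod_ge_0]).
    assert (F * B <= 2 * g) by nra. nra.
Qed.

Definition odd_pt (n : nat) : C := RtoC (2 * INR n + 1).

Lemma odd_pt_half n : (odd_pt n / 2)%C = RtoC (INR n + 1 / 2).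
Proof. unfold odd_pt. rewrite <- RtoC_div by lra. f_equal. field. Qed.

Lemma odd_pt_conj n : ((1 - odd_pt n) / 2)%C = (- RtoC (INR n))%C.
Proof. unfold odd_pt. rewrite <- RtoC_minus, <- RtoC_div, <- RtoC_opp by lra. f_equal. field. Qed.

Lemma gamB_odd n : gamB (odd_pt n) = 0%C.
Proof. unfold gamB. rewrite odd_pt_conj. apply rgamma_neg_nat. Qed.

Lemma gamQ_odd n : (1 <= n)%nat -> gamQ (odd_pt n) = 0%C.
Proof.
  intros Hn. unfold gamQ. rewrite gamB_odd, odd_pt_conj.
  destruct n as [|n]; [lia|].
  replace (- RtoC (INR (S n)) + 1)%C with (- RtoC (INR n))%C by (rewrite S_INR, RtoC_plus; ring).
  rewrite rgamma_neg_nat. ring.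
Qed.

Lemma gamB_derive_odd n : C_derive gamB (odd_pt n) = (- / 2 * C_derive rgamma (- RtoC (INR n)))%C.
Proof.
  apply is_C_derive_unique.
  apply (cder_ext (fun z => rgamma (- / 2 * z + / 2)%C)); [intros z; unfold gamB; f_equal; field|].
  eapply cder_eq.
  - apply (cder_comp rgamma (fun z => - / 2 * z + / 2)%C).
    + apply entire_cder, rgamma_entire.
    + apply cder_plus; [apply cder_scal, cder_id|apply cder_const].
  - cbv beta. replace (- / 2 * odd_pt n + / 2)%C with (- RtoC (INR n))%C by (rewrite <- odd_pt_conj; field). ring.
Qed.

Lemma gamP_derive_odd n : Cmod (rgamma (/ 2)) / 2 <= Cmod (C_derive gamP (odd_pt n)).
Proof.
  rewrite gamP_derive, gamB_odd, gamB_derive_odd, Cmult_0_r, Cplus_0_l, !Cmod_mult, Cmod_opp, rgamma_derive_neg_nat.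
  replace (Cmod (/ 2)) with (/ 2) by (rewrite <- RtoC_inv, Cmod_R, Rabs_pos_eq; lra).
  unfold gamA. rewrite odd_pt_half. generalize (rgamma_half_nat_lower n). lra.
Qed.

(* [gamP] and [gamQ] vanish at [2 n + 1 >= 3], so only the last term of the
   recursion survives there. *)
Lemma xik_odd_lower xi0 k n : (1 <= n)%nat ->
  (Cmod (rgamma (/ 2)) / 4) ^ k * Cmod (xi0 (odd_pt n)) <= Cmod (xik xi0 k (odd_pt n)).
Proof.
  intros Hn. induction k as [|k IH]; [simpl; lra|].
  set (g := Cmod (rgamma (/ 2))) in *. assert (Hg : 0 <= g) by apply Cmod_ge_0.
  cbn [xik pow]. rewrite gamQ_odd by auto. unfold gamP at 1. rewrite gamB_odd.
  match goal with |- _ <= Cmod ?x =>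
    replace x with (- (RtoC (INR k - 1 / 2) * C_derive gamP (odd_pt n) * xik xi0 k (odd_pt n)))%C by ring end.
  rewrite Cmod_opp, !Cmod_mult, Cmod_R.
  assert (Hk : 1 / 2 <= Rabs (INR k - 1 / 2)).
  { destruct k as [|k]; [simpl; rewrite Rabs_left; lra|].
    rewrite S_INR. generalize (pos_INR k). intros. rewrite Rabs_pos_eq; lra. }
  pose proof (gamP_derive_odd n) as HP. fold g in HP.
  assert (H1 : g / 4 <= Rabs (INR k - 1 / 2) * Cmod (C_derive gamP (odd_pt n))).
  { replace (g / 4) with (1 / 2 * (g / 2)) by field. apply Rmult_le_compat; lra. }
  rewrite Rmult_assoc. apply Rmult_le_compat; auto; [lra|].
  apply Rmult_le_pos; [apply pow_le; lra|apply Cmod_ge_0].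
Qed.

Lemma zeta_ge_1 zeta s : is_riemann_zeta zeta -> 1 < s -> 1 <= Cmod (zeta (RtoC s)).
Proof.
  intros Hz Hs. destruct (zeta_real zeta s Hz Hs) as [_ HL].
  eapply Rle_trans; [|apply re_le_Cmod]. eapply Rle_trans; [|apply Rle_abs].
  apply (lim_ge_const (fun n => rsum (fun m => exp (- s * ln (INR (S m)))) (S n))).
  - now apply is_lim_seq_incr_1 in HL.
  - intros n. induction n as [|n IH].
    + cbn [rsum]. simpl INR. rewrite ln_1, Rmult_0_r, exp_0. lra.
    + cbn [rsum] in IH |- *. generalize (exp_pos (- s * ln (INR (S (S n))))). lra.
Qed.

(** In [xi0 * gamA = prefE * zeta] at [s = 2 n + 1] the factors [s] and [zeta] are at least 1, and
    [s - 1 = 2 n] cancels the linear bound on [n! * gamA]. What remains is [pi^(-s/2) * n!]. *)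
Lemma xi0_odd_lower zeta xi0 n : is_riemann_zeta zeta ->
  (forall s, s <> RtoC 1 -> (xi0 s * gamA s = prefE s * zeta s)%C) -> (1 <= n)%nat ->
  exp (- (INR n + 1 / 2) * ln PI) * INR (fact n) <= Cmod (rgamma (/ 2)) * Cmod (xi0 (odd_pt n)).
Proof.
  intros Hz HE Hn. assert (Hx : 1 <= INR n) by (change 1 with (INR 1); now apply le_INR).
  assert (H1 : odd_pt n <> RtoC 1).
  { unfold odd_pt. intros E. apply RtoC_inj in E. lra. }
  pose proof (f_equal Cmod (HE _ H1)) as E. unfold gamA, prefE in E.
  rewrite odd_pt_half, !Cmod_mult, <- RtoC_opp, Cmod_Rcpow in E.
  pose proof (zeta_ge_1 zeta (2 * INR n + 1) Hz ltac:(lra)) as HZ. fold (odd_pt n) in HZ.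
  replace (Cmod (odd_pt n - 1)) with (2 * INR n) in E
    by (unfold odd_pt; rewrite <- RtoC_minus, Cmod_R, Rabs_pos_eq; lra).
  replace (Cmod (odd_pt n)) with (2 * INR n + 1) in E
    by (unfold odd_pt; rewrite Cmod_R, Rabs_pos_eq; lra).
  cbn [Re RtoC fst] in E. set (e := exp (- (INR n + 1 / 2) * ln PI)) in *.
  assert (He : 0 < e) by apply exp_pos.
  destruct n as [|m]; [lia|]. pose proof (rgamma_half_nat_upper m) as HU.
  set (x := INR (S m)) in *. set (B := Cmod (rgamma (RtoC (x + 1 / 2)))) in *.
  set (F := INR (fact (S m))) in *. set (g := Cmod (rgamma (/ 2))) in *.
  set (X := Cmod (xi0 (odd_pt (S m)))) in *. set (Z := Cmod (zeta (odd_pt (S m)))) in *.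
  assert (HX : 0 <= X) by apply Cmod_ge_0. assert (HF : 0 <= F) by apply pos_INR.
  assert (H2 : 2 * x * e <= X * B).
  { rewrite E. replace (2 * x * e) with (1 * (2 * x) * e * 1) by ring.
    apply Rmult_le_compat; auto; try lra.
    - apply Rmult_le_pos; lra.
    - apply Rmult_le_compat_r; [lra|]. apply Rmult_le_compat_r; lra. }
  apply Rmult_le_reg_l with (2 * x); [lra|].
  apply Rle_trans with (X * (F * B)); [nra|].
  apply Rle_trans with (X * (2 * g * x)); [now apply Rmult_le_compat_l|lra].
Qed.

Lemma fact_not_le_geom c x : 0 < c -> exists N, forall n, (N <= n)%nat -> x ^ n < c * INR (fact n).
Proof.
  intros Hc. destruct (cv_speed_pow_fact x c Hc) as [N HN]. exists N. intros n Hn.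
  specialize (HN n Hn). unfold R_dist in HN. rewrite Rminus_0_r in HN.
  apply Rabs_def2 in HN. pose proof (INR_fact_lt_0 n) as HF.
  apply Rmult_lt_reg_r with (/ INR (fact n)); [now apply Rinv_0_lt_compat|].
  rewrite Rmult_assoc, Rinv_r by lra. unfold Rdiv in HN. lra.
Qed.

Lemma xik_not_bigO zeta xi0 k alpha : is_riemann_zeta zeta ->
  (forall s, s <> RtoC 1 -> (xi0 s * gamA s = prefE s * zeta s)%C) ->
  bigO_exp_pow (xik xi0 k) alpha -> 1 < alpha.
Proof.
  intros Hz HE [M [r HM]]. apply Rnot_le_lt. intros Ha.
  set (g := Cmod (rgamma (/ 2))).
  assert (Hg : 0 < g) by (apply Cmod_gt_0, rgamma_half_neq).
  (* The power of pi to be beaten is [exp ((2 n + 1) p)]. The constant [c] gathers all factors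
     independent of [n], so that the contradiction is [exp ((2 + 2 p) n) < c * n!]. As [M] may be
     negative or 0, a positive [M'] replaces it. *)
  set (p := ln PI / 2). set (M' := Rabs M + 1). assert (HM' : 0 < M') by (unfold M'; generalize (Rabs_pos M); lra).
  set (c := (g / 4) ^ k / (M' * g * exp (1 + p))).
  assert (Hc : 0 < c).
  { apply Rdiv_lt_0_compat; [apply pow_lt; lra|].
    repeat apply Rmult_lt_0_compat; auto; apply exp_pos. }
  destruct (fact_not_le_geom c (exp (2 + 2 * p)) Hc) as [N HN].
  destruct (nat_above r) as [m [Hm [Hm1 _]]].
  set (n := (N + m)%nat). specialize (HN n ltac:(unfold n; lia)).
  assert (Hmn : INR m <= INR n) by (apply le_INR; unfold n; lia).
  assert (Hm2 : 1 <= INR m) by (change 1 with (INR 1); now apply le_INR).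
  assert (Hs : Cmod (odd_pt n) = 2 * INR n + 1) by (unfold odd_pt; rewrite Cmod_R, Rabs_pos_eq; lra).
  specialize (HM (odd_pt n)). rewrite Hs in HM. specialize (HM ltac:(lra)).
  assert (HR : Rpower (2 * INR n + 1) alpha <= 2 * INR n + 1).
  { rewrite <- (Rpower_1 (2 * INR n + 1)) at 2 by lra. apply Rle_Rpower; lra. }
  pose proof (xik_odd_lower xi0 k n ltac:(unfold n; lia)) as H1.
  pose proof (xi0_odd_lower zeta xi0 n Hz HE ltac:(unfold n; lia)) as H2. fold g in H1, H2.
  assert (H3 : Cmod (xik xi0 k (odd_pt n)) <= M' * exp (2 * INR n + 1)).
  { eapply Rle_trans; [apply HM|].
    apply Rle_trans with (M' * exp (Rpower (2 * INR n + 1) alpha)).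
    - apply Rmult_le_compat_r; [left; apply exp_pos|]. unfold M'. generalize (Rle_abs M). lra.
    - apply Rmult_le_compat_l; [lra|]. now apply exp_le_compat. }
  set (G := (g / 4) ^ k) in *. assert (HG : 0 < G) by (apply pow_lt; lra).
  set (X := Cmod (xi0 (odd_pt n))) in *. set (F := INR (fact n)) in *.
  set (e := exp (- (INR n + 1 / 2) * ln PI)) in *. assert (He : 0 < e) by apply exp_pos.
  assert (H4 : G * (e * F) <= g * (M' * exp (2 * INR n + 1))).
  { apply Rle_trans with (G * (g * X)); [apply Rmult_le_compat_l; lra|].
    replace (G * (g * X)) with (g * (G * X)) by ring. apply Rmult_le_compat_l; lra. }
  rewrite exp_pow_INR in HN.
  assert (HE' : exp ((2 + 2 * p) * INR n) * exp (1 + p) * e = exp (2 * INR n + 1)).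
  { unfold e. rewrite <- !exp_plus. f_equal. unfold p. field. }
  rewrite <- HE' in H4. pose proof (exp_pos (1 + p)) as Hp.
  assert (H5 : c * F * (M' * g * exp (1 + p)) = G * F) by (unfold c; field; lra).
  assert (H6 : exp ((2 + 2 * p) * INR n) * (M' * g * exp (1 + p)) < c * F * (M' * g * exp (1 + p))).
  { apply Rmult_lt_compat_r; auto. repeat apply Rmult_lt_0_compat; auto. }
  rewrite H5 in H6. apply (Rmult_lt_compat_r e) in H6; auto. lra.
Qed.

Lemma growth_order_one (f : C -> C) : gr f -> (forall alpha, bigO_exp_pow f alpha -> 1 < alpha) ->
  growth_order f = Finite 1.
Proof.
  intros Hf Hl. apply is_glb_Rbar_unique. split.
  - intros a [_ Ha]. simpl. left. now apply Hl.
  - intros b Hb. destruct b as [b| |]; simpl.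
    + apply Rnot_lt_le. intros H.
      (* A lower bound [b > 1] would exceed the admissible exponent half-way between 1 and [b]. *)
      specialize (Hb ((1 + b) / 2)). simpl in Hb.
      assert (b <= (1 + b) / 2); [|lra]. apply Hb. split; [lra|]. apply gr_bigO; auto. lra.
    + apply (Hb 2). split; [lra|]. apply gr_bigO; auto. lra.
    + exact I.
Qed.

Theorem mainTheorem3 (zeta : C -> C) (Hzeta : is_riemann_zeta zeta) (k : nat) :
  exists xi : C -> C,
    fills_singularities (xi_formula zeta k) xi /\
    is_entire xi /\
    growth_order xi = Finite 1%R.
Proof.
  destruct (riemann_xi zeta Hzeta) as [xi0 [H0 HE]].
  destruct (egr_xik xi0 k H0) as [Hent Hgr].
  exists (xik xi0 k). split; [|split].
  - apply fills_of_nonint; [exact Hent|]. now apply xi_formula_nonint.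
  - exact Hent.
  - apply growth_order_one; [exact Hgr|]. intros alpha. now apply (xik_not_bigO zeta).
Qed.
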